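(* Let $0<\alpha<1$, $0<\tau<1$, and let $S$ be the fundamental solution of the fractional Zener wave equation with parameters $\alpha,\tau$. Then $S$ is an $L^1_{\mathrm{loc}}$-function on $\mathbb{R}^2$ which is continuous on $\mathbb{R}^{2}\setminus \{(0,0)\}$. Its partial derivative with respect to $x$, $\partial_{x}S$, is discontinuous on the half-line $\{(0,t): t>0\}$. On $\mathbb{R}^2\setminus\bigl(\{0\}\times[0,\infty)\bigr)$, $S$ is of class $C^{\infty}$. In particular, the ($C^\infty$-)wave front set of $S$ is $$\mathrm{WF}(S) = \{(0,0;\xi,\eta): (\xi, \eta)\neq(0,0)\} \cup \{(0,t; \xi,0): t>0,\ \xi\neq0\}.$$
   Context: The fractional Zener wave operator is $$P = \frac{\partial^2}{\partial t^2} - \mathcal{L}^{-1}_{s\to t}\Bigl(\frac{1+s^{\alpha}}{1+\tau s^{\alpha}}\Bigr) \ast_{t} \frac{\partial^2}{\partial x^2},$$ where $\mathcal{L}^{-1}$ is the inverse Laplace transform, $\ast_t$ is convolution in $t$, and powers use the principal branch. $\mathcal{S}'(\mathbb{R}\times\mathbb{R}_+)$ denotes the space of tempered distributions on $\mathbb{R}^2$ (variables $(x,t)$) vanishing on $\mathbb{R}\times(-\infty,0)$. The fundamental solution $S$ is the unique element of $\mathcal{S}'(\mathbb{R}\times\mathbb{R}_+)$ with $PS=\delta(x)\delta(t)$. Equivalently, its Laplace transform with respect to $t$ is $$\tilde S(x,s)=\frac{1}{2s}\,l_\alpha(s)\exp\bigl(-|x|\,s\,l_\alpha(s)\bigr),\quad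 x\in\mathbb{R},\ \operatorname{Re}s>0,\qquad l_\alpha(s)=\sqrt{\frac{1+\tau s^\alpha}{1+s^\alpha}},$$ with principal branches. In $(x,t;\xi,\eta)$, $(\xi,\eta)$ is the covector (frequency) dual to $(x,t)$. *)

(* Defs.v *)
From mathcomp Require Import all_boot all_order all_algebra.
From mathcomp Require Import complex.
From mathcomp Require Import all_classical all_reals all_analysis.

Set Implicit Arguments.
Unset Strict Implicit.
Unset Printing Implicit Defensive.

Import Order.TTheory GRing.Theory Num.Theory numFieldNormedType.Exports.
Import Normc.
Local Open Scope classical_set_scope.
Local Open Scope complex_scope.
Local Open Scope ring_scope.

Section ComplexFunctions.
Context {R : realType}.

Definition re (z : R[i]) : R := complex.Re z.
Definition im (z : R[i]) : R := complex.Im z.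

Definition cexp (z : R[i]) : R[i] :=
  (expR (re z) * cos (im z)) +i* (expR (re z) * sin (im z)).

(* Principal argument, with values in ]-pi, pi] for z != 0. *)
Definition carg (z : R[i]) : R :=
  if 0 <= im z then acos (re z / normc z) else - acos (re z / normc z).

(* Principal branch of z ^ a for z != 0. *)
Definition cpow (z : R[i]) (a : R) : R[i] :=
  (normc z `^ a)%:C * cexp (0 +i* (a * carg z)).

End ComplexFunctions.

(* R[i] carries no normed R-module structure, so limits, derivatives and
   integrals of complex-valued functions of real variables are taken on the
   real and imaginary parts. *)
Section Calculus.
Context {R : realType} {V : normedModType R}.
Implicit Types (f : V -> R[i]) (U : set V).

Definition ccontinuous_at f (z : V) : Prop :=
  {for z, continuous (re \o f)} /\ {for z, continuous (im \o f)}.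

Definition cderivable f (z v : V) : Prop :=
  derivable (re \o f) z v /\ derivable (im \o f) z v.

Definition cderive (v : V) f : V -> R[i] :=
  fun z => ('D_v (re \o f) z) +i* ('D_v (im \o f) z).

Definition iter_derive (vs : seq V) f : V -> R[i] := foldr cderive f vs.

(* C^oo on U, for U open: directional derivatives of all orders exist and are
   continuous on U. *)
Definition smooth_on U f : Prop :=
  forall (vs : seq V) (z : V), U z ->
    ccontinuous_at (iter_derive vs f) z /\
    forall v, cderivable (iter_derive vs f) z v.

Definition support f : set V := closure [set z | f z != 0].

Definition test_function f : Prop := smooth_on setT f /\ compact (support f).

Definition schwartz f : Prop :=
  smooth_on setT f /\
  forall (n : nat) (vs : seq V), exists M : R, forall z : V,
    (1 + `|z|) ^+ n * normc (iter_derive vs f z) <= M.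

End Calculus.

(* A distribution is a functional on all complex-valued functions of which only
   the values on test (resp. Schwartz) functions are meaningful. *)
Section Distributions.
Context {R : realType} {V : normedModType R}.
Implicit Types (u : (V -> R[i]) -> R[i]) (f phi psi : V -> R[i]).

(* Continuity: u is bounded by a constant times the maximum of finitely many
   Schwartz seminorms, indexed by ps. *)
Definition tempered u : Prop :=
  (forall (a : R[i]) phi psi, schwartz phi -> schwartz psi ->
     u (fun z => a * phi z + psi z) = a * u phi + u psi) /\
  (exists (C : R) (ps : seq (nat * seq V)), forall phi (M : R),
     schwartz phi ->
     (forall p, p \in ps -> forall z,
        (1 + `|z|) ^+ p.1 * normc (iter_derive p.2 phi z) <= M) ->
     normc (u phi) <= C * M).

Definition vanishes_on u (U : set V) : Prop :=
  forall phi, test_function phi -> support phi `<=` U -> u phi = 0.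

Definition dist_derive (v : V) u : (V -> R[i]) -> R[i] :=
  fun phi => - u (cderive v phi).

End Distributions.

Section HalfLine.
Context {R : realType}.
Implicit Types (K : (R -> R[i]) -> R[i]).

(* The pairing <K, f> of a tempered distribution K on R vanishing on ]-oo, 0[
   with a function f that agrees near [0, +oo[ with some Schwartz function: it
   does not depend on the Schwartz function chosen. *)
Definition half_line_pairing K (f : R -> R[i]) : R[i] :=
  xget 0 [set c | exists phi : R -> R[i],
    [/\ schwartz phi,
        exists2 e : R, 0 < e & forall t, - e < t -> phi t = f t
      & c = K phi]].

Definition laplace K (s : R[i]) : R[i] :=
  half_line_pairing K (fun t => cexp (- (s * t%:C))).

Definition inverse_laplace (F : R[i] -> R[i]) K : Prop :=
  [/\ tempered K, vanishes_on K [set t | t < 0]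
    & forall s : R[i], 0 < re s -> laplace K s = F s].

(* <K *_t u, phi> = <K(r), <u(x, t), phi(x, t + r)>> *)
Definition conv_t K (u : (R * R -> R[i]) -> R[i]) : (R * R -> R[i]) -> R[i] :=
  fun phi => half_line_pairing K (fun r => u (fun z => phi (z.1, z.2 + r))).

End HalfLine.

(* The plane R * R carries the coordinates (x, t). *)
Section Zener.
Context {R : realType}.
Implicit Types (S : (R * R -> R[i]) -> R[i]).

Definition e_x : R * R := (1, 0).
Definition e_t : R * R := (0, 1).

Definition dirac0 : (R * R -> R[i]) -> R[i] := fun phi => phi (0, 0).

Definition zener_symbol (alpha tau : R) (s : R[i]) : R[i] :=
  (1 + cpow s alpha) / (1 + tau%:C * cpow s alpha).

(* K stands for the inverse Laplace transform of zener_symbol alpha tau. *)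
Definition zener_operator (K : (R -> R[i]) -> R[i]) S : (R * R -> R[i]) -> R[i] :=
  fun phi => dist_derive e_t (dist_derive e_t S) phi
             - conv_t K (dist_derive e_x (dist_derive e_x S)) phi.

Definition zener_fundamental_solution (alpha tau : R) S : Prop :=
  [/\ tempered S, vanishes_on S [set z | z.2 < 0]
    & exists2 K, inverse_laplace (zener_symbol alpha tau) K
      & forall phi, schwartz phi -> zener_operator K S phi = dirac0 phi].

End Zener.

Section Regular.
Context {R : realType}.
Implicit Types (f : R * R -> R[i]).

Local Notation mu2 :=
  ((@lebesgue_measure R) \x (@lebesgue_measure R))%E.

Definition L1loc f : Prop :=
  [/\ measurable_fun setT (re \o f), measurable_fun setT (im \o f)
    & forall A : set (R * R), compact A ->
        (\int[mu2]_(z in A) (normc (f z))%:E < +oo)%E].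

Definition cintegral f : R[i] :=
  (\int[mu2]_z re (f z))%R +i* (\int[mu2]_z im (f z))%R.

Definition represented_by (u : (R * R -> R[i]) -> R[i]) f : Prop :=
  forall phi, test_function phi -> u phi = cintegral (fun z => f z * phi z).

End Regular.

Section WaveFront.
Context {R : realType}.
Implicit Types (u : (R * R -> R[i]) -> R[i]) (phi : R * R -> R[i]).

Definition dot (z zeta : R * R) : R := z.1 * zeta.1 + z.2 * zeta.2.

(* Fourier transform of the compactly supported distribution phi u. *)
Definition localized_fourier u phi (zeta : R * R) : R[i] :=
  u (fun z => phi z * cexp (0 +i* (- dot z zeta))).

Definition open_cone (G : set (R * R)) : Prop :=
  open G /\ forall (c : R) zeta, 0 < c -> G zeta -> G (c *: zeta).

Definition rapidly_decreasing_on (G : set (R * R)) (F : R * R -> R[i]) : Prop :=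
  forall n : nat, exists C : R, forall zeta, G zeta ->
    (1 + `|zeta|) ^+ n * normc (F zeta) <= C.

Definition WF u : set ((R * R) * (R * R)) :=
  [set p | p.2 != (0, 0) /\
     ~ exists phi G, [/\ test_function phi, phi p.1 != 0, open_cone G, G p.2
                       & rapidly_decreasing_on G (localized_fourier u phi)]].

End WaveFront.

(* Main.v *)
(* On the line s = 1 + iη put l = l_alpha(s). Solving the equation in Fourier-Laplace variables represents S
by the inverse Laplace integral of (l / (2 s)) exp (-|x| s l). As arg l is of order -|η|^(-alpha), Re (s l)
grows like |η|^(1 - alpha), so the integrand decays faster than any power for x != 0, whence smoothness; the
decay in t < 0 comes from shifting the line. The x-derivative jumps across x = 0 by the distribution
t |-> -J with Laplace transform l^2 = tau + (1 - tau) / (1 + s^alpha). Rotating the contour onto the negative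
axis shows that J is bounded below by a positive constant on (0, T), so the jump never vanishes.
For a test function phi let W(om, s) be the Fourier-Laplace transform of phi S; then
(s^2 + om^2 / l^2) W is the transform of phi at x = 0 up to lower order terms. Along a ray (xi, 0), om^2 W
thus tends to an integral against l^2: rapid decay would make J vanish on the support of phi. Along rays with
eta != 0, W multiplied by om^2 / tau - eta^2 tends to a multiple of phi(0, 0), while at times t > 0 phi S
decays rapidly there by integration by parts in s. *)
From HB Require Import structures.
Require Import Defs.
From mathcomp Require Import all_boot all_order all_algebra.
From mathcomp Require Import complex.
From mathcomp Require Import all_classical all_reals all_analysis.
From mathcomp Require Import measurable_realfun.
From mathcomp Require Import ring lra.

Set Implicit Arguments.
Unset Strict Implicit.
Unset Printing Implicit Defensive.

Import Order.TTheory GRing.Theory Num.Theory numFieldNormedType.Exports.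
Import Normc.
Local Open Scope classical_set_scope.
Local Open Scope complex_scope.
Local Open Scope ring_scope.

(** [S] is an abstract functional, known only through its pairings. Those with [h x * exp (- s t)]
    can be computed: the convolution with [K] becomes multiplication by the symbol and the equation
    becomes an ordinary differential equation in [x], inverted by a suitable choice of [h]. A
    general test function is a limit of Riemann sums of such products in every Schwartz seminorm,
    and temperedness carries the limit through [S]. The obstacle is the axis: at [x = 0] the
    integrand is only [O (1 / |η|)]. Symbol estimates uniform in [x] gain [|η|^(alpha - 1)] per
    [η]-derivative, because against [exp (- |x| s l)] a factor [|x|] is worth that much; so every
    factor [t] buys convergence. Trading half a power of [|x|] for decay gives the majorant
    [|x|^(-1/2)] that Fubini needs. Frequency asymptotics come from a bootstrap: each use of the
    equation improves the bound on the localized transform by one power of the parameter, since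
    derivatives that fall on [phi] are of lower order. *)

Local Notation mR := measurableTypeR.
Local Notation ccont := ccontinuous_at.
Local Notation test := test_function.

(** * Complex numbers: real and imaginary parts, modulus, exponential *)

Section ComplexArith.
Context {R : realType}.
Implicit Types (z w : R[i]) (x y : R).

Lemma reD z w : re (z + w) = re z + re w. Proof. by case: z; case: w. Qed.
Lemma imD z w : im (z + w) = im z + im w. Proof. by case: z; case: w. Qed.
Lemma reN z : re (- z) = - re z. Proof. by case: z. Qed.
Lemma imN z : im (- z) = - im z. Proof. by case: z. Qed.
Lemma reB z w : re (z - w) = re z - re w. Proof. by rewrite reD reN. Qed.
Lemma imB z w : im (z - w) = im z - im w. Proof. by rewrite imD imN. Qed.
Lemma reM z w : re (z * w) = re z * re w - im z * im w.
Proof. by case: z; case: w. Qed.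
Lemma imM z w : im (z * w) = re z * im w + im z * re w.
Proof. by case: z; case: w. Qed.
Lemma reMr x z : re (x%:C * z) = x * re z. Proof. by rewrite reM /= mul0r subr0. Qed.
Lemma imMr x z : im (x%:C * z) = x * im z. Proof. by rewrite imM /= mul0r addr0. Qed.
Lemma re0 : re (0 : R[i]) = 0. Proof. by []. Qed.
Lemma im0 : im (0 : R[i]) = 0. Proof. by []. Qed.
Lemma re1 : re (1 : R[i]) = 1. Proof. by []. Qed.
Lemma im1 : im (1 : R[i]) = 0. Proof. by []. Qed.
Lemma cplxP z w : re z = re w -> im z = im w -> z = w.
Proof. by case: z; case: w => a b c d /= -> ->. Qed.
Definition reimE := (reD, imD, reN, imN, reM, imM, re0, im0, re1, im1).

Lemma normcEs z : normc z = Num.sqrt (re z ^+ 2 + im z ^+ 2).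
Proof. by case: z. Qed.
Lemma normc_sqr z : normc z ^+ 2 = re z ^+ 2 + im z ^+ 2.
Proof. by rewrite normcEs sqr_sqrtr// addr_ge0// sqr_ge0. Qed.
Lemma normc_ge0 z : 0 <= normc z. Proof. by rewrite normcEs sqrtr_ge0. Qed.
Lemma normc_re z : `|re z| <= normc z.
Proof. by rewrite normcEs -sqrtr_sqr ler_wsqrtr// lerDl sqr_ge0. Qed.
Lemma normc_im z : `|im z| <= normc z.
Proof. by rewrite normcEs -sqrtr_sqr ler_wsqrtr// lerDr sqr_ge0. Qed.
Lemma re_le_normc z : re z <= normc z.
Proof. exact: le_trans (ler_norm _) (normc_re z). Qed.
Lemma normc_reim z : normc z <= `|re z| + `|im z|.
Proof.
rewrite normcEs -(@ger0_norm _ (`|re z| + `|im z|)) ?addr_ge0//.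
rewrite -sqrtr_sqr ler_wsqrtr// sqrrD !real_normK ?num_real// lerD2r lerDl.
by rewrite mulrn_wge0// mulr_ge0.
Qed.
Lemma normcR x : normc x%:C = `|x|.
Proof. by rewrite normcEs /= expr0n addr0 sqrtr_sqr. Qed.
Lemma normcD z w : normc (z + w) <= normc z + normc w.
Proof. exact: le_normcD. Qed.
Lemma normcB z w : normc (z - w) <= normc z + normc w.
Proof. by rewrite -(normcN w); exact: normcD. Qed.
Lemma normc_distC z w : normc (z - w) = normc (w - z).
Proof. by rewrite -normcN opprB. Qed.
Lemma normc_eq0 z : (normc z == 0) = (z == 0).
Proof. by apply/eqP/eqP => [/eq0_normc//|->]; rewrite normc0. Qed.
Lemma normc_gt0 z : (0 < normc z) = (z != 0).
Proof. by rewrite lt_neqAle normc_ge0 andbT eq_sym normc_eq0. Qed.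
Lemma normcX z n : normc (z ^+ n) = normc z ^+ n.
Proof. by elim: n => [|n IH]; rewrite ?expr0 ?normc1// !exprS normcM IH. Qed.
Lemma normc_sum (I : Type) (s : seq I) (F : I -> R[i]) :
  normc (\sum_(i <- s) F i) <= \sum_(i <- s) normc (F i).
Proof.
elim: s => [|a s IH]; first by rewrite !big_nil normc0.
by rewrite !big_cons (le_trans (normcD _ _))// lerD2l.
Qed.
Lemma reV z : re z^-1 = re z / normc z ^+ 2.
Proof. by rewrite normc_sqr; case: z. Qed.
Lemma imV z : im z^-1 = - im z / normc z ^+ 2.
Proof. by rewrite normc_sqr; case: z => a b /=; rewrite mulNr. Qed.

Lemma cexpD z w : cexp (z + w) = cexp z * cexp w.
Proof.
apply: cplxP; rewrite ?reM ?imM /cexp /= reD imD expRD ?cosD ?sinD; ring.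
Qed.
Lemma cexp0 : cexp (0 : R[i]) = 1.
Proof. by apply: cplxP; rewrite /= expR0 ?cos0 ?sin0 ?mul1r ?mulr0. Qed.
Lemma normc_cexp z : normc (cexp z) = expR (re z).
Proof.
rewrite normcEs /= !exprMn -mulrDr cos2Dsin2 mulr1 sqrtr_sqr ger0_norm//.
Qed.
Lemma cexpR x : cexp x%:C = (expR x)%:C.
Proof. by apply: cplxP; rewrite /= ?cos0 ?sin0 ?mulr1 ?mulr0. Qed.

End ComplexArith.

(** * Differential calculus of complex-valued functions *)

Section Calc.
Context {R : realType} {V : normedModType R}.
Implicit Types (f g : V -> R[i]) (z v : V) (U : set V).

(** Derivability and the value in one relation: the rules compose forward, and [cder_eq] adjusts the
    value at the end by an algebraic identity. *)
Definition is_cder f z v (d : R[i]) : Prop :=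
  is_derive z v (re \o f) (re d) /\ is_derive z v (im \o f) (im d).

Lemma is_cderP f z v d : is_cder f z v d -> cderivable f z v /\ cderive v f z = d.
Proof.
move=> [[? e1] [? e2]]; split; first by split.
by apply: cplxP; rewrite /= ?e1 ?e2.
Qed.

Lemma cderivable_is f z v : cderivable f z v -> is_cder f z v (cderive v f z).
Proof. by move=> [/derivableP ? /derivableP ?]; split. Qed.

Lemma cder_eq f z v d d' : is_cder f z v d -> d = d' -> is_cder f z v d'.
Proof. by move=> + <-. Qed.

Lemma is_cder_near f g z v d : (\near z, f z = g z) ->
  is_cder f z v d -> is_cder g z v d.
Proof.
move=> fg [h1 h2]; split.
- by apply: near_eq_is_derive h1; near=> y; rewrite /= (near fg y).
- by apply: near_eq_is_derive h2; near=> y; rewrite /= (near fg y).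
Unshelve. all: by end_near. Qed.

Lemma cder_cst (a : R[i]) z v : is_cder (fun=> a) z v 0.
Proof. by split; rewrite ?re0 ?im0; exact: is_derive_cst. Qed.

Lemma is_cderD f g z v df dg : is_cder f z v df -> is_cder g z v dg ->
  is_cder (fun y => f y + g y) z v (df + dg).
Proof.
move=> [f1 f2] [g1 g2]; split; rewrite ?reD ?imD.
- rewrite (_ : _ \o _ = (re \o f) + (re \o g)); first exact: is_deriveD.
  by apply/funext => y; rewrite /= reD.
- rewrite (_ : _ \o _ = (im \o f) + (im \o g)); first exact: is_deriveD.
  by apply/funext => y; rewrite /= imD.
Qed.

Lemma is_derM (r q : V -> R) z v (dr dq : R) : is_derive z v r dr -> is_derive z v q dq ->
  is_derive z v (fun y => r y * q y) (r z * dq + dr * q z).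
Proof.
move=> hr hq; have := is_deriveM hr hq.
by rewrite /GRing.scale /= (mulrC (q z)).
Qed.

Lemma is_cderM f g z v df dg : is_cder f z v df -> is_cder g z v dg ->
  is_cder (fun y => f y * g y) z v (df * g z + f z * dg).
Proof.
move=> [f1 f2] [g1 g2]; split.
- rewrite (_ : _ \o _ = (fun y => re (f y) * re (g y)) - (fun y => im (f y) * im (g y))); last first.
    by apply/funext => y; rewrite /= reM.
  apply: (is_derive_eq (is_deriveB (is_derM f1 g1) (is_derM f2 g2))).
  by rewrite /= !reimE; ring.
- rewrite (_ : _ \o _ = (fun y => re (f y) * im (g y)) + (fun y => im (f y) * re (g y))); last first.
    by apply/funext => y; rewrite /= imM.
  apply: (is_derive_eq (is_deriveD (is_derM f1 g2) (is_derM f2 g1))).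
  by rewrite /= !reimE; ring.
Qed.

Lemma is_cderZ (a : R[i]) f z v df : is_cder f z v df ->
  is_cder (fun y => a * f y) z v (a * df).
Proof.
move=> h; apply: cder_eq (is_cderM (cder_cst a z v) h) _.
by rewrite mul0r add0r.
Qed.

Lemma is_cderN f z v df : is_cder f z v df -> is_cder (fun y => - f y) z v (- df).
Proof.
move=> h; have := is_cderZ (-1) h; rewrite mulN1r.
by apply: is_cder_near; near=> y; rewrite mulN1r.
Unshelve. all: by end_near. Qed.

Lemma is_cderB f g z v df dg : is_cder f z v df -> is_cder g z v dg ->
  is_cder (fun y => f y - g y) z v (df - dg).
Proof. by move=> hf hg; apply: is_cderD => //; exact: is_cderN. Qed.

Lemma is_cder_sum (I : Type) (s : seq I) (F : I -> V -> R[i]) (D : I -> R[i]) z v :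
  (forall i, is_cder (F i) z v (D i)) ->
  is_cder (fun y => \sum_(i <- s) F i y) z v (\sum_(i <- s) D i).
Proof.
move=> h; elim: s => [|a s IH].
  rewrite big_nil; have := cder_cst 0 z v.
  by apply: is_cder_near; near=> y; rewrite big_nil.
rewrite big_cons; have := is_cderD (h a) IH.
by apply: is_cder_near; near=> y; rewrite big_cons.
Unshelve. all: by end_near. Qed.

(** The difference quotient of [f] at [z] along [v] is literally that of [h |-> f (h *: v + z)] at
    0. One-variable results, the chain rule above all, reach directional derivatives through it. *)
Lemma is_derive_line (W : normedModType R) (f : V -> W) z v (d : W) :
  is_derive z v f d <-> is_derive (0 : R) (1 : R) (fun h : R => f (h *: v + z)) d.
Proof.
have e : (fun h : R => h^-1 *: (((fun h : R => f (h *: v + z)) \o shift (0 : R)) (h *: (1 : R)) - f ((0 : R) *: v + z)))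
   = (fun h : R => h^-1 *: ((f \o shift z) (h *: v) - f z)).
  apply/funext => h; rewrite /= /shift /= addr0 scale0r add0r.
  by rewrite /GRing.scale /= mulr1.
split=> -[d1 d2]; split.
- by rewrite /derivable e.
- by rewrite /derive e.
- by move: d1; rewrite /derivable e.
- by move: d2; rewrite /derive e.
Qed.

Lemma is_derive_compR (r : V -> R) (g : R -> R) z v (dr dg : R) :
  is_derive z v r dr -> is_derive (r z) (1 : R) g dg ->
  is_derive z v (g \o r) (dg * dr).
Proof.
move=> /is_derive_line hr hg; apply/is_derive_line.
have hg' : is_derive (r ((0 : R) *: v + z)) (1 : R) g dg by rewrite scale0r add0r.
by have := @is_derive1_comp _ g (fun h : R => r (h *: v + z)) 0 _ _ hg' hr.
Qed.

Lemma is_cderR (r : V -> R) z v (dr : R) : is_derive z v r dr ->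
  is_cder (fun y => (r y)%:C) z v dr%:C.
Proof. by move=> h; split => //=; exact: is_derive_cst. Qed.

Lemma cder_exp f z v df : is_cder f z v df ->
  is_cder (fun y => cexp (f y)) z v (df * cexp (f z)).
Proof.
move=> [f1 f2].
have e := is_derive_compR f1 (is_derive_expR _).
have c := is_derive_compR f2 (is_derive_cos _).
have s := is_derive_compR f2 (is_derive_sin _).
split; rewrite ?reM ?imM.
- rewrite (_ : _ \o _ = fun y => (expR \o (re \o f)) y * (cos \o (im \o f)) y) //.
  by apply: (is_derive_eq (is_derM e c)) => /=; ring.
- rewrite (_ : _ \o _ = fun y => (expR \o (re \o f)) y * (sin \o (im \o f)) y) //.
  by apply: (is_derive_eq (is_derM e s)) => /=; ring.
Qed.

Lemma is_derV (r : V -> R) z v (dr : R) : r z != 0 -> is_derive z v r dr ->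
  is_derive z v (fun y => (r y)^-1) (- dr / r z ^+ 2).
Proof.
move=> r0 [h1 h2]; split; first exact: derivableV.
by rewrite deriveV// h2 /GRing.scale /= mulrC mulrN mulNr.
Qed.

(** The parts of [1 / f] are those of the conjugate of [f] over the real function [N = |f|^2]; [hd]
    brings the expected value [- df / f^2] to the same real denominator. *)
Lemma is_cderV f z v df : f z != 0 -> is_cder f z v df ->
  is_cder (fun y => (f y)^-1) z v (- df / f z ^+ 2).
Proof.
move=> f0 [f1 f2].
pose N := fun y => re (f y) * re (f y) + im (f y) * im (f y).
have Nz : N z = normc (f z) ^+ 2 by rewrite /N normc_sqr !expr2.
have N0 : N z != 0 by rewrite Nz expf_neq0// normc_eq0.
have hN : is_derive z v N _ := is_deriveD (is_derM f1 f1) (is_derM f2 f2).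
have hNV := is_derV N0 hN.
have NE y : N y = normc (f y) ^+ 2 by rewrite /N normc_sqr !expr2.
have hd : - df / f z ^+ 2 = - df * ((re (f z) -i* im (f z)) ^+ 2) / ((N z)%:C ^+ 2).
  have fE : f z * (re (f z) -i* im (f z)) = (N z)%:C.
    by apply: cplxP; rewrite ?reM ?imM /N /=; ring.
  have c0 : (re (f z) -i* im (f z)) != 0.
    apply/eqP => h; move: fE; rewrite h mulr0 => /(congr1 (@re R)) /= /esym/eqP.
    by rewrite (negbTE N0).
  by rewrite -fE; field; rewrite f0 c0.
have hd2 : ((N z)%:C ^+ 2)^-1 = ((N z ^+ 2)^-1)%:C by rewrite -rmorphXn fmorphV.
split; rewrite hd hd2.
- rewrite (_ : _ \o _ = fun y => re (f y) * (N y)^-1); last first.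
    by apply/funext => y; rewrite /= reV NE.
  apply: (is_derive_eq (is_derM f1 hNV)).
  by rewrite expr2 /= !reimE /= /N; field.
- rewrite (_ : _ \o _ = fun y => (- im (f y)) * (N y)^-1); last first.
    by apply/funext => y; rewrite /= imV NE.
  apply: (is_derive_eq (is_derM (is_deriveN f2) hNV)).
  rewrite (_ : (- (im \o f)) z = - im (f z)) // .
  by rewrite expr2 /= !reimE /= /N; field.
Qed.

Lemma ccont_cst (a : R[i]) z : ccont (fun=> a) z.
Proof. by split; exact: cst_continuous. Qed.

Lemma ccontD f g z : ccont f z -> ccont g z ->
  ccont (fun y => f y + g y) z.
Proof.
move=> [f1 f2] [g1 g2]; split.
- rewrite (_ : _ \o _ = (re \o f) + (re \o g)); first exact: continuousD.
  by apply/funext => y; rewrite /= reD.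
- rewrite (_ : _ \o _ = (im \o f) + (im \o g)); first exact: continuousD.
  by apply/funext => y; rewrite /= imD.
Qed.

Lemma ccontM f g z : ccont f z -> ccont g z ->
  ccont (fun y => f y * g y) z.
Proof.
move=> [f1 f2] [g1 g2]; split.
- rewrite (_ : _ \o _ = (re \o f) * (re \o g) - (im \o f) * (im \o g)).
    by apply: continuousB; exact: continuousM.
  by apply/funext => y; rewrite /= reM.
- rewrite (_ : _ \o _ = (re \o f) * (im \o g) + (im \o f) * (re \o g)).
    by apply: continuousD; exact: continuousM.
  by apply/funext => y; rewrite /= imM.
Qed.

Lemma ccontR (r : V -> R) z : {for z, continuous r} -> ccont (fun y => (r y)%:C) z.
Proof. by move=> h; split => //=; exact: cst_continuous. Qed.

Lemma ccont_exp f z : ccont f z -> ccont (fun y => cexp (f y)) z.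
Proof.
move=> [f1 f2].
have e : {for z, continuous (expR \o (re \o f))}.
  by apply: continuous_comp => //; exact: continuous_expR.
have c : {for z, continuous (cos \o (im \o f))}.
  by apply: continuous_comp => //; exact: continuous_cos.
have s : {for z, continuous (sin \o (im \o f))}.
  by apply: continuous_comp => //; exact: continuous_sin.
by split; [exact: continuousM e c|exact: continuousM e s].
Qed.

Lemma ccont_near f g z : (\near z, f z = g z) -> ccont f z -> ccont g z.
Proof.
move=> fg [h1 h2]; have fgz := nbhs_singleton fg; split.
- rewrite /prop_for /continuous_at /= -fgz; apply: cvg_trans h1.
  by apply: near_eq_cvg; near=> y; rewrite /= (near fg y).
- rewrite /prop_for /continuous_at /= -fgz; apply: cvg_trans h2.
  by apply: near_eq_cvg; near=> y; rewrite /= (near fg y).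
Unshelve. all: by end_near. Qed.

Lemma ccont_norm f z : ccont f z -> {for z, continuous (fun y => normc (f y))}.
Proof.
move=> [f1 f2].
rewrite (_ : (fun y => _) = Num.sqrt \o ((re \o f) * (re \o f) + (im \o f) * (im \o f))).
  apply: continuous_comp; last exact: sqrt_continuous.
  by apply: continuousD; exact: continuousM.
by apply/funext => y; rewrite /= normcEs !expr2.
Qed.

End Calc.

Lemma ccont_comp {R : realType} {V W : normedModType R} (f : W -> R[i]) (g : V -> W) z :
  {for z, continuous g} -> ccont f (g z) -> ccont (f \o g) z.
Proof.
by move=> cg [f1 f2]; split; [exact: (continuous_comp cg f1)|exact: (continuous_comp cg f2)].
Qed.

Lemma is_cder_comp {R : realType} {V : normedModType R} (f : R -> R[i]) (g : V -> R) z v d dg :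
  is_derive z v g dg -> is_cder f (g z) 1 d -> is_cder (f \o g) z v (dg%:C * d).
Proof.
move=> hg [h1 h2]; split; rewrite ?reMr ?imMr mulrC.
- exact: (is_derive_compR hg h1).
- exact: (is_derive_compR hg h2).
Qed.

Lemma cder_cont {R : realType} (f : R -> R[i]) (x : R) d :
  is_cder f x 1 d -> ccont f x.
Proof.
move=> [[h1 _] [h2 _]]; split.
- by apply: differentiable_continuous; exact/derivable1_diffP.
- by apply: differentiable_continuous; exact/derivable1_diffP.
Qed.

(** * Smoothness through families stable under differentiation *)

Section Smooth.
Context {R : realType} {V : normedModType R}.
Implicit Types (f g : V -> R[i]) (z v : V) (U : set V).

Lemma cderive_eq_on U f g : open U -> (forall z, U z -> f z = g z) ->
  forall v z, U z -> cderive v f z = cderive v g z.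
Proof.
move=> oU fg v z Uz; have nU : \near z, U z by exact: open_nbhs_nbhs.
apply: cplxP => /=; apply: near_eq_derive; near=> y; rewrite /= fg//; near: y; exact: nU.
Unshelve. all: by end_near. Qed.

Lemma iter_derive_eq_on U f g : open U -> (forall z, U z -> f z = g z) ->
  forall vs z, U z -> iter_derive vs f z = iter_derive vs g z.
Proof.
move=> oU fg; elim=> [|v vs IH] z Uz /=; first exact: fg.
exact: cderive_eq_on Uz.
Qed.

Lemma iter_derive_cat vs ws f : iter_derive vs (iter_derive ws f) = iter_derive (vs ++ ws) f.
Proof. by rewrite /iter_derive foldr_cat. Qed.

Lemma smooth_cder U f vs z v : smooth_on U f -> U z ->
  is_cder (iter_derive vs f) z v (iter_derive (v :: vs) f z).
Proof. by move=> sf Uz; apply: cderivable_is; have [_] := sf vs z Uz. Qed.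

Lemma smooth_cder0 U f z v : smooth_on U f -> U z -> is_cder f z v (cderive v f z).
Proof. exact: (@smooth_cder U f [::]). Qed.

Lemma smooth_cont U f z : smooth_on U f -> U z -> ccont f z.
Proof. by move=> /(_ [::] z) h /h[]. Qed.

Lemma smooth_iter U f ws : smooth_on U f -> smooth_on U (iter_derive ws f).
Proof. by move=> sf vs z Uz; rewrite iter_derive_cat; exact: sf. Qed.

Lemma smooth_cderive U f v : smooth_on U f -> smooth_on U (cderive v f).
Proof. exact: (@smooth_iter U f [:: v]). Qed.

Lemma smooth_sub U U' f : U' `<=` U -> smooth_on U f -> smooth_on U' f.
Proof. by move=> UU sf vs z /UU; exact: sf. Qed.

Lemma smooth_eq_on U f g : open U -> (forall z, U z -> f z = g z) ->
  smooth_on U f -> smooth_on U g.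
Proof.
move=> oU fg sf vs z Uz; have [c d] := sf vs z Uz.
have nU : \near z, U z by exact: open_nbhs_nbhs.
have e : \near z, iter_derive vs f z = iter_derive vs g z.
  by near=> y; apply: (iter_derive_eq_on oU fg); near: y; exact: nU.
split; first exact: ccont_near c.
move=> v; have := cderivable_is (d v).
by move=> /(is_cder_near e)/is_cderP[].
Unshelve. all: by end_near. Qed.

(** The complex linear span of [F], as an inductive predicate so that its closure properties go by
    induction on the combination. *)
Inductive spn (F : set (V -> R[i])) : (V -> R[i]) -> Prop :=
| spn0 : spn F (fun=> 0)
| spnS a f g : F f -> spn F g -> spn F (fun z => a * f z + g z).

Lemma spn1 F f : F f -> spn F f.
Proof.
move=> Ff; rewrite (_ : f = fun z => 1 * f z + 0); first exact: (spnS 1 Ff (spn0 F)).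
by apply/funext => z; rewrite mul1r addr0.
Qed.

Lemma spnD F f g : spn F f -> spn F g -> spn F (fun z => f z + g z).
Proof.
move=> + sg; elim=> [|a h k Fh sk IH].
  by rewrite (_ : (fun _ => _) = g)//; apply/funext => z; rewrite add0r.
rewrite (_ : (fun _ => _) = fun z => a * h z + (k z + g z)); first exact: spnS.
by apply/funext => z; rewrite addrA.
Qed.

Lemma spnZ F b f : spn F f -> spn F (fun z => b * f z).
Proof.
elim=> [|a h k Fh sk IH].
  by rewrite (_ : (fun _ => _) = fun=> 0); [exact: spn0|apply/funext => z; rewrite mulr0].
rewrite (_ : (fun _ => _) = fun z => (b * a) * h z + b * k z); first exact: spnS.
by apply/funext => z; rewrite mulrDr mulrA.
Qed.

(** The device behind the smoothness proofs below: if the members of [F] are continuous and their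
    directional derivatives are combinations of members, then all iterated derivatives stay in the
    span. Closing a family once replaces an induction over lists of directions. *)
Definition dstable U (F : set (V -> R[i])) :=
  forall f, F f -> (forall z, U z -> ccont f z) /\
    forall v, exists2 g, spn F g & forall z, U z -> is_cder f z v (g z).

Lemma dstable_spn U F : dstable U F -> dstable U (spn F).
Proof.
move=> dF f; elim=> [|a h k Fh sk [ck dk]].
  split=> [z _|v]; first exact: ccont_cst.
  by exists (fun=> 0); [exact: spn0|move=> z _; exact: cder_cst].
have [ch dh] := dF _ Fh; split=> [z Uz|v].
  by apply: ccontD (ck _ Uz); apply: ccontM (ch _ Uz); exact: ccont_cst.
have [h' sh' hh'] := dh v; have [k' sk' hk'] := dk v.
exists (fun z => a * h' z + k' z).
  apply: spnD; first exact/spn1/spnZ.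
  exact: sk'.
move=> z Uz; apply: is_cderD (hk' _ Uz); exact: is_cderZ (hh' _ Uz).
Qed.

Lemma spn_spn F f : spn (spn F) f -> spn F f.
Proof.
elim=> [|a h k Fh sk IH]; first exact: spn0.
by apply: spnD => //; exact: spnZ.
Qed.

Lemma dstable_iter U F f : open U -> dstable U F -> F f -> forall vs,
  exists2 g, spn F g & forall z, U z -> iter_derive vs f z = g z.
Proof.
move=> oU dF Ff; elim=> [|v vs [g sg hg]].
  by exists f => //; exact: spn1.
have [_ /(_ v)[g' /spn_spn sg' hg']] := dstable_spn dF sg.
exists g' => // z Uz /=; rewrite (cderive_eq_on oU hg)//.
by have [] := is_cderP (hg' z Uz).
Qed.

Lemma dstable_smooth U F f : open U -> dstable U F -> F f -> smooth_on U f.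
Proof.
move=> oU dF Ff vs z Uz; have [g sg hg] := dstable_iter oU dF Ff vs.
have [cg dg] := dstable_spn dF sg.
have nU : \near z, U z by exact: open_nbhs_nbhs.
have e : \near z, g z = iter_derive vs f z.
  by near=> y; rewrite hg//; near: y; exact: nU.
split; first by apply: ccont_near e _; exact: cg.
move=> v; have [g' _ hg'] := dg v.
by have /(is_cder_near e)/is_cderP[] := hg' z Uz.
Unshelve. all: by end_near. Qed.

Lemma smooth_dstable U : dstable U (smooth_on U).
Proof.
move=> f sf; split=> [z Uz|v]; first exact: (smooth_cont sf Uz).
exists (cderive v f); first exact/spn1/smooth_cderive.
by move=> z Uz; exact: (smooth_cder0 v sf Uz).
Qed.

Lemma smooth_spn U f : open U -> spn (smooth_on U) f -> smooth_on U f.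
Proof.
move=> oU sf; exact: (dstable_smooth oU (dstable_spn (@smooth_dstable U)) sf).
Qed.

Lemma smoothD U f g : open U -> smooth_on U f -> smooth_on U g ->
  smooth_on U (fun z => f z + g z).
Proof. by move=> oU sf sg; apply: smooth_spn => //; apply: spnD; exact: spn1. Qed.

Lemma smoothZ U (a : R[i]) f : open U -> smooth_on U f -> smooth_on U (fun z => a * f z).
Proof. by move=> oU sf; apply: smooth_spn => //; apply: spnZ; exact: spn1. Qed.

Lemma smooth_cst U (a : R[i]) : open U -> smooth_on U (fun=> a).
Proof.
move=> oU; apply: (@dstable_smooth _ [set f | exists a, f = fun=> a]); [by []| |by exists a].
move=> f [b ->]; split=> [z _|v]; first exact: ccont_cst.
by exists (fun=> 0); [exact: spn0|move=> z _; exact: cder_cst].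
Qed.

Lemma smooth_sum U (I : Type) (s : seq I) (F : I -> V -> R[i]) : open U ->
  (forall i, smooth_on U (F i)) -> smooth_on U (fun z => \sum_(i <- s) F i z).
Proof.
move=> oU h; elim: s => [|a s IH].
  by rewrite (_ : (fun _ => _) = fun=> 0); [exact: smooth_cst|apply/funext => z; rewrite big_nil].
rewrite (_ : (fun _ => _) = fun z => F a z + \sum_(i <- s) F i z); first exact: (smoothD oU (h a) IH).
by apply/funext => z; rewrite big_cons.
Qed.

Lemma iter_derive_cst (a : R[i]) (vs : seq V) :
  iter_derive vs (fun=> a) = fun=> (if vs is [::] then a else 0).
Proof.
case/lastP: vs => // vs v; rewrite -cats1 -iter_derive_cat /=.
have -> : cderive v (fun=> a) = (fun=> 0) :> (V -> R[i]).
  by apply/funext => z; have [_ ->] := is_cderP (cder_cst a z v).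
have -> : iter_derive vs (fun=> 0) = fun=> 0 :> R[i].
  elim: vs => //= w vs ->; apply/funext => z.
  by have [_ ->] := is_cderP (cder_cst 0 z w).
by case: vs.
Qed.

Lemma iter_deriveD U f g vs z : smooth_on U f -> smooth_on U g -> open U -> U z ->
  iter_derive vs (fun z => f z + g z) z = iter_derive vs f z + iter_derive vs g z.
Proof.
move=> sf sg oU; elim: vs z => [//|v vs IH] z Uz.
rewrite [LHS]/= (cderive_eq_on oU IH)//.
by have [_ ->] := is_cderP (is_cderD (smooth_cder vs v sf Uz) (smooth_cder vs v sg Uz)).
Qed.

Lemma iter_deriveZ U (a : R[i]) f vs z : smooth_on U f -> open U -> U z ->
  iter_derive vs (fun z => a * f z) z = a * iter_derive vs f z.
Proof.
move=> sf oU; elim: vs z => [//|v vs IH] z Uz.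
rewrite [LHS]/= (cderive_eq_on oU IH)//.
by have [_ ->] := is_cderP (is_cderZ a (smooth_cder vs v sf Uz)).
Qed.

Lemma iter_derive_sum U (I : Type) (s : seq I) (F : I -> V -> R[i]) vs z : open U ->
  (forall i, smooth_on U (F i)) -> U z ->
  iter_derive vs (fun z => \sum_(i <- s) F i z) z = \sum_(i <- s) iter_derive vs (F i) z.
Proof.
move=> oU h Uz; elim: s => [|a s IH].
  rewrite (_ : (fun _ => _) = fun=> 0); last by apply/funext => y; rewrite big_nil.
  by rewrite iter_derive_cst big_nil; case: vs.
rewrite (_ : (fun _ => _) = fun z => F a z + \sum_(i <- s) F i z); last first.
  by apply/funext => y; rewrite big_cons.
by rewrite (iter_deriveD _ (h a) (smooth_sum _ oU h) oU Uz) IH big_cons.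
Qed.

(** All ways to deal the directions out to two factors, their order kept: the index set of the
    Leibniz rule. *)
Fixpoint lsplit (vs : seq V) : seq (seq V * seq V) :=
  if vs is v :: vs' then
    [seq (v :: p.1, p.2) | p <- lsplit vs'] ++ [seq (p.1, v :: p.2) | p <- lsplit vs']
  else [:: ([::], [::])].

Lemma leibniz U f g vs z : open U -> smooth_on U f -> smooth_on U g -> U z ->
  iter_derive vs (fun z => f z * g z) z =
  \sum_(p <- lsplit vs) iter_derive p.1 f z * iter_derive p.2 g z.
Proof.
move=> oU sf sg; elim: vs z => [|v vs IH] z Uz; first by rewrite big_seq1.
rewrite [LHS]/= (cderive_eq_on oU IH)// big_cat !big_map /= -big_split /=.
have := @is_cder_sum R V _ (lsplit vs) (fun p z => iter_derive p.1 f z * iter_derive p.2 g z).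
move=> /(_ _ z v (fun p => is_cderM (smooth_cder p.1 v sf Uz) (smooth_cder p.2 v sg Uz))).
by case/is_cderP.
Qed.

Lemma smoothM U f g : open U -> smooth_on U f -> smooth_on U g ->
  smooth_on U (fun z => f z * g z).
Proof.
move=> oU sf sg.
pose F := [set h | exists f g, [/\ smooth_on U f, smooth_on U g & h = fun z => f z * g z]].
suff dF : dstable U F by apply: (dstable_smooth oU dF); exists f, g.
move=> _ [a [b [sa sb ->]]]; split=> [z Uz|v].
  by apply: ccontM; [exact: (smooth_cont sa Uz)|exact: (smooth_cont sb Uz)].
exists (fun z => cderive v a z * b z + a z * cderive v b z).
  apply: spnD; apply: spn1.
    by exists (cderive v a), b; split; [exact: smooth_cderive|exact: sb|reflexivity].
  by exists a, (cderive v b); split; [exact: sa|exact: smooth_cderive|reflexivity].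
by move=> z Uz; apply: is_cderM; [exact: (smooth_cder0 v sa Uz)|exact: (smooth_cder0 v sb Uz)].
Qed.

Lemma smooth_exp U f : open U -> smooth_on U f -> smooth_on U (fun z => cexp (f z)).
Proof.
move=> oU sf.
pose F := [set h | exists2 g, smooth_on U g & h = fun z => g z * cexp (f z)].
suff dF : dstable U F.
  apply: (dstable_smooth oU dF).
  by exists (fun=> 1); [exact: smooth_cst|apply/funext => z; rewrite mul1r].
move=> _ [a sa ->]; split=> [z Uz|v].
  by apply: ccontM; [exact: (smooth_cont sa Uz)|apply: ccont_exp; exact: (smooth_cont sf Uz)].
exists (fun z => (cderive v a z + a z * cderive v f z) * cexp (f z)).
  apply: spn1; exists (fun z => cderive v a z + a z * cderive v f z); last reflexivity.
  apply: (smoothD oU); first exact: smooth_cderive.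
  by apply: (smoothM oU sa); exact: smooth_cderive.
move=> z Uz; apply: cder_eq; first exact: (is_cderM (smooth_cder0 v sa Uz) (cder_exp (smooth_cder0 v sf Uz))).
by rewrite mulrDl mulrA.
Qed.

(** The stable family is [g / f^n] with [g] smooth; a derivative that falls on the denominator
    raises [n] by one, hence the free exponent. *)
Lemma smoothV U f : open U -> (forall z, U z -> f z != 0) -> smooth_on U f ->
  smooth_on U (fun z => (f z)^-1).
Proof.
move=> oU f0 sf.
pose F := [set h | exists g n, smooth_on U g /\ h = fun z => g z * (f z)^-1 ^+ n].
suff dF : dstable U F.
  apply: (dstable_smooth oU dF).
  exists (fun=> 1), 1%N; split; first exact: smooth_cst.
  by apply/funext => z; rewrite mul1r.
have pw n z v : U z -> is_cder (fun z => (f z)^-1 ^+ n) z v (n%:R * (- cderive v f z) * (f z)^-1 ^+ n.+1).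
  move=> Uz; elim: n => [|n IH].
    rewrite !mul0r; have := cder_cst 1 z v.
    by apply: is_cder_near; near=> y; rewrite expr0.
  have := is_cderM (is_cderV (f0 z Uz) (smooth_cder0 v sf Uz)) IH.
  rewrite (_ : (fun y => _) = fun z => (f z)^-1 ^+ n.+1); last by apply/funext => y; rewrite exprS.
  move=> h; apply: cder_eq h _; rewrite -exprVn -(natr1 n) !exprS expr0.
  by move: ((f z)^-1) ((f z)^-1 ^+ n) (cderive v f z) => w wn d; ring.
move=> _ [a [n [sa ->]]]; split=> [z Uz|v].
  apply: ccontM; first exact: (smooth_cont sa Uz).
  elim: n => [|n IH]; first by apply: ccont_near (ccont_cst 1 z); near=> y; rewrite expr0.
  have fV : ccont (fun z => (f z)^-1) z.
    have [f1 f2] := smooth_cont sf Uz; split.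
    - rewrite (_ : _ \o _ = fun y => re (f y) / (normc (f y) ^+ 2)); last by apply/funext => y /=; rewrite reV.
      apply: continuousM => //; apply: continuousV; first by rewrite expf_neq0// normc_eq0 f0.
      have cN := ccont_norm (conj f1 f2).
      by rewrite (_ : (fun y => _) = (fun y => normc (f y)) * (fun y => normc (f y))); [exact: continuousM|apply/funext => y; rewrite expr2].
    - rewrite (_ : _ \o _ = fun y => (- im (f y)) / (normc (f y) ^+ 2)); last by apply/funext => y /=; rewrite imV.
      apply: continuousM; first exact: continuousN.
      apply: continuousV; first by rewrite expf_neq0// normc_eq0 f0.
      have cN := ccont_norm (conj f1 f2).
      by rewrite (_ : (fun y => _) = (fun y => normc (f y)) * (fun y => normc (f y))); [exact: continuousM|apply/funext => y; rewrite expr2].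
  by have := ccontM fV IH; apply: ccont_near; near=> y; rewrite exprS.
exists (fun z => cderive v a z * (f z)^-1 ^+ n + n%:R * (- (a z * cderive v f z) * (f z)^-1 ^+ n.+1)).
  apply: spnD.
    by apply: spn1; exists (cderive v a), n; split; [exact: smooth_cderive|reflexivity].
  apply: spnZ; apply: spn1; exists (fun z => - (a z * cderive v f z)), n.+1; split; last reflexivity.
  have := smoothZ (-1) oU (smoothM oU sa (smooth_cderive v sf)).
  by apply: smooth_eq_on => // y _; rewrite mulN1r.
move=> z Uz; apply: cder_eq (is_cderM (smooth_cder0 v sa Uz) (pw n z v Uz)) _.
by congr (_ + _); ring.
Unshelve. all: by end_near. Qed.

End Smooth.

(** * Composition with an affine map [A] of linear part [L] *)

Section Affine.
Context {R : realType} {V W : normedModType R}.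
Context (A L : V -> W).
Context (AL : forall (h : R) v z, A (h *: v + z) = h *: L v + A z).

Let quot_affine (q : W -> R) z v :
  (fun h : R => h^-1 *: (((q \o A) \o shift z) (h *: v) - (q \o A) z)) =
  (fun h => h^-1 *: ((q \o shift (A z)) (h *: L v) - q (A z))).
Proof. by apply/funext => h; rewrite /= /shift /= AL. Qed.

Lemma cderive_affine (f : W -> R[i]) v : cderive v (f \o A) = cderive (L v) f \o A.
Proof.
have e (q : W -> R) z : 'D_v (q \o A) z = 'D_(L v) q (A z).
  by rewrite /derive quot_affine.
by apply/funext => z; apply: cplxP; exact: e.
Qed.

Lemma cderivable_affine (f : W -> R[i]) z v : cderivable f (A z) (L v) -> cderivable (f \o A) z v.
Proof.
have e (q : W -> R) : derivable q (A z) (L v) -> derivable (q \o A) z v.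
  by rewrite /derivable quot_affine.
by move=> [h1 h2]; split; [exact: (e (re \o f))|exact: (e (im \o f))].
Qed.

Lemma iter_derive_affine (f : W -> R[i]) vs :
  iter_derive vs (f \o A) = iter_derive (map L vs) f \o A.
Proof. by elim: vs => //= v vs ->; rewrite cderive_affine. Qed.

Lemma smooth_affine (f : W -> R[i]) U : continuous A -> smooth_on U f ->
  smooth_on (A @^-1` U) (f \o A).
Proof.
move=> cA sf vs z Uz; rewrite iter_derive_affine.
have [c d] := sf (map L vs) _ Uz; split; first exact: ccont_comp (cA z) c.
by move=> v; apply: cderivable_affine; exact: d.
Qed.
End Affine.

(** * Schwartz functions and their multipliers *)

Section Schwartz.
Context {R : realType} {V : normedModType R}.
Implicit Types (f g : V -> R[i]) (z v : V).

Let openT' := @openT V.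

(** Polynomial growth of all derivatives: the multipliers of the Schwartz space
    ([schwartz_slowM]). *)
Definition slow f := smooth_on setT f /\
  forall vs, exists n (C : R), forall z, normc (iter_derive vs f z) <= C * (1 + `|z|) ^+ n.

Definition rapid f := forall n : nat, exists M : R, forall z, (1 + `|z|) ^+ n * normc (f z) <= M.

Lemma one_norm_ge1 z : 1 <= 1 + `|z| :> R. Proof. by rewrite lerDl. Qed.
Lemma one_norm_gt0 z : 0 < 1 + `|z| :> R. Proof. exact: lt_le_trans (one_norm_ge1 z). Qed.
Lemma one_normX_gt0 z n : 0 < (1 + `|z|) ^+ n :> R.
Proof. by rewrite exprn_gt0// one_norm_gt0. Qed.

Lemma schwartz_smooth f : schwartz f -> smooth_on setT f. Proof. by case. Qed.

Lemma schwartzP f : schwartz f <-> smooth_on setT f /\ forall vs, rapid (iter_derive vs f).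
Proof.
split=> -[sf h]; split; [exact: sf|move=> vs n; exact: h|exact: sf|move=> n vs; exact: h].
Qed.

Lemma schwartz_iter f vs : schwartz f -> schwartz (iter_derive vs f).
Proof.
move=> [sf h]; split; first exact: smooth_iter.
by move=> n ws; have [M hM] := h n (ws ++ vs); exists M => z; rewrite iter_derive_cat.
Qed.

Lemma schwartz_cderive f v : schwartz f -> schwartz (cderive v f).
Proof. exact: (@schwartz_iter f [:: v]). Qed.

Lemma rapid0 : rapid (fun=> 0).
Proof. by move=> n; exists 0 => z; rewrite normc0 mulr0. Qed.

Lemma rapidD f g : rapid f -> rapid g -> rapid (fun z => f z + g z).
Proof.
move=> hf hg n; have [M hM] := hf n; have [N hN] := hg n; exists (M + N) => z.
apply: le_trans (lerD (hM z) (hN z)); rewrite -mulrDr; apply: ler_wpM2l; last exact: normcD.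
exact/ltW/one_normX_gt0.
Qed.

Lemma rapidZ (a : R[i]) f : rapid f -> rapid (fun z => a * f z).
Proof.
move=> hf n; have [M hM] := hf n; exists (normc a * M) => z.
by rewrite normcM mulrCA ler_wpM2l// normc_ge0.
Qed.

Lemma rapid_spn (F : set (V -> R[i])) f : (forall g, F g -> rapid g) -> spn F f -> rapid f.
Proof.
move=> hF; elim=> [|a h k Fh sk IH]; first exact: rapid0.
by apply: rapidD IH; apply: rapidZ; exact: hF.
Qed.

(** Derivatives are combinations of members, so decay has to be checked only on the members
    themselves, undifferentiated. *)
Lemma dstable_schwartz (F : set (V -> R[i])) f : dstable setT F ->
  (forall g, F g -> rapid g) -> F f -> schwartz f.
Proof.
move=> dF rF Ff; apply/schwartzP; split; first exact: (dstable_smooth openT' dF).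
move=> vs; have [g sg hg] := dstable_iter openT' dF Ff vs.
by move=> n; have [M hM] := rapid_spn rF sg n; exists M => z; rewrite hg.
Qed.

Lemma schwartzD f g : schwartz f -> schwartz g -> schwartz (fun z => f z + g z).
Proof.
move=> /schwartzP[sf hf] /schwartzP[sg hg]; apply/schwartzP; split; first exact: (smoothD openT' sf sg).
move=> vs n; have [M hM] := rapidD (hf vs) (hg vs) n; exists M => z.
by rewrite (iter_deriveD _ sf sg openT').
Qed.

Lemma schwartzZ (a : R[i]) f : schwartz f -> schwartz (fun z => a * f z).
Proof.
move=> /schwartzP[sf hf]; apply/schwartzP; split; first exact: (smoothZ _ openT' sf).
move=> vs n; have [M hM] := rapidZ a (hf vs) n; exists M => z.
by rewrite (iter_deriveZ _ _ sf openT').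
Qed.

Lemma schwartz0 : schwartz ((fun=> 0) : V -> R[i]).
Proof.
apply/schwartzP; split; first exact: (smooth_cst _ openT').
by move=> vs; rewrite iter_derive_cst; case: vs => [|? ?]; exact: rapid0.
Qed.

Lemma schwartz_slowM f g : slow g -> schwartz f -> schwartz (fun z => g z * f z).
Proof.
move=> [sg hg] /schwartzP[sf hf]; apply/schwartzP; split; first exact: (smoothM openT' sg sf).
move=> vs.
have -> : iter_derive vs (fun z => g z * f z) =
    fun z => \sum_(p <- lsplit vs) iter_derive p.1 g z * iter_derive p.2 f z.
  by apply/funext => z; rewrite (leibniz _ openT' sg sf).
elim: (lsplit vs) => [|p s IH].
  by move=> n; exists 0 => z; rewrite big_nil normc0 mulr0.
suff h : rapid (fun z => iter_derive p.1 g z * iter_derive p.2 f z).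
  by move=> n; have [M hM] := rapidD h IH n; exists M => z; rewrite big_cons.
move=> n; have [k [C hC]] := hg p.1; have [M hM] := hf p.2 (n + k)%N.
exists (C * M) => z; rewrite normcM mulrCA.
have C0 : 0 <= C by rewrite -(pmulr_lge0 _ (one_normX_gt0 z k)) (le_trans _ (hC z))// normc_ge0.
apply: (@le_trans _ _ (C * (1 + `|z|) ^+ k * ((1 + `|z|) ^+ n * normc (iter_derive p.2 f z)))).
  apply: ler_wpM2r (hC z); rewrite mulr_ge0 ?normc_ge0//; exact/ltW/one_normX_gt0.
rewrite -mulrA ler_wpM2l// mulrA -exprD addnC; exact: hM.
Qed.

Lemma slow_bound_le (C : R) n m z : 0 <= C -> (n <= m)%N ->
  C * (1 + `|z|) ^+ n <= C * (1 + `|z|) ^+ m.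
Proof. by move=> C0 nm; rewrite ler_wpM2l// ler_weXn2l// one_norm_ge1. Qed.

Definition pgrowth f := exists n (C : R), 0 <= C /\ forall z, normc (f z) <= C * (1 + `|z|) ^+ n.

Lemma pgrowth_ex f : (exists n (C : R), forall z, normc (f z) <= C * (1 + `|z|) ^+ n) -> pgrowth f.
Proof.
move=> [n [C h]]; exists n, C; split => //.
by rewrite -(pmulr_lge0 _ (one_normX_gt0 0 n)) (le_trans _ (h 0))// normc_ge0.
Qed.

Lemma pgrowth0 : pgrowth (fun=> 0).
Proof. by exists 0%N, 0; split => // z; rewrite normc0 mul0r. Qed.

Lemma pgrowthD f g : pgrowth f -> pgrowth g -> pgrowth (fun z => f z + g z).
Proof.
move=> [n [C [C0 hC]]] [m [D [D0 hD]]]; exists (n + m)%N, (C + D); split; first exact: addr_ge0.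
move=> z; apply: le_trans (normcD _ _) _; rewrite mulrDl lerD//.
  by apply: le_trans (hC z) _; rewrite slow_bound_le// leq_addr.
by apply: le_trans (hD z) _; rewrite slow_bound_le// leq_addl.
Qed.

Lemma pgrowthM f g : pgrowth f -> pgrowth g -> pgrowth (fun z => f z * g z).
Proof.
move=> [n [C [C0 hC]]] [m [D [D0 hD]]]; exists (n + m)%N, (C * D); split; first exact: mulr_ge0.
by move=> z; rewrite normcM exprD mulrACA ler_pM// normc_ge0.
Qed.

Lemma pgrowth_cst a : pgrowth (fun=> a).
Proof. by exists 0%N, (normc a); split => [|z]; rewrite ?normc_ge0// expr0 mulr1. Qed.

Lemma pgrowth_spn (F : set (V -> R[i])) f : (forall g, F g -> pgrowth g) -> spn F f -> pgrowth f.
Proof.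
move=> hF; elim=> [|a h k Fh sk IH]; first exact: pgrowth0.
by apply: pgrowthD IH; apply: pgrowthM (hF _ Fh); exact: pgrowth_cst.
Qed.

Lemma dstable_slow (F : set (V -> R[i])) f : dstable setT F ->
  (forall g, F g -> pgrowth g) -> F f -> slow f.
Proof.
move=> dF rF Ff; split; first exact: (dstable_smooth openT' dF).
move=> vs; have [g sg hg] := dstable_iter openT' dF Ff vs.
have [n [C [_ hC]]] := pgrowth_spn rF sg.
by exists n, C => z; rewrite hg.
Qed.

Lemma schwartz_slow f : schwartz f -> slow f.
Proof.
move=> [sf h]; split => // vs; have [M hM] := h 0%N vs; exists 0%N, M => z.
by have := hM z; rewrite expr0 mul1r mulr1.
Qed.

Lemma slow_linear (L : V -> R) : (forall (h : R) v z, L (h *: v + z) = h * L v + L z) ->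
  (exists C, forall z, `|L z| <= C * (1 + `|z|)) -> continuous L -> slow (fun z => (L z)%:C).
Proof.
move=> hL [C hC] cL.
have dL z v : is_cder (fun z => (L z)%:C) z v (L v)%:C.
  apply: is_cderR; apply/is_derive_line.
  rewrite (_ : (fun h : R => _) = fun h : R => h * L v + L z); last by apply/funext => h; rewrite hL.
  apply: (@is_derive_eq _ _ _ _ _ _ _ (L v * 1 + 0)); last by rewrite mulr1 addr0.
  apply: (is_deriveD _ (is_derive_cst _ _ _)).
  rewrite (_ : (fun h => h * L v) = L v \*: id); last by apply/funext => h; rewrite /= mulrC.
  exact: is_deriveZ.
apply: (@dstable_slow [set f | f = (fun z => (L z)%:C) \/ exists a, f = fun=> a]); last by left.
- move=> f [->|[a ->]]; split.
  + by move=> z _; exact: ccontR (cL z).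
  + by move=> v; exists (fun=> (L v)%:C); [apply: spn1; right; exists (L v)%:C|move=> z _; exact: dL].
  + by move=> z _; exact: ccont_cst.
  + by move=> v; exists (fun=> 0); [exact: spn0|move=> z _; exact: cder_cst].
- move=> f [->|[a ->]]; last exact: pgrowth_cst.
  by apply: pgrowth_ex; exists 1%N, C => z; rewrite normcR expr1.
Qed.

End Schwartz.

(** * Test functions *)

Section TestFunctions.
Context {R : realType} {V : normedModType R}.
Implicit Types (f g : V -> R[i]) (z v : V).
Context (hV : forall M : R, compact [set z : V | `|z| <= M]).

Lemma support_sub f (A : set V) : closed A -> (forall z, ~ A z -> f z = 0) -> Defs.support f `<=` A.
Proof.
move=> cA h; rewrite [A in _ `<=` A](closure_id A).1 //; apply: closure_subset => z /= /eqP fz.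
by apply: contrapT => /h.
Qed.

Lemma support_out f z : ~ Defs.support f z -> f z = 0.
Proof.
move=> h; apply/eqP/negP => /negP fz; apply: h.
by apply: (@subset_closure _ [set z | f z != 0]).
Qed.

(** By Heine-Borel ([hV], supplied by [cptB1] on the line and [cptB2] on the plane), compact support
    amounts to vanishing outside a ball, which is the form that the proofs below produce and
    consume. *)
Lemma testP f : test f <->
  smooth_on setT f /\ exists M : R, forall z, M < `|z| -> f z = 0.
Proof.
split=> [[sf cf]|[sf [M hM]]]; split => //.
  have [M [Mr hM]] := compact_bounded cf.
  exists (M + 1) => z hz; apply: support_out => sz.
  have := hM (M + 1); rewrite ltrDl ltr01 => /(_ isT z sz).
  by rewrite /= leNgt hz.
apply: (@subclosed_compact _ _ [set z : V | `|z| <= M]).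
- exact: closed_closure.
- exact: hV.
- apply: support_sub; last by move=> z /negP; rewrite -ltNge; exact: hM.
  by apply: compact_closed => //; exact: norm_hausdorff.
Qed.

Lemma closedball_closed (M : R) : closed [set z : V | `|z| <= M].
Proof. by apply: compact_closed => //; exact: norm_hausdorff. Qed.

Lemma test_bound f : test f -> exists M : R, forall z, normc (f z) <= M.
Proof.
move=> /testP[sf [M hM]].
have cN : {within [set z : V | `|z| <= M], continuous (fun z => normc (f z))}.
  by apply: continuous_subspaceT => z; apply: ccont_norm; exact: (smooth_cont sf).
have cK := continuous_compact cN (@hV M).
have [K [Kr hK]] := compact_bounded cK.
exists (`|K| + 1) => z.
have [zM|zM] := leP `|z| M; last by rewrite hM// normc0 addr_ge0.
have := hK (`|K| + 1); rewrite (le_lt_trans (ler_norm K)) ?ltrDl// => /(_ isT (normc (f z))).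
by rewrite /= ger0_norm ?normc_ge0//; apply; exists z.
Qed.

Lemma test_iter f vs : test f -> test (iter_derive vs f).
Proof.
move=> /testP[sf [M hM]]; apply/testP; split; first exact: smooth_iter.
exists M => z hz.
have oU : open [set z : V | M < `|z|].
  rewrite (_ : [set z | _] = ~` [set z : V | `|z| <= M]); first by rewrite openC; exact: closedball_closed.
  by apply/seteqP; split => y /=; rewrite ltNge => /negP.
by rewrite (iter_derive_eq_on (g := fun=> 0) oU)// iter_derive_cst; case: vs.
Qed.

Lemma test_cderive f v : test f -> test (cderive v f).
Proof. exact: (@test_iter f [:: v]). Qed.

Lemma test_schwartz f : test f -> schwartz f.
Proof.
move=> tf; split; first exact: tf.1.
move=> n vs; have tg := test_iter vs tf.
have [M hM] := test_bound tg; have [_ [K hK]] := (testP _).1 tg.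
exists ((1 + `|K|) ^+ n * M) => z.
have M0 : 0 <= M by exact: le_trans (normc_ge0 _) (hM z).
have [zK|zK] := leP `|z| K; last first.
  by rewrite hK// normc0 mulr0 mulr_ge0// exprn_ge0// addr_ge0.
rewrite ler_pM// ?normc_ge0// ?exprn_ge0 ?addr_ge0//.
by rewrite lerXn2r ?nnegrE ?addr_ge0// lerD2l (le_trans zK)// ler_norm.
Qed.

Lemma testM f g : test f -> smooth_on setT g -> test (fun z => f z * g z).
Proof.
move=> /testP[sf [M hM]] sg; apply/testP; split; first exact: (smoothM openT sf sg).
by exists M => z hz; rewrite hM// mul0r.
Qed.

Lemma testD f g : test f -> test g -> test (fun z => f z + g z).
Proof.
move=> /testP[sf [M hM]] /testP[sg [N hN]]; apply/testP; split; first exact: (smoothD openT sf sg).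
by exists (Num.max M N) => z; rewrite gt_max => /andP[h1 h2]; rewrite hM// hN// addr0.
Qed.

Lemma testZ (a : R[i]) f : test f -> test (fun z => a * f z).
Proof.
move=> /testP[sf [M hM]]; apply/testP; split; first exact: (smoothZ _ openT sf).
by exists M => z hz; rewrite hM// mulr0.
Qed.

End TestFunctions.

Lemma cptB1 {R : realType} (M : R) : compact [set z : R | `|z| <= M].
Proof.
rewrite (_ : [set z | _] = `[- M, M]%classic); first exact: segment_compact.
by apply/seteqP; split => z /=; rewrite in_itv /= ler_norml.
Qed.

Lemma cptB2 {R : realType} (M : R) : compact [set z : R * R | `|z| <= M].
Proof.
rewrite (_ : [set z | _] = [set z : R | `|z| <= M] `*` [set z : R | `|z| <= M]).
  by apply: compact_setX; exact: cptB1.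
by apply/seteqP; split => z /=; rewrite prod_normE ge_max => /andP.
Qed.

(** * Bumps, steps and plateaus on the line *)

Section Bump.
Context {R : realType}.
Implicit Types (x y t : R) (n k : nat).

Lemma exprMexpRN_le k y : 0 <= y -> y ^+ k * expR (- y) <= k`!%:R.
Proof.
move=> y0; rewrite expRN ler_pdivrMr ?expR_gt0//.
have f0 : 0 < k`!%:R :> R by rewrite ltr0n fact_gt0.
case: k f0 => [|k] f0.
  by rewrite expr0 fact0 mul1r -expR0 ler_expR.
rewrite -ler_pdivrMl// mulrC; apply: le_trans (expR_ge1Dxn k y0).
by rewrite lerDr.
Qed.

(** The classical [exp (- 1 / x)], with a power of [1 / x] in front that closes the family under
    differentiation. *)
Definition flat n x : R := if 0 < x then x^-1 ^+ n * expR (- x^-1) else 0.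

Lemma flat_ge0 n x : 0 <= flat n x.
Proof.
rewrite /flat; case: ltP => // x0.
by rewrite mulr_ge0 ?expR_ge0// exprn_ge0// invr_ge0 ltW.
Qed.

Lemma flat_gt0 n x : 0 < x -> 0 < flat n x.
Proof. by move=> x0; rewrite /flat x0 mulr_gt0 ?expR_gt0// exprn_gt0// invr_gt0. Qed.

Lemma flat_le0 n x : x <= 0 -> flat n x = 0.
Proof. by rewrite /flat leNgt => /negbTE ->. Qed.

(** From [y^k exp (-y) <= k!] with [y = 1 / x] and [k = n + 2]. Quadratic smallness is what
    [is_derive_quad] needs at 0, where the two formulas meet. *)
Lemma flat_sqr n x : flat n x <= (n.+2)`!%:R * x ^+ 2.
Proof.
rewrite /flat; case: ltP => x0; last by rewrite mulr_ge0// sqr_ge0.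
have y0 : 0 <= x^-1 by rewrite invr_ge0 ltW.
have := exprMexpRN_le n.+2 y0.
rewrite -ler_pdivrMr ?exprn_gt0//; apply: le_trans.
by rewrite -exprVn mulrAC -exprD addn2.
Qed.

Lemma is_derive_quad (f : R -> R) (C : R) : (forall x, `|f x| <= C * x ^+ 2) ->
  is_derive (0 : R) (1 : R) f 0.
Proof.
move=> hf; have f0 : f 0 = 0.
  by apply/eqP; rewrite -normr_le0 (le_trans (hf 0))// expr0n mulr0.
have C0 : 0 <= C by have := le_trans (normr_ge0 _) (hf 1); rewrite expr1n mulr1.
have h : (fun h : R => h^-1 *: ((f \o shift (0 : R)) (h *: (1 : R)) - f 0)) @ 0^' --> (0 : R).
  apply/cvgrPdist_le => e e0; near=> x.
  have x0 : x != 0 by near: x; exact: nbhs_dnbhs_neq.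
  rewrite sub0r normrN /= f0 subr0 /shift /= addr0 /GRing.scale /= mulr1 normrM normfV.
  rewrite ler_pdivrMl ?normr_gt0//; apply: le_trans (hf x) _.
  rewrite -real_normK ?num_real// expr2 mulrA mulrC ler_wpM2l//.
  have : `|x| <= e / (C + 1).
    near: x; apply: dnbhs0_le; rewrite divr_gt0// ltr_wpDl//.
  rewrite ler_pdivlMr ?ltr_wpDl// => h; apply: le_trans h.
  by rewrite mulrC ler_wpM2l// lerDl.
split; first by apply/cvg_ex; exists 0.
by rewrite /derive; apply/cvg_lim.
Unshelve. all: by end_near. Qed.

Lemma is_derive_flat n x : is_derive x (1 : R) (flat n) (- n%:R * flat n.+1 x + flat n.+2 x).
Proof.
have [x0|x0|->] := ltgtP x 0.
- rewrite !flat_le0 ?ltW// mulr0 addr0.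
  apply: (near_eq_is_derive _ (is_derive_cst (0 : R) x (1 : R))).
  near=> y; rewrite /= flat_le0// ltW//; near: y; exact: lt_nbhsl.
- apply: (@near_eq_is_derive _ _ _ (fun y => y^-1 ^+ n * expR (- y^-1))).
    near=> y; rewrite /flat ifT//; near: y; exact: lt_nbhsr.
  have dV : is_derive x (1 : R) (fun y => y^-1) (- 1 / x ^+ 2).
    exact: (is_derV (lt0r_neq0 x0) (is_derive_id x (1 : R))).
  have dE := is_derive_compR (is_deriveN dV) (is_derive_expR _).
  have dX := is_deriveX n dV.
  have eX : (fun y : R => y^-1) ^+ n = fun y : R => y^-1 ^+ n.
    by apply/funext => y; elim: n {dX} => [|n IH]; rewrite ?expr0// !exprS -IH.
  rewrite eX in dX.
  have := is_derM dX dE.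
  move=> h; apply: is_derive_eq h _.
  rewrite /flat x0 /= /GRing.scale /= (_ : (- (fun y => y^-1)) x = - x^-1)//.
  rewrite -!exprVn; case: n dX {eX} => [|n] _ /=.
    by rewrite !expr0 oppr0 !mul0r; ring.
  by rewrite !exprS; ring.
- rewrite !flat_le0// mulr0 addr0.
  apply: (@is_derive_quad _ (n.+2)`!%:R) => y.
  by rewrite ger0_norm ?flat_ge0// flat_sqr.
Unshelve. all: by end_near. Qed.

Lemma smooth_flat n : smooth_on setT (fun x => (flat n x)%:C).
Proof.
pose F := [set f : R -> R[i] | exists n, f = fun x => (flat n x)%:C].
suff dF : dstable setT F by apply: (dstable_smooth openT dF); exists n.
have d m (x v : R) : is_cder (fun x => (flat m x)%:C) x v
    (v%:C * ((- m%:R)%:C * (flat m.+1 x)%:C + 1 * (flat m.+2 x)%:C)).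
  have h := is_derive_flat m x.
  have -> : v%:C * ((- m%:R)%:C * (flat m.+1 x)%:C + 1 * (flat m.+2 x)%:C)
    = ((- m%:R * flat m.+1 x + flat m.+2 x) * v)%:C.
    by rewrite mul1r -rmorphM -rmorphD -rmorphM mulrC.
  apply: is_cderR; exact: (is_derive_compR (is_derive_id x v) h).
move=> _ [m ->]; split=> [x _|v].
  exact: cder_cont (d m x 1).
exists (fun x => v%:C * ((- m%:R)%:C * (flat m.+1 x)%:C + 1 * (flat m.+2 x)%:C)); last by move=> x _; exact: d.
by apply: spnZ; apply: spnD; apply: spnZ; apply: spn1; [exists m.+1|exists m.+2].
Qed.

Lemma aff_lin (a b : R) (h v z : R) : a * (h *: v + z) + b = h *: (a * v) + (a * z + b).
Proof. by rewrite /GRing.scale /= mulrDr mulrCA addrA. Qed.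

Lemma cont_aff (a b : R) : continuous (fun x : R => a * x + b).
Proof.
move=> x; apply: (@continuousD _ _ _ (fun x => a * x) (cst b)); last exact: cst_continuous.
by apply: (@continuousM _ _ (cst a) id); [exact: cst_continuous|exact: cvg_id].
Qed.

Lemma smooth_aff1 (f : R -> R[i]) (a b : R) : smooth_on setT f ->
  smooth_on setT (fun x => f (a * x + b)).
Proof. by move=> sf; exact: (smooth_affine (aff_lin a b) (@cont_aff a b) sf). Qed.

Lemma smooth_flat_aff n (a b : R) : smooth_on setT (fun x => (flat n (a * x + b))%:C).
Proof. exact: (smooth_aff1 a b (smooth_flat n)). Qed.

Definition bump1 t : R := flat 0 (1 + t) * flat 0 (1 - t).

Lemma bump1_ge0 t : 0 <= bump1 t. Proof. by rewrite mulr_ge0 ?flat_ge0. Qed.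
Lemma bump1_gt0 t : `|t| < 1 -> 0 < bump1 t.
Proof.
rewrite ltr_norml => /andP[h1 h2]; rewrite mulr_gt0// flat_gt0//.
  by rewrite -ltrBlDl sub0r.
by rewrite subr_gt0.
Qed.
Lemma bump1_out t : 1 <= `|t| -> bump1 t = 0.
Proof.
rewrite leNgt ltr_norml negb_and -!leNgt => /orP[h|h]; rewrite /bump1.
  by rewrite (@flat_le0 _ (1 + t)) ?mul0r// addrC -lerBrDr sub0r.
by rewrite (@flat_le0 _ (1 - t)) ?mulr0// subr_le0.
Qed.
Lemma smooth_bump1 : smooth_on setT (fun x => (bump1 x)%:C).
Proof.
have := smoothM openT (smooth_flat_aff 0 1 1) (smooth_flat_aff 0 (-1) 1).
by apply: smooth_eq_on openT _ => x _; rewrite -rmorphM /bump1; congr ((flat _ _ * flat _ _)%:C); ring.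
Qed.

Definition bumpa (a r t : R) : R := bump1 ((t - a) / r).
Lemma bumpa_ge0 a r t : 0 <= bumpa a r t. Proof. exact: bump1_ge0. Qed.
Lemma bumpa_gt0 a r t : 0 < r -> `|t - a| < r -> 0 < bumpa a r t.
Proof.
move=> r0 h; apply: bump1_gt0.
by rewrite normrM normfV (gtr0_norm r0) ltr_pdivrMr// mul1r.
Qed.
Lemma bumpa_out a r t : 0 < r -> r <= `|t - a| -> bumpa a r t = 0.
Proof.
move=> r0 h; apply: bump1_out.
by rewrite normrM normfV (gtr0_norm r0) ler_pdivlMr// mul1r.
Qed.
Lemma test_bumpa a r : 0 < r -> test (fun x => (bumpa a r x)%:C).
Proof.
move=> r0; apply/(testP cptB1); split.
  have := smooth_aff1 r^-1 (- a / r) smooth_bump1.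
  by apply: smooth_eq_on openT _ => x _; rewrite /bumpa; congr (bump1 _)%:C; ring.
exists (r + `|a|) => t ht; rewrite bumpa_out//.
rewrite -(lerD2r `|a|) (le_trans (ltW ht))//.
by rewrite -[X in `|X| <= _](subrK a) ler_normD.
Qed.

(** Rises from 0 to 1 on [-2, -1]. The transition lies strictly to the left of 0, so that a factor
    [step] is invisible to distributions carried by [t >= 0], while it cuts off the growth of
    [exp (- s t)] at [-oo]. *)
Definition step t : R := flat 0 (t + 2) / (flat 0 (t + 2) + flat 0 (-1 - t)).

Lemma step_den t : 0 < flat 0 (t + 2) + flat 0 (-1 - t).
Proof.
have [h|h] := ltP (-2) t.
  by rewrite ltr_wpDr ?flat_ge0// flat_gt0//; lra.
by rewrite ltr_wpDl ?flat_ge0// flat_gt0//; lra.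
Qed.
Lemma step0 t : t <= - 2 -> step t = 0.
Proof. by move=> h; rewrite /step flat_le0 ?mul0r//; lra. Qed.
Lemma step1 t : - 1 <= t -> step t = 1.
Proof.
move=> h; rewrite /step (@flat_le0 _ (-1 - t)); last by lra.
by rewrite addr0 divff// lt0r_neq0// flat_gt0//; lra.
Qed.
Lemma smooth_step : smooth_on setT (fun t => (step t)%:C).
Proof.
have s1 := smooth_flat_aff 0 1 2; have s2 := smooth_flat_aff 0 (-1) (-1).
have sD := smoothD openT s1 s2.
have h0 x : setT x -> (flat 0 (1 * x + 2))%:C + (flat 0 (-1 * x - 1))%:C != 0.
  move=> _; rewrite -rmorphD; apply/eqP => /(congr1 (@re R)) /= /eqP.
  apply/negP; rewrite lt0r_neq0// mul1r (_ : -1 * x - 1 = -1 - x); last by ring.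
  exact: step_den.
have := smoothM openT s1 (smoothV openT h0 sD).
apply: smooth_eq_on openT _ => x _; rewrite -rmorphD -fmorphV -rmorphM /step mul1r.
by congr (_ / (_ + flat _ _))%:C; ring.
Qed.

Lemma cderive_step_test v : test (cderive v (fun t => (step t)%:C)).
Proof.
apply/(testP cptB1); split; first exact: (smooth_cderive v smooth_step).
exists 2 => t; rewrite ltr_normr => /orP[h|h].
- rewrite (@cderive_eq_on _ _ [set x : R | -1 < x] _ (fun=> 1)) /=; [|exact: open_gt| |by lra].
    by have [_ ->] := is_cderP (cder_cst (V := R) 1 t v).
  by move=> z /= hz; rewrite step1// ltW.
- rewrite (@cderive_eq_on _ _ [set x : R | x < -2] _ (fun=> 0)) /=; [|exact: open_lt| |by lra].
    by have [_ ->] := is_cderP (cder_cst (V := R) 0 t v).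
  by move=> z /= hz; rewrite step0// ltW.
Qed.

Lemma step_bounded vs : exists M : R, forall t, normc (iter_derive vs (fun t => (step t)%:C) t) <= M.
Proof.
case/lastP: vs => [|vs v].
  exists 1 => t; rewrite -[iter_derive _ _ _]/((step t)%:C) normcR /step normrM normfV (ger0_norm (flat_ge0 _ _)).
  by rewrite (gtr0_norm (step_den t)) ler_pdivrMr ?step_den// mul1r lerDl flat_ge0.
have [M hM] := test_bound cptB1 (test_iter cptB1 vs (cderive_step_test v)).
by exists M => t; rewrite -cats1 -iter_derive_cat; exact: hM.
Qed.

(** Plateaus: 1 on [-n, n] and 0 beyond n + 2. The two flanks are translates of one step, hence
    derivative bounds independent of [n]. *)
Definition kap (n : nat) (x : R) : R[i] := (step (1 * x + n%:R))%:C * (step (-1 * x + n%:R))%:C.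

Lemma kap1 n x : `|x| <= n%:R -> kap n x = 1.
Proof.
rewrite ler_norml => /andP[h1 h2].
by rewrite /kap !step1 ?mulr1// ; lra.
Qed.

Lemma kap_out n x : n%:R + 2 <= `|x| -> kap n x = 0.
Proof.
rewrite ler_normr => /orP[h|h]; rewrite /kap.
  by rewrite (@step0 (-1 * x + _)) ?mulr0//; lra.
by rewrite (@step0 (1 * x + _)) ?mul0r//; lra.
Qed.

Lemma test_kap n : test (kap n).
Proof.
apply/(testP cptB1); split.
  exact: (smoothM openT (smooth_aff1 1 n%:R smooth_step) (smooth_aff1 (-1) n%:R smooth_step)).
by exists (n%:R + 2) => x /ltW; exact: kap_out.
Qed.

Lemma kap_bounded vs : exists M : R, forall n x, normc (iter_derive vs (kap n) x) <= M.
Proof.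
suff [M hM] : exists M : R, forall n x, \sum_(p <- lsplit vs)
    normc (iter_derive p.1 (fun x => (step (1 * x + n%:R))%:C) x) *
    normc (iter_derive p.2 (fun x => (step (-1 * x + n%:R))%:C) x) <= M.
  exists M => n x; apply: le_trans (hM n x).
  rewrite (leibniz _ openT (smooth_aff1 1 n%:R smooth_step) (smooth_aff1 (-1) n%:R smooth_step))//.
  by apply: le_trans (normc_sum _ _) _; apply: ler_sum => p _; rewrite normcM.
elim: (lsplit vs) => [|p s [M hM]]; first by exists 0 => n x; rewrite big_nil.
have [M1 h1] := step_bounded (map (fun v => 1 * v) p.1).
have [M2 h2] := step_bounded (map (fun v => -1 * v) p.2).
exists (M1 * M2 + M) => n x; rewrite big_cons lerD//.
rewrite ler_pM ?normc_ge0//.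
- have := h1 (1 * x + n%:R).
  by rewrite (iter_derive_affine (aff_lin 1 n%:R) (fun t => (step t)%:C)).
- have := h2 (-1 * x + n%:R).
  by rewrite (iter_derive_affine (aff_lin (-1) n%:R) (fun t => (step t)%:C)).
Qed.

End Bump.

(** * Tensor products on the plane *)

Section Tensor.
Context {R : realType}.
Implicit Types (f g a b : R -> R[i]).

Lemma fst_lin (h : R) (v z : R * R) : (h *: v + z).1 = h *: v.1 + z.1. Proof. by []. Qed.
Lemma snd_lin (h : R) (v z : R * R) : (h *: v + z).2 = h *: v.2 + z.2. Proof. by []. Qed.

Lemma smooth_fst f : smooth_on setT f -> smooth_on setT (fun z : R * R => f z.1).
Proof. by move=> sf; apply: (smooth_affine fst_lin _ sf) => z; exact: cvg_fst. Qed.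
Lemma smooth_snd f : smooth_on setT f -> smooth_on setT (fun z : R * R => f z.2).
Proof. by move=> sf; apply: (smooth_affine snd_lin _ sf) => z; exact: cvg_snd. Qed.

Lemma norm_fst (z : R * R) : `|z.1| <= `|z|.
Proof. by rewrite prod_normE le_max lexx. Qed.
Lemma norm_snd (z : R * R) : `|z.2| <= `|z|.
Proof. by rewrite prod_normE le_max lexx orbT. Qed.
Lemma norm_prod_le (z : R * R) : `|z| <= `|z.1| + `|z.2|.
Proof. by rewrite prod_normE ge_max lerDl lerDr !normr_ge0. Qed.

Lemma one_norm_prod (z : R * R) : 1 + `|z| <= (1 + `|z.1|) * (1 + `|z.2|).
Proof.
have := norm_prod_le z; have := mulr_ge0 (normr_ge0 z.1) (normr_ge0 z.2).
by rewrite mulrDl mul1r mulrDr mulr1; lra.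
Qed.

Lemma cderive_fst f v : cderive v (fun z : R * R => f z.1) = fun z => cderive v.1 f z.1.
Proof. exact: (cderive_affine fst_lin f v). Qed.
Lemma cderive_snd f v : cderive v (fun z : R * R => f z.2) = fun z => cderive v.2 f z.2.
Proof. exact: (cderive_affine snd_lin f v). Qed.

Lemma cderive_tensor f g v : smooth_on setT f -> smooth_on setT g ->
  cderive v (fun z : R * R => f z.1 * g z.2) =
  fun z => cderive v.1 f z.1 * g z.2 + f z.1 * cderive v.2 g z.2.
Proof.
move=> sf sg; apply/funext => z.
have := is_cderM (smooth_cder0 v (smooth_fst sf) (I : setT z)) (smooth_cder0 v (smooth_snd sg) (I : setT z)).
by case/is_cderP => _ ->; rewrite cderive_fst cderive_snd.
Qed.

Lemma schwartz_tensor f g : schwartz f -> schwartz g -> schwartz (fun z : R * R => f z.1 * g z.2).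
Proof.
move=> sf sg.
pose F := [set h : R * R -> R[i] | exists f g, [/\ schwartz f, schwartz g & h = fun z => f z.1 * g z.2]].
suff dF : dstable setT F.
  apply: (dstable_schwartz dF); last by exists f, g; split; [exact: sf|exact: sg|reflexivity].
  move=> _ [a [b [sa sb ->]]] n.
  have [M hM] := ((schwartzP a).1 sa).2 [::] n; have [N hN] := ((schwartzP b).1 sb).2 [::] n.
  exists (M * N) => z; rewrite normcM.
  apply: (@le_trans _ _ (((1 + `|z.1|) * (1 + `|z.2|)) ^+ n * (normc (a z.1) * normc (b z.2)))).
    apply: ler_wpM2r; first by rewrite mulr_ge0 ?normc_ge0.
    by rewrite lerXn2r ?nnegrE ?mulr_ge0 ?addr_ge0// one_norm_prod.
  rewrite exprMn mulrACA ler_pM// mulr_ge0 ?normc_ge0// exprn_ge0 ?addr_ge0//.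
move=> _ [a [b [sa sb ->]]]; split=> [z zT|v].
  by apply: ccontM; [exact: (smooth_cont (smooth_fst sa.1))|exact: (smooth_cont (smooth_snd sb.1))].
exists (fun z => cderive v.1 a z.1 * b z.2 + a z.1 * cderive v.2 b z.2).
  apply: spnD; apply: spn1.
    by exists (cderive v.1 a), b; split; [exact: schwartz_cderive|exact: sb|reflexivity].
  by exists a, (cderive v.2 b); split; [exact: sa|exact: schwartz_cderive|reflexivity].
move=> z zT; rewrite -(_ : cderive v (fun z : R * R => a z.1 * b z.2) z = cderive v.1 a z.1 * b z.2 + a z.1 * cderive v.2 b z.2).
  exact: (smooth_cder0 v (smoothM openT (smooth_fst sa.1) (smooth_snd sb.1)) zT).
by rewrite (cderive_tensor v sa.1 sb.1).
Qed.

Lemma test_tensor f g : test f -> test g ->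
  test (fun z : R * R => f z.1 * g z.2).
Proof.
move=> /(testP cptB1)[sf [M hM]] /(testP cptB1)[sg [N hN]].
apply/(testP cptB2); split.
  exact: (smoothM openT (smooth_fst sf) (smooth_snd sg)).
exists (Num.max M N) => z; rewrite prod_normE lt_max => /orP[h|h].
  have [h1|h1] := ltP M `|z.1|; first by rewrite hM// mul0r.
  by move: h; rewrite gt_max ltNge h1.
have [h1|h1] := ltP N `|z.2|; first by rewrite hN// mulr0.
by move: h; rewrite gt_max [in X in _ && X]ltNge h1 andbF.
Qed.

Definition kap2 (n : nat) (z : R * R) : R[i] := kap n z.1 * kap n z.2.

Lemma kap2_1 n z : `|z| <= n%:R -> kap2 n z = 1.
Proof.
by rewrite prod_normE ge_max => /andP[h1 h2]; rewrite /kap2 !kap1// mulr1.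
Qed.

Lemma test_kap2 n : test (kap2 n).
Proof. exact: test_tensor (test_kap n) (test_kap n). Qed.

Lemma kap2_bounded vs : exists M : R, forall n z, normc (iter_derive vs (kap2 n) z) <= M.
Proof.
suff [M hM] : exists M : R, forall n z, \sum_(p <- lsplit vs)
    normc (iter_derive p.1 (fun z : R * R => kap n z.1) z) *
    normc (iter_derive p.2 (fun z : R * R => kap n z.2) z) <= M.
  exists M => n z; apply: le_trans (hM n z).
  rewrite (leibniz _ openT (smooth_fst (test_kap n).1) (smooth_snd (test_kap n).1))//.
  by apply: le_trans (normc_sum _ _) _; apply: ler_sum => p _; rewrite normcM.
elim: (lsplit vs) => [|p s [M hM]]; first by exists 0 => n x; rewrite big_nil.
have [M1 h1] := @kap_bounded R (map fst p.1).
have [M2 h2] := @kap_bounded R (map snd p.2).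
exists (M1 * M2 + M) => n z; rewrite big_cons lerD//.
rewrite ler_pM ?normc_ge0//.
- by rewrite (iter_derive_affine fst_lin (kap n)) /=; exact: h1.
- by rewrite (iter_derive_affine snd_lin (kap n)) /=; exact: h2.
Qed.

End Tensor.

(** * Vanishing of a tempered functional, from test functions to Schwartz functions *)

Section Vanish.
Context {R : realType} {V : normedModType R}.
Context (u : (V -> R[i]) -> R[i]).
Context (tu : tempered u).

Lemma temperedD phi psi : schwartz phi -> schwartz psi ->
  u (fun z => phi z + psi z) = u phi + u psi.
Proof.
move=> sp sq; have := tu.1 1 _ _ sp sq; rewrite mul1r => <-.
by congr u; apply/funext => z; rewrite mul1r.
Qed.

Lemma tempered0 : u (fun=> 0) = 0.
Proof.
have := temperedD (@schwartz0 R V) (@schwartz0 R V).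
rewrite (_ : (fun _ => _) = fun=> 0); last by apply/funext => z; rewrite addr0.
by move/eqP; rewrite -subr_eq0 opprD addrA subrr sub0r oppr_eq0 => /eqP.
Qed.

Lemma temperedZ a phi : schwartz phi -> u (fun z => a * phi z) = a * u phi.
Proof.
move=> sp; have := tu.1 a _ _ sp (@schwartz0 R V); rewrite tempered0 addr0 => <-.
by congr u; apply/funext => z; rewrite addr0.
Qed.

Lemma temperedB phi psi : schwartz phi -> schwartz psi ->
  u (fun z => phi z - psi z) = u phi - u psi.
Proof.
move=> sp sq; rewrite -mulN1r -(temperedZ _ sq) -temperedD//; last exact: schwartzZ.
by congr u; apply/funext => z; rewrite mulN1r.
Qed.

Context (U : set V).
Context (vu : vanishes_on u U).
Context (k : nat -> V -> R[i]).
Context (tk : forall n, test (k n))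
  (k1 : forall n z, `|z| <= n%:R -> k n z = 1)
  (kb : forall vs, exists M : R, forall n z, normc (iter_derive vs (k n) z) <= M)
  (hV : forall M : R, compact [set z : V | `|z| <= M]).

(** Cutting off with the plateaus leaves [phi * (1 - k n)], which lives where [|z| >= n]. One spare
    power of [1 + |z|], taken from the rapid decay of [phi], turns this into a factor [1 / (n + 1)]
    in each of the finitely many seminorms that control [u]. *)
Lemma vanish_schwartz phi : schwartz phi -> Defs.support phi `<=` U -> u phi = 0.
Proof.
move=> sp pU.
pose psi n z := phi z * (1 - k n z).
have s1 n : smooth_on setT (fun z => 1 + -1 * k n z).
  exact: (smoothD openT (smooth_cst _ openT) (smoothZ _ openT (tk n).1)).
have e1 n : (fun z => 1 + -1 * k n z) = (fun z => 1 - k n z) by apply/funext => z; rewrite mulN1r.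
have it1 vs n z : iter_derive vs (fun z => 1 - k n z) z =
    (if vs is [::] then 1 else 0) - iter_derive vs (k n) z.
  rewrite -e1 (iter_deriveD _ (smooth_cst _ openT) (smoothZ _ openT (tk n).1) openT)//.
  by rewrite iter_derive_cst (iter_deriveZ _ _ (tk n).1 openT)// mulN1r.
have bnd1 vs : exists2 M : R, 0 <= M & forall n z, normc (iter_derive vs (fun z => 1 - k n z) z) <= M.
  have [M hM] := kb vs; exists (1 + M).
    by rewrite addr_ge0// (le_trans (normc_ge0 _) (hM 0%N 0)).
  move=> n z; rewrite it1; apply: le_trans (normcB _ _) _; rewrite lerD//.
  by case: (vs) => [|? ?]; rewrite ?normc1 ?normc0.
have zero vs n z : `|z| < n%:R -> iter_derive vs (fun z => 1 - k n z) z = 0.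
  move=> hz.
  have oU : open [set z : V | `|z| < n%:R].
    rewrite (_ : [set z | _] = (fun z : V => `|z|) @^-1` [set x : R | x < n%:R])//.
    by apply: open_comp => [y _|]; [exact: norm_continuous|exact: open_lt].
  rewrite (iter_derive_eq_on (g := fun=> 0) oU)//.
    by rewrite iter_derive_cst; case: vs.
  by move=> y /= /ltW hy; rewrite k1// subrr.
have spsi n : schwartz (psi n).
  rewrite (_ : psi n = fun z => phi z + -1 * (k n z * phi z)); last first.
    by apply/funext => z; rewrite /psi; ring.
  apply: schwartzD => //; apply: schwartzZ; apply: schwartz_slowM => //.
  by apply: schwartz_slow; exact: test_schwartz.
have est m vs : exists2 K : R, 0 <= K & forall n z,
    (1 + `|z|) ^+ m * normc (iter_derive vs (psi n) z) <= K / n.+1%:R.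
  have [K K0 hK] : exists2 K : R, 0 <= K & forall n z, \sum_(p <- lsplit vs)
     (1 + `|z|) ^+ m * (normc (iter_derive p.1 phi z) * normc (iter_derive p.2 (fun z => 1 - k n z) z)) <= K / n.+1%:R.
    elim: (lsplit vs) => [|p s [K K0 hK]]; first by exists 0 => // n z; rewrite big_nil mul0r.
    have [B B0 hB] := bnd1 p.2; have [M hM] := ((schwartzP phi).1 sp).2 p.1 m.+1.
    have M0 : 0 <= M.
      by apply: le_trans (hM 0); rewrite mulr_ge0 ?normc_ge0// exprn_ge0// addr_ge0.
    exists (M * B + K); first by rewrite addr_ge0// mulr_ge0.
    move=> n z; rewrite big_cons mulrDl lerD//.
    have [zn|zn] := ltP `|z| n%:R.
      by rewrite zero// normc0 !mulr0 divr_ge0// mulr_ge0.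
    rewrite ler_pdivlMr ?ltr0n//.
    apply: (@le_trans _ _ ((1 + `|z|) ^+ m * (normc (iter_derive p.1 phi z) * B) * (1 + `|z|))).
      apply: ler_pM; rewrite ?mulr_ge0 ?normc_ge0 ?exprn_ge0 ?addr_ge0//.
        by rewrite ler_wpM2l ?exprn_ge0 ?addr_ge0// ler_wpM2l ?normc_ge0.
      by rewrite -natr1 addrC lerD2l.
    apply: le_trans (_ : ((1 + `|z|) ^+ m.+1 * normc (iter_derive p.1 phi z)) * B <= _).
      by rewrite exprS le_eqVlt; apply/orP; left; apply/eqP; ring.
    by rewrite ler_wpM2r.
  exists K => // n z; apply: le_trans (hK n z).
  have s1' : smooth_on setT (fun z => 1 - k n z) by rewrite -e1; exact: s1.
  have -> := leibniz vs openT sp.1 s1' (I : setT z).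
  apply: le_trans (ler_wpM2l _ (normc_sum _ _)) _; first by rewrite exprn_ge0// addr_ge0.
  by rewrite big_distrr /=; apply: ler_sum => p _; rewrite normcM.
have [_ [C [ps hps]]] := tu.
have [K K0 hK] : exists2 K : R, 0 <= K & forall n p, p \in ps -> forall z,
    (1 + `|z|) ^+ p.1 * normc (iter_derive p.2 (psi n) z) <= K / n.+1%:R.
  elim: (ps) => [|p s [K K0 hK]]; first by exists 0.
  have [K' K'0 hK'] := est p.1 p.2.
  exists (K + K'); first exact: addr_ge0.
  move=> n q; rewrite inE => /predU1P[->|qs] z; rewrite mulrDl.
    by apply: le_trans (hK' n z) _; rewrite lerDr divr_ge0.
  by apply: le_trans (hK n q qs z) _; rewrite lerDl divr_ge0.
(* The part that is cut off is a test function supported in [U], where [u] vanishes. *)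
have upsi n : u phi = u (psi n).
  have tkn : test (fun z => k n z * phi z) by exact: (testM hV (tk n) sp.1).
  have h0 : u (fun z => k n z * phi z) = 0.
    apply: vu => //; apply: subset_trans pU; apply: closureS => z /=.
    by apply: contra => /eqP ->; rewrite mulr0.
  have := temperedB sp (test_schwartz hV tkn); rewrite h0 subr0 => <-.
  by congr u; apply/funext => z; rewrite /psi; ring.
apply/eqP; rewrite -normc_eq0 eq_le normc_ge0 andbT.
have bn n : normc (u phi) <= (C * K) / n.+1%:R.
  by rewrite (upsi n) -mulrA; apply: hps => // p ps' z; exact: hK.
apply/ler_addgt0Pl => e e0; rewrite addr0.
have [n hn] : exists n, (C * K) / e < n.+1%:R.
  exists (Num.truncn `|(C * K) / e|); apply: le_lt_trans (ler_norm _) _; exact: truncnS_gt.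
apply: le_trans (bn n) _; by rewrite ler_pdivrMr ?ltr0n// (mulrC e) -ler_pdivrMr// ltW.
Qed.

End Vanish.

(** * Measurability and convergence for complex-valued functions *)

Section OpenMeasurable2.
Context {R : realType}.

(** The product sigma-algebra contains the squares; an open set is the union of the countably many
    squares of rational centre and radius [1 / (n + 1)] that it contains. *)
Lemma open_measurable2 (U : set (R * R)) : open U -> measurable U.
Proof.
move=> oU.
pose box (k : (rat * rat) * nat) : set (R * R) :=
  [set z | `|z.1 - ratr k.1.1| < k.2.+1%:R^-1] `&` [set z | `|z.2 - ratr k.1.2| < k.2.+1%:R^-1].
have mb k : measurable (box k).
  have mI (a e : R) : measurable [set x : R | `|x - a| < e].
    rewrite (_ : [set x | _] = `]a - e, a + e[%classic); first exact: measurable_itv.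
    by apply/seteqP; split => x /=; rewrite in_itv /= ltr_distl.
  apply: measurableI.
    rewrite (_ : [set z | _] = fst @^-1` [set x : R | `|x - ratr k.1.1| < k.2.+1%:R^-1])//.
    by rewrite -[X in measurable X]setTI; apply: measurable_fst.
  rewrite (_ : [set z | _] = snd @^-1` [set x : R | `|x - ratr k.1.2| < k.2.+1%:R^-1])//.
  by rewrite -[X in measurable X]setTI; apply: measurable_snd.
have -> : U = \bigcup_k (if `[< box k `<=` U >] then box k else set0).
  apply/seteqP; split => [z Uz|z [k _]]; last by case: asboolP => // kU kz; exact: kU.
  have /nbhs_ballP[e /= e0 he] : nbhs z U by exact: open_nbhs_nbhs.
  pose n := Num.truncn (2 / e).
  (* Radius below [e / 2]: a square of this size that contains [z] stays within distance [e] of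
     [z]. *)
  have hn : 2 / n.+1%:R < e.
    rewrite ltr_pdivrMr ?ltr0n// mulrC -ltr_pdivrMr//.
    exact: truncnS_gt.
  have n0 : 0 < (n.+1%:R : R)^-1 by rewrite invr_gt0 ltr0n.
  have ex (x : R) : exists p : rat, `|x - ratr p| < (n.+1%:R : R)^-1.
    have [|p] := @rat_in_itvoo R (x - n.+1%:R^-1) (x + n.+1%:R^-1); first by move: n0; move: (n.+1%:R^-1 : R) => k k0; lra.
    by rewrite in_itv /= -ltr_distl distrC => h; exists p.
  have [p hp] := ex z.1; have [q hq] := ex z.2.
  exists ((p, q), n) => //; rewrite asboolT; first by split.
  move=> y [/= h1 h2]; apply: he.
  have tri (a b c : R) : `|a - c| < n.+1%:R^-1 -> `|b - c| < n.+1%:R^-1 -> `|a - b| < e.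
    move=> h h'; apply: le_lt_trans hn; rewrite mulr_natl mulr2n.
    have -> : a - b = (a - c) - (b - c) by ring.
    by rewrite (le_trans (ler_normB _ _))// ltW// ltrD.
  by split; rewrite /ball /=; [exact: (tri _ _ (ratr p))|exact: (tri _ _ (ratr q))].
apply: countable_bigcupT_measurable; first exact: countableP.
by move=> k; case: ifP => _; [exact: mb|exact: measurable0].
Qed.

Lemma cont_measurable2 (f : R * R -> R) (D : set (R * R)) : open D ->
  (forall z, D z -> {for z, continuous f}) -> measurable_fun D f.
Proof.
move=> oD cf; apply: (measurability _ (RGenOInfty.measurableE R)) => _ [_ [a ->] <-].
apply: open_measurable2.
rewrite openE => z [Dz fz].
have h1 : nbhs z D by exact: open_nbhs_nbhs.
have h2 : nbhs z (f @^-1` `]a, +oo[%classic).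
  by apply: (cf z Dz); apply: open_nbhs_nbhs; split => //; exact: interval_open.
exact: filterI h1 h2.
Qed.

End OpenMeasurable2.

Section SeqCont.
Context {R : realType} {V : normedModType R}.

(** Dominated convergence speaks of sequences. Sequences with the explicit rate [1 / (n + 1)] are
    enough, since a failure of continuity at [z] produces one of them by choice. *)
Lemma seq_continuous (f : V -> R) (z : V) :
  (forall u : nat -> V, (forall n, `|z - u n| < n.+1%:R^-1) -> f (u n) @[n --> \oo] --> f z) ->
  {for z, continuous f}.
Proof.
move=> h; apply: contrapT => nc.
have [e [e0 he]] : exists e : R, 0 < e /\ forall d : R, 0 < d -> exists y, `|z - y| < d /\ e < `|f z - f y|.
  apply: contrapT => ne; apply: nc; apply/cvgrPdist_le => e e0.
  apply: contrapT => nn; apply: ne; exists e; split => // d d0.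
  apply: contrapT => ny; apply: nn; apply/nbhs_ballP; exists d => //= y.
  rewrite -ball_normE /= => hy; rewrite leNgt; apply/negP => hlt; apply: ny; exists y; split => //.
have n0 n : 0 < (n.+1%:R : R)^-1 by rewrite invr_gt0 ltr0n.
have /choice[u hu] := fun n => he _ (n0 n).
have /cvgrPdist_le /(_ _ e0) [N _ hN] := h u (fun n => (hu n).1).
by have := hN N (leqnn N); rewrite /= leNgt (hu N).2.
Qed.

End SeqCont.

Section CMeas.
Context {R : realType} d {T : measurableType d}.
Implicit Types (f g : T -> R[i]) (D : set T).

Definition cmeas D f := measurable_fun D (re \o f) /\ measurable_fun D (im \o f).

Lemma cmeas_cst D (a : R[i]) : cmeas D (fun=> a).
Proof. by split; exact: measurable_cst. Qed.

Lemma cmeasD D f g : cmeas D f -> cmeas D g -> cmeas D (fun x => f x + g x).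
Proof.
move=> [f1 f2] [g1 g2]; split.
- rewrite (_ : _ \o _ = (re \o f) \+ (re \o g)); first exact: measurable_funD.
  by apply/funext => y; rewrite /= reD.
- rewrite (_ : _ \o _ = (im \o f) \+ (im \o g)); first exact: measurable_funD.
  by apply/funext => y; rewrite /= imD.
Qed.

Lemma cmeasM D f g : cmeas D f -> cmeas D g -> cmeas D (fun x => f x * g x).
Proof.
move=> [f1 f2] [g1 g2]; split.
- rewrite (_ : _ \o _ = (re \o f) \* (re \o g) \- (im \o f) \* (im \o g)).
    by apply: measurable_funB; exact: measurable_funM.
  by apply/funext => y; rewrite /= reM.
- rewrite (_ : _ \o _ = (re \o f) \* (im \o g) \+ (im \o f) \* (re \o g)).
    by apply: measurable_funD; exact: measurable_funM.
  by apply/funext => y; rewrite /= imM.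
Qed.

Lemma cmeasZ D (a : R[i]) f : cmeas D f -> cmeas D (fun x => a * f x).
Proof. by move=> hf; apply: cmeasM => //; exact: cmeas_cst. Qed.

Lemma cmeasN D f : cmeas D f -> cmeas D (fun x => - f x).
Proof. by move=> /(cmeasZ (-1)); congr cmeas; apply/funext => y; rewrite mulN1r. Qed.

Lemma cmeasB D f g : cmeas D f -> cmeas D g -> cmeas D (fun x => f x - g x).
Proof. by move=> hf hg; apply: cmeasD => //; exact: cmeasN. Qed.

Lemma cmeasR D (r : T -> R) : measurable_fun D r -> cmeas D (fun x => (r x)%:C).
Proof. by move=> h; split => //=; exact: measurable_cst. Qed.

Lemma cmeas_norm D f : cmeas D f -> measurable_fun D (fun x => normc (f x)).
Proof.
move=> [f1 f2].
rewrite (_ : (fun x => _) = Num.sqrt \o (((re \o f) \* (re \o f)) \+ ((im \o f) \* (im \o f)))).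
  apply: measurableT_comp; first by apply: continuous_measurable_fun; exact: sqrt_continuous.
  by apply: measurable_funD; exact: measurable_funM.
by apply/funext => y; rewrite /= normcEs !expr2.
Qed.

Lemma cmeasS D D' f : measurable D -> D' `<=` D -> cmeas D f -> cmeas D' f.
Proof. by move=> mD h [f1 f2]; split; [exact: measurable_funS f1|exact: measurable_funS f2]. Qed.

End CMeas.

Lemma cmeas_comp {R : realType} d1 d2 {T1 : measurableType d1} {T2 : measurableType d2}
  (f : T2 -> R[i]) (g : T1 -> T2) : measurable_fun setT g -> cmeas setT f -> cmeas setT (f \o g).
Proof. by move=> mg [f1 f2]; split; [exact: (measurableT_comp f1)|exact: (measurableT_comp f2)]. Qed.

Lemma ccont_cmeas1 {R : realType} (f : R -> R[i]) : (forall x, ccont f x) -> cmeas setT f.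
Proof. by move=> h; split; apply: continuous_measurable_fun => x; have [] := h x. Qed.

Lemma ccont_cmeas2 {R : realType} (f : R * R -> R[i]) : (forall x, ccont f x) -> cmeas setT f.
Proof. by move=> h; split; apply: (cont_measurable2 openT) => x _; have [] := h x. Qed.

Section Ccvg.
Context {R : realType}.
Definition ccvg (u : nat -> R[i]) (l : R[i]) : Prop :=
  (re (u n) @[n --> \oo] --> re l) /\ (im (u n) @[n --> \oo] --> im l).

Lemma ccvg_unique u l l' : ccvg u l -> ccvg u l' -> l = l'.
Proof. by move=> [a b] [c d]; apply: cplxP; [exact: cvg_unique a c|exact: cvg_unique b d]. Qed.

Lemma ccvg_norm0 u l : normc (u n - l) @[n --> \oo] --> (0 : R) -> ccvg u l.
Proof.
move=> h; split; apply/cvgrPdist_le => e e0; move/cvgrPdist_le: h => /(_ e e0); apply: filterS => n;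
  rewrite sub0r normrN ger0_norm ?normc_ge0//; apply: le_trans.
- by rewrite distrC -reB normc_re.
- by rewrite distrC -imB normc_im.
Qed.

Lemma ccvg_sqz u l (e : nat -> R) : (forall n, normc (u n - l) <= e n) ->
  e n @[n --> \oo] --> (0 : R) -> ccvg u l.
Proof.
move=> h ce; apply: ccvg_norm0; apply: (squeeze_cvgr _ _ ce); last exact: cvg_cst.
by apply: nearW => n; rewrite normc_ge0 h.
Qed.

Lemma ccvg_norm u l : ccvg u l -> normc (u n) @[n --> \oo] --> normc l.
Proof.
move=> [a b].
have h : Num.sqrt (re (u n) * re (u n) + im (u n) * im (u n)) @[n --> \oo]
    --> Num.sqrt (re l * re l + im l * im l).
  have c : re (u n) * re (u n) + im (u n) * im (u n) @[n --> \oo] --> re l * re l + im l * im l.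
    by apply: cvgD; exact: cvgM.
  exact: (cvg_comp _ _ c (@sqrt_continuous R _)).
rewrite (_ : (fun n => normc (u n)) = fun n => Num.sqrt (re (u n) * re (u n) + im (u n) * im (u n))).
  by rewrite normcEs !expr2.
by apply/funext => n; rewrite normcEs !expr2.
Qed.

Lemma ccvg_cst l : ccvg (fun=> l) l. Proof. by split; exact: cvg_cst. Qed.
Lemma ccvgD u v l m : ccvg u l -> ccvg v m -> ccvg (fun n => u n + v n) (l + m).
Proof.
move=> [a b] [c d]; split; [under eq_fun do rewrite reD|under eq_fun do rewrite imD]; rewrite ?reD ?imD; exact: cvgD.
Qed.
Lemma ccvgM u v l m : ccvg u l -> ccvg v m -> ccvg (fun n => u n * v n) (l * m).
Proof.
move=> [a b] [c d]; split; [under eq_fun do rewrite reM|under eq_fun do rewrite imM]; rewrite ?reM ?imM.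
- by apply: cvgB; exact: cvgM.
- by apply: cvgD; exact: cvgM.
Qed.
End Ccvg.

(** * Complex integrals, dominated convergence, parameters and Fubini *)

Section CInt.
Context {R : realType} d {T : measurableType d} (mu : {measure set T -> \bar R}).
Implicit Types (f g : T -> R[i]) (D : set T).

Definition cint D f : R[i] := (\int[mu]_(x in D) re (f x))%R +i* (\int[mu]_(x in D) im (f x))%R.
Definition cintble D f := mu.-integrable D (EFin \o (re \o f)) /\ mu.-integrable D (EFin \o (im \o f)).

Lemma eq_cint D f g : (forall x, D x -> f x = g x) -> cint D f = cint D g.
Proof.
by move=> h; congr (_ +i* _); apply: eq_Rintegral => x; rewrite inE => Dx; rewrite h.
Qed.

Lemma integrable_dom D (f : T -> R) (g : T -> R) : measurable D -> measurable_fun D f ->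
  mu.-integrable D (EFin \o g) -> (forall x, D x -> `|f x| <= g x) -> mu.-integrable D (EFin \o f).
Proof.
move=> mD mf ig h; apply: (le_integrable mD _ _ ig); first exact/measurable_EFinP.
by move=> x Dx /=; rewrite lee_fin (le_trans (h x Dx))// ler_norm.
Qed.

Lemma cintble_dom D f (g : T -> R) : measurable D -> cmeas D f ->
  mu.-integrable D (EFin \o g) -> (forall x, D x -> normc (f x) <= g x) -> cintble D f.
Proof.
move=> mD [f1 f2] ig h; split; apply: (integrable_dom mD _ ig) => // x Dx.
  exact: le_trans (normc_re _) (h x Dx).
exact: le_trans (normc_im _) (h x Dx).
Qed.

Lemma cintble_cmeas D f : measurable D -> cintble D f -> cmeas D f.
Proof.
by move=> mD [/integrableP[/measurable_EFinP m1 _] /integrableP[/measurable_EFinP m2 _]].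
Qed.

Lemma cintble_norm D f : measurable D -> cintble D f ->
  mu.-integrable D (EFin \o (fun x => normc (f x))).
Proof.
move=> mD h; have mf := cintble_cmeas mD h; case: h => h1 h2.
have := integrableD mD (integrable_norm h1) (integrable_norm h2).
rewrite (_ : (_ \+ _)%E = EFin \o (fun x => `|re (f x)| + `|im (f x)|)) => [h|]; last first.
  by apply/funext => x /=; rewrite EFinD.
apply: (integrable_dom mD _ h); first exact: cmeas_norm.
by move=> x _; rewrite ger0_norm ?normc_ge0// normc_reim.
Qed.

Lemma cintbleD D f g : measurable D -> cintble D f -> cintble D g -> cintble D (fun x => f x + g x).
Proof.
move=> mD hf hg; apply: (cintble_dom mD (g := fun x => normc (f x) + normc (g x))).
- by apply: cmeasD; exact: cintble_cmeas.
- have := integrableD mD (cintble_norm mD hf) (cintble_norm mD hg).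
  by congr integrable; apply/funext => x /=; rewrite EFinD.
- by move=> x _; exact: normcD.
Qed.

Lemma cintbleZ D (a : R[i]) f : measurable D -> cintble D f -> cintble D (fun x => a * f x).
Proof.
move=> mD hf; apply: (cintble_dom mD (g := fun x => normc a * normc (f x))).
- by apply: cmeasZ; exact: cintble_cmeas.
- exact: (integrableZl mD (normc a) (cintble_norm mD hf)).
- by move=> x _; rewrite normcM.
Qed.

Lemma cintD D f g : measurable D -> cintble D f -> cintble D g ->
  cint D (fun x => f x + g x) = cint D f + cint D g.
Proof.
move=> mD [f1 f2] [g1 g2]; apply: cplxP; rewrite ?reD ?imD /= -RintegralD//; apply: eq_Rintegral => x _.
  by rewrite /= reD.
by rewrite /= imD.
Qed.

Lemma cintZ D (a : R[i]) f : measurable D -> cintble D f ->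
  cint D (fun x => a * f x) = a * cint D f.
Proof.
move=> mD [f1 f2]; have iZ (k : R) (r : T -> R) : mu.-integrable D (EFin \o r) -> mu.-integrable D (EFin \o (fun x => k * r x)).
  by move=> hr; have := integrableZl mD k hr.
apply: cplxP; rewrite ?reM ?imM /= -!RintegralZl//.
- rewrite -RintegralB; [|exact: mD|exact: (iZ _ _ f1)|exact: (iZ _ _ f2)].
  by apply: eq_Rintegral => x _; rewrite reM.
- rewrite -RintegralD; [|exact: mD|exact: (iZ _ _ f2)|exact: (iZ _ _ f1)].
  by apply: eq_Rintegral => x _; rewrite imM.
Qed.

Lemma cintN D f : measurable D -> cintble D f -> cint D (fun x => - f x) = - cint D f.
Proof.
move=> mD hf; rewrite -mulN1r -(cintZ _ mD hf).
by apply: eq_cint => x _; rewrite mulN1r.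
Qed.

Lemma cintbleN D f : measurable D -> cintble D f -> cintble D (fun x => - f x).
Proof. by move=> mD /(cintbleZ (-1) mD); congr cintble; apply/funext => x; rewrite mulN1r. Qed.

Lemma cintB D f g : measurable D -> cintble D f -> cintble D g ->
  cint D (fun x => f x - g x) = cint D f - cint D g.
Proof. by move=> mD hf hg; rewrite cintD ?cintN//; exact: cintbleN. Qed.

(** Multiplying by the conjugate of the integral [w] makes it the real number [|w|^2], to which the
    monotonicity of real integrals applies. *)
Lemma cint_norm_le D f : measurable D -> cintble D f ->
  normc (cint D f) <= \int[mu]_(x in D) normc (f x).
Proof.
move=> mD hf; have [h0|h0] := eqVneq (normc (cint D f)) 0.
  by rewrite h0; apply: Rintegral_ge0 => x _; exact: normc_ge0.
pose w := cint D f; have w0 : 0 < normc w by rewrite lt0r h0 normc_ge0.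
pose cw : R[i] := re w -i* im w.
have ncw : normc cw = normc w by rewrite !normcEs /= sqrrN.
have e1 : re (cw * w) = normc w ^+ 2 by rewrite normc_sqr reM /=; ring.
have e2 : cw * w = cint D (fun x => cw * f x) by rewrite cintZ.
rewrite -(ler_pM2l w0) -expr2 -e1 e2 /=.
rewrite -RintegralZl//; last exact: cintble_norm.
apply: le_Rintegral => //.
- exact: (cintbleZ cw mD hf).1.
- exact: (integrableZl mD _ (cintble_norm mD hf)).
- by move=> x _; rewrite (le_trans (re_le_normc _))// normcM ncw.
Qed.

Lemma cint_le D f (g : T -> R) : measurable D -> cmeas D f ->
  mu.-integrable D (EFin \o g) -> (forall x, D x -> normc (f x) <= g x) ->
  normc (cint D f) <= \int[mu]_(x in D) g x.
Proof.
move=> mD mf ig h; have hf := cintble_dom mD mf ig h.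
apply: le_trans (cint_norm_le mD hf) _; apply: le_Rintegral => //; exact: cintble_norm.
Qed.

Lemma cint_mkcond D f : cint D f = cint setT (fun x => if x \in D then f x else 0).
Proof.
by rewrite /cint; congr (_ +i* _); rewrite Rintegral_mkcond; apply: eq_Rintegral => x _;
  rewrite /patch; case: ifP.
Qed.

Lemma Rint_dct D (f_ : nat -> T -> R) (f g : T -> R) : measurable D ->
  (forall n, measurable_fun D (f_ n)) ->
  (forall x, D x -> f_ n x @[n --> \oo] --> f x) ->
  mu.-integrable D (EFin \o g) -> (forall n x, D x -> `|f_ n x| <= g x) ->
  mu.-integrable D (EFin \o f) /\
  (\int[mu]_(x in D) f_ n x)%R @[n --> \oo] --> (\int[mu]_(x in D) f x)%R.
Proof.
move=> mD mf cf ig h.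
have mlim : measurable_fun D f by exact: (measurable_fun_cvg mf cf).
have hfg x : D x -> `|f x| <= g x.
  move=> Dx; have c : `|f_ n x| @[n --> \oo] --> `|f x| by apply: cvg_norm; exact: cf.
  by rewrite -(cvg_lim _ c)//; apply: limr_le; [by apply/cvg_ex; exists (`|f x|)|apply: nearW => n; exact: h].
have intf : mu.-integrable D (EFin \o f) by exact: (integrable_dom mD mlim ig).
split => //.
have [] := @dominated_convergence _ T R mu D mD (fun n x => (f_ n x)%:E) (EFin \o f) (EFin \o g).
- by move=> n; exact/measurable_EFinP.
- exact/measurable_EFinP.
- by apply: aeW => x Dx; apply: cvg_EFin; [exact: nearW|exact: cf].
- exact: ig.
- by apply: aeW => x n Dx; rewrite lee_fin h.
move=> _ _ hc; apply: fine_cvg; rewrite fineK//; exact: integrable_fin_num.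
Qed.

Lemma cint_dct D (f_ : nat -> T -> R[i]) (f : T -> R[i]) (g : T -> R) : measurable D ->
  (forall n, cmeas D (f_ n)) ->
  (forall x, D x -> ccvg (f_^~ x) (f x)) ->
  mu.-integrable D (EFin \o g) -> (forall n x, D x -> normc (f_ n x) <= g x) ->
  cintble D f /\ ccvg (fun n => cint D (f_ n)) (cint D f).
Proof.
move=> mD mf cf ig h.
have [i1 c1] := @Rint_dct D (fun n => re \o f_ n) (re \o f) g mD (fun n => (mf n).1)
  (fun x Dx => (cf x Dx).1) ig (fun n x Dx => le_trans (normc_re _) (h n x Dx)).
have [i2 c2] := @Rint_dct D (fun n => im \o f_ n) (im \o f) g mD (fun n => (mf n).2)
  (fun x Dx => (cf x Dx).2) ig (fun n x Dx => le_trans (normc_im _) (h n x Dx)).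
by split; split.
Qed.

End CInt.

Section Param.
Context {R : realType} {V : normedModType R} d {T : measurableType d} (mu : {measure set T -> \bar R}).
Implicit Types (D : set T).

Lemma seq_near_ball (z : V) (e : R) (u : nat -> V) : 0 < e ->
  (forall n, `|z - u n| < n.+1%:R^-1) -> exists N : nat, forall n, `|z - u (n + N)%N| < e.
Proof.
move=> e0 hu; exists (Num.truncn e^-1) => n; apply: lt_le_trans (hu _) _.
rewrite -[leRHS]invrK lef_pV2 ?posrE ?invr_gt0 ?ltr0n//.
apply: le_trans (ltW (truncnS_gt _)) _.
by rewrite ler_nat ltnS leq_addl.
Qed.

Lemma seq_cvg_inv (z : V) (u : nat -> V) :
  (forall n, `|z - u n| < n.+1%:R^-1) -> u n @[n --> \oo] --> z.
Proof.
move=> hu; apply/cvgrPdist_le => e e0.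
have [N hN] := seq_near_ball e0 hu.
exists N => // n /= Nn; rewrite -(subnK Nn); exact/ltW/hN.
Qed.

Lemma cint_continuous D (F : V -> T -> R[i]) (g : T -> R) (z : V) (e : R) : measurable D -> 0 < e ->
  (forall y, `|z - y| < e -> cmeas D (F y)) ->
  (forall x, D x -> ccont (F^~ x) z) ->
  mu.-integrable D (EFin \o g) ->
  (forall y x, `|z - y| < e -> D x -> normc (F y x) <= g x) ->
  ccont (fun y => cint mu D (F y)) z.
Proof.
move=> mD e0 mF cF ig hg.
have h u : (forall n, `|z - u n| < n.+1%:R^-1) -> ccvg (fun n => cint mu D (F (u n))) (cint mu D (F z)).
  move=> hu; have [N hN] := seq_near_ball e0 hu; have cu := seq_cvg_inv hu.
  have [_ [c1 c2]] : cintble mu D (F z) /\ ccvg (fun n => cint mu D (F (u (n + N)%N))) (cint mu D (F z)).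
    apply: (cint_dct (g := g) mD) => // [n|x Dx|n x Dx].
    - exact: mF.
    - have [a b] := cF x Dx.
      have cuN : u (n + N)%N @[n --> \oo] --> z by rewrite (cvg_shiftn N u).
      by split; [exact: (cvg_comp _ _ cuN a)|exact: (cvg_comp _ _ cuN b)].
    - exact: hg.
  by split; [move: c1; rewrite (cvg_shiftn N (fun n => re (cint mu D (F (u n)))))|
             move: c2; rewrite (cvg_shiftn N (fun n => im (cint mu D (F (u n)))))].
by split; apply: seq_continuous => u /h[].
Qed.

(** On the line [h |-> h *: v + z] this is differentiation under the integral sign in one real
    parameter, for real and imaginary parts separately. *)
Lemma is_cder_cint D (F DF : V -> T -> R[i]) (G : T -> R) (z v : V) (e : R) : measurable D -> 0 < e ->
  (forall h : R, `|h| < e -> cintble mu D (F (h *: v + z))) ->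
  (forall (h : R) y, `|h| < e -> D y -> is_cder (F^~ y) (h *: v + z) v (DF (h *: v + z) y)) ->
  mu.-integrable D (EFin \o G) ->
  (forall (h : R) y, `|h| < e -> D y -> normc (DF (h *: v + z) y) <= G y) ->
  is_cder (fun y => cint mu D (F y)) z v (cint mu D (DF z)).
Proof.
move=> mD e0 iF dF iG hG.
pose I : set R := `](- e), e[%classic.
have I0 : I 0 by rewrite /I /= in_itv /= oppr_lt0 e0.
have II h : I h -> `|h| < e by rewrite /I /= in_itv /= ltr_norml.
(* Moves the base point: a derivative at [h *: v + z] along [v] is a derivative at [h] of the
   function restricted to the line. *)
have line (q : V -> R) h d' : is_derive (h *: v + z) v q d' -> is_derive h (1 : R) (fun h : R => q (h *: v + z)) d'.
  move=> /is_derive_line hq.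
  have := hq.
  have -> : (fun k : R => q (k *: v + (h *: v + z))) = (fun k : R => q (k *: v + z)) \o (shift h).
    by apply/funext => k; rewrite /= /shift /= scalerDl addrA.
  move=> hs; have : is_derive ((0 : R) + h) (1 : R) (fun k : R => q (k *: v + z)) d'; last by rewrite add0r.
  have e1 : (fun k : R => q (k *: v + z)) = ((fun k : R => q (k *: v + z)) \o shift h) \o shift (- h).
    by apply/funext => k; rewrite /= /shift /= subrK.
  rewrite e1; have hs' : is_derive ((fun k : R => k - h) (0 + h)) (1 : R) ((fun k : R => q (k *: v + z)) \o shift h) d'.
    by rewrite add0r subrr.
  have := is_derive_compR (is_derive_shift (0 + h) (1 : R) (- h)) hs'.
  by rewrite mulr1.
have Gnn y : 0 <= `|G y| by [].
have iG' : mu.-integrable D (EFin \o (fun y => `|G y|)) by exact: integrable_norm.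
suff main (q : R[i] -> R) : (forall w, `|q w| <= normc w) ->
    (forall h, I h -> mu.-integrable D (EFin \o (q \o F (h *: v + z)))) ->
    (forall h y, I h -> D y -> is_derive (h *: v + z) v (q \o (F^~ y)) (q (DF (h *: v + z) y))) ->
    is_derive z v (fun y => \int[mu]_(x in D) q (F y x)) (\int[mu]_(x in D) q (DF z x)).
  split.
  - apply: main => [w|h Ih|h y Ih Dy]; first exact: normc_re.
      exact: (iF h (II h Ih)).1.
    exact: (dF h y (II h Ih) Dy).1.
  - apply: main => [w|h Ih|h y Ih Dy]; first exact: normc_im.
      exact: (iF h (II h Ih)).2.
    exact: (dF h y (II h Ih) Dy).2.
move=> hq iq dq; apply/is_derive_line.
pose f (h : R) (y : T) : R := q (F (h *: v + z) y).
have df h y : I h -> D y -> is_derive h (1 : R) (f^~ y) (q (DF (h *: v + z) y)).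
  by move=> Ih Dy; apply: (line (q \o (F^~ y))); exact: dq.
have p1 h y : I h -> D y -> partial1of2 f h y = q (DF (h *: v + z) y).
  by move=> Ih Dy; rewrite partial1of2E; have [_ ->] := df h y Ih Dy.
have hder h y : I h -> D y -> derivable (f^~ y) h 1 by move=> Ih Dy; have [] := df h y Ih Dy.
have hb h y : I h -> D y -> `|partial1of2 f h y| <= `|G y|.
  move=> Ih Dy; rewrite p1//; apply: le_trans (hq _) _.
  exact: le_trans (hG h y (II h Ih) Dy) (ler_norm _).
have D1 := @derivable_under_integral R _ T mu f D mD 0 (- e) e I0 iq hder (fun y => `|G y|) Gnn iG' hb.
have D2 := @differentiation_under_integral R _ T mu f D mD 0 (- e) e I0 iq hder (fun y => `|G y|) Gnn iG' hb.
split; first exact: D1.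
rewrite -derive1E; transitivity (\int[mu]_(y in D) (partial1of2 f ^~ y) 0); first exact: D2.
apply: eq_Rintegral => y; rewrite inE => Dy; rewrite p1//.
by rewrite scale0r add0r.
Qed.

End Param.

Section Fubini.
Context {R : realType} d1 d2 (T1 : measurableType d1) (T2 : measurableType d2)
  (m1 : {sigma_finite_measure set T1 -> \bar R}) (m2 : {sigma_finite_measure set T2 -> \bar R}).

(** The uses of Fubini below are dominated by a product [a x * b y], which reduces all integrability
    conditions to the two factors. *)
Lemma integrable_prod_dom (a : T1 -> R) (b : T2 -> R) :
  (forall x, 0 <= a x) -> (forall y, 0 <= b y) ->
  m1.-integrable setT (EFin \o a) -> m2.-integrable setT (EFin \o b) ->
  (m1 \x m2)%E.-integrable setT (EFin \o (fun z => a z.1 * b z.2)).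
Proof.
move=> a0 b0 ia ib.
have ma : measurable_fun setT a by have /integrableP[/measurable_EFinP] := ia.
have mb : measurable_fun setT b by have /integrableP[/measurable_EFinP] := ib.
have mab : measurable_fun setT (EFin \o (fun z : T1 * T2 => a z.1 * b z.2)).
  apply/measurable_EFinP; apply: measurable_funM.
    exact: (measurableT_comp ma measurable_fst).
  exact: (measurableT_comp mb measurable_snd).
apply/(integrable12ltyP m1 m2 mab) => /=.
have -> : (fun x => \int[m2]_y `|(a x * b y)%:E|)%E = (fun x => (a x)%:E * (\int[m2]_y (b y)%:E))%E.
  apply/funext => x; rewrite -integralZl//.
  by apply: eq_integral => y _; rewrite gee0_abs ?lee_fin ?mulr_ge0// EFinM.
have fb : (\int[m2]_y (b y)%:E)%E \is a fin_num by exact: integrable_fin_num.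
rewrite -(fineK fb).
have -> : (\int[m1]_x ((a x)%:E * (fine (\int[m2]_y (b y)%:E))%:E))%E = (\int[m1]_x ((EFin \o a) x * (fine (\int[m2]_y (b y)%:E))%:E))%E by [].
by rewrite integralZr// -(fineK (integrable_fin_num measurableT ia)) -EFinM ltry.
Qed.

Context (f : T1 * T2 -> R[i]) (a : T1 -> R) (b : T2 -> R).
Context (mf : cmeas setT f) (a0 : forall x, 0 <= a x) (b0 : forall y, 0 <= b y)
  (ia : m1.-integrable setT (EFin \o a)) (ib : m2.-integrable setT (EFin \o b))
  (hf : forall x y, normc (f (x, y)) <= a x * b y).

Lemma cintble_prod : cintble (m1 \x m2)%E setT f.
Proof.
apply: (cintble_dom measurableT mf (integrable_prod_dom a0 b0 ia ib)).
by case=> x y _; exact: hf.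
Qed.

Lemma cintble_prod1 x : cintble m2 setT (fun y => f (x, y)).
Proof.
have mfx : cmeas setT (fun y => f (x, y)).
  by apply: (cmeas_comp (g := fun y => (x, y))) mf; exact: measurable_pair1.
exact: (cintble_dom measurableT mfx (integrableZl measurableT (a x) ib) (fun y _ => hf x y)).
Qed.

Lemma cintble_prod2 y : cintble m1 setT (fun x => f (x, y)).
Proof.
have mfy : cmeas setT (fun x => f (x, y)).
  by apply: (cmeas_comp (g := fun x => (x, y))) mf; exact: measurable_pair2.
apply: (cintble_dom measurableT mfy (integrableZl measurableT (b y) ia)).
by move=> x _; rewrite mulrC; exact: hf.
Qed.

Let fub1 (q : R[i] -> R) : (m1 \x m2)%E.-integrable setT (EFin \o (q \o f)) ->
  (forall x, m2.-integrable setT (EFin \o (q \o (fun y => f (x, y))))) ->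
  (\int[m1]_x (\int[m2]_y q (f (x, y))) = \int[(m1 \x m2)%E]_z q (f z))%R /\
  m1.-integrable setT (EFin \o (fun x => \int[m2]_y q (f (x, y)))%R).
Proof.
move=> iq ix.
have e : (EFin \o (fun x => \int[m2]_y q (f (x, y)))%R) = (fun x => \int[m2]_y (q (f (x, y)))%:E)%E.
  by apply/funext => x; rewrite /Rintegral /= fineK//; exact: (integrable_fin_num measurableT (ix x)).
split; last by rewrite e; exact: (integrable_fubini_F iq).
by rewrite {1}/Rintegral; congr fine; have := integral12_prod_meas1 iq; rewrite /fubini_F /= => <-; rewrite -e.
Qed.

Let fub2 (q : R[i] -> R) : (forall w, `|q w| <= normc w) -> (m1 \x m2)%E.-integrable setT (EFin \o (q \o f)) ->
  (forall y, m1.-integrable setT (EFin \o (q \o (fun x => f (x, y))))) ->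
  (\int[m2]_y (\int[m1]_x q (f (x, y))) = \int[(m1 \x m2)%E]_z q (f z))%R /\
  m2.-integrable setT (EFin \o (fun y => \int[m1]_x q (f (x, y)))%R).
Proof.
move=> hq iq ix.
have e : (EFin \o (fun y => \int[m1]_x q (f (x, y)))%R) = (fun y => \int[m1]_x (q (f (x, y)))%:E)%E.
  by apply/funext => y; rewrite /Rintegral /= fineK//; exact: (integrable_fin_num measurableT (ix y)).
split; last first.
  apply: (integrable_dom measurableT (g := fun y => fine (\int[m1]_x (a x)%:E)%E * b y)).
  - by apply/measurable_EFinP; rewrite e; exact: (measurable_fubini_G iq).
  - exact: (integrableZl measurableT _ ib).
  - move=> y _; apply: le_trans (le_normr_Rintegral measurableT (ix y)) _.
    rewrite mulrC -RintegralZl//; apply: le_Rintegral => //.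
    + exact: (integrable_norm (ix y)).
    + exact: (integrableZl measurableT _ ia).
    + by move=> x _ /=; apply: le_trans (hq _) _; rewrite mulrC; exact: hf.
by rewrite {1}/Rintegral; congr fine; have := integral21_prod_meas1 iq; rewrite /fubini_G /= => <-; rewrite -e.
Qed.

Lemma cfubini1 : cint m1 setT (fun x => cint m2 setT (fun y => f (x, y))) = cint (m1 \x m2)%E setT f.
Proof.
apply: cplxP => /=.
  by have [] := @fub1 (@re R) cintble_prod.1 (fun x => (cintble_prod1 x).1).
by have [] := @fub1 (@im R) cintble_prod.2 (fun x => (cintble_prod1 x).2).
Qed.

Lemma cfubini2 : cint m2 setT (fun y => cint m1 setT (fun x => f (x, y))) = cint (m1 \x m2)%E setT f.
Proof.
apply: cplxP => /=.
  by have [] := @fub2 (@re R) normc_re cintble_prod.1 (fun x => (cintble_prod2 x).1).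
by have [] := @fub2 (@im R) normc_im cintble_prod.2 (fun x => (cintble_prod2 x).2).
Qed.

Lemma cfubini : cint m1 setT (fun x => cint m2 setT (fun y => f (x, y))) =
  cint m2 setT (fun y => cint m1 setT (fun x => f (x, y))).
Proof. by rewrite cfubini1 cfubini2. Qed.

Lemma cintble_fubini1 : cintble m1 setT (fun x => cint m2 setT (fun y => f (x, y))).
Proof.
split.
  by have [] := @fub1 (@re R) cintble_prod.1 (fun x => (cintble_prod1 x).1).
by have [] := @fub1 (@im R) cintble_prod.2 (fun x => (cintble_prod1 x).2).
Qed.

End Fubini.

(** * Fundamental theorem of calculus, on intervals and on unbounded domains *)

Section FTC.
Context {R : realType}.
Notation mu := (@lebesgue_measure R).
Implicit Types (F f : R -> R[i]) (a b : R).

Lemma ccont_within f (A : set R) : (forall x, A x -> ccont f x) ->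
  {within A, continuous (re \o f)} /\ {within A, continuous (im \o f)}.
Proof.
by move=> h; split; apply: continuous_in_subspaceT => x; rewrite inE => /h[].
Qed.

Lemma cintble_itv f a b : (forall x, a <= x <= b -> ccont f x) -> cintble mu `[a, b]%classic f.
Proof.
move=> h; have [c1 c2] : {within `[a, b], continuous (re \o f)} /\ {within `[a, b], continuous (im \o f)}.
  by apply: ccont_within => x /=; rewrite in_itv /=; exact: h.
by split; apply: continuous_compact_integrable => //; exact: segment_compact.
Qed.

Lemma cFTC F f a b : a <= b -> (forall x, a <= x <= b -> is_cder F x 1 (f x)) ->
  (forall x, a <= x <= b -> ccont f x) ->
  cint mu `[a, b]%classic f = F b - F a.
Proof.
rewrite le_eqVlt => /predU1P[->|ab] hF hf.
  rewrite subrr set_itv1; apply: cplxP; rewrite /= Rintegral_set1//.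
have [c1 c2] : {within `[a, b], continuous (re \o f)} /\ {within `[a, b], continuous (im \o f)}.
  by apply: ccont_within => x /=; rewrite in_itv /=; exact: hf.
have one (q : R[i] -> R) : {within `[a, b], continuous (q \o f)} ->
    (forall x, a <= x <= b -> is_derive x (1 : R) (q \o F) (q (f x))) ->
    \int[mu]_(x in `[a, b]) q (f x) = q (F b) - q (F a).
  move=> cq dq; have dc x : a <= x <= b -> {for x, continuous (q \o F)}.
    by move=> hx; apply: differentiable_continuous; apply/derivable1_diffP; have [] := dq x hx.
  rewrite /Rintegral (@continuous_FTC2 _ _ (q \o F) _ _ ab cq).
  - by rewrite -EFinB.
  - split.
    + move=> x; rewrite in_itv /= => /andP[h1 h2]; have xab : a <= x <= b by rewrite !ltW.
      by have [] := dq x xab.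
    + by apply: cvg_at_right_filter; apply: dc; rewrite lexx ltW.
    + by apply: cvg_at_left_filter; apply: dc; rewrite lexx ltW.
  - move=> x; rewrite in_itv /= => /andP[h1 h2]; rewrite derive1E.
    by have [|_ ->] := dq x; rewrite ?ltW.
apply: cplxP; rewrite ?reB ?imB /=.
  by apply: one => // x hx; exact: (hF x hx).1.
by apply: one => // x hx; exact: (hF x hx).2.
Qed.

Lemma cint_limit_sets (D : nat -> set (mR R)) (E : set (mR R)) (f : mR R -> R[i]) : measurable E -> (forall n, measurable (D n)) ->
  (forall n, D n `<=` E) -> (forall x, E x -> exists N, forall n, (N <= n)%N -> D n x) ->
  cintble mu E f -> ccvg (fun n => cint mu (D n) f) (cint mu E f).
Proof.
move=> mE mD DE hD hf.
have e n : cint mu (D n) f = cint mu E (fun x => if x \in D n then f x else 0).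
  rewrite cint_mkcond [RHS]cint_mkcond; apply: eq_cint => x _.
  have [xD|xD] := boolP (x \in D n); last by case: ifP.
  by rewrite mem_set//; apply: (DE n); rewrite inE in xD.
have -> : (fun n => cint mu (D n) f) = (fun n => cint mu E (fun x => if x \in D n then f x else 0)).
  by apply/funext => n; exact: e.
pose fn n (x : mR R) : R[i] := if x \in D n then f x else 0.
have m1 n : cmeas E (fn n).
  have [f1 f2] := cintble_cmeas mE hf.
  have aux (q : R[i] -> R) : q 0 = 0 -> measurable_fun E (q \o f) ->
     measurable_fun E (q \o fn n).
    move=> q0 mq; rewrite (_ : _ \o _ = (q \o f) \* (\1_(D n) : R -> R)).
      by apply: measurable_funM => //; exact: measurable_indic.
    by apply/funext => x /=; rewrite /fn indicE; case: ifP => _; rewrite ?mulr1 ?mulr0.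
  by split; exact: aux.
have c1 x : E x -> ccvg (fn^~ x) (f x).
  move=> Ex; have [N hN] := hD x Ex.
  by split; apply: cvg_near_cst; exists N => // n /= /hN Dn; rewrite /fn mem_set.
have b1 n x : E x -> normc (fn n x) <= normc (f x).
  by move=> Ex; rewrite /fn; case: ifP; rewrite ?normc0 ?normc_ge0.
by have [] := cint_dct mE m1 c1 (cintble_norm mE hf) b1.
Qed.

Lemma cint_limit_half f a : cintble mu `[a, +oo[%classic f ->
  ccvg (fun n => cint mu `[a, a + n%:R]%classic f) (cint mu `[a, +oo[%classic f).
Proof.
move=> hf; apply: cint_limit_sets => //.
- by move=> n x /=; rewrite !in_itv /= andbT => /andP[].
- move=> x /=; rewrite in_itv /= andbT => ax.
  exists (Num.truncn (x - a)).+1 => n Nn /=; rewrite in_itv /= ax /= -lerBlDl.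
  by apply: le_trans (ltW (truncnS_gt _)) _; rewrite ler_nat.
Qed.

Lemma cint_limitT f : cintble mu setT f ->
  ccvg (fun n => cint mu `[- n%:R, n%:R]%classic f) (cint mu setT f).
Proof.
move=> hf; apply: cint_limit_sets => // x _.
exists (Num.truncn `|x|).+1 => n Nn /=; rewrite in_itv /= -ler_norml.
by apply: le_trans (ltW (truncnS_gt _)) _; rewrite ler_nat.
Qed.

Lemma cint_halfline F f a : (forall x, a <= x -> is_cder F x 1 (f x)) ->
  (forall x, a <= x -> ccont f x) ->
  cintble mu `[a, +oo[%classic f -> ccvg (fun n => F (a + n%:R)) 0 ->
  cint mu `[a, +oo[%classic f = - F a.
Proof.
move=> hF hf fi cF; have := cint_limit_half fi.
have -> : (fun n => cint mu `[a, a + n%:R]%classic f) = (fun n => F (a + n%:R) + (- F a)).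
  apply/funext => n; apply: cFTC; first by rewrite lerDl.
  - by move=> x /andP[h _]; exact: hF.
  - by move=> x /andP[h _]; exact: hf.
move=> h; apply: (ccvg_unique h); rewrite -[X in ccvg _ X]add0r.
by apply: ccvgD => //; exact: ccvg_cst.
Qed.

Lemma cint_derT F f : (forall x, is_cder F x 1 (f x)) -> (forall x, ccont f x) ->
  cintble mu setT f -> ccvg (fun n => F n%:R) 0 -> ccvg (fun n => F (- n%:R)) 0 ->
  cint mu setT f = 0.
Proof.
move=> hF hf fi c1 c2; have := cint_limitT fi.
have -> : (fun n => cint mu `[- n%:R, n%:R]%classic f) = (fun n => F n%:R + -1 * F (- n%:R)).
  apply/funext => n; rewrite mulN1r; apply: cFTC => //.
  by rewrite (@le_trans _ _ 0)// oppr_le0.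
move=> h; apply: (ccvg_unique h); rewrite -[X in ccvg _ X]addr0.
apply: ccvgD => //; rewrite -[X in ccvg _ X](mulr0 (-1)); apply: ccvgM => //; exact: ccvg_cst.
Qed.

End FTC.

(** * Integrable majorants and changes of variable on the line *)

Section RealIntegrals.
Context {R : realType}.
Notation mu := (@lebesgue_measure R).

Lemma contT_integrable_ge0 (f : R -> R) (M : \bar R) : continuous f -> (forall x, 0 <= f x) ->
  (\int[mu]_x (f x)%:E = M)%E -> (M < +oo)%E -> mu.-integrable setT (EFin \o f).
Proof.
move=> cf f0 iM M0; apply/integrableP; split.
  by apply/measurable_EFinP; exact: continuous_measurable_fun.
by under eq_integral do rewrite /= ger0_norm//; rewrite iM.
Qed.

Lemma setle_itv : [set x : R | 0 <= x] = `[0, +oo[%classic.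
Proof. by apply/seteqP; split => x /=; rewrite in_itv /= andbT. Qed.

Lemma continuous_one_norm : continuous (fun x : R => 1 + `|x|).
Proof. by move=> x; apply: cvgD; [exact: cvg_cst|exact: norm_continuous]. Qed.

Lemma is_derive_powRC (g : R -> R) (x d c : R) : 0 < g x -> is_derive x (1 : R) g d ->
  is_derive x (1 : R) (fun y => g y `^ c) (c * g x `^ (c - 1) * d).
Proof. by move=> g0 dg; exact: (is_derive_compR dg (is_derive1_powR c g0)). Qed.

Lemma continuous_powRC (g : R -> R) (c : R) x : 0 < g x -> {for x, continuous g} ->
  {for x, continuous (fun y => g y `^ c)}.
Proof.
move=> g0 cg; apply: (@continuous_comp _ _ _ g (@powR R ^~ c)) => //.
apply: differentiable_continuous; apply/derivable1_diffP.
by have [] := is_derive1_powR c g0.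
Qed.

Lemma powR_cvg_pinfty0 (d : R) : 0 < d -> (1 + x) `^ (- d) @[x --> +oo%R] --> (0 : R).
Proof.
move=> d0; apply/cvgrPdist_le => e e0; near=> x.
have x0 : 0 < 1 + x by rewrite ltr_wpDr//; near: x; exact: nbhs_pinfty_ge.
rewrite sub0r normrN ger0_norm ?powR_ge0// powRN.
have xe : e^-1 `^ (d^-1) <= 1 + x.
  by rewrite -lerBlDl; near: x; exact: nbhs_pinfty_ge.
rewrite -[leRHS]invrK lef_pV2 ?posrE ?invr_gt0 ?powR_gt0//.
have := ge0_ler_powR (ltW d0) _ _ xe.
rewrite !nnegrE powR_ge0 (ltW x0) => /(_ isT isT).
by rewrite -powRrM mulVf ?gt_eqF// powRr1// invr_ge0 ltW.
Unshelve. all: by end_near. Qed.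

(** The standard integrable majorant, for [d > 0]; [wt 1] is [1 / (1 + |x|)^2]. *)
Definition wt (d x : R) : R := (1 + `|x|) `^ (- (1 + d)).

Lemma wt_gt0 d x : 0 < wt d x.
Proof. by rewrite powR_gt0// ltr_wpDr. Qed.
Lemma wt_ge0 d x : 0 <= wt d x. Proof. exact/ltW/wt_gt0. Qed.

Lemma integrable_wt (d : R) : 0 < d -> mu.-integrable setT (EFin \o wt d).
Proof.
move=> d0.
have cw : continuous (wt d).
  move=> x; apply: (@continuous_powRC (fun x => 1 + `|x|) (- (1 + d))); last exact: continuous_one_norm.
  by rewrite ltr_wpDr.
have h : (\int[mu]_(x in `[0%R, +oo[) (wt d x)%:E = 0%:E - (- (d^-1 * (1 + 0) `^ (- d)))%:E)%E.
  apply: (@ge0_continuous_FTC2y R (wt d) (fun x => - (d^-1 * (1 + x) `^ (- d)))).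
  - by move=> x _; exact: wt_ge0.
  - exact: continuous_subspaceT.
  - rewrite -oppr0; apply: cvgN; rewrite -[X in _ --> X](mulr0 d^-1).
    by apply: cvgM; [exact: cvg_cst|exact: powR_cvg_pinfty0].
  - move=> x x0; have x1 : 0 < 1 + x by rewrite ltr_wpDr// ltW.
    have d1 : is_derive x (1 : R) (fun y : R => 1 + y) (0 + 1) := is_deriveD (is_derive_cst _ _ _) (is_derive_id _ _).
    have d2 := is_deriveN (is_deriveZ d^-1 (is_derive_powRC (- d) x1 d1)).
    by have [] := d2.
  - apply: cvg_at_right_filter; apply: cvgN; apply: cvgM; first exact: cvg_cst.
    apply: continuous_powRC; first by rewrite addr0.
    by apply: cvgD; [exact: cvg_cst|exact: cvg_id].
  - move=> x; rewrite in_itv /= andbT => x0; have x1 : 0 < 1 + x by rewrite ltr_wpDr// ltW.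
    have d1 : is_derive x (1 : R) (fun y : R => 1 + y) (0 + 1) := is_deriveD (is_derive_cst _ _ _) (is_derive_id _ _).
    have d2 := is_deriveN (is_deriveZ d^-1 (is_derive_powRC (- d) x1 d1)).
    rewrite derive1E; have [_ e2] := d2.
    transitivity (- (d^-1 *: (- d * (1 + x) `^ (- d - 1) * (0 + 1)))); first exact: e2.
    rewrite /wt /GRing.scale /= gtr0_norm// add0r mulr1 mulNr mulrN opprK mulrA mulVf ?gt_eqF// mul1r.
    by congr (_ `^ _); ring.
apply: (@contT_integrable_ge0 _ (2%:E * (0%:E - (- (d^-1 * (1 + 0) `^ (- d)))%:E))%E) => //.
- by move=> x; exact: wt_ge0.
- rewrite ge0_symfun_integralT//; first by rewrite setle_itv h.
  + by move=> x; exact: wt_ge0.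
  + by move=> x; rewrite /wt /= normrN.
- by rewrite -EFinB -EFinM ltry.
Qed.

Lemma expRN_cvg0 (k : R) : 0 < k -> expR (- (k * x)) @[x --> +oo%R] --> (0 : R).
Proof.
move=> k0; apply: (cvg_comp (fun x => k * x) (fun x => expR (- x))); last exact: cvgr_expR.
apply/cvgryPge => A; near=> x; rewrite -ler_pdivrMl//; near: x; exact: nbhs_pinfty_ge.
Unshelve. all: by end_near. Qed.

Lemma continuous_expk (k : R) : continuous (fun x : R => expR (- (k * x))).
Proof.
move=> x; apply: (@continuous_comp _ _ _ (fun x => - (k * x)) expR); last exact: continuous_expR.
by apply: cvgN; apply: cvgM; [exact: cvg_cst|exact: cvg_id].
Qed.

Lemma integral_exp_half (k : R) : 0 < k ->
  (\int[mu]_(x in `[0%R, +oo[) (expR (- (k * x)))%:E = (k^-1)%:E)%E.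
Proof.
move=> k0.
have dE (x : R) : is_derive x (1 : R) (fun x => - (k^-1 * expR (- (k * x)))) (expR (- (k * x))).
  have d1 : is_derive x (1 : R) (fun x : R => k * x) (k * 1) := is_deriveZ k (is_derive_id x (1 : R)).
  have d2 := is_deriveN (is_deriveZ k^-1 (is_derive_compR (is_deriveN d1) (is_derive_expR _))).
  apply: is_derive_eq d2 _; rewrite /GRing.scale /= mulr1 !mulrN opprK.
  by rewrite (_ : (- (fun x : R => k * x)) x = - (k * x))// mulrCA mulVf ?mulr1// gt_eqF.
rewrite (@ge0_continuous_FTC2y R _ (fun x => - (k^-1 * expR (- (k * x)))) 0 0).
- by rewrite mulr0 oppr0 expR0 mulr1 -EFinB sub0r opprK.
- by move=> x _; exact: expR_ge0.
- by apply: continuous_subspaceT; exact: continuous_expk.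
- rewrite -oppr0; apply: cvgN; rewrite -[X in _ --> X](mulr0 k^-1).
  by apply: cvgM; [exact: cvg_cst|exact: expRN_cvg0].
- by move=> x _; have [] := dE x.
- apply: cvg_at_right_filter; apply: cvgN; apply: cvgM; first exact: cvg_cst.
  exact: continuous_expk.
- by move=> x _; rewrite derive1E; have [_ ->] := dE x.
Qed.

Lemma integral_exp_abs (k : R) : 0 < k ->
  (\int[mu]_x (expR (- (k * `|x|)))%:E = (2 / k)%:E)%E.
Proof.
move=> k0; rewrite ge0_symfun_integralT.
- have e : (\int[mu]_(x in `[0%R, +oo[) (expR (- (k * `|x|)))%:E = \int[mu]_(x in `[0%R, +oo[) (expR (- (k * x)))%:E)%E.
    by apply: eq_integral => x; rewrite inE /= in_itv /= andbT => x0; rewrite ger0_norm.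
  by rewrite setle_itv e integral_exp_half// -EFinM.
- by move=> x; exact: expR_ge0.
- move=> x; apply: (@continuous_comp _ _ _ (fun x : R => `|x|) (fun y => expR (- (k * y)))).
    exact: norm_continuous.
  exact: continuous_expk.
- by move=> x /=; rewrite normrN.
Qed.

Lemma integrable_exp_abs (k : R) : 0 < k ->
  mu.-integrable setT (EFin \o (fun x => expR (- (k * `|x|)))).
Proof.
move=> k0; apply: (contT_integrable_ge0 _ _ (integral_exp_abs k0)); last exact: ltry.
- move=> x; apply: (@continuous_comp _ _ _ (fun x : R => `|x|) (fun y => expR (- (k * y)))).
    exact: norm_continuous.
  exact: continuous_expk.
- by move=> x; exact: expR_ge0.
Qed.

Lemma Rintegral_exp_abs (k : R) : 0 < k -> (\int[mu]_x expR (- (k * `|x|)) = 2 / k)%R.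
Proof. by move=> k0; rewrite /Rintegral integral_exp_abs. Qed.

Lemma itv_cst (a b c : R) : mu.-integrable setT (EFin \o (fun x => if a <= x <= b then c else 0)).
Proof.
have := integrableZl measurableT c (@integrable_indic_itv R a b true false).
congr integrable; apply/funext => x /=; rewrite indicE mem_setE in_itv /=.
by case: ifP; rewrite ?mule1 ?mule0.
Qed.

(** The image of Lebesgue measure under a translation agrees with it on the intervals []x, y]],
    hence everywhere by uniqueness; the rest is integration against a push-forward. *)
Lemma integral_shift (f : R -> R) (a : R) : mu.-integrable setT (EFin \o f) ->
  mu.-integrable setT (EFin \o (fun x => f (x + a))) /\
  (\int[mu]_x f (x + a) = \int[mu]_x f x)%R.
Proof.
move=> fi.
have mphi : measurable_fun setT (fun x : mR R => (x + a) : mR R).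
  by apply: continuous_measurable_fun => x; apply: cvgD; [exact: cvg_id|exact: cvg_cst].
have hmu : forall A, measurable A -> mu A = pushforward mu (fun x : mR R => (x + a) : mR R) A.
  apply: (@lebesgue_measure_unique R (pushforward mu (fun x : mR R => (x + a) : mR R))).
  move=> _ [[x y] _ <-]; transitivity (mu `]x - a, y - a]%classic); last first.
    congr (mu _); apply/seteqP; split => z /=; rewrite !in_itv /= ltrBlDr lerBrDr//.
  rewrite !lebesgue_measure_itv /= !lte_fin ltrD2r; case: ifP => // _.
  by rewrite -!EFinB; congr EFin; ring.
have e : (\int[mu]_x `|(f (x + a))%:E| = \int[mu]_x `|(f x)%:E|)%E.
  have := @ge0_integral_pushforward _ _ _ _ R _ mphi mu setT (fun x => `|(f x)%:E|)%E measurableT.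
  rewrite preimage_setT => <- //.
  - by apply: eq_measure_integral => A mA _; exact/esym/hmu.
  - by apply: measurableT_comp => //; have /integrableP[] := fi.
have fi' : mu.-integrable setT (EFin \o (fun x => f (x + a))).
  apply/integrableP; split.
    have /integrableP[mf _] := fi.
    exact: (measurableT_comp mf mphi).
  by rewrite /= e; have /integrableP[] := fi.
split => //; rewrite /Rintegral; congr fine.
have := @integral_pushforward _ _ _ _ R _ mphi mu setT (EFin \o f).
move=> h; rewrite -[LHS](h _ _ measurableT) ?preimage_setT//.
- by apply: eq_measure_integral => A mA _; exact/esym/hmu.
- by have /integrableP[] := fi.
Qed.

Lemma cint_shift (f : R -> R[i]) (a : R) : cintble mu setT f ->
  cintble mu setT (fun x => f (x + a)) /\ cint mu setT (fun x => f (x + a)) = cint mu setT f.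
Proof.
move=> [f1 f2]; have [i1 e1] := integral_shift a f1; have [i2 e2] := integral_shift a f2.
by split; [split|apply: cplxP => /=].
Qed.

Lemma cint_itv_split (f : R -> R[i]) (a b c : R) : a <= b -> b <= c ->
  (forall x, a <= x <= c -> ccont f x) ->
  cint mu `[a, c]%classic f = cint mu `[a, b[%classic f + cint mu `]b, c]%classic f /\
  cint mu `[a, b[%classic f = cint mu `[a, b]%classic f /\ cint mu `]b, c]%classic f = cint mu `[b, c]%classic f.
Proof.
move=> ab bc cf.
have [i1 i2] := @cintble_itv R f a c cf.
have iS (q : R -> R) (A B : set (mR R)) : measurable A -> measurable B -> B `<=` A ->
    mu.-integrable A (EFin \o q) -> mu.-integrable B (EFin \o q).
  by move=> mA mB BA; exact: integrableS.
have [j1 j2] : cintble mu `[a, b[%classic f.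
  have sub : `[a, b[ `<=` (`[a, c] : set R) by apply: subset_itvl; rewrite bnd_simp.
  by split; [exact: (iS _ _ _ _ _ sub i1)|exact: (iS _ _ _ _ _ sub i2)].
have [k1 k2] : cintble mu `]b, c]%classic f.
  have sub : `]b, c] `<=` (`[a, c] : set R) by apply: subset_itvr; rewrite bnd_simp.
  by split; [exact: (iS _ _ _ _ _ sub i1)|exact: (iS _ _ _ _ _ sub i2)].
split; last split.
- have h (q : R[i] -> R) : mu.-integrable `[a, c] (EFin \o (q \o f)) -> mu.-integrable `[a, b[ (EFin \o (q \o f)) ->
   (\int[mu]_(x in `[a, c]) q (f x) = \int[mu]_(x in `[a, b[) q (f x) + \int[mu]_(x in `]b, c]) q (f x))%R.
    move=> iq jq; rewrite Rintegral_itv_bndo_bndc// -(@Rintegral_itvB R _ (BLeft a) (BRight c) b iq) ?bnd_simp//.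
    by rewrite addrC subrK.
  by apply: cplxP; rewrite ?reD ?imD /=; exact: h.
- by apply: cplxP; rewrite /= Rintegral_itv_bndo_bndc.
- by apply: cplxP; rewrite /= Rintegral_itv_obnd_cbnd.
Qed.

End RealIntegrals.

(** * Two-sided Laplace transform of test functions on the line [Re s = 1] *)

Section Laplace.
Context {R : realType}.
Notation mu := (@lebesgue_measure R).
Implicit Types (q : R -> R[i]).

Definition sl (η : R) : R[i] := 1 +i* η.

Lemma cmeasT1 (f : R -> R[i]) : (forall x, ccont f x) -> cmeas (T := mR R) setT f.
Proof. exact: ccont_cmeas1. Qed.

Lemma cintZT (a : R[i]) (f : R -> R[i]) : cintble mu setT f ->
  cint mu setT (fun x => a * f x) = a * cint mu setT f.
Proof. exact: (cintZ a measurableT). Qed.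

Lemma cintDT (f g : R -> R[i]) : cintble mu setT f -> cintble mu setT g ->
  cint mu setT (fun x => f x + g x) = cint mu setT f + cint mu setT g.
Proof. exact: (cintD measurableT). Qed.

Lemma cintBT (f g : R -> R[i]) : cintble mu setT f -> cintble mu setT g ->
  cint mu setT (fun x => f x - g x) = cint mu setT f - cint mu setT g.
Proof. exact: (cintB measurableT). Qed.

Lemma cintZi (i : interval R) (a : R[i]) (f : R -> R[i]) : cintble mu [set` i] f ->
  cint mu [set` i] (fun x => a * f x) = a * cint mu [set` i] f.
Proof.
have mi : measurable ([set` i] : set (mR R)) by exact: measurable_itv.
exact: (cintZ a mi).
Qed.

Lemma cintbleZT (a : R[i]) (f : R -> R[i]) : cintble mu setT f -> cintble mu setT (fun x => a * f x).
Proof. exact: (cintbleZ a measurableT). Qed.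

Lemma cintbleDT (f g : R -> R[i]) : cintble mu setT f -> cintble mu setT g -> cintble mu setT (fun x => f x + g x).
Proof. exact: (cintbleD measurableT). Qed.

Lemma cintble_cpt (f : R -> R[i]) (M C : R) : (forall x, ccont f x) ->
  (forall x, M < `|x| -> f x = 0) -> (forall x, normc (f x) <= C) -> cintble mu setT f.
Proof.
move=> cf hM hC; apply: (cintble_dom measurableT (cmeasT1 cf) (@itv_cst R (- M) M C)).
move=> x _; case: ifP => [_|]; first exact: hC.
by move=> /negbT; rewrite -ler_norml -ltNge => /hM ->; rewrite normc0.
Qed.

Lemma test_bd_supp q : test q -> exists M C : R,
  [/\ 0 <= M, 0 <= C, forall x, M < `|x| -> q x = 0 & forall x, normc (q x) <= C].
Proof.
move=> tq; have [_ [M hM]] := (testP cptB1 q).1 tq.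
have [C hC] := test_bound cptB1 tq.
exists `|M|, C; split => // [|x hx]; first exact: le_trans (normc_ge0 _) (hC 0).
by apply: hM; apply: le_lt_trans hx; exact: ler_norm.
Qed.

Lemma cintble_test q : test q -> cintble mu setT q.
Proof.
move=> tq; have [M [C [M0 C0 hM hC]]] := test_bd_supp tq.
by apply: (cintble_cpt (M := M) (C := C)) => // x; exact: (smooth_cont tq.1).
Qed.

Lemma cint_cpt0 (F f : R -> R[i]) (M C : R) : (forall x, is_cder F x 1 (f x)) ->
  (forall x, ccont f x) -> (forall x, M < `|x| -> F x = 0) ->
  (forall x, M < `|x| -> f x = 0) -> (forall x, normc (f x) <= C) ->
  cint mu setT f = 0.
Proof.
move=> hF cf FM fM hC.
have big (n : nat) : M < n%:R -> F n%:R = 0 /\ F (- n%:R) = 0.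
  by move=> h; split; apply: FM; rewrite ?normrN ger0_norm.
apply: (cint_derT hF cf); first exact: cintble_cpt fM hC.
- have b1 : \forall n \near \oo, F n%:R = 0.
    by near=> n; apply: (big n _).1; near: n; exact: nbhs_infty_gtr.
  by split; apply: cvg_near_cst; apply: filterS b1 => n /= ->.
- have b1 : \forall n \near \oo, F (- n%:R) = 0.
    by near=> n; apply: (big n _).2; near: n; exact: nbhs_infty_gtr.
  by split; apply: cvg_near_cst; apply: filterS b1 => n /= ->.
Unshelve. all: by end_near. Qed.

Lemma cint_test_deriv q : test q -> cint mu setT (cderive (1 : R) q) = 0.
Proof.
move=> tq; have [M [C [M0 C0 hM hC]]] := test_bd_supp tq.
have tq' := test_cderive cptB1 (1 : R) tq.
have [M' [C' [M'0 C'0 hM' hC']]] := test_bd_supp tq'.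
apply: (@cint_cpt0 q _ (M + M') C') => //.
- by move=> x; exact: (smooth_cder0 (1 : R) tq.1 (I : setT x)).
- by move=> x; exact: (smooth_cont tq'.1).
- by move=> x hx; apply: hM; apply: le_lt_trans hx; rewrite lerDl.
- by move=> x hx; apply: hM'; apply: le_lt_trans hx; rewrite lerDr.
Qed.

Definition rotc (s : R[i]) (t : R) : R[i] := cexp (s * t%:C).

Lemma smooth_id : smooth_on setT (fun t : R => t%:C).
Proof.
have h : slow (fun t : R => t%:C).
  apply: (@slow_linear R R id) => //.
    by exists 1 => z; rewrite mul1r lerDr.
  by move=> z; exact: cvg_id.
exact: h.1.
Qed.

Lemma smooth_rotc s : smooth_on setT (rotc s).
Proof. by apply: (smooth_exp openT); apply: (smoothZ _ openT); exact: smooth_id. Qed.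

Lemma is_cder_id (t : R) : is_cder (fun t : R => t%:C) t 1 1.
Proof. exact: (is_cderR (is_derive_id t 1)). Qed.

Lemma is_cder_rotc s (t : R) : is_cder (rotc s) t 1 (s * rotc s t).
Proof.
by have := cder_exp (is_cderZ s (is_cder_id t)); rewrite mulr1.
Qed.

Lemma test_rotc q s : test q -> test (fun t => q t * rotc s t).
Proof. by move=> tq; apply: (testM cptB1 tq); exact: smooth_rotc. Qed.

(** The sign in [exp (+ s t)] is opposite to that of the transform of [S]: a test function is a
    superposition of [exp (- s t)] with weights [L q s]. *)
Definition L q (s : R[i]) : R[i] := cint mu setT (fun t => q t * rotc s t).

Lemma normc_rotc s t : normc (rotc s t) = expR (re s * t).
Proof. by rewrite normc_cexp reM /= mulr0 subr0. Qed.

Lemma L_deriv q s : test q -> s * L q s = - L (cderive (1 : R) q) s.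
Proof.
move=> tq; have tq' := test_cderive cptB1 (1 : R) tq.
rewrite /L -cintZ//; last exact: (cintble_test (test_rotc s tq)).
rewrite -cintN//; last exact: (cintble_test (test_rotc s tq')).
apply/eqP; rewrite -subr_eq0; apply/eqP.
rewrite -cintB//.
- have := cint_test_deriv (test_rotc s tq).
  rewrite (_ : cderive (1 : R) (fun t => q t * rotc s t) = fun t => cderive (1 : R) q t * rotc s t + q t * (s * rotc s t)).
    by move=> <-; apply: eq_cint => x _; rewrite opprK addrC; congr (_ + _); ring.
  apply/funext => t; have := is_cderM (smooth_cder0 (1 : R) tq.1 (I : setT t)) (is_cder_rotc s t).
  by case/is_cderP.
- by apply: cintbleZ => //; exact: (cintble_test (test_rotc s tq)).
- by apply: cintbleN => //; exact: (cintble_test (test_rotc s tq')).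
Qed.

Lemma L_derivn q s n : test q ->
  s ^+ n * L q s = (-1) ^+ n * L (iter_derive (nseq n (1 : R)) q) s.
Proof.
move=> tq; elim: n => [|n IH]; first by rewrite !expr0.
rewrite exprSr -mulrA mulrCA IH mulrCA L_deriv; last exact: (test_iter cptB1).
by rewrite exprSr mulrN mulrN1 mulNr.
Qed.

Lemma normc_sl_ge η : 1 <= normc (sl η) :> R.
Proof. by have := normc_re (sl η); rewrite normr1. Qed.

Lemma normc_sl_wt η : 1 + `|η| <= 2 * normc (sl η).
Proof. have := normc_sl_ge η; have := normc_im (sl η); rewrite /=; lra. Qed.

Lemma normc_sl_le η : normc (sl η) <= 1 + `|η|.
Proof. by have := normc_reim (sl η); rewrite /= normr1. Qed.

Lemma L_bound q : test q -> exists2 C : R, 0 <= C & forall s, re s <= 1 -> -1 <= re s -> normc (L q s) <= C.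
Proof.
move=> tq; have [M [C [M0 C0 hM hC]]] := test_bd_supp tq.
have ii := @itv_cst R (- M) M (C * expR M).
exists (\int[mu]_x (if - M <= x <= M then C * expR M else 0))%R.
  by apply: Rintegral_ge0 => x _; case: ifP => // _; rewrite mulr_ge0// expR_ge0.
move=> s s1 s2; apply: (cint_le measurableT _ ii).
  by apply: cmeasT1 => x; exact: (smooth_cont (test_rotc s tq).1).
move=> x _; rewrite normcM normc_rotc; case: ifP => [hx|/negbT].
  rewrite ler_pM// ?normc_ge0 ?expR_ge0//.
  rewrite ler_expR; apply: le_trans (ler_norm _) _; rewrite normrM.
  rewrite -[leRHS]mul1r ler_pM//; first by rewrite ler_norml s2 s1.
  by rewrite ler_norml.
by rewrite -ler_norml -ltNge => /hM ->; rewrite normc0 mul0r.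
Qed.

(** Up to sign [s^n L q s] is the transform of the [n]-th derivative, hence bounded, and
    [1 + |η| <= 2 |s|] on the line. *)
Lemma L_decay q (n : nat) : test q ->
  exists2 C : R, 0 <= C & forall η, (1 + `|η|) ^+ n * normc (L q (sl η)) <= C.
Proof.
move=> tq; have [C C0 hC] := L_bound (test_iter cptB1 (nseq n (1 : R)) tq).
exists (2 ^+ n * C); first by rewrite mulr_ge0// exprn_ge0.
move=> η; apply: (@le_trans _ _ ((2 * normc (sl η)) ^+ n * normc (L q (sl η)))).
  by rewrite ler_wpM2r ?normc_ge0// lerXn2r ?nnegrE ?addr_ge0// ?mulr_ge0 ?normc_ge0// normc_sl_wt.
rewrite exprMn -mulrA ler_wpM2l ?exprn_ge0// -normcX -normcM L_derivn// normcM normcX normcN normc1 expr1n mul1r.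
by apply: hC; rewrite /= ?lexx// (le_trans _ ler01)// lerN10.
Qed.

Lemma wt_natE (n : nat) (x : R) : wt n%:R x = ((1 + `|x|) ^+ n.+1)^-1.
Proof. by rewrite /wt nat1r powRN powR_mulrn// addr_ge0. Qed.

Lemma decay_wt (v : R) (C x : R) (n : nat) : (1 + `|x|) ^+ n.+1 * v <= C -> v <= C * wt n%:R x.
Proof.
move=> h; rewrite wt_natE ler_pdivlMr ?exprn_gt0 ?ltr_wpDr// mulrC; exact: h.
Qed.

Lemma L_cont q : test q -> forall η : R, ccont (fun η => L q (sl η)) η.
Proof.
move=> tq η; have [M [C [M0 C0 hM hC]]] := test_bd_supp tq.
have ii := @itv_cst R (- M) M (C * expR M).
apply: (@cint_continuous R _ _ _ mu setT (fun η t => q t * rotc (sl η) t) _ η 1 measurableT ltr01 _ _ ii).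
- by move=> y _; apply: cmeasT1 => x; exact: (smooth_cont (test_rotc (sl y) tq).1).
- move=> x _; apply: ccontM; first exact: ccont_cst.
  apply: ccont_exp; apply: ccontM; last exact: ccont_cst.
  by split; [exact: cst_continuous|exact: cvg_id].
- move=> y x _ _; rewrite normcM normc_rotc /= mul1r; case: ifP => [/andP[_ hx]|/negbT].
    by rewrite ler_pM// ?normc_ge0 ?expR_ge0// ler_expR.
  by rewrite -ler_norml -ltNge => /hM ->; rewrite normc0 mul0r.
Qed.

Lemma cintble_L q : test q -> cintble mu setT (fun η => L q (sl η)).
Proof.
move=> tq; have [C C0 hC] := L_decay 2 tq.
apply: (cintble_dom measurableT (cmeasT1 (L_cont tq)) (integrableZl measurableT C (integrable_wt ltr01))).
by move=> x _; have := decay_wt (hC x).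
Qed.

End Laplace.

(** * Fourier inversion on the line [Re s = 1] *)

Section Inversion.
Context {R : realType}.
Notation mu := (@lebesgue_measure R).
Implicit Types (q : R -> R[i]).

Definition eps (n : nat) : R := n.+1%:R^-1.
Lemma eps_gt0 n : 0 < eps n. Proof. by rewrite invr_gt0 ltr0n. Qed.
Lemma eps_cvg : eps n @[n --> \oo] --> (0 : R).
Proof. exact: cvg_harmonic. Qed.

Lemma is_derive_atan' (x : R) : is_derive x (1 : R) (@atan R) (1 + x ^+ 2)^-1.
Proof. by split; [exact: derivable_atan|rewrite -derive1E derive1_atan]. Qed.

Lemma Rint_itv_cst (a b c : R) : a <= b -> (\int[mu]_x (if a <= x <= b then c else 0) = c * (b - a))%R.
Proof.
move=> ab; have mi : measurable (`[a, b]%classic : set (mR R)) by exact: measurable_itv.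
rewrite (_ : (\int[mu]_x _)%R = (\int[mu]_(x in `[a, b]) c)%R).
  apply: etrans (Rintegral_cst mu mi _) _; congr (_ * _).
  apply: etrans (congr1 fine (@lebesgue_measure_itv R `[a, b])) _; rewrite /= lte_fin.
  by move: ab; rewrite le_eqVlt => /predU1P[->|ab]; rewrite ?ltxx ?subrr// ab -EFinB.
rewrite [RHS]Rintegral_mkcond; apply: eq_Rintegral => x _; rewrite patchE.
case: ifPn => [h|]; first by rewrite mem_set//= in_itv.
by move=> h; rewrite memNset//= in_itv /=; exact/negP.
Qed.

Lemma Rint_gt0 (b : R -> R) (x0 : R) : continuous b -> (forall x, 0 <= b x) ->
  mu.-integrable setT (EFin \o b) -> 0 < b x0 -> 0 < (\int[mu]_x b x)%R.
Proof.
move=> cb b0 ib bx0.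
have /nbhs_ballP[e /= e0 he] : \forall y \near x0, b x0 / 2 < b y.
  by apply: (cvgr_gt _ (cb x0)); rewrite ltr_pdivrMr// ltr_pMr// ltr1n.
have xe : x0 - e / 2 <= x0 + e / 2 by lra.
apply: (@lt_le_trans _ _ (\int[mu]_x (if x0 - e / 2 <= x <= x0 + e / 2 then b x0 / 2 else 0))%R).
  by rewrite Rint_itv_cst// mulr_gt0 ?divr_gt0//; lra.
apply: le_Rintegral => //; first exact: itv_cst.
move=> x _; case: ifP => // /andP[h1 h2]; apply/ltW/he.
by rewrite /ball /= ltr_distl; apply/andP; split; lra.
Qed.

Lemma bumpa_cont (a r : R) : 0 < r -> continuous (bumpa a r).
Proof.
move=> r0 x; have [sb _] := test_bumpa a r0.
by have [] := smooth_cont (z := x) sb I.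
Qed.

Lemma bumpa_int (a r : R) : 0 < r -> mu.-integrable setT (EFin \o bumpa a r) /\ 0 < (\int[mu]_x bumpa a r x)%R.
Proof.
move=> r0; have [ib _] := cintble_test (test_bumpa a r0); split => //.
apply: (Rint_gt0 (x0 := a) (bumpa_cont r0)) => //; first exact: bumpa_ge0.
by apply: bumpa_gt0 => //; rewrite subrr normr0.
Qed.

Lemma cintR (d' : measure_display) (T : measurableType d') (m : {measure set T -> \bar R}) (b : T -> R) :
  cint m setT (fun w => (b w)%:C) = ((\int[m]_w b w)%R)%:C.
Proof. by apply: cplxP => //=; rewrite -[RHS]/(0 : R) -[LHS]/(\int[m]_w 0)%R /Rintegral integral0. Qed.

Lemma re_sl (η : R) : re (sl η) = 1. Proof. by []. Qed.
Lemma im_sl (η : R) : im (sl η) = η. Proof. by []. Qed.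
Definition ci : R[i] := 0 +i* 1.

Lemma is_cder_sl η : is_cder sl η (1 : R) ci.
Proof. by split; [exact: is_derive_cst|exact: is_derive_id]. Qed.

Lemma normc_ci : normc ci = 1 :> R.
Proof. by rewrite normcEs /= expr0n expr1n add0r sqrtr1. Qed.

Definition tB B : R -> R[i] := fun t => t%:C * B t.

Lemma test_tB B : test B -> test (tB B).
Proof.
move=> h; have := testM cptB1 h (@smooth_id R).
by congr test; apply/funext => t; rewrite mulrC.
Qed.

(** The derivative along a curve [g] in the [s]-plane brings down a factor [t]. The bounds [D] on
    [g'] and [G] on [Re g] dominate the integrand over the support of [B]. A general curve serves
    the vertical line as well as the rays of the contour rotation. *)
Lemma is_cder_L B (g dg : R -> R[i]) (x G D : R) : test B ->
  (forall y, `|y - x| < 1 -> is_cder g y (1 : R) (dg y) /\ normc (dg y) <= D /\ `|re (g y)| <= G) ->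
  is_cder (fun y => L B (g y)) x (1 : R) (dg x * L (tB B) (g x)).
Proof.
move=> hB hg; have ht := test_tB hB; have [M [C [M0 C0 hM hC]]] := test_bd_supp ht.
have -> : dg x * L (tB B) (g x) = cint mu setT (fun t => dg x * (tB B t * rotc (g x) t)).
  by rewrite cintZT//; exact: (cintble_test (test_rotc _ ht)).
have nb (h : R) : `|h| < 1 -> `|(h *: (1 : R) + x) - x| < 1.
  by rewrite addrK -[_ *: _]/(h * 1) mulr1.
apply: (@is_cder_cint R R _ _ mu setT (fun y t => B t * rotc (g y) t)
  (fun y t => dg y * (tB B t * rotc (g y) t))
  (fun r => if - M <= r <= M then D * (C * expR (G * M)) else 0) x (1 : R) 1 measurableT ltr01).
- by move=> h _; exact: (cintble_test (test_rotc _ hB)).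
- move=> h t h1 _; have [d1 _] := hg _ (nb h h1).
  have := is_cderM (cder_cst (B t) (h *: (1 : R) + x) (1 : R)) (cder_exp (is_cderM d1 (cder_cst t%:C (h *: (1 : R) + x) (1 : R)))).
  by move=> H; apply: cder_eq H _; rewrite /tB /rotc /=; ring.
- exact: itv_cst.
- move=> h t h1 _; have [_ [d2 d3]] := hg _ (nb h h1).
  rewrite normcM (normcM (tB B t)) normc_rotc; case: ifP => [tM|/negbT].
    have e1 : expR (re (g (h *: 1 + x)) * t) <= expR (G * M).
      rewrite ler_expR; apply: le_trans (ler_norm _) _; rewrite normrM ler_pM//.
      by rewrite ler_norml.
    apply: ler_pM d2 _; rewrite ?mulr_ge0 ?normc_ge0 ?expR_ge0//.
    by apply: ler_pM (hC t) e1; rewrite ?normc_ge0 ?expR_ge0.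
  by rewrite -ler_norml -ltNge => /hM ->; rewrite normc0 mul0r mulr0.
Qed.

Definition cj (z : R[i]) : R[i] := re z +i* (- im z).

Lemma re_cj z : re (cj z) = re z. Proof. by []. Qed.

Lemma im_cj z : im (cj z) = - im z. Proof. by []. Qed.

Lemma cjM z w : cj (z * w) = cj z * cj w.
Proof. by apply: cplxP; rewrite ?re_cj ?im_cj ?reM ?imM ?re_cj ?im_cj; ring. Qed.

Lemma L_real (b : R -> R) (x : R) : test (fun t => (b t)%:C) ->
  L (fun t => (b t)%:C) x%:C = (\int[mu]_t (b t * expR (x * t)))%:C%R.
Proof.
move=> _; rewrite /L.
have e t : (b t)%:C * rotc x%:C t = (b t * expR (x * t))%:C by rewrite /rotc -rmorphM cexpR -rmorphM.
rewrite (_ : (fun t => _) = fun t => (b t * expR (x * t))%:C); last exact/funext.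
by rewrite /cint; apply: cplxP => //=; rewrite /Rintegral integral0.
Qed.

Lemma cj_L (b : R -> R) η : test (fun t => (b t)%:C) ->
  L (fun t => (b t)%:C) (sl (- η)) = cj (L (fun t => (b t)%:C) (sl η)).
Proof.
move=> tb; have e t : (b t)%:C * rotc (sl (- η)) t = cj ((b t)%:C * rotc (sl η) t).
  rewrite cjM; congr (_ * _); first by apply: cplxP; rewrite /= ?oppr0.
  rewrite /rotc /cexp; have -> : re (sl (- η) * t%:C) = re (sl η * t%:C) by rewrite !reM !re_sl /= !mulr0.
  have -> : im (sl (- η) * t%:C) = - im (sl η * t%:C) by rewrite !imM !im_sl /=; ring.
  by rewrite cosN sinN mulrN.
have [i1 i2] := cintble_test (test_rotc (sl η) tb).
rewrite /L (_ : (fun t => _) = fun t => cj ((b t)%:C * rotc (sl η) t)); last exact/funext.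
move: i2; set f := (fun t => (b t)%:C * rotc (sl η) t) => i2.
apply: cplxP => //; transitivity (\int[mu]_t (-1 * im (f t)))%R.
  by apply: eq_Rintegral => t _; rewrite mulN1r.
by rewrite RintegralZl// mulN1r.
Qed.

Lemma realC_neq0 (x : R) : 0 < x -> x%:C != 0 :> R[i].
Proof. by move=> x0; rewrite -normc_eq0 normcR normr_eq0 gt_eqF. Qed.

Lemma mulcj (z : R[i]) : z * cj z = (normc z ^+ 2)%:C.
Proof.
rewrite normcEs sqr_sqrtr ?addr_ge0 ?sqr_ge0//.
by apply: cplxP; rewrite ?reM ?imM re_cj im_cj /=; ring.
Qed.

(** For the averages of [u^k p (u t)] over [u] in [0, 1], a derivative in [t] raises [k] by one and
    replaces [p] by [p']. With [k = 0] and [p = q'] the average is the quotient of [q] by [t] used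
    in [tB_div]. *)
Lemma tB_dstable : dstable setT [set h | exists k p, test p /\ h = fun t => cint mu `[0, 1]%classic (fun u => (u ^+ k)%:C * p (u * t))].
Proof.
suff D k p (v t : R) : test p -> is_cder (fun t => cint mu `[0, 1]%classic (fun u => (u ^+ k)%:C * p (u * t))) t v
    (v%:C * cint mu `[0, 1]%classic (fun u => (u ^+ k.+1)%:C * cderive (1 : R) p (u * t))).
  move=> _ [k [p [tp ->]]]; have tp' := test_cderive cptB1 (1 : R) tp.
  split=> [t _|v]; first exact: cder_cont (D k p 1 t tp).
  exists (fun t => v%:C * cint mu `[0, 1]%classic (fun u => (u ^+ k.+1)%:C * cderive (1 : R) p (u * t))); last by move=> t _; exact: D.
  by apply: spnZ; apply: spn1; exists k.+1, (cderive (1 : R) p).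
move=> tp; have tp' := test_cderive cptB1 (1 : R) tp; have [M [C [M0 C0 hM hC]]] := test_bd_supp tp'.
have cK (m : nat) (g : R -> R[i]) (x u : R) : test g -> ccont (fun u : R => (u ^+ m)%:C * g (u * x)) u.
  move=> tg; apply: ccontM; first by apply: ccontR; exact: exprn_continuous.
  apply: (ccont_comp (f := g) (g := fun u : R => u * x)); last exact: (smooth_cont tg.1).
  by apply: cvgM; [exact: cvg_id|exact: cvg_cst].
have mi : measurable (`[0, 1]%classic : set (mR R)) by exact: measurable_itv.
rewrite -cintZi; last by apply: cintble_itv => u _; exact: cK.
apply: (@is_cder_cint R R _ _ mu `[0, 1]%classic (fun t u => (u ^+ k)%:C * p (u * t))
  (fun t u => v%:C * ((u ^+ k.+1)%:C * cderive (1 : R) p (u * t))) (fun=> `|v| * C) t v 1 mi ltr01).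
- by move=> h _; apply: cintble_itv => u _; exact: cK.
- move=> h u _ _; have d := is_cder_comp (f := p) (is_deriveZ u (is_derive_id (h *: v + t) v)) (smooth_cder0 (1 : R) tp.1 I).
  apply: cder_eq (is_cderZ (u ^+ k)%:C d) _.
  by rewrite exprSr !rmorphM /=; ring.
- exact: (cintble_itv (f := fun=> (`|v| * C)%:C) (fun x _ => ccont_cst _ _)).1.
- move=> h u _ hu; have /andP[u0 u1] : 0 <= u <= 1 by move: hu; rewrite /= in_itv.
  rewrite (normcM v%:C) (normcM (u ^+ _)%:C) !normcR; apply: ler_wpM2l => //.
  rewrite -[leRHS]mul1r; apply: ler_pM => //; first exact: normc_ge0.
  by rewrite normrX ger0_norm// exprn_ile1.
Qed.

(* Hadamard: [q t = t * \int_0^1 q' (u t) du] when [q 0 = 0]. *)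
Lemma tB_div q : test q -> q 0 = 0 -> exists2 g, test g & q = tB g.
Proof.
move=> tq q0; have tq' := test_cderive cptB1 (1 : R) tq; have [M [C [M0 C0 hM hC]]] := test_bd_supp tq.
pose g t := cint mu `[0, 1]%classic (fun u => (u ^+ 0)%:C * cderive (1 : R) q (u * t)).
have cq (t u : R) : ccont (fun u : R => cderive (1 : R) q (u * t)) u.
  apply: (ccont_comp (f := cderive (1 : R) q) (g := fun u : R => u * t)); last exact: (smooth_cont tq'.1).
  by apply: cvgM; [exact: cvg_id|exact: cvg_cst].
have E t : t%:C * g t = q t.
  rewrite /g (_ : (fun u => _) = fun u => cderive (1 : R) q (u * t)); last by apply/funext => u; rewrite expr0 mul1r.
  rewrite -cintZi; last by apply: cintble_itv => u _; exact: cq.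
  rewrite (@cFTC _ (fun u => q (u * t)) (fun u => t%:C * cderive (1 : R) q (u * t)))//; first by rewrite mul1r mul0r q0 subr0.
    move=> u _; have d : is_derive u (1 : R) (fun u : R => u * t) t.
      by rewrite (_ : (fun u => _) = t \*: id); [apply: is_derive_eq; rewrite -[_ *: _]/(t * 1) mulr1|apply/funext => y /=; rewrite -[RHS]/(t * y) mulrC].
    exact: (is_cder_comp (f := q) d (smooth_cder0 (1 : R) tq.1 I)).
  by move=> u _; apply: ccontM; [exact: ccont_cst|exact: cq].
exists g; last by apply/funext => t; rewrite /tB E.
apply/(testP cptB1); split.
  by apply: dstable_smooth openT tB_dstable _; exists 0, (cderive (1 : R) q).
exists M => t ht; have t0 : t%:C != 0 :> R[i].
  by rewrite -normc_eq0 normcR gt_eqF// (le_lt_trans M0).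
by apply: (mulfI t0); rewrite E hM// mulr0.
Qed.

(** [ci * L (tB q)] is the [η]-derivative of [L q], which decays at both ends of the line. *)
Lemma int_L_tB q : test q -> cint mu setT (fun η => L (tB q) (sl η)) = 0.
Proof.
move=> tq; have tt := test_tB tq; have [C C0 hC] := L_decay 1 tq.
have ci0 : ci != 0 :> R[i] by rewrite -normc_eq0 normc_ci oner_eq0.
have lim (u : nat -> R) : (forall n, `|u n| = n%:R) -> ccvg (fun n => L q (sl (u n))) 0.
  move=> hu; apply: (@ccvg_sqz _ _ _ (fun n => C * eps n)); last by rewrite -(mulr0 C); apply: cvgMr; exact: eps_cvg.
  by move=> n; rewrite subr0 /eps ler_pdivlMr ?ltr0n// mulrC -nat1r -hu -[1 + _]expr1; exact: hC.
apply: (mulfI ci0); rewrite mulr0 -(cintZT ci (cintble_L tt)).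
apply: (@cint_derT _ (fun η => L q (sl η))).
- move=> η; apply: (is_cder_L (g := sl) (dg := fun=> ci) (D := 1) (G := 1) tq) => y _.
  by split; [exact: is_cder_sl|rewrite normc_ci normr1].
- by move=> η; apply: ccontM; [exact: ccont_cst|exact: L_cont].
- exact: cintbleZT (cintble_L tt).
- by apply: lim => n; rewrite ger0_norm.
- by apply: lim => n; rewrite normrN ger0_norm.
Qed.

Let b0 (t : R) : R := bumpa 0 1 t.
Let b0c t : R[i] := (b0 t)%:C.

(** The inversion constant, obtained as a Plancherel quotient for the bump [b0]; its value is
    [2 pi]. In this form positivity is read off, and the later divisions rest on positivity. *)
Definition kF : R := (\int[mu]_η normc (L b0c (sl η)) ^+ 2) / (\int[mu]_t (b0 t ^+ 2 * expR (2 * t))).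

Let tb0 : test b0c := test_bumpa 0 ltr01.

Let b0_gt0 : 0 < b0 0.
Proof. by apply: bumpa_gt0 => //; rewrite subrr normr0. Qed.

(** The integral of [L q] vanishes when [q 0 = 0], such a [q] being of the form [tB g]; so it is
    proportional to [q 0]. The bump [b0] measures the proportion, and the division by [b0 0] is
    postponed. *)
Lemma int_L q : test q -> b0c 0 * cint mu setT (fun η => L q (sl η)) = q 0 * cint mu setT (fun η => L b0c (sl η)).
Proof.
move=> tq; pose r t := b0c 0 * q t + (- q 0) * b0c t.
have t1 := testZ cptB1 (b0c 0) tq; have t2 := testZ cptB1 (- q 0) tb0.
have tr : test r by exact: (testD cptB1 t1 t2).
have [g tg eg] : exists2 g, test g & r = tB g by apply: tB_div => //; rewrite /r mulNr mulrC subrr.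
have iq := cintble_L tq; have ib := cintble_L tb0.
apply/eqP; rewrite -subr_eq0 -mulNr -(cintZT _ iq) -(cintZT _ ib) -cintDT; [|exact: cintbleZT|exact: cintbleZT].
rewrite -(int_L_tB tg) -eg; apply/eqP/eq_cint => η _.
have jq := cintble_test (test_rotc (sl η) tq); have jb := cintble_test (test_rotc (sl η) tb0).
rewrite /L -(cintZT _ jq) -(cintZT _ jb) -(cintDT (cintbleZT _ jq) (cintbleZT _ jb)).
by apply: eq_cint => t _; rewrite /r; ring.
Qed.

(** Translating [q] by [t] multiplies its transform by [exp (- s t)], so the value at [t] is reached
    from the value at 0. *)
Lemma int_L_rotc q (t : R) : test q -> cintble mu setT (fun η => L q (sl η) * rotc (- sl η) t) /\
  b0c 0 * cint mu setT (fun η => L q (sl η) * rotc (- sl η) t) = q t * cint mu setT (fun η => L b0c (sl η)).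
Proof.
move=> tq; have ts : test (fun y => q (y + t)).
  have [sq [M hM]] := (testP cptB1 _).1 tq.
  apply/(testP cptB1); split.
    by have := smooth_aff1 1 t sq; congr smooth_on; apply/funext => y; rewrite mul1r.
  exists (M + `|t|) => y hy; apply: hM; rewrite -ltrBrDr in hy; apply: lt_le_trans hy _.
  by rewrite lerBlDr -{1}[y](addrK t); exact: ler_normB.
have e : (fun η => L q (sl η) * rotc (- sl η) t) = fun η => L (fun y => q (y + t)) (sl η).
  apply/funext => η; have [i E] := cint_shift t (cintble_test (test_rotc (sl η) tq)).
  rewrite mulrC /L -E -(cintZT _ i).
  apply: eq_cint => y _; rewrite mulrCA; congr (_ * _); rewrite /rotc -cexpD; congr cexp.
  by rewrite rmorphD; ring.
by rewrite e; split; [exact: cintble_L|rewrite (int_L ts) add0r].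
Qed.

Lemma L_b0_gt0 : 0 < normc (L b0c (sl 0)).
Proof.
have cb : continuous b0 := bumpa_cont (a := 0) ltr01.
rewrite -[sl 0]/(1%:C) (L_real _ tb0) normcR; apply: lt_le_trans (ler_norm _).
apply: (Rint_gt0 (x0 := 0)).
- move=> t; apply: cvgM; first exact: cb.
  apply: (cvg_comp (fun t => 1 * t) expR); last exact: continuous_expR.
  by apply: cvgM; [exact: cvg_cst|exact: cvg_id].
- by move=> t; rewrite mulr_ge0 ?bumpa_ge0 ?expR_ge0.
- have := (cintble_test (test_rotc 1 tb0)).1; congr (_.-integrable _ (EFin \o _)).
  apply/funext => t; transitivity (re (b0 t * expR (1 * t))%:C); last by [].
  by congr re; rewrite /b0c /rotc !mul1r cexpR -rmorphM.
- by rewrite mulr_gt0 ?expR_gt0.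
Qed.

Lemma L_b0_sqr : 0 < (\int[mu]_η normc (L b0c (sl η)) ^+ 2)%R.
Proof.
have cL := L_cont tb0.
apply: (Rint_gt0 (x0 := 0)).
- by move=> η; apply: cvgM; exact: ccont_norm (cL η).
- by move=> η; exact: sqr_ge0.
- have [D D0 hD] := L_decay 0 tb0.
  have iLL : cintble mu setT (fun η => L b0c (sl η) * L b0c (sl η)).
    apply: (cintble_dom measurableT _ (integrableZl measurableT D (cintble_norm measurableT (cintble_L tb0)))) => [|η _].
      by apply: cmeasT1 => η; apply: ccontM; exact: cL.
    rewrite (normcM (L _ _)); apply: ler_wpM2r; first exact: normc_ge0.
    have := hD η; rewrite expr0 mul1r; exact.
  by have := cintble_norm measurableT iLL; congr (_.-integrable _ (EFin \o _)); apply/funext => η; rewrite normcM.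
- exact: exprn_gt0 L_b0_gt0.
Qed.

(** The double integral of [L b0 s * b0 t * exp (2 t) * exp (- s t)] is computed in both orders:
    integration in [t] leaves [|L b0|^2], integration in [η] leaves a multiple of
    [b0^2 exp (2 t)]. *)
Lemma kF_spec : 0 < kF /\ cint mu setT (fun η => L b0c (sl η)) = kF%:C * b0c 0.
Proof.
have bN : b0c 0 != 0 := realC_neq0 b0_gt0.
(* For [s = 1 + i η] one has [exp (2 t) exp (- s t) = exp ((1 - i η) t)]: the weight returns to the
   line [Re s = 1], where conjugation is [η |-> - η]. *)
pose w t := b0c t * rotc 2 t; have tw : test w := test_rotc 2 tb0.
have [C C0 hC] := L_decay 2 tb0; have cL := L_cont tb0.
have hw η : normc (L b0c (sl η)) <= C * wt 1 η by have := decay_wt (n := 1) (hC η).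
have tw1 := test_rotc (-1) tw.
pose K (z : (mR R * mR R)%type) : R[i] := L b0c (sl z.1) * (w z.2 * rotc (- sl z.1) z.2).
have mK : cmeas setT K.
  apply: ccont_cmeas2 => z; apply: ccontM; first exact: (ccont_comp (g := fst) cvg_fst (cL z.1)).
  apply: ccontM; first exact: (ccont_comp (g := snd) cvg_snd (smooth_cont tw.1 (I : setT z.2))).
  apply: ccont_exp; apply: ccontM; last by apply: ccontR; exact: cvg_snd.
  by split; [exact: cst_continuous|apply: cvgN; exact: cvg_fst].
have hK η t : normc (K (η, t)) <= C * wt 1 η * normc (w t * rotc (-1) t).
  rewrite /K (normcM (L _ _)); apply: (ler_pM (normc_ge0 _) (normc_ge0 _) (hw η)).
  by rewrite !(normcM (w t)) !normc_rotc; apply: lexx.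
have fub := @cfubini R _ _ (mR R) (mR R) mu mu K _ _ mK
  (fun η => mulr_ge0 C0 (wt_ge0 1 η)) (fun t => normc_ge0 (w t * rotc (-1) t))
  (integrableZl measurableT C (@integrable_wt R 1 ltr01)) (cintble_norm measurableT (cintble_test tw1)) hK.
have E1 : cint mu setT (fun η => cint mu setT (fun t => K (η, t))) = ((\int[mu]_η normc (L b0c (sl η)) ^+ 2)%R)%:C.
  rewrite -cintR; apply: eq_cint => η _.
  transitivity (cint mu setT (fun t => L b0c (sl η) * (w t * rotc (- sl η) t))); first by [].
  rewrite (cintZT _ (cintble_test (test_rotc _ tw))).
  rewrite (_ : cint _ _ _ = L b0c (sl (- η))); last first.
    apply: eq_cint => t _; rewrite /w -mulrA; congr (_ * _); rewrite /rotc -cexpD; congr cexp.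
    by apply: cplxP; rewrite !(reD, imD, reM, imM, reN, imN) /=; ring.
  by rewrite (cj_L η tb0); exact: mulcj.
have wE t : w t * b0c t = ((b0 t ^+ 2 * expR (2 * t))%R)%:C.
  rewrite /w /b0c /rotc (_ : 2 * t%:C = (2 * t)%:C); last by rewrite rmorphM rmorph_nat.
  by rewrite cexpR -!rmorphM; congr (_%:C); ring.
have iw : cintble mu setT (fun t => ((b0 t ^+ 2 * expR (2 * t))%R)%:C).
  by have := cintble_test (testM cptB1 tw tb0.1); congr cintble; apply/funext => t; exact: wE.
have E2 : b0c 0 * cint mu setT (fun t => cint mu setT (fun η => K (η, t))) =
    cint mu setT (fun η => L b0c (sl η)) * ((\int[mu]_t (b0 t ^+ 2 * expR (2 * t)))%R)%:C.
  have -> : (fun t => cint mu setT (fun η => K (η, t))) =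
      fun t => (b0c 0)^-1 * cint mu setT (fun η => L b0c (sl η)) * ((b0 t ^+ 2 * expR (2 * t))%R)%:C.
    apply/funext => t; rewrite -wE; apply: (mulfI bN).
    transitivity (b0c 0 * cint mu setT (fun η => w t * (L b0c (sl η) * rotc (- sl η) t))).
      by congr (_ * _); apply: eq_cint => η _; rewrite /K mulrCA.
    rewrite (cintZT _ (int_L_rotc t tb0).1) mulrCA (int_L_rotc t tb0).2.
    by rewrite -[(b0c 0)^-1 * _ * _]mulrA (mulVKf bN); ring.
  by rewrite (cintZT _ iw) cintR -[(b0c 0)^-1 * _ * _]mulrA (mulVKf bN).
have cb : continuous b0 := bumpa_cont (a := 0) ltr01.
have P2 : 0 < (\int[mu]_t (b0 t ^+ 2 * expR (2 * t)))%R.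
  apply: (Rint_gt0 (x0 := 0)).
  - move=> t; apply: cvgM; first by apply: cvgM; exact: cb.
    apply: (cvg_comp (fun t => 2 * t) expR); last exact: continuous_expR.
    by apply: cvgM; [exact: cvg_cst|exact: cvg_id].
  - by move=> t; rewrite mulr_ge0 ?sqr_ge0 ?expR_ge0.
  - exact: iw.1.
  - by rewrite mulr_gt0 ?exprn_gt0 ?expR_gt0.
have pN := realC_neq0 P2.
split; first exact: divr_gt0 L_b0_sqr P2.
apply: (mulIf pN); rewrite -E2 -fub E1 [LHS]mulrC [RHS]mulrAC; congr (_ * _).
by rewrite /kF -[RHS]rmorphM; congr (_%:C); exact: (esym (divfK (lt0r_neq0 P2) _)).
Qed.

Lemma kF_gt0 : 0 < kF. Proof. by case: kF_spec. Qed.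

Lemma fourier_inversion q (t : R) : test q ->
  cintble mu setT (fun η => L q (sl η) * rotc (- sl η) t) /\
  cint mu setT (fun η => L q (sl η) * rotc (- sl η) t) = kF%:C * q t.
Proof.
move=> tq; have [i e] := int_L_rotc t tq; split => //.
have bN : b0c 0 != 0 := realC_neq0 b0_gt0.
by apply: (mulfI bN); rewrite e kF_spec.2; ring.
Qed.

End Inversion.

Arguments kF {R}.
Arguments kF_gt0 {R}.

Local Arguments normc : simpl never.

(** * The principal logarithm on the slit plane *)

Section Log.
Context {R : realType}.
Implicit Types z w : R[i].

(** The complement of the closed negative half-axis, in terms of the denominator of the half-angle
    formula. *)
Definition slit z := 0 < normc z + re z.

(* The principal logarithm: the half-angle formula arg z = 2 atan (y / (|z| + x)) covers the whole slit plane. *)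
Definition clog z : R[i] := ln (normc z) +i* (2 * atan (im z / (normc z + re z))).

Lemma slit_re z : 0 < re z -> slit z.
Proof. by move=> z0; rewrite /slit ltr_wpDl ?normc_ge0. Qed.

Lemma slit_im z : im z != 0 -> slit z.
Proof.
move=> z0; have h : normc z ^+ 2 > re z ^+ 2 by rewrite normc_sqr ltrDl exprn_even_gt0.
have : `|re z| < normc z by rewrite -(ger0_norm (normc_ge0 z)) -ltr_sqr ?nnegrE// real_normK ?num_real// real_normK ?num_real.
by rewrite /slit -ltrBlDr sub0r; apply: le_lt_trans; rewrite -normrN ler_norm.
Qed.

Lemma slit_normc z : slit z -> 0 < normc z.
Proof.
by rewrite /slit => h; have := re_le_normc z; lra.
Qed.

Lemma slit_neq0 z : slit z -> z != 0.
Proof. by move=> /slit_normc; rewrite normc_gt0. Qed.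

Lemma half_angle z : slit z -> (normc z + re z) ^+ 2 + im z ^+ 2 = 2 * normc z * (normc z + re z).
Proof. by move=> _; have := normc_sqr z => h; rewrite sqrrD h; ring: h. Qed.

Lemma cos_atan_sqr (u : R) : cos (atan u) ^+ 2 = (1 + u ^+ 2)^-1.
Proof. by rewrite cos_atan exprVn sqr_sqrtr// addr_ge0 ?sqr_ge0. Qed.

Lemma cos_2atan (u : R) : cos (2 * atan u) = (1 - u ^+ 2) / (1 + u ^+ 2).
Proof.
rewrite mulr_natl cos_mulr2n cos_atan_sqr.
have h : 1 + u ^+ 2 != 0 by rewrite gt_eqF// ltr_wpDr ?sqr_ge0.
by field.
Qed.

Lemma sin_2atan (u : R) : sin (2 * atan u) = 2 * u / (1 + u ^+ 2).
Proof.
have ca : cos (atan u) != 0 by rewrite cos_atan invr_eq0 sqrtr_eq0 -ltNge ltr_wpDr ?sqr_ge0.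
have sa : sin (atan u) = u * cos (atan u) by rewrite -{2}(atanK u) /tan divfK.
rewrite mulr_natl sin_mulr2n sa mulrCA -expr2 cos_atan_sqr.
by rewrite -mulr_natl mulrA.
Qed.

Lemma cos_arg z : slit z -> cos (im (clog z)) = re z / normc z.
Proof.
move=> sz; have n0 := slit_normc sz; have h := half_angle sz; have n2 := normc_sqr z.
rewrite /= cos_2atan; set a := normc z + re z in h *.
have a0 : a != 0 by rewrite gt_eqF.
have h2 : 1 + (im z / a) ^+ 2 = 2 * normc z / a by apply: (mulIf (expf_neq0 2 a0)); rewrite mulrDl mul1r exprMn exprVn divfK ?expf_neq0// h; field.
have h3 : 1 - (im z / a) ^+ 2 = 2 - 2 * normc z / a by rewrite -h2; ring.
rewrite h3 h2 /a; have := lt0r_neq0 n0; move: a0; rewrite /a => a0 nn0; field; rewrite nn0 a0; done.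
Qed.

Lemma sin_arg z : slit z -> sin (im (clog z)) = im z / normc z.
Proof.
move=> sz; have n0 := slit_normc sz; have h := half_angle sz.
rewrite /= sin_2atan; set a := normc z + re z in h *.
have a0 : a != 0 by rewrite gt_eqF.
have h2 : 1 + (im z / a) ^+ 2 = 2 * normc z / a by apply: (mulIf (expf_neq0 2 a0)); rewrite mulrDl mul1r exprMn exprVn divfK ?expf_neq0// h; field.
rewrite h2; have := lt0r_neq0 n0; move=> nn0; field; rewrite nn0 a0; done.
Qed.

Lemma cexp_clog z : slit z -> cexp (clog z) = z.
Proof.
move=> sz; have n0 := slit_normc sz; have nn0 := lt0r_neq0 n0.
rewrite /cexp cos_arg// sin_arg//= lnK ?posrE//.
by apply: cplxP; rewrite /= mulrC divfK.
Qed.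

Lemma arg_bound z : - pi < im (clog z) < pi.
Proof.
have := atan_gtNpi2 (im z / (normc z + re z)); have := atan_ltpi2 (im z / (normc z + re z)).
by rewrite /=; move=> h1 h2; apply/andP; split; lra.
Qed.

(** The two angles lie in []-pi, pi[] and have the same cosine; the sign of [im z] selects the
    branch of [carg]. *)
Lemma carg_clog z : slit z -> carg z = im (clog z).
Proof.
move=> sz; have /andP[p1 p2] := arg_bound z.
rewrite /carg -cos_arg//; case: ifPn => [h|].
  rewrite cosK// in_itv /= (ltW p2) andbT mulr_ge0//.
  by rewrite -(@atan0 R) le_atan// divr_ge0// ltW.
rewrite -ltNge => h; rewrite cosKN ?opprK// (ltW p1) /= pmulr_rle0//.
by rewrite -(@atan0 R) le_atan// pmulr_lle0 ?invr_gt0// ltW.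
Qed.

Lemma cpow_clog z (a : R) : slit z -> cpow z a = cexp (a%:C * clog z).
Proof.
move=> sz; rewrite /cpow carg_clog// /powR gt_eqF ?slit_normc//.
rewrite -cexpR -cexpD; congr cexp; apply: cplxP; rewrite ?reD ?imD ?reM ?imM /=; ring.
Qed.

Lemma is_derive_sqrtP (x : R) : 0 < x -> is_derive x (1 : R) (@Num.sqrt R) (2 * Num.sqrt x)^-1.
Proof. by move=> x0; exact: (is_derive1_sqrt x0). Qed.

Lemma is_derive_normc (V : normedModType R) (f : V -> R[i]) (x v : V) d : f x != 0 -> is_cder f x v d ->
  is_derive x v (fun y => normc (f y)) ((re (f x) * re d + im (f x) * im d) / normc (f x)).
Proof.
move=> fx [h1 h2].
have -> : (fun y => normc (f y)) = Num.sqrt \o (fun y => re (f y) * re (f y) + im (f y) * im (f y)).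
  by apply/funext => y; rewrite normcEs.
have h := is_deriveD (is_derM h1 h1) (is_derM h2 h2).
have p0 : 0 < re (f x) * re (f x) + im (f x) * im (f x) by rewrite -!expr2 -normc_sqr exprn_gt0// normc_gt0.
apply: is_derive_eq (is_derive_compR h (is_derive_sqrtP p0)) _.
rewrite -!expr2 -normcEs /=; have : normc (f x) != 0 by rewrite normc_eq0.
by move=> n0; field.
Qed.

Lemma is_cder_clog (V : normedModType R) (f : V -> R[i]) (x v : V) d : slit (f x) -> is_cder f x v d ->
  is_cder (fun y => clog (f y)) x v (d / f x).
Proof.
move=> sx hf; have [h1 h2] := hf.
have n0 := slit_normc sx; have nn0 := lt0r_neq0 n0; have f0 := slit_neq0 sx.
have ha := half_angle sx; have n2 := normc_sqr (f x).
have hn := is_derive_normc f0 hf.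
have a0 : normc (f x) + re (f x) != 0 by rewrite gt_eqF.
split.
  apply: is_derive_eq (is_derive_compR hn (is_derive1_ln n0)) _.
  by rewrite reM reV imV; field.
have hq := is_derM h2 (@is_derV _ _ (fun y => normc (f y) + re (f y)) x v _ a0 (is_deriveD hn h1)).
apply: is_derive_eq (is_deriveZ 2 (is_derive_compR hq (is_derive_atan' _))) _.
rewrite /GRing.scale /= imM reV imV.
set a := normc (f x) + re (f x) in a0 ha *; set r := normc (f x) in ha nn0 n2 *.
have h3 : 1 + (im (f x) / a) ^+ 2 = 2 * r / a by apply: (mulIf (expf_neq0 2 a0)); rewrite mulrDl mul1r exprMn exprVn divfK ?expf_neq0// ha; field.
rewrite h3.
(* Writing [(im f)^2] as [(r - re f) (r + re f)] lets the denominator [a = r + re f] cancel. *)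
have y2 : im (f x) ^+ 2 = (r - re (f x)) * (r + re (f x)) by rewrite -[LHS](addKr (re (f x) ^+ 2)) -n2; ring.
have -> : 2 * ((2 * r / a)^-1 * (im (f x) * (- ((re (f x) * re d + im (f x) * im d) / r + re d) / a ^+ 2) + im d * a^-1))
  = (im d * (r * a - im (f x) ^+ 2) - im (f x) * re d * (re (f x) + r)) / (r ^+ 2 * a) by field; rewrite nn0 a0.
have ea : a = r + re (f x) by [].
clearbody r; rewrite ea in a0 *; rewrite y2; field; rewrite nn0; exact: a0.
Qed.

Lemma clog_cont (V : normedModType R) (f : V -> R[i]) (x : V) : slit (f x) -> ccont f x ->
  ccont (fun y => clog (f y)) x.
Proof.
move=> sx cf; have [c1 c2] := cf; have n0 := slit_normc sx.
have cn := ccont_norm cf; split.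
  by apply: (@continuous_comp _ _ _ (fun y => normc (f y)) (@ln R)) => //; exact: continuous_ln.
have ca : {for x, continuous (fun y => im (f y) / (normc (f y) + re (f y)))}.
  apply: cvgM; first exact: c2.
  by apply: cvgV; [rewrite gt_eqF|apply: cvgD; [exact: cn|exact: c1]].
apply: cvgM; first exact: cvg_cst.
by move=> A hA; exact: (ca _ (@continuous_atan R _ A hA)).
Qed.

End Log.

Section Projections.
Context {R : realType}.
Implicit Types (f : R -> R[i]).

Lemma ccont_fst f (z : R * R) : ccont f z.1 -> ccont (fun z : R * R => f z.1) z.
Proof.
move=> h; have c1 : {for z, continuous (fst : R * R -> R)} by exact: cvg_fst.
exact: (ccont_comp c1 h).
Qed.

Lemma ccont_snd f (z : R * R) : ccont f z.2 -> ccont (fun z : R * R => f z.2) z.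
Proof.
move=> h; have c1 : {for z, continuous (snd : R * R -> R)} by exact: cvg_snd.
exact: (ccont_comp c1 h).
Qed.

Lemma ccont_pair1 (f : R -> R -> R[i]) (x y : R) :
  ccont (fun z : R * R => f z.1 z.2) (x, y) -> ccont (fun x => f x y) x.
Proof.
move=> h; have c1 : (x : R) @[x --> x] --> x by exact: cvg_id.
have c2 : (fun=> y : R) x @[x --> x] --> y by exact: cvg_cst.
have c3 : {for x, continuous (fun x : R => ((x, y) : R * R))} by exact: (cvg_pair c1 c2).
exact: (ccont_comp c3 h).
Qed.

End Projections.

(** * Weights on the line [Re s = 1] *)

Section Line.
Context {R : realType}.
Implicit Types η : R.

(** The bracket [<η>], comparable with [|s|] on the line, in which all orders are measured. *)
Definition jb η : R := 1 + `|η|.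
Definition sinv η : R[i] := (sl η)^-1.
Lemma jb_ge1 η : 1 <= jb η. Proof. by rewrite /jb lerDl. Qed.

Lemma jb_gt0 η : 0 < jb η. Proof. exact: lt_le_trans ltr01 (jb_ge1 η). Qed.

Lemma slit_sl η : slit (sl η). Proof. by apply: slit_re; rewrite re_sl ltr01. Qed.

Lemma sl_neq0 η : sl η != 0. Proof. exact: slit_neq0 (slit_sl η). Qed.

Lemma jb_le_sl η : jb η <= 2 * normc (sl η).
Proof. exact: normc_sl_wt. Qed.

Lemma sl_le_jb η : normc (sl η) <= jb η.
Proof. exact: normc_sl_le. Qed.

Lemma jb_powRD η (r r' : R) : jb η `^ (r + r') = jb η `^ r * jb η `^ r'.
Proof. by rewrite powRD// implybE (gt_eqF (jb_gt0 η)) orbT. Qed.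

Lemma jb_powR_le η (r r' : R) : r <= r' -> jb η `^ r <= jb η `^ r'.
Proof. by move=> h; rewrite ler_powR// jb_ge1. Qed.

Lemma is_cder_sinv η : is_cder sinv η (1 : R) (- ci * (sinv η * sinv η)).
Proof.
apply: cder_eq (is_cderV (sl_neq0 η) (is_cder_sl η)) _.
by rewrite /sinv -expr2 exprVn.
Qed.

Lemma normc_sinv η : normc (sinv η) <= 2 * jb η `^ (- 1).
Proof.
rewrite normcV powR_inv1 ?(ltW (jb_gt0 _))// ler_pdivlMr ?jb_gt0// mulrC ler_pdivrMr ?slit_normc ?slit_sl//.
exact: jb_le_sl.
Qed.

End Line.

(** * The symbols of the Zener operator and their estimates *)

Section Symbol.
Context {R : realType} (alpha tau : R).
Context (hp : 0 < alpha < 1 /\ 0 < tau < 1).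
Set Default Proof Using "All".
Let alpha_gt0 : 0 < alpha. Proof. by case: hp => /andP[]. Qed.
Let alpha_lt1 : alpha < 1. Proof. by case: hp => /andP[]. Qed.
Let tau_gt0 : 0 < tau. Proof. by case: hp => _ /andP[]. Qed.
Let tau_lt1 : tau < 1. Proof. by case: hp => _ /andP[]. Qed.
Implicit Types (η x : R).
Local Arguments clog : simpl never.
Local Arguments cpow : simpl never.
Local Arguments cexp : simpl never.
Local Arguments sl : simpl never.

Definition spow η : R[i] := cpow (sl η) alpha.
(** Taken as the basic symbol because its derivative closes up: [u' = i alpha u (1 - u) / s], with
    [|u| <= 1] and [|1 - u| <= 1]. *)
Definition usym η : R[i] := spow η / (1 + spow η).
(** This is [l^2 = (1 + tau s^alpha) / (1 + s^alpha)]. Its inverse [csym] is the Zener symbol, its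
    principal root [lsym] is [l], and [psym] is the exponent [s l]. *)
Definition qsym η : R[i] := 1 - (1 - tau)%:C * usym η.
Definition lsym η : R[i] := cexp (2^-1%:C * clog (qsym η)).
Definition csym η : R[i] := (qsym η)^-1.
Definition psym η : R[i] := sl η * lsym η.
(** The Laplace transform of the fundamental solution in [t], at [s = 1 + i η]. *)
Definition St x η : R[i] := 2^-1%:C * (sinv η * (lsym η * cexp (- (`|x|%:C * psym η)))).

(** When [Re z > 0] the half-angle tangent satisfies [|im z| < |z| + re z], so its arctangent stays
    below [pi / 4] in modulus. *)
Lemma arg_re (z : R[i]) : 0 < re z -> - (pi / 2) < im (clog z) < pi / 2.
Proof.
move=> z0; have sz := slit_re z0; rewrite /clog /=.
have b : `|im z| < normc z + re z.
  have := normc_im z; lra.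
have a1 := @atan1 R; move: b; rewrite ltr_norml => /andP[b1 b2].
have : atan (im z / (normc z + re z)) < pi / 4.
  by rewrite -a1 lt_atan// ltr_pdivrMr ?mul1r.
have : - (pi / 4) < atan (im z / (normc z + re z)).
  by rewrite -a1 -atanN lt_atan// ltr_pdivlMr ?mulN1r.
move=> h1 h2; apply/andP; split; lra.
Qed.

Lemma alpha_scale (b t : R) : - b < t < b -> - b < alpha * t < b.
Proof.
rewrite -!ltr_norml normrM (gtr0_norm alpha_gt0) => tb; apply: le_lt_trans tb.
by rewrite ler_piMl// ltW.
Qed.

Lemma cpow_arg (z : R[i]) : slit z -> cpow z alpha =
  (normc z `^ alpha * cos (alpha * im (clog z))) +i* (normc z `^ alpha * sin (alpha * im (clog z))).
Proof.
by move=> sz; rewrite /cpow carg_clog// /cexp /= expR0 !mul1r; apply: cplxP; rewrite ?reM ?imM /= mul0r ?subr0 ?addr0.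
Qed.

Lemma normc_cpow (z : R[i]) : normc (cpow z alpha) = normc z `^ alpha.
Proof. by rewrite /cpow normcM normcR normc_cexp /= expR0 mulr1 ger0_norm// powR_ge0. Qed.

Lemma re_cpow_gt0 (z : R[i]) : 0 < re z -> 0 < re (cpow z alpha).
Proof.
move=> z0; have sz := slit_re z0; rewrite cpow_arg//=.
rewrite mulr_gt0 ?powR_gt0 ?slit_normc//.
by apply: cos_gt0_pihalf; apply: alpha_scale; exact: arg_re.
Qed.

Lemma re_spow η : 0 < re (spow η).
Proof. by apply: re_cpow_gt0; rewrite re_sl ltr01. Qed.

Lemma normc_1spow η : 1 <= normc (1 + spow η).
Proof. by have := re_le_normc (1 + spow η); have := re_spow η; rewrite reD /=; lra. Qed.

Lemma spow1_neq0 η : 1 + spow η != 0.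
Proof. by rewrite -normc_gt0 (lt_le_trans ltr01)// normc_1spow. Qed.

Lemma usym1 η : 1 - usym η = (1 + spow η)^-1.
Proof. by have h := spow1_neq0 η; rewrite /usym; field. Qed.

Lemma normc_usym η : normc (usym η) <= 1.
Proof.
have h := lt_le_trans ltr01 (normc_1spow η).
rewrite normcM normcV ler_pdivrMr// mul1r -(@ler_pXn2r _ 2%N) ?nnegrE ?normc_ge0//.
have -> : normc (1 + spow η) ^+ 2 = 1 + 2 * re (spow η) + normc (spow η) ^+ 2.
  by rewrite !normc_sqr reD imD /= add0r; ring.
by rewrite lerDr addr_ge0// mulr_ge0// ltW// re_spow.
Qed.

Lemma normc_usym1 η : normc (1 - usym η) <= 1.
Proof. by rewrite usym1 normcV invf_le1 ?normc_1spow// (lt_le_trans ltr01)// normc_1spow. Qed.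

Lemma qsymE η : qsym η = tau%:C + (1 - tau)%:C * (1 - usym η).
Proof. by rewrite /qsym rmorphB rmorph1; ring. Qed.

Lemma qsymV η : csym η = zener_symbol alpha tau (sl η).
Proof.
rewrite /csym qsymE usym1 /zener_symbol -/(spow η) rmorphB rmorph1.
have h := spow1_neq0 η.
have -> : tau%:C + (1 - tau%:C) * (1 + spow η)^-1 = (1 + tau%:C * spow η) / (1 + spow η) by field.
by rewrite invf_div.
Qed.

Lemma re_qsym η : tau <= re (qsym η).
Proof.
rewrite qsymE usym1 reD reMr reV lerDl.
rewrite mulr_ge0 ?subr_ge0 ?(ltW tau_lt1)// divr_ge0 ?exprn_ge0 ?normc_ge0//.
by rewrite reD addr_ge0 ?(ltW (re_spow η))// ler01.
Qed.

Lemma re_qsym_gt0 η : 0 < re (qsym η).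
Proof. exact: lt_le_trans (re_qsym η). Qed.

Lemma slit_q η : slit (qsym η). Proof. exact: slit_re (re_qsym_gt0 η). Qed.
Lemma qsym_neq0 η : qsym η != 0. Proof. exact: slit_neq0 (slit_q η). Qed.

Lemma normc_qsym η : normc (qsym η) <= 1.
Proof.
rewrite qsymE; apply: le_trans (normcD _ _) _; rewrite normcM !normcR (gtr0_norm tau_gt0) (gtr0_norm (_ : 0 < 1 - tau)) ?subr_gt0//.
have h1 := normc_usym1 η; have h2 : 0 < 1 - tau by rewrite subr_gt0.
by nra.
Qed.

Lemma normc_csym η : normc (csym η) <= tau^-1.
Proof.
rewrite normcV lef_pV2 ?posrE ?normc_gt0 ?qsym_neq0//.
exact: le_trans (re_qsym η) (re_le_normc _).
Qed.

Lemma lsym_sqr η : lsym η ^+ 2 = qsym η.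
Proof.
rewrite expr2 -cexpD -{3}(cexp_clog (slit_q η)); congr cexp.
by apply: cplxP; rewrite ?reD ?imD ?reM ?imM /=; field.
Qed.

Lemma normc_lsym η : normc (lsym η) <= 1.
Proof.
rewrite -(@ler_pXn2r _ 2%N) ?nnegrE ?normc_ge0// expr1n -normcX lsym_sqr; exact: normc_qsym.
Qed.

(** [(Re l)^2 = Re (l^2) + (Im l)^2 >= tau], and the principal root has positive real part. *)
Lemma re_lsym η : Num.sqrt tau <= re (lsym η).
Proof.
have l0 : 0 < re (lsym η).
  rewrite /lsym /cexp; set t := im (2^-1%:C * _).
  have [th] : t = 2^-1 * im (clog (qsym η)) by rewrite /t imMr.
  have /andP[h1 h2] := arg_bound (qsym η).
  have : - (pi / 2) < t < pi / 2 by rewrite th; apply/andP; split; lra.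
  by clearbody t => tb; rewrite [re _]/= mulr_gt0 ?expR_gt0// cos_gt0_pihalf.
have h : tau <= re (lsym η) ^+ 2.
  have := re_qsym η; rewrite -lsym_sqr expr2 reM; have := sqr_ge0 (im (lsym η)); lra.
by rewrite -(ger0_norm (ltW l0)) -sqrtr_sqr ler_wsqrtr.
Qed.

Lemma re_lsym_gt0 η : 0 < re (lsym η).
Proof. by apply: lt_le_trans (re_lsym η); rewrite sqrtr_gt0. Qed.

Lemma im_spow_neg η : im (spow (- η)) = - im (spow η).
Proof.
rewrite /spow !cpow_arg ?slit_sl//=.
have -> : normc (sl (- η)) = normc (sl η) by rewrite !normcEs /= sqrrN.
by rewrite mulNr atanN !mulrN sinN mulrN.
Qed.

(** For [η >= 1] the half-angle tangent [η / (|s| + 1)] is at least [η / (η + 2) >= 1/3]. Hence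
    [arg s >= 2 atan (1/3)], and [sin0] bounds [sin (alpha arg s)] from below. *)
Definition sin0 : R := sin (alpha * (2 * atan 3^-1)).

Lemma sin0_gt0 : 0 < sin0.
Proof.
have a0 : 0 < atan 3^-1 :> R by rewrite -[ltLHS](@atan0 R) lt_atan// invr_gt0.
have := atan_ltpi2 (3^-1 : R) => a1.
have b : - pi < 2 * atan (3^-1 : R) < pi by apply/andP; split; lra.
have /andP[_ b2] := alpha_scale b.
by apply: sin_gt0_pi; rewrite b2 andbT mulr_gt0// mulr_gt0.
Qed.

Lemma im_spow_ge η : 1 <= η -> sin0 * normc (sl η) `^ alpha <= im (spow η).
Proof.
move=> e1; have n1 := slit_normc (slit_sl η).
have a0 : 0 < atan 3^-1 :> R by rewrite -[ltLHS](@atan0 R) lt_atan// invr_gt0.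
have h : 2 * atan 3^-1 <= im (clog (sl η)).
  rewrite /clog [leRHS]/= ler_wpM2l//; apply: le_atan; rewrite ler_pdivlMr ?addr_gt0//.
  by have := normc_sl_le η; rewrite ger0_norm; lra.
have := arg_re (z := sl η) ltr01; rewrite /spow (cpow_arg (slit_sl _)).
move: h; set t := im (clog _) => h /alpha_scale/andP[b1 b2].
rewrite [leRHS]/= [leLHS]mulrC.
apply: ler_wpM2l; first exact: powR_ge0.
have b3 : alpha * (2 * atan 3^-1) <= alpha * t by rewrite ler_wpM2l// ltW.
have b4 : 0 < alpha * (2 * atan 3^-1) by rewrite mulr_gt0// mulr_gt0.
rewrite /sin0 leNgt; apply/negP; rewrite ltr_sin ?in_itv /= ?(ltW b1) ?(ltW b2)//; first by lra.
by apply/andP; split; lra.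
Qed.

Lemma im_usym η : im (usym η) = im (spow η) / normc (1 + spow η) ^+ 2.
Proof.
have -> : usym η = 1 - (1 + spow η)^-1 by rewrite -usym1 subKr.
by rewrite imB imV !imD /=; ring.
Qed.

(** [Im u = Im (s^alpha) / |1 + s^alpha|^2], with numerator at least [sin0 |s|^alpha] in modulus and
    denominator at most [(2 |s|^alpha)^2]. *)
Lemma im_usym_ge η : 1 <= `|η| ->
  sin0 / 4 * normc (sl η) `^ (- alpha) <= `|im (usym η)|.
Proof.
move=> e1; have n1 := slit_normc (slit_sl η).
have b1 : sin0 * normc (sl η) `^ alpha <= `|im (spow η)|.
  have [e0|e0] := leP 0 η.
    by apply: le_trans (ler_norm _); apply: im_spow_ge; rewrite -(ger0_norm e0).
  have -> : normc (sl η) = normc (sl (- η)) by rewrite !normcEs !re_sl !im_sl sqrrN.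
  rewrite -normrN -im_spow_neg; apply: le_trans (ler_norm _); apply: im_spow_ge.
  by rewrite -(ltr0_norm e0).
set N := normc (sl η) `^ alpha in b1 *.
have N1 : 1 <= N by rewrite -(powRr0 (normc (sl η))) ler_powR ?normc_sl_ge// ltW.
have N0 : 0 < N by apply: lt_le_trans N1.
have b2 : normc (1 + spow η) <= 2 * N.
  apply: le_trans (normcD _ _) _; rewrite normc_cpow -/N normc1; lra.
rewrite powRN -/N im_usym normrM (ger0_norm (_ : 0 <= (normc _ ^+ 2)^-1)) ?invr_ge0 ?exprn_ge0 ?normc_ge0//.
have d0 : 0 < normc (1 + spow η) ^+ 2 by rewrite exprn_gt0// (lt_le_trans ltr01)// normc_1spow.
rewrite ler_pdivlMr//; apply: le_trans b1.
have b3 : normc (1 + spow η) ^+ 2 <= (2 * N) ^+ 2 by rewrite lerXn2r ?nnegrE ?normc_ge0// mulr_ge0// ltW.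
apply: (@le_trans _ _ (sin0 / 4 * N^-1 * (2 * N) ^+ 2)).
  by rewrite ler_wpM2l// mulr_ge0 ?invr_ge0 ?(ltW N0)// divr_ge0// ltW// sin0_gt0.
rewrite le_eqVlt; apply/orP; left; apply/eqP; have := lt0r_neq0 N0 => N0'; field; done.
Qed.

Lemma sgn_im_spow η : 0 <= η * im (spow η).
Proof.
wlog e0 : η / 0 <= η.
  move=> h; have [e0|e0] := leP 0 η; first exact: h.
  have := h (- η); rewrite im_spow_neg mulrNN; apply; rewrite oppr_ge0; exact: ltW.
have t0 : 0 <= im (clog (sl η)).
  by rewrite /clog [leRHS]/= mulr_ge0// -(@atan0 R) le_atan// divr_ge0// addr_ge0 ?normc_ge0.
have := alpha_scale (arg_re (z := sl η) ltr01).
rewrite /spow (cpow_arg (slit_sl _)); move: t0; set t := im (clog _) => t0.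
move=> /andP[_ b1]; apply: mulr_ge0 e0 _; rewrite [im _]/= mulr_ge0 ?powR_ge0//.
apply: sin_ge0_pi; rewrite mulr_ge0 ?(ltW alpha_gt0)//=.
by have := @pi_ge0 R; lra.
Qed.

(** [Re (s l) = Re l - η Im l] and [2 Re l Im l = Im (l^2) = - (1 - tau) Im u]. As [η] and [Im u]
    never have opposite signs, the second term is nonnegative: it expresses the dissipation. *)
Lemma re_psymE η : re (psym η) = re (lsym η) + (1 - tau) * `|η| * `|im (usym η)| / (2 * re (lsym η)).
Proof.
have l0 := re_lsym_gt0 η.
have e1 : 2 * re (lsym η) * im (lsym η) = - (1 - tau) * im (usym η).
  have : im (qsym η) = - (1 - tau) * im (usym η) by rewrite /qsym imB imMr /=; ring.
  by rewrite -lsym_sqr => <-; rewrite expr2 imM; ring.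
have e2 : `|η| * `|im (usym η)| = η * im (usym η).
  rewrite -normrM ger0_norm// im_usym mulrA divr_ge0 ?sgn_im_spow// exprn_ge0 ?normc_ge0//.
have -> : (1 - tau) * `|η| * `|im (usym η)| = - η * (2 * re (lsym η) * im (lsym η)).
  by rewrite -mulrA e2 e1; ring.
by rewrite /psym reM re_sl im_sl; have := lt0r_neq0 l0 => l0'; field.
Qed.

(** For [|η| >= 1] the dissipative term of [re_psymE] is at least of order [|η| |s|^(-alpha)]; for
    [|η| < 1] the bound [Re l >= sqrt tau] suffices, [jb η] being at most 2 there. *)
Lemma re_psym_ge : exists2 k : R, 0 < k & forall η, k * jb η `^ (1 - alpha) <= re (psym η).
Proof.
have s0 := sin0_gt0; have t1 : 0 < 1 - tau by rewrite subr_gt0.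
have st0 : 0 < Num.sqrt tau by rewrite sqrtr_gt0.
pose k1 := (1 - tau) * (sin0 / 4) / 4.
have k10 : 0 < k1 by rewrite !(mulr_gt0, divr_gt0).
exists (Num.min (Num.sqrt tau / 2) k1); first by rewrite lt_min k10 divr_gt0.
move=> η; have l0 := re_lsym_gt0 η; rewrite re_psymE.
have j0 := jb_gt0 η.
have ip : 0 <= (1 - tau) * `|η| * `|im (usym η)| / (2 * re (lsym η)).
  apply: divr_ge0; first by rewrite !mulr_ge0// ltW.
  by rewrite mulr_ge0// ltW.
have [e1|e1] := leP 1 `|η|.
  apply: (@le_trans _ _ (k1 * jb η `^ (1 - alpha))).
    by rewrite ler_wpM2r ?powR_ge0// ge_min lexx orbT.
  rewrite -[leLHS]add0r lerD ?(ltW l0)//.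
  have b := im_usym_ge e1.
  have n1 := slit_normc (slit_sl η).
  have b2 : jb η `^ (- alpha) <= normc (sl η) `^ (- alpha).
    by rewrite !powRN lef_pV2 ?posrE ?powR_gt0// ge0_ler_powR ?nnegrE ?(ltW alpha_gt0) ?(ltW n1) ?(ltW j0)// sl_le_jb.
  have b3 : jb η <= 2 * `|η| by rewrite /jb; lra.
  have lr : 2 * re (lsym η) <= 2 by have := normc_lsym η; have := re_le_normc (lsym η); lra.
  have -> : jb η `^ (1 - alpha) = jb η * jb η `^ (- alpha).
    by rewrite powRD ?powRr1 ?(ltW j0)// implybE (gt_eqF j0) orbT.
  rewrite ler_pdivlMr; last by rewrite mulr_gt0.
  set J := jb η `^ (- alpha) in b2 *.
  have J0 : 0 <= J by exact: powR_ge0.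
  apply: (@le_trans _ _ (k1 * (jb η * J) * 2)).
    by rewrite ler_wpM2l// mulr_ge0 ?(ltW k10)// mulr_ge0// ltW.
  have -> : k1 * (jb η * J) * 2 = (1 - tau) * (jb η / 2 * (sin0 / 4 * J)) by rewrite /k1; field.
  rewrite -[leRHS]mulrA; apply: ler_wpM2l; first exact: ltW.
  apply: ler_pM.
  - by rewrite divr_ge0// ltW.
  - by rewrite mulr_ge0// divr_ge0// ltW.
  - by lra.
  - by apply: le_trans b; rewrite ler_wpM2l// divr_ge0// ltW.
apply: (@le_trans _ _ (Num.sqrt tau / 2 * jb η `^ (1 - alpha))).
  by rewrite ler_wpM2r ?powR_ge0// ge_min lexx.
rewrite -[leLHS]addr0 lerD//; apply: le_trans (re_lsym η).
rewrite -mulrA ler_piMr ?(ltW st0)// mulrC ler_pdivrMr// mul1r.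
apply: (@le_trans _ _ (2 `^ (1 - alpha))).
  by rewrite ge0_ler_powR ?nnegrE ?subr_ge0 ?(ltW alpha_lt1) ?(ltW j0)// /jb; lra.
by rewrite -[leRHS]powRr1 // ler_powR ?ler1n// gerBl ltW.
Qed.

Definition symb (m : R) (a : R -> R -> R[i]) : Prop :=
  (exists C, forall x η, normc (a x η) <= C * jb η `^ (- m)) /\
  forall z, ccont (fun z : R * R => a z.1 z.2) z.

(** Symbols of order [-m] with [j] controlled [η]-derivatives, uniformly in [x]. A derivative gains
    [1 - alpha] instead of 1, which is the gain of the exponential: it brings down [|x|], worth
    [<η>^(alpha - 1)] against [exp (- |x| s l)]. *)
Fixpoint sym (j : nat) (m : R) (a : R -> R -> R[i]) : Prop :=
  symb m a /\
  if j is j'.+1 then exists2 a', forall x η, is_cder (a x) η (1 : R) (a' x η) & sym j' (m + (1 - alpha)) a'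
  else True.

Lemma sym_bound j m a : sym j m a -> exists2 C, 0 <= C & forall x η, normc (a x η) <= C * jb η `^ (- m).
Proof.
case: j => [|j] [[[C hC] _] _]; exists C => //;
  have := le_trans (normc_ge0 _) (hC 0 0); by rewrite /jb normr0 addr0 powR1 mulr1.
Qed.

Lemma sym_cont j m a z : sym j m a -> ccont (fun z : R * R => a z.1 z.2) z.
Proof. by case: j => [|j] [[_ h] _]. Qed.

Lemma symb_eta m (f : R -> R[i]) C : (forall η, normc (f η) <= C * jb η `^ (- m)) ->
  (forall η, ccont f η) -> symb m (fun _ => f).
Proof.
move=> hC cf; split; first by exists C.
move=> z; apply: ccont_snd; exact: cf.
Qed.

Lemma sym_le j m m' a : m' <= m -> sym j m a -> sym j m' a.
Proof.
elim: j m m' a => [|j IH] m m' a mm ha; have [C C0 hC] := sym_bound ha; (split;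
  first by (split; first by exists C => x η; apply: le_trans (hC x η) _; rewrite ler_wpM2l// jb_powR_le// lerN2);
  move=> z; exact: sym_cont ha) => //.
by case: ha => _ [a' h1 h2]; exists a' => //; apply: IH h2; rewrite lerD2r.
Qed.

Lemma symS j m a : sym j.+1 m a -> sym j m a.
Proof.
elim: j m a => [|j IH] m a [hb [a' h1 h2]]; split => //.
by exists a' => //; exact: IH.
Qed.

Lemma sym_cst j (b : R[i]) : sym j 0 (fun _ _ => b).
Proof.
suff z i m : sym i m (fun _ _ => 0).
  case: j => [|j]; (split; first by apply: (@symb_eta 0 _ (normc b)) => η; rewrite ?oppr0 ?powRr0 ?mulr1//; exact: ccont_cst) => //.
  by exists (fun _ _ => 0) => // x η; exact: cder_cst.
elim: i m => [|i IH] m; (split; first by apply: (@symb_eta _ _ 0) => η; rewrite ?normc0 ?mul0r//; exact: ccont_cst) => //.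
by exists (fun _ _ => 0) => // x η; exact: cder_cst.
Qed.

Lemma symD j m a b : sym j m a -> sym j m b -> sym j m (fun x η => a x η + b x η).
Proof.
elim: j m a b => [|j IH] m a b ha hb; have [C C0 hC] := sym_bound ha; have [D D0 hD] := sym_bound hb;
  (split; first by (split; first by exists (C + D) => x η; rewrite mulrDl; apply: le_trans (normcD _ _) _; rewrite lerD);
  move=> z; apply: ccontD; [exact: sym_cont ha|exact: sym_cont hb]) => //.
case: ha => _ [a' h1 h2]; case: hb => _ [b' h3 h4].
exists (fun x η => a' x η + b' x η); last exact: IH.
by move=> x η; exact: (is_cderD (h1 x η) (h3 x η)).
Qed.

Lemma symM j m m' a b : sym j m a -> sym j m' b -> sym j (m + m') (fun x η => a x η * b x η).
Proof.
elim: j m m' a b => [|j IH] m m' a b ha hb; have [C C0 hC] := sym_bound ha; have [D D0 hD] := sym_bound hb;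
  (split; first by (split; first by exists (C * D) => x η; rewrite normcM opprD jb_powRD mulrACA ler_pM ?normc_ge0);
  move=> z; apply: ccontM; [exact: sym_cont ha|exact: sym_cont hb]) => //.
have ha' := symS ha; have hb' := symS hb.
case: ha => _ [a' h1 h2]; case: hb => _ [b' h3 h4].
exists (fun x η => a' x η * b x η + a x η * b' x η).
  by move=> x η; exact: is_cderM.
apply: symD; first by rewrite addrAC; exact: IH.
by rewrite -addrA; exact: IH.
Qed.

Lemma symM0 j m a b : sym j 0 a -> sym j m b -> sym j m (fun x η => a x η * b x η).
Proof. by move=> ha hb; rewrite -(add0r m); exact: symM. Qed.

Lemma sym_ext j m a b : (forall x η, a x η = b x η) -> sym j m a -> sym j m b.
Proof. by move=> h; congr sym; apply/funext => x; apply/funext => η. Qed.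

Lemma sym_sinv j : sym j 1 (fun _ => sinv).
Proof.
elim: j => [|j IH]; (split; first by apply: (@symb_eta _ _ 2) => η; [exact: normc_sinv|exact: cder_cont (is_cder_sinv η)]) => //.
exists (fun _ η => - ci * (sinv η * sinv η)); first by move=> x η; exact: is_cder_sinv.
apply: symM0; first exact: sym_cst.
by apply: (@sym_le j (1 + 1)); [rewrite lerD2l gerBl ltW|exact: symM].
Qed.

Definition dusym η : R[i] := alpha%:C * (ci * (sinv η * (usym η * (1 - usym η)))).

Lemma is_cder_spow η : is_cder spow η (1 : R) (alpha%:C * (ci * sinv η) * spow η).
Proof.
have h := cder_exp (is_cderZ alpha%:C (is_cder_clog (slit_sl η) (is_cder_sl η))).
have e : (fun y => cexp (alpha%:C * clog (sl y))) = spow.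
  by apply/funext => y; rewrite /spow cpow_clog// slit_sl.
by rewrite e in h; apply: cder_eq h _; rewrite -e /sinv mulrA.
Qed.

Lemma is_cder_usym η : is_cder usym η (1 : R) (dusym η).
Proof.
have h1 := is_cder_spow η; have n := spow1_neq0 η.
have h2 := @is_cderV _ _ (fun y => 1 + spow y) η _ _ n (is_cderD (cder_cst 1 η (1 : R)) h1).
apply: cder_eq (is_cderM h1 h2) _.
by rewrite /dusym usym1 /usym; field.
Qed.

Lemma sym_usym j : sym j 0 (fun _ => usym).
Proof.
elim: j => [|j IH]; (split; first by apply: (@symb_eta _ _ (1)) => η; [rewrite oppr0 powRr0 mulr1 normc_usym|exact: cder_cont (is_cder_usym η)]) => //.
exists (fun _ η => dusym η); first by move=> x η; exact: is_cder_usym.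
apply: (@sym_le _ 1); first by rewrite add0r gerBl ltW.
apply: symM0; first exact: sym_cst.
apply: symM0; first exact: sym_cst.
rewrite -[X in sym _ X](addr0 1); apply: symM; first exact: sym_sinv.
apply: symM0 => //; apply: symD; first exact: sym_cst.
apply: (sym_ext (a := fun _ η => (-1) * usym η)); first by move=> x η; rewrite mulN1r.
by apply: symM0 => //; exact: sym_cst.
Qed.

Lemma is_cder_qsym η : is_cder qsym η (1 : R) (- ((1 - tau)%:C * dusym η)).
Proof.
have := is_cderB (cder_cst 1 η (1 : R)) (is_cderZ (1 - tau)%:C (is_cder_usym η)).
by move=> h; apply: cder_eq h _; rewrite sub0r.
Qed.

Lemma is_cder_csym η : is_cder csym η (1 : R) ((1 - tau)%:C * dusym η * (csym η * csym η)).
Proof.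
apply: cder_eq (is_cderV (qsym_neq0 η) (is_cder_qsym η)) _.
by rewrite opprK /csym -[in RHS]expr2 exprVn.
Qed.

Lemma sym_dusym j : sym j (1 - alpha) (fun _ => dusym).
Proof.
have [_ [a' h1 h2]] := sym_usym j.+1; rewrite add0r in h2.
apply: sym_ext h2 => x η; have [_ <-] := is_cderP (h1 x η).
by have [_ ->] := is_cderP (is_cder_usym η).
Qed.

Lemma sym_csym j : sym j 0 (fun _ => csym).
Proof.
elim: j => [|j IH]; (split; first by apply: (@symb_eta _ _ (tau^-1)) => η; [rewrite oppr0 powRr0 mulr1 normc_csym|exact: cder_cont (is_cder_csym η)]) => //.
exists (fun _ η => (1 - tau)%:C * dusym η * (csym η * csym η)); first by move=> x η; exact: is_cder_csym.
rewrite add0r -[X in sym _ X]addr0; apply: symM; last exact: symM0.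
by apply: symM0; [exact: sym_cst|exact: sym_dusym].
Qed.

Definition dlsym η : R[i] := (- (2^-1 * (1 - tau)))%:C * (dusym η * (csym η * lsym η)).

Lemma is_cder_lsym η : is_cder lsym η (1 : R) (dlsym η).
Proof.
have h := cder_exp (is_cderZ 2^-1%:C (is_cder_clog (slit_q η) (is_cder_qsym η))).
by apply: cder_eq h _; rewrite /dlsym -/(lsym η) -/(csym η) rmorphN rmorphM; ring.
Qed.

Lemma sym_lsym j : sym j 0 (fun _ => lsym).
Proof.
elim: j => [|j IH]; (split; first by apply: (@symb_eta _ _ (1)) => η; [rewrite oppr0 powRr0 mulr1 normc_lsym|exact: cder_cont (is_cder_lsym η)]) => //.
exists (fun _ => dlsym); first by move=> x η; exact: is_cder_lsym.
apply: symM0; first exact: sym_cst.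
rewrite add0r -[X in sym _ X]addr0; apply: symM; first exact: sym_dusym.
by apply: symM0 => //; exact: sym_csym.
Qed.

Definition dpsym η : R[i] := ci * lsym η + sl η * dlsym η.

Lemma is_cder_psym η : is_cder psym η (1 : R) (dpsym η).
Proof. exact: is_cderM (is_cder_sl η) (is_cder_lsym η). Qed.

(** In [s l'] the factor [s] cancels the [1 / s] contained in [u'], so that [(s l)'] is of order
    0. *)
Lemma sym_dpsym j : sym j 0 (fun _ => dpsym).
Proof.
have u1 i : sym i 0 (fun _ η => 1 - usym η).
  apply: symD; first exact: sym_cst.
  apply: (sym_ext (a := fun _ η => (-1) * usym η)); first by move=> x η; rewrite mulN1r.
  by apply: symM0; [exact: sym_cst|exact: sym_usym].
apply: symD; first by apply: symM0; [exact: sym_cst|exact: sym_lsym].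
apply: (sym_ext (a := fun _ η => ((- (2^-1 * (1 - tau)))%:C * (alpha%:C * ci)) * (usym η * ((1 - usym η) * (csym η * lsym η))))).
  by move=> x η; rewrite /dlsym /dusym /sinv; have := sl_neq0 η => h; field.
apply: symM0; first exact: sym_cst.
apply: symM0; first exact: sym_usym.
apply: symM0; first exact: u1.
by apply: symM0; [exact: sym_csym|exact: sym_lsym].
Qed.

Definition expx x η : R[i] := cexp (- (`|x|%:C * psym η)).

Lemma normc_expx x η : normc (expx x η) = expR (- (`|x| * re (psym η))).
Proof. by rewrite normc_cexp reN reMr. Qed.

Lemma is_cder_expx x η : is_cder (expx x) η (1 : R) (- `|x|%:C * dpsym η * expx x η).
Proof.
have h := cder_exp (is_cderN (is_cderZ `|x|%:C (is_cder_psym η))).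
by apply: cder_eq h _; rewrite -/(expx x η); ring.
Qed.

(** The bound is [y^k exp (-y) <= k!] with [y] a multiple of [|x| <η>^(1 - alpha)]. A derivative
    multiplies by the order-0 symbol [- (s l)'] and raises [k] by one, which is a gain of
    [1 - alpha]; hence the induction treats all [k] at once. *)
Lemma sym_expx j k : sym j (k%:R * (1 - alpha)) (fun x η => (`|x| ^+ k)%:C * expx x η).
Proof.
have [kap k0 hk] := re_psym_ge.
have b i : exists C, forall x η, normc ((`|x| ^+ i)%:C * expx x η) <= C * jb η `^ (- (i%:R * (1 - alpha))).
  exists (i`!%:R / kap ^+ i) => x η; rewrite normcM normcR normc_expx ger0_norm ?exprn_ge0//.
  set J := jb η `^ (1 - alpha) in hk.
  have J0 : 0 < jb η `^ (1 - alpha) by rewrite powR_gt0// jb_gt0.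
  have y0 : 0 <= `|x| * (kap * jb η `^ (1 - alpha)) by rewrite !mulr_ge0// ltW.
  apply: (@le_trans _ _ (`|x| ^+ i * expR (- (`|x| * (kap * jb η `^ (1 - alpha)))))).
    by rewrite ler_wpM2l ?exprn_ge0// ler_expR lerN2 ler_wpM2l.
  have -> : jb η `^ (- (i%:R * (1 - alpha))) = (jb η `^ (1 - alpha) ^+ i)^-1.
    by rewrite powRN mulrC powRrM powR_mulrn// powR_ge0.
  rewrite -mulrA -invfM -exprMn ler_pdivlMr ?exprn_gt0 ?mulr_gt0// mulrAC -exprMn.
  exact: exprMexpRN_le.
have cb i z : ccont (fun z : R * R => (`|z.1| ^+ i)%:C * expx z.1 z.2) z.
  have cn : {for z, continuous (fun z : R * R => `|z.1|)}.
    by apply: (@continuous_comp _ _ _ fst (fun x : R => `|x|)); [exact: cvg_fst|exact: norm_continuous].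
  apply: ccontM.
    apply: ccontR; apply: (@continuous_comp _ _ _ (fun z : R * R => `|z.1|) (fun x : R => x ^+ i)) => //.
    exact: exprn_continuous.
  apply: ccont_exp; have := ccontM (ccont_cst (-1) z) (ccontM (ccontR cn)
    (ccont_snd (cder_cont (is_cder_psym z.2)))).
  by congr ccont; apply/funext => y; rewrite mulN1r.
elim: j k => [|j IH] k; (split; first by split; [exact: b|exact: cb]) => //.
exists (fun x η => - dpsym η * ((`|x| ^+ k.+1)%:C * expx x η)).
  move=> x η; apply: cder_eq (is_cderZ (`|x| ^+ k)%:C (is_cder_expx x η)) _.
  by rewrite exprS rmorphM; ring.
apply: symM0.
  apply: (sym_ext (a := fun _ η => (-1) * dpsym η)); first by move=> x η; rewrite mulN1r.
  by apply: symM0; [exact: sym_cst|exact: sym_dpsym].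
by have := IH k.+1; rewrite -(natr1 k) mulrDl mul1r.
Qed.

Lemma sym_St j : sym j 1 St.
Proof.
apply: symM0; first exact: sym_cst.
rewrite -[X in sym _ X](addr0 1); apply: symM; first exact: sym_sinv.
apply: symM0; first exact: sym_lsym.
by have := sym_expx j 0; rewrite mul0r; apply: sym_ext => x η; rewrite expr0 mul1r.
Qed.

End Symbol.
Unset Default Proof Using.

(** * The resolvent kernel [exp (- p |x|)] *)

Section Resolvent.
Context {R : realType}.
Notation mu := (@lebesgue_measure R).
Implicit Types (h : R -> R[i]) (p : R[i]).
Local Arguments cexp : simpl never.

Definition ker p (y : R) : R[i] := cexp (- (`|y|%:C * p)).

Lemma normc_ker p y : normc (ker p y) = expR (- (re p * `|y|)).
Proof. by rewrite normc_cexp reN reMr mulrC. Qed.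

Lemma ker_cont p y : ccont (ker p) y.
Proof.
apply: ccont_exp; have := ccontM (ccont_cst (-1) y) (ccontM (ccontR (@norm_continuous _ R y)) (ccont_cst p y)).
by congr ccont; apply/funext => z; rewrite mulN1r.
Qed.

(** [2 p] times the inverse of [p^2 - d^2/dx^2], written with [h (x + y)] so that derivatives fall
    on [h]. *)
Definition conv p h (x : R) : R[i] := cint mu setT (fun y => ker p y * h (x + y)).

Lemma test_shift_cont h x y : test h -> ccont (fun y => h (x + y)) y.
Proof.
move=> th; apply: (ccont_comp (f := h) (g := fun y => x + y)); last exact: (smooth_cont th.1).
by apply: cvgD; [exact: cvg_cst|exact: cvg_id].
Qed.

Lemma cintble_conv p h x : test h -> 0 < re p -> cintble mu setT (fun y => ker p y * h (x + y)).
Proof.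
move=> th p0; have [M [C [M0 C0 hM hC]]] := test_bd_supp th.
apply: (cintble_dom measurableT _ (integrableZl measurableT C (integrable_exp_abs p0))).
  by apply: cmeasT1 => y; apply: ccontM; [exact: ker_cont|exact: test_shift_cont].
by move=> y _; rewrite normcM normc_ker mulrC ler_wpM2r ?expR_ge0.
Qed.

Lemma is_cder_shift (V : normedModType R) (h : V -> R[i]) (y z v : V) : smooth_on setT h ->
  is_cder (fun x => h (x + y)) z v (cderive v h (z + y)).
Proof.
move=> sh; have AL (b : R) (w x : V) : (b *: w + x) + y = b *: id w + (x + y) by rewrite addrA.
rewrite -[cderive v h (z + y)]/((cderive v h \o (fun x => x + y)) z) -(cderive_affine AL).
apply: cderivable_is; apply: (cderivable_affine AL).
by have [] := is_cderP (smooth_cder0 v sh (I : setT (z + y))).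
Qed.

Lemma is_cder_conv p h x v : test h -> 0 < re p ->
  is_cder (conv p h) x v (conv p (cderive v h) x).
Proof.
move=> th p0; have th' := test_cderive cptB1 v th.
have [M [C [M0 C0 hM hC]]] := test_bd_supp th'.
apply: (@is_cder_cint R _ _ _ mu setT (fun x y => ker p y * h (x + y)) (fun x y => ker p y * cderive v h (x + y))
  (fun y => C * expR (- (re p * `|y|))) x v 1 measurableT ltr01).
- by move=> a _; exact: cintble_conv.
- by move=> a y _ _; apply: is_cderZ; exact: (is_cder_shift y (a *: v + x) v th.1).
- exact: (integrableZl measurableT C (integrable_exp_abs p0)).
- by move=> a y _ _; rewrite normcM normc_ker mulrC ler_wpM2r ?expR_ge0.
Qed.

(** Half of the exponent keeps the integral finite; the other half gives decay in [x], because
    [|y| >= |x| - M] wherever [h (x + y)] is nonzero. *)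
Lemma conv_rapid p h : test h -> 0 < re p -> rapid (conv p h).
Proof.
move=> th p0 n; have [M [C [M0 C0 hM hC]]] := test_bd_supp th.
have k0 : 0 < re p / 2 by rewrite divr_gt0.
set k := re p / 2 in k0.
exists (n`!%:R / k ^+ n * expR (k * (1 + M)) * (C * (2 / k))) => x.
have b : normc (conv p h x) <= expR (- (k * (`|x| - M))) * (C * (2 / k)).
  apply: (@le_trans _ _ (\int[mu]_y (expR (- (k * (`|x| - M))) * C * expR (- (k * `|y|))))%R).
    apply: (cint_le measurableT).
    - by apply: cmeasT1 => y; apply: ccontM; [exact: ker_cont|exact: test_shift_cont].
    - exact: (integrableZl measurableT _ (integrable_exp_abs k0)).
    move=> y _; rewrite normcM normc_ker.
    have [xy|xy] := leP `|x + y| M; last first.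
      by rewrite hM// normc0 mulr0 !mulr_ge0 ?expR_ge0.
    rewrite mulrAC -expRD ler_pM ?expR_ge0 ?normc_ge0// ler_expR.
    have e : re p = 2 * k by rewrite /k; field.
    have : `|x| <= M + `|y|.
      by rewrite -[x](addrK y) (le_trans (ler_normB _ _))// lerD2r.
    rewrite e; nra.
  rewrite RintegralZl ?Rintegral_exp_abs -?mulrA//.
  exact: (integrable_exp_abs k0).
apply: (@le_trans _ _ ((1 + `|x|) ^+ n * (expR (- (k * (`|x| - M))) * (C * (2 / k))))).
  by rewrite ler_wpM2l// exprn_ge0// addr_ge0.
rewrite [leLHS]mulrA ler_wpM2r ?mulr_ge0 ?invr_ge0 ?(ltW k0)//.
have -> : expR (- (k * (`|x| - M))) = expR (- (k * (1 + `|x|))) * expR (k * (1 + M)) by rewrite -expRD; congr expR; ring.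
rewrite mulrA ler_wpM2r ?expR_ge0// ler_pdivlMr ?exprn_gt0// mulrAC -exprMn [(_ + _) * k]mulrC.
by apply: exprMexpRN_le; rewrite mulr_ge0 ?(ltW k0)// addr_ge0.
Qed.

Lemma schwartz_conv p h : test h -> 0 < re p -> schwartz (conv p h).
Proof.
move=> th p0; apply: (@dstable_schwartz _ _ [set f | exists2 h, test h & f = conv p h]); last by exists h.
- move=> _ [q tq ->]; split => [x _|v]; first exact: (cder_cont (is_cder_conv x 1 tq p0)).
  exists (conv p (cderive v q)) => [|x _]; last exact: is_cder_conv.
  by apply: spn1; exists (cderive v q) => //; exact: (test_cderive cptB1).
- by move=> _ [q tq ->]; exact: conv_rapid.
Qed.

(** Two integrations by parts on each half-line; the kink of the kernel at 0 leaves [- 2 p h x]. *)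
Lemma conv_ode p h x : test h -> 0 < re p ->
  conv p (cderive (1 : R) (cderive (1 : R) h)) x = p ^+ 2 * conv p h x - 2 * p * h x.
Proof.
move=> th p0; set h1 := cderive (1 : R) h; set h2 := cderive (1 : R) h1.
have th1 : test h1 := test_cderive cptB1 _ th.
have th2 : test h2 := test_cderive cptB1 _ th1.
have c2 := cintble_conv x th2 p0; have c0 := cintbleZT (- p ^+ 2) (cintble_conv x th p0).
apply/eqP; rewrite addrC -subr_eq -mulNr; apply/eqP.
rewrite /conv -(cintZT _ (cintble_conv x th p0)) -(cintDT c2 c0).
set f := (fun y => _ + _).
have cf : cintble mu setT f := cintbleDT c2 c0.
have lim := cint_limitT cf.
have cc y : ccont f y.
  apply: ccontD; first by apply: ccontM; [exact: ker_cont|exact: test_shift_cont].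
  by apply: ccontM; [exact: ccont_cst|apply: ccontM; [exact: ker_cont|exact: test_shift_cont]].
have dsh q (y : R) : test q -> is_cder (fun y => q (x + y)) y 1 (cderive (1 : R) q (x + y)).
  move=> tq; have ih : is_derive y (1 : R) (fun y : R => x + y) 1.
    by have := is_deriveD (is_derive_cst x y (1 : R)) (is_derive_id y (1 : R)); rewrite add0r.
  have := is_cder_comp ih (smooth_cder0 (1 : R) tq.1 (I : setT (x + y))); rewrite mul1r; exact.
pose E (s : R) (y : R) := cexp (- (s%:C * p * y%:C)).
have dE s y : is_cder (E s) y 1 (- (s%:C * p) * E s y).
  have := cder_exp (is_cderN (is_cderZ (s%:C * p) (is_cder_id y))).
  by move=> H; apply: cder_eq H _; rewrite mulr1.
(* A primitive of [f] on the half-line where [|y| = s y], for [s = 1] and for [s = -1]. *)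
pose F s y := E s y * (h1 (x + y) + s%:C * p * h (x + y)).
have dF (s y : R) : s ^+ 2 = 1 -> is_cder (F s) y 1 (E s y * h2 (x + y) + - p ^+ 2 * (E s y * h (x + y))).
  move=> s1; have := is_cderM (dE s y) (is_cderD (dsh h1 y th1) (is_cderZ (s%:C * p) (dsh h y th))).
  move=> H; apply: cder_eq H _; rewrite -/h1 -/h2.
  have s1' : s%:C * s%:C = 1 :> R[i] by rewrite -rmorphM -expr2 s1.
  have -> : - (s%:C * p) * E s y * (h1 (x + y) + s%:C * p * h (x + y)) + E s y * (h2 (x + y) + s%:C * p * h1 (x + y))
    = E s y * h2 (x + y) - (s%:C * s%:C) * p ^+ 2 * (E s y * h (x + y)) by ring.
  by rewrite s1' mul1r mulNr.
have cE (y : R) (s : R) : `|y| = s * y -> ker p y = E s y.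
  by move=> e; rewrite /ker e /E; congr cexp; rewrite rmorphM; ring.
have [M [C [M0 C0 hM hC]]] := test_bd_supp th.
have [M1 [C1 [M10 C10 hM1 hC1]]] := test_bd_supp th1.
(* Beyond [N] both [h (x + y)] and its derivative vanish, so the outer boundary terms are 0 and the
   truncated integrals are constant. *)
have [N hN] : exists N : nat, `|x| + M + M1 < N%:R.
  by exists (Num.truncn (`|x| + M + M1)).+1; exact: truncnS_gt.
suff hh n : (N <= n)%N -> cint mu `[- n%:R, n%:R]%classic f = - (2 * p * h x).
  apply: (ccvg_unique lim); split; apply: cvg_near_cst; exists N => // n /hh e.
    exact: (congr1 (@re R) e).
  exact: (congr1 (@im R) e).
move=> Nn; have n0 : - n%:R <= (0 : R) by rewrite oppr_le0.
have nN : `|x| + M + M1 < n%:R by apply: lt_le_trans hN _; rewrite ler_nat.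
have [-> [-> ->]] := @cint_itv_split R f (- n%:R) 0 n%:R n0 (ler0n _ _) (fun x _ => cc x).
have far (y : R) : n%:R <= `|y| -> h (x + y) = 0 /\ h1 (x + y) = 0.
  move=> ny; have : `|y| <= `|x + y| + `|x| by rewrite -{1}[y](addKr x) addrC (le_trans (ler_normD _ _))// normrN addrC.
  by move=> l; split; [apply: hM; lra|apply: hM1; lra].
rewrite (@cFTC R (F (-1)) f _ _ n0) => [|y /andP[_ y0]|//]; last first.
  have -> : f y = E (-1) y * h2 (x + y) + - p ^+ 2 * (E (-1) y * h (x + y)) by rewrite /f (cE _ (-1)) ?ler0_norm ?mulN1r.
  by apply: dF; rewrite sqrrN expr1n.
rewrite (@cFTC R (F 1) f _ _ (ler0n _ _)) => [|y /andP[y0 _]|//]; last first.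
  have -> : f y = E 1 y * h2 (x + y) + - p ^+ 2 * (E 1 y * h (x + y)) by rewrite /f (cE _ 1) ?ger0_norm ?mul1r.
  by apply: dF; rewrite expr1n.
have [z1 z2] := far n%:R (ler_norm _); have [|z3 z4] := far (- n%:R); first by rewrite normrN ler_norm.
rewrite /F z1 z2 z3 z4 !(mulr0, addr0) sub0r subr0 /E rmorph0 !mulr0 !oppr0 !cexp0 rmorphN1 rmorph1; ring.
Qed.

End Resolvent.

(** * Schwartz representatives of [exp (- s t)] on the half-line *)

Section HalfLine.
Context {R : realType}.
Implicit Types (h : R -> R[i]) (η : R).
Local Arguments cexp : simpl never.

(** Agrees with [exp (- s t)] for [t >= -1]: a representative as [half_line_pairing] asks for. *)
Definition eb η (t : R) : R[i] := (step t)%:C * rotc (- sl η) t.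

Lemma rapid_rotc (g : R -> R[i]) (M C : R) η : (forall t, t < - M -> g t = 0) ->
  (forall t, normc (g t) <= C) -> rapid (fun t => g t * rotc (- sl η) t).
Proof.
move=> gM gC n; have C0 : 0 <= C := le_trans (normc_ge0 _) (gC 0).
exists (C * (n`!%:R * expR (1 + 2 * `|M|))) => t.
rewrite normcM normc_rotc reN re_sl mulN1r.
have [tM|tM] := ltP t (- M).
  by rewrite gM// normc0 mul0r mulr0 !mulr_ge0 ?expR_ge0.
rewrite mulrCA ler_pM ?normc_ge0 ?mulr_ge0 ?exprn_ge0 ?expR_ge0 ?addr_ge0//.
have y0 : 0 <= 1 + 2 * `|M| + t by have := ler_norm M; have := normr_ge0 M; lra.
have b : 1 + `|t| <= 1 + 2 * `|M| + t.
  by have := ler_norm M; have := normr_ge0 M; case: (ltrgt0P t) => [|t0|->]; lra.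
apply: (@le_trans _ _ ((1 + 2 * `|M| + t) ^+ n * expR (- t))).
  have t0 : 0 <= 1 + `|t| by rewrite addr_ge0.
  by rewrite ler_wpM2r ?expR_ge0// lerXn2r.
have -> : - t = - (1 + 2 * `|M| + t) + (1 + 2 * `|M|) by ring.
by rewrite expRD mulrA ler_wpM2r ?expR_ge0// exprMexpRN_le.
Qed.

Lemma schwartz_eb η : schwartz (eb η).
Proof.
apply: (@dstable_schwartz _ _ [set f | exists2 g : R -> R[i], test g \/ g = (fun t => (step t)%:C)
    & f = fun t => g t * rotc (- sl η) t]); last by exists (fun t => (step t)%:C) => //; right.
- move=> _ [g gP ->].
  have sg : smooth_on setT g by case: gP => [[]//|->]; exact: smooth_step.
  have hd z v := is_cderM (smooth_cder0 v sg (I : setT z)) (smooth_cder0 v (smooth_rotc (- sl η)) (I : setT z)).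
  split=> [z _|v]; first by apply: ccontM; [exact: (smooth_cont sg)|exact: (smooth_cont (smooth_rotc _))].
  exists (fun t => (v%:C * - sl η) * (g t * rotc (- sl η) t) + (cderive v g t * rotc (- sl η) t)).
    apply: spnS; first by exists g.
    apply: spn1; exists (cderive v g) => //; left.
    by case: gP => [tg|->]; [exact: (test_cderive cptB1)|exact: cderive_step_test].
  move=> z _; apply: cder_eq (hd z v) _; rewrite addrC; congr (_ + _).
  have -> : cderive v (rotc (- sl η)) z = v%:C * (- sl η * rotc (- sl η) z); last by ring.
  have iv : is_derive (0 : R) (1 : R) (fun h : R => h *: v + z) v.
    have := is_deriveD (is_derM (is_derive_id (0 : R) (1 : R)) (is_derive_cst v (0 : R) (1 : R))) (is_derive_cst z (0 : R) (1 : R)).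
    by rewrite addr0 mulr0 add0r mul1r.
  have := is_cder_comp iv (is_cder_rotc (- sl η) _); rewrite scale0r add0r => -[d1 d2].
  have [_ <-] : cderivable (rotc (- sl η)) z v /\ cderive v (rotc (- sl η)) z = v%:C * (- sl η * rotc (- sl η) z).
    by apply: is_cderP; split; apply/is_derive_line.
  by [].
- move=> _ [g gP ->].
  case: gP => [tg|->].
    have [M [C [M0 C0 hM hC]]] := test_bd_supp tg.
    apply: (@rapid_rotc g M C) => // t tM; apply: hM; rewrite ltrNr in tM.
    by apply: lt_le_trans tM _; rewrite -normrN ler_norm.
  have [C hC] := step_bounded ([::] : seq R).
  by apply: (@rapid_rotc _ 2 C) => // t tM; rewrite step0// ltW.
Qed.

Lemma eb1 η t : - 1 <= t -> eb η t = rotc (- sl η) t.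
Proof. by move=> t1; rewrite /eb step1// mul1r. Qed.

Lemma schwartz_shift h (r : R) : schwartz h -> schwartz (fun t => h (t + r)).
Proof.
move=> [sh hh]; have AL (b w x : R) : (b *: w + x) + r = b *: id w + (x + r) by rewrite addrA.
have ca : continuous (fun x : R => x + r) by move=> x; apply: cvgD; [exact: cvg_id|exact: cvg_cst].
split; first by have := smooth_affine AL ca sh; rewrite preimage_setT.
move=> n vs; have [M hM] := hh n vs; exists ((1 + `|r|) ^+ n * M) => t.
rewrite -[fun t => h (t + r)]/(h \o (fun x : R => x + r)) (iter_derive_affine AL) map_id /=.
apply: le_trans (_ : (1 + `|r|) ^+ n * ((1 + `|t + r|) ^+ n * normc (iter_derive vs h (t + r))) <= _); last first.
  by rewrite ler_wpM2l ?hM// exprn_ge0// addr_ge0.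
rewrite mulrA -exprMn ler_wpM2r ?normc_ge0// lerXn2r ?nnegrE ?mulr_ge0 ?addr_ge0//.
have : `|t| <= `|t + r| + `|r| by rewrite -{1}(addrK r t) ler_normB.
have : 0 <= `|r| * `|t + r| by rewrite mulr_ge0.
by move=> h1 h2; rewrite mulrDr mulrDl mulrDl; lra.
Qed.

(** The difference is supported in [T <= - e], inside the region [T < 0] where [u] vanishes. [T] is
    the identity on the line and the time coordinate on the plane. *)
Lemma tempered_agree (V : normedModType R) (u : (V -> R[i]) -> R[i]) (T : V -> R) (e : R) phi psi :
  (forall z, - e < T z -> phi z = psi z) -> 0 < e -> continuous T ->
  (forall chi, schwartz chi -> Defs.support chi `<=` [set z | T z < 0] -> u chi = 0) ->
  tempered u -> schwartz phi -> schwartz psi -> u phi = u psi.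
Proof.
move=> h e0 cT van tu sp sq; apply/eqP; rewrite -subr_eq0 -(temperedB tu sp sq); apply/eqP.
have sB : schwartz (fun z => phi z - psi z).
  by have := schwartzD sp (schwartzZ (-1) sq); congr schwartz; apply/funext => z; rewrite mulN1r.
apply: van => //; apply: (@subset_trans _ [set z | T z <= - e]).
  apply: support_sub; first exact: (closed_comp (fun z _ => cT z) (@closed_le _ (- e))).
  by move=> z /negP; rewrite -ltNge => /h ->; rewrite subrr.
by move=> z /= Tz; apply: le_lt_trans Tz _; rewrite oppr_lt0.
Qed.

End HalfLine.

(** * The fundamental solution tested on exponentials in [t] *)

Section Fundamental.
Context {R : realType} (alpha tau : R) (S : (R * R -> R[i]) -> R[i]).
Context (hp : 0 < alpha < 1 /\ 0 < tau < 1) (hS : zener_fundamental_solution alpha tau S).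
Set Default Proof Using "All".
Implicit Types (h : R -> R[i]) (η : R).
Local Arguments cexp : simpl never.

(** The Laplace transform of [S] in [t], tested against [h] in [x]. *)
Definition Us η h : R[i] := S (fun z => h z.1 * eb η z.2).

Lemma S_temp : tempered S. Proof. by case: hS. Qed.

Lemma S_agree phi psi (e : R) : 0 < e -> (forall z : R * R, - e < z.2 -> phi z = psi z) ->
  schwartz phi -> schwartz psi -> S phi = S psi.
Proof.
move=> e0 h; have [tS vS _] := hS.
move=> sp sq; apply: (tempered_agree h e0 _ _ tS sp sq); first by move=> z; exact: cvg_snd.
by move=> chi; exact: (vanish_schwartz tS vS test_kap2 kap2_1 kap2_bounded cptB2).
Qed.

Lemma cderive_0 (V : normedModType R) (f : V -> R[i]) : cderive 0 f = fun=> 0.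
Proof.
have d0 (r : V -> R) z : 'D_0 r z = 0.
  rewrite /derive (_ : (fun _ => _) = fun=> 0); first exact: lim_cst.
  by apply/funext => a; rewrite /= scaler0 add0r subrr scaler0.
by apply/funext => z; rewrite /cderive !d0.
Qed.

(** [half_line_pairing] chooses among the values of [K] on all representatives; by [tempered_agree]
    these values coincide. *)
Lemma laplace_sl (K : (R -> R[i]) -> R[i]) (f : R -> R[i]) (e : R) phi :
  tempered K -> vanishes_on K [set t | t < 0] -> 0 < e -> schwartz phi ->
  (forall t, - e < t -> phi t = f t) -> half_line_pairing K f = K phi.
Proof.
move=> tK vK e0 sp hp'; apply: xget_unique; first by exists phi; split => //; exists e.
move=> _ [psi [sq [e' e'0 hq] ->]].
have m0 : 0 < Num.min e e' by rewrite lt_min e0.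
apply: (@tempered_agree R R K id (Num.min e e') psi phi _ m0 _ _ tK sq sp).
- move=> z; rewrite ltrNl lt_min => /andP[z1 z2]; rewrite hp' ?hq//; by rewrite ltrNl.
- by move=> z; exact: cvg_id.
- by move=> chi; exact: (vanish_schwartz tK vK test_kap kap1 kap_bounded cptB1).
Qed.

(** The equation tested on [h x * eb η t]. Two time derivatives give [s^2], and the convolution
    gives the Laplace transform of [K], because [exp (- s (t + r))] factors. *)
Lemma U_eq η h : schwartz h ->
  sl η ^+ 2 * Us η h - csym alpha tau η * Us η (cderive (1 : R) (cderive (1 : R) h)) = h 0.
Proof.
move=> sh; have [_ _ [K [tK vK lK] eqK]] := hS.
have sb := schwartz_eb η.
set h2 := cderive (1 : R) (cderive (1 : R) h).
have sh2 : schwartz h2 := schwartz_cderive (1 : R) (schwartz_cderive (1 : R) sh).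
have := eqK _ (schwartz_tensor sh sb).
rewrite /zener_operator /Defs.dirac0 /= [eb η 0]eb1 ?lerN10// /rotc mulr0 cexp0 mulr1 => <-.
congr (_ - _).
  rewrite /dist_derive opprK.
  have smh := schwartz_smooth sh; have smb := schwartz_smooth sb.
  have smb1 := smooth_cderive (1 : R) smb.
  have -> : cderive e_t (fun z : R * R => h z.1 * eb η z.2) = fun z => h z.1 * cderive (1 : R) (eb η) z.2.
    by rewrite cderive_tensor//; apply/funext => z; rewrite /= cderive_0 mul0r add0r.
  have -> : cderive e_t (fun z : R * R => h z.1 * cderive (1 : R) (eb η) z.2) = fun z => h z.1 * cderive (1 : R) (cderive (1 : R) (eb η)) z.2.
    by rewrite cderive_tensor//; apply/funext => z; rewrite /= cderive_0 mul0r add0r.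
  rewrite /Us -(temperedZ S_temp _ (schwartz_tensor sh sb)).
  apply: (@S_agree _ _ 1 ltr01).
  - move=> z z1; rewrite mulrCA; congr (_ * _).
    have U1 : open [set t : R | - 1 < t] by exact: open_gt.
    have e1 (t : R) : - 1 < t -> eb η t = rotc (- sl η) t by move=> /ltW; exact: eb1.
    have d1 (t : R) : cderive (1 : R) (rotc (- sl η)) t = - sl η * rotc (- sl η) t.
      by have [] := is_cderP (is_cder_rotc (- sl η) t).
    have e2 (t : R) : - 1 < t -> cderive (1 : R) (eb η) t = - sl η * rotc (- sl η) t.
      by move=> t1; rewrite (cderive_eq_on U1 e1).
    rewrite (cderive_eq_on U1 e2)// e1//.
    have [_ ->] := is_cderP (is_cderZ (- sl η) (is_cder_rotc (- sl η) z.2)).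
    by rewrite expr2; ring.
  - exact: schwartzZ (schwartz_tensor sh sb).
  - exact: (schwartz_tensor sh (schwartz_cderive (1 : R) (schwartz_cderive (1 : R) sb))).
rewrite (qsymV hp) -lK ?re_sl// /conv_t.
have -> : laplace K (sl η) = K (eb η).
  apply: (laplace_sl tK vK ltr01 sb) => t t1.
  by rewrite eb1 ?ltW// /rotc mulNr.
have -> : K (eb η) * Us η h2 = K (fun t => Us η h2 * eb η t) by rewrite (temperedZ tK _ sb) mulrC.
(* [r] and [t] are kept above [-1/2], so that [t + r > -1] and the cut-offs at [t], at [r] and at
   [t + r] all equal 1. *)
have e0 : 0 < 2^-1 :> R by rewrite invr_gt0.
apply/esym; apply: (laplace_sl tK vK e0 (schwartzZ _ sb)) => r r1.
rewrite /dist_derive opprK.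
have sbr := schwartz_shift r sb.
have smh := schwartz_smooth sh; have smb := schwartz_smooth sbr.
have -> : cderive e_x (fun z : R * R => h z.1 * eb η (z.2 + r)) = fun z => cderive (1 : R) h z.1 * eb η (z.2 + r).
  by rewrite (cderive_tensor e_x smh smb); apply/funext => z; rewrite /= cderive_0 mulr0 addr0.
have -> : cderive e_x (fun z : R * R => cderive (1 : R) h z.1 * eb η (z.2 + r)) = fun z => h2 z.1 * eb η (z.2 + r).
  by rewrite (cderive_tensor e_x (smooth_cderive (1 : R) smh) smb); apply/funext => z; rewrite /= cderive_0 mulr0 addr0.
rewrite /Us [LHS]mulrC -(temperedZ S_temp _ (schwartz_tensor sh2 sb)).
apply: (S_agree e0).
- move=> z z1; rewrite mulrCA; congr (_ * _).
  have b1 : - 1 <= r by lra.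
  have b2 : - 1 <= z.2 by lra.
  have b3 : - 1 <= z.2 + r by lra.
  by rewrite !eb1// /rotc -cexpD -mulrDr -rmorphD addrC.
- exact: schwartzZ (schwartz_tensor sh2 sb).
- exact: schwartz_tensor sh2 sbr.
Qed.

Lemma re_psym_gt0 η : 0 < re (psym alpha tau η).
Proof.
have [k k0 hk] := re_psym_ge hp; apply: lt_le_trans (hk η).
by rewrite mulr_gt0// powR_gt0// jb_gt0.
Qed.

(** The Schwartz function [g = (l / (2 s)) conv p h] solves [s^2 g - c g'' = h]; so [U_eq] applied
    to [g] returns [g 0], which is the integral on the right. *)
Lemma U_rep η h : test h ->
  Us η h = cint (@lebesgue_measure R) setT (fun x => St alpha tau x η * h x).
Proof.
move=> th; have p0 := re_psym_gt0 η; set p := psym alpha tau η in p0.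
set l := lsym alpha tau η; set s := sl η.
set a := 2^-1%:C * (sinv η * l).
pose g x := a * conv p h x.
have sc := schwartz_conv th p0.
have sg : schwartz g by exact: schwartzZ.
have s0 : s != 0 := sl_neq0 η; have q0 := qsym_neq0 hp η.
have l2 : l ^+ 2 = qsym alpha tau η := lsym_sqr hp η.
have dg (q : R -> R[i]) (x : R) : test q -> cderive (1 : R) (fun x => a * conv p q x) x = a * conv p (cderive (1 : R) q) x.
  by move=> tq; have [_ ->] := is_cderP (is_cderZ a (is_cder_conv x 1 tq p0)).
have th1 := test_cderive cptB1 (1 : R) th.
have g2 x : cderive (1 : R) (cderive (1 : R) g) x = p ^+ 2 * g x - qsym alpha tau η * h x.
  have -> : cderive (1 : R) g = fun x => a * conv p (cderive (1 : R) h) x by apply/funext => y; exact: dg.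
  rewrite dg// conv_ode// /g -l2 /a /p /psym -/s -/l /sinv -/s.
  have -> : (2^-1%:C : R[i]) = 2^-1 by rewrite fmorphV rmorph_nat.
  by field.
have hE x : h x = sl η ^+ 2 * g x + (- csym alpha tau η) * cderive (1 : R) (cderive (1 : R) g) x.
  rewrite g2 /p /psym exprMn l2 -/s /csym -/p.
  by field.
have sg2 : schwartz (cderive (1 : R) (cderive (1 : R) g)) by do 2 apply: schwartz_cderive.
have UL (q r : R -> R[i]) (b c : R[i]) : schwartz q -> schwartz r ->
   Us η (fun x => b * q x + c * r x) = b * Us η q + c * Us η r.
  move=> sq sr; have sb := schwartz_eb η.
  have tq := schwartz_tensor sq sb; have tr := schwartz_tensor sr sb.
  rewrite /Us -(temperedZ S_temp _ tq) -(temperedZ S_temp _ tr) -(temperedD S_temp (schwartzZ _ tq) (schwartzZ _ tr)).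
  by congr S; apply/funext => z; rewrite mulrDl !mulrA.
have -> : Us η h = Us η (fun x => sl η ^+ 2 * g x + (- csym alpha tau η) * cderive (1 : R) (cderive (1 : R) g) x).
  by congr Us; apply/funext.
rewrite UL// mulNr U_eq// /g /conv -cintZT; last exact: cintble_conv.
by apply: eq_cint => x _; rewrite add0r /St /ker -/p -/l /a !mulrA.
Qed.

End Fundamental.
Unset Default Proof Using.

(** * Riemann sums with explicit error *)

Section Riemann.
Context {R : realType}.
Notation mu := (@lebesgue_measure R).
Implicit Types (F : R -> R[i]).

Definition C1b F (K : R) := exists2 DF, (forall x, is_cder F x 1 (DF x)) /\ (forall x, ccont DF x)
  & forall x, normc (DF x) <= K.

Lemma C1b_cont F K x : C1b F K -> ccont F x.
Proof. by move=> [DF [h _] _]; exact: cder_cont (h x). Qed.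

Lemma cint_itv_le F (a b K : R) : a <= b -> (forall x, a <= x <= b -> ccont F x) ->
  (forall x, a <= x <= b -> normc (F x) <= K) -> normc (cint mu `[a, b]%classic F) <= K * (b - a).
Proof.
move=> ab cF hK.
have mi : measurable (`[a, b]%classic : set (mR R)) by exact: measurable_itv.
have fi : (mu `[a, b]%classic < +oo)%E by rewrite lebesgue_measure_itv /=; case: ifP => _; rewrite ?ltry.
have ic : mu.-integrable `[a, b]%classic (EFin \o (fun=> K)) by exact: (cintble_itv (fun x _ => ccont_cst K%:C x)).1.
apply: le_trans (cint_le mi (cintble_cmeas mi (cintble_itv cF)) ic _) _.
  by move=> x /=; rewrite in_itv /=; exact: hK.
have hK' x : a <= x <= b -> is_cder (fun y : R => K%:C * y%:C) x 1 K%:C.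
  by move=> _; have := is_cderZ K%:C (is_cder_id x); rewrite mulr1.
have := congr1 (@re R) (cFTC ab hK' (fun x _ => ccont_cst K%:C x)).
by rewrite reB !reMr /= -mulrBr => ->.
Qed.

Lemma C1b_lip F K a b : C1b F K -> a <= b -> normc (F b - F a) <= K * (b - a).
Proof.
move=> [DF [hF cF] bF] ab.
rewrite -(@cFTC R F DF _ _ ab (fun x _ => hF x) (fun x _ => cF x)).
exact: cint_itv_le.
Qed.

Lemma riemann_step F K a d : C1b F K -> 0 <= d -> 
  normc (cint mu `[a, a + d]%classic F - d%:C * F a) <= K * d ^+ 2.
Proof.
move=> hF d0; have cF x := C1b_cont x hF.
have ab : a <= a + d by rewrite lerDl.
have K0 : 0 <= K by have [DF _ b] := hF; exact: le_trans (normc_ge0 _) (b 0).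
have e : cint mu `[a, a + d]%classic (fun=> F a) = d%:C * F a.
  rewrite (@cFTC R (fun x => F a * x%:C) (fun=> F a) _ _ ab).
  - by rewrite -mulrBr -rmorphB addrAC subrr add0r mulrC.
  - by move=> x _; have := is_cderZ (F a) (is_cder_id x); rewrite mulr1.
  - by move=> x _; exact: ccont_cst.
have mi : measurable (`[a, a + d]%classic : set (mR R)) by exact: measurable_itv.
have cc x : a <= x <= a + d -> ccont (fun x => F x - F a) x.
  by move=> _; have := ccontD (cF x) (ccont_cst (- F a) x).
have cst_i : cintble mu `[a, a + d]%classic (fun=> F a) by apply: cintble_itv => x _; exact: ccont_cst.
have F_i : cintble mu `[a, a + d]%classic F by apply: cintble_itv => x _; exact: cF.
rewrite -e -(cintB mi F_i cst_i); apply: le_trans (cint_itv_le (K := K * d) ab cc _) _.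
  move=> x /andP[ax xd]; apply: le_trans (C1b_lip hF ax) _.
  by rewrite ler_wpM2l// lerBlDl.
by rewrite addrAC subrr add0r -mulrA expr2.
Qed.

Lemma riemann F K a d m : C1b F K -> 0 <= d ->
  normc (cint mu `[a, a + m%:R * d]%classic F - \sum_(k < m) d%:C * F (a + k%:R * d)) <= m%:R * (K * d ^+ 2).
Proof.
move=> hF d0; have cF x := C1b_cont x hF.
elim: m => [|m IH].
  rewrite !mul0r addr0 big_ord0 subr0.
  have -> : cint mu `[a, a]%classic F = 0.
    have h := @cFTC R (fun=> 0) (fun=> 0) a a (lexx _) (fun x _ => cder_cst 0 x 1) (fun x _ => ccont_cst 0 x).
    apply/eqP; rewrite -normc_eq0 -normr_le0 ger0_norm ?normc_ge0//.
    have [K1 hK1] : exists K1, forall x, a <= x <= a -> normc (F x) <= K1.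
      by exists (normc (F a)) => x; rewrite -eq_le => /eqP <-.
    by have := cint_itv_le (lexx a) (fun x _ => cF x) hK1; rewrite subrr mulr0.
  by rewrite normc0.
have am : a <= a + m%:R * d by rewrite lerDl mulr_ge0.
have am1 : a + m%:R * d <= a + m.+1%:R * d by rewrite lerD2l ler_wpM2r// ler_nat.
have [-> [-> ->]] := cint_itv_split am am1 (fun x _ => cF x).
rewrite big_ord_recr /=.
set A := cint mu _ F; set B := cint mu _ F; set s := \sum_(k < m) _; set t := _ * F _.
have -> : A + B - (s + t) = (A - s) + (B - t) by ring.
apply: le_trans (normcD _ _) _; rewrite -natr1 mulrDl mul1r lerD//.
have eB : a + m.+1%:R * d = a + m%:R * d + d by rewrite -natr1; ring.
rewrite /B eB; exact: riemann_step.
Qed.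

(** [2 (n + 1)^3] nodes at spacing [(n + 1)^(-2)] fill [[-(n + 1), n + 1]]: the discretization error
    [2 (n + 1)^3 * K (n + 1)^(-4)] and the tail both tend to 0. *)
Definition mesh (n : nat) : R := (n.+1%:R ^+ 2)^-1.
Definition node (n k : nat) : R := - n.+1%:R + k%:R * mesh n.
Definition rsum (F : R -> R[i]) (n : nat) : R[i] := \sum_(k < 2 * n.+1 ^ 3) (mesh n)%:C * F (node n k).
Definition wtail (n : nat) : R := (\int[mu]_x wt 1 x - \int[mu]_(x in `[(- n.+1%:R)%R, n.+1%:R]) wt 1 x)%R.

Lemma mesh_ge0 n : 0 <= mesh n. Proof. by rewrite invr_ge0 exprn_ge0. Qed.

Lemma mesh_end n : - n.+1%:R + (2 * n.+1 ^ 3)%:R * mesh n = n.+1%:R.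
Proof. by rewrite /mesh natrM natrX; have n0 : n.+1%:R != 0 :> R by []; field. Qed.

Lemma wtail_cvg : wtail n @[n --> \oo] --> (0 : R).
Proof.
have iw : cintble mu setT (fun x => (wt 1 x)%:C).
  have iw := @integrable_wt R 1 ltr01.
  have mw : measurable_fun setT (wt 1 : mR R -> R) by apply/measurable_EFinP; have /integrableP[] := iw.
  by apply: (cintble_dom measurableT (cmeasR mw) iw) => x _; rewrite normcR ger0_norm ?wt_ge0.
have [h _] := cint_limitT iw; rewrite /= in h.
rewrite -[X in _ --> X](subrr (\int[mu]_x wt 1 x)%R); apply: cvgB; first exact: cvg_cst.
by move: h; rewrite -(cvg_shiftS (fun n : nat => \int[mu]_(x in `[(- n%:R)%R, n%:R]) wt 1 x)%R).
Qed.

Lemma wtail_bound F n C : (forall x, ccont F x) -> (forall x, normc (F x) <= C * wt 1 x) ->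
  normc (cint mu setT F - cint mu `[- n.+1%:R, n.+1%:R]%classic F) <= C * wtail n.
Proof.
move=> cF hC; have iw := @integrable_wt R 1 ltr01.
have iF : cintble mu setT F := cintble_dom measurableT (cmeasT1 cF) (integrableZl measurableT C iw) (fun x _ => hC x).
have mi : measurable (`[- n.+1%:R, n.+1%:R]%classic : set (mR R)) by exact: measurable_itv.
have mi' := measurableC mi.
have sub (g : R -> R) : mu.-integrable setT (EFin \o g) ->
  (\int[mu]_x g x - \int[mu]_(x in `[(- n.+1%:R)%R, n.+1%:R]) g x = \int[mu]_(x in ~` `[(- n.+1%:R)%R, n.+1%:R]) g x)%R.
  move=> ig; apply/eqP; rewrite subr_eq addrC -Rintegral_setU//; last 2 first.
  - by rewrite setUv.
  - by apply/disj_set2P; rewrite setICr.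
  by rewrite setUv.
have e : cint mu setT F - cint mu `[- n.+1%:R, n.+1%:R]%classic F = cint mu (~` `[- n.+1%:R, n.+1%:R]%classic) F.
  by have [i1 i2] := iF; apply: cplxP; rewrite ?reB ?imB; exact: sub.
rewrite e /wtail (sub _ iw) -RintegralZl//; last exact: integrableS iw.
apply: (cint_le mi') => //; first exact: (cmeasS measurableT _ (cmeasT1 cF)).
have iw' := integrableS measurableT mi' (@subsetT _ _) iw.
exact: (integrableZl mi' C iw').
Qed.

Lemma rsum_bound F n C K : C1b F K -> (forall x, normc (F x) <= C * wt 1 x) ->
  normc (cint mu setT F - rsum F n) <= C * wtail n + K * (2 / n.+1%:R).
Proof.
move=> hF hC; have cF x := C1b_cont x hF.
have -> : cint mu setT F - rsum F n = (cint mu setT F - cint mu `[- n.+1%:R, n.+1%:R]%classic F)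
   + (cint mu `[- n.+1%:R, n.+1%:R]%classic F - rsum F n) by rewrite addrA subrK.
apply: le_trans (normcD _ _) _; rewrite lerD ?wtail_bound//.
have := riemann (- n.+1%:R) (2 * n.+1 ^ 3) hF (mesh_ge0 n); rewrite mesh_end => /le_trans; apply.
rewrite le_eqVlt; apply/orP; left; apply/eqP.
by rewrite /mesh natrM natrX; have n0 : n.+1%:R != 0 :> R by []; field.
Qed.

End Riemann.

(** * Partial transform in [t] of a test function of the plane *)

Section PartialFourier.
Context {R : realType}.
Notation mu := (@lebesgue_measure R).
Implicit Types (phi : R * R -> R[i]) (z v : R * R) (η x t : R).
Local Arguments cexp : simpl never.

(** Equal to [Ft phi x η * exp (- s t)] by [psiE], the integrand of the inversion formula for [phi].
    In the form of a convolution in [t] it commutes with derivatives in all directions. *)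
Definition psi phi η z : R[i] := cint mu setT (fun r => phi (z.1, z.2 + r) * rotc (sl η) r).
Definition Ft phi x η : R[i] := L (fun t => phi (x, t)) (sl η).

Lemma test2_bd phi : test phi -> exists M C : R,
  [/\ 0 <= M, 0 <= C, forall z, M < `|z| -> phi z = 0 & forall z, normc (phi z) <= C].
Proof.
move=> tq; have [_ [M hM]] := (testP cptB2 phi).1 tq.
have [C hC] := test_bound cptB2 tq.
exists `|M|, C; split => // [|x hx]; first exact: le_trans (normc_ge0 _) (hC 0).
by apply: hM; apply: le_lt_trans hx; exact: ler_norm.
Qed.

Lemma line_lin (a b : R) (h v z : R) : ((a, b + (h *: v + z)) : R * R) = h *: ((0, v) : R * R) + (a, b + z).
Proof. by apply/pair_equal_spec; split; rewrite /= ?mulr0 ?scaler0 ?add0r// addrCA. Qed.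

Lemma line_cont (a b : R) : continuous (fun t : R => ((a, b + t) : R * R)).
Proof. move=> t; have c1 : (fun=> a : R) x @[x --> t] --> a by exact: cvg_cst.
have c2 : b + x @[x --> t] --> b + t by apply: cvgD; [exact: cvg_cst|exact: cvg_id].
exact: (cvg_pair c1 c2). Qed.

Lemma smooth_line phi a b : smooth_on setT phi -> smooth_on setT (fun t => phi (a, b + t)).
Proof.
by move=> sp; have := smooth_affine (line_lin a b) (@line_cont a b) sp; rewrite preimage_setT.
Qed.

Lemma cderive_line phi a b (v : R) : cderive v (fun t => phi (a, b + t)) = fun t => cderive (0, v) phi (a, b + t).
Proof. exact: (cderive_affine (line_lin a b) phi v). Qed.

Lemma test_line phi a b : test phi -> test (fun t => phi (a, b + t)).
Proof.
move=> tp; have [M [C [M0 C0 hM hC]]] := test2_bd tp.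
apply/(testP cptB1); split; first exact: smooth_line tp.1.
exists (M + `|b|) => t tM; apply: hM; apply: lt_le_trans (norm_snd _); rewrite /=.
have : `|t| <= `|b + t| + `|b| by rewrite -{1}[t](addKr b) addrC (le_trans (ler_normD _ _))// normrN addrC.
lra.
Qed.

Lemma line0 phi a : (fun t => phi (a, 0 + t)) = (fun t => phi (a, t)).
Proof. by apply/funext => t; rewrite add0r. Qed.

Lemma test_slice phi x : test phi -> test (fun t => phi (x, t)).
Proof. by move=> tp; rewrite -line0; exact: test_line. Qed.

Lemma cderive_slice phi x : cderive (1 : R) (fun t => phi (x, t)) = fun t => cderive e_t phi (x, t).
Proof. by rewrite -line0 cderive_line; apply/funext => t; rewrite add0r. Qed.

Lemma iter_slice phi x n : iter_derive (nseq n (1 : R)) (fun t => phi (x, t)) = fun t => iter_derive (nseq n e_t) phi (x, t).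
Proof. by elim: n => //= n ->; exact: cderive_slice. Qed.

Lemma psiE phi η z : test phi -> psi phi η z = Ft phi z.1 η * rotc (- sl η) z.2.
Proof.
move=> tp; have tq := test_rotc (sl η) (test_slice z.1 tp).
have [_ e] := cint_shift z.2 (cintble_test tq).
rewrite /Ft /L -e mulrC -cintZT; last by have [] := cint_shift z.2 (cintble_test tq).
apply: eq_cint => r _; rewrite mulrCA [r + z.2]addrC; congr (_ * _).
by rewrite /rotc -cexpD; congr cexp; rewrite rmorphD; ring.
Qed.

Lemma Ft_decay phi n : test phi -> exists2 C, 0 <= C &
  forall x η, (1 + `|η|) ^+ n * normc (Ft phi x η) <= C.
Proof.
move=> tp; have tn := test_iter cptB2 (nseq n e_t) tp.
have [M [C [M0 C0 hM hC]]] := test2_bd tn.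
have ii := @itv_cst R (- M) M (C * expR M).
exists (2 ^+ n * (\int[mu]_x (if - M <= x <= M then C * expR M else 0)))%R.
  rewrite mulr_ge0 ?exprn_ge0//; apply: Rintegral_ge0 => x _; case: ifP => // _; by rewrite mulr_ge0// expR_ge0.
move=> x η; apply: (@le_trans _ _ ((2 * normc (sl η)) ^+ n * normc (Ft phi x η))).
  by rewrite ler_wpM2r ?normc_ge0// lerXn2r ?nnegrE ?addr_ge0// ?mulr_ge0 ?normc_ge0// normc_sl_wt.
rewrite exprMn -mulrA ler_wpM2l ?exprn_ge0// -normcX -normcM L_derivn; last exact: test_slice.
rewrite normcM normcX normcN normc1 expr1n mul1r iter_slice.
apply: (cint_le measurableT _ ii).
  by apply: cmeasT1 => t; exact: (smooth_cont (test_rotc _ (test_slice x tn)).1).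
move=> t _; rewrite normcM normc_rotc re_sl mul1r.
have sup : M < `|t| -> iter_derive (nseq n e_t) phi (x, t) = 0.
  by move=> tM; apply: hM; exact: lt_le_trans tM (norm_snd (x, t)).
case: ifP => [/andP[_ tM]|/negbT]; first by rewrite ler_pM ?normc_ge0 ?expR_ge0// ler_expR.
by rewrite -ler_norml -ltNge => /sup ->; rewrite normc0 mul0r.
Qed.

Lemma Ft_out phi : test phi -> exists2 M, 0 <= M & forall x η, M < `|x| -> Ft phi x η = 0.
Proof.
move=> tp; have [M [C [M0 C0 hM hC]]] := test2_bd tp; exists M => // x η xM.
rewrite /Ft /L (_ : (fun t => _) = fun=> 0); last first.
  by apply/funext => t; rewrite hM ?mul0r//; exact: lt_le_trans xM (norm_fst (x, t)).
by apply: cplxP; rewrite /= /Rintegral integral0.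
Qed.

Lemma is_cder_psi phi η z v : test phi -> is_cder (psi phi η) z v (psi (cderive v phi) η z).
Proof.
move=> tp; have tp' := test_cderive cptB2 v tp.
have [M [C [M0 C0 hM hC]]] := test2_bd tp'.
pose B := M + `|v| + `|z|.
have B0 : 0 <= B by rewrite !addr_ge0.
have cm (q : R * R -> R[i]) w : test q -> forall r, ccont (fun r => q (w.1, w.2 + r) * rotc (sl η) r) r.
  by move=> tq r; exact: (smooth_cont (test_rotc _ (test_line w.1 w.2 tq)).1).
apply: (@is_cder_cint R (R * R)%type _ _ mu setT (fun z r => phi (z.1, z.2 + r) * rotc (sl η) r)
  (fun z r => cderive v phi (z.1, z.2 + r) * rotc (sl η) r)
  (fun r => if - B <= r <= B then C * expR B else 0) z v 1 measurableT ltr01).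
- by move=> a _; exact: (cintble_test (test_rotc (sl η) (test_line _ _ tp))).
- move=> a r _ _; set w := a *: v + z.
  have := is_cder_shift (0, r) w v tp.1.
  have e (q : R * R -> R[i]) : (fun x : R * R => q (x + (0, r))) = fun x : R * R => q (x.1, x.2 + r).
    by apply/funext => x; congr q; apply/pair_equal_spec; split => //=; rewrite addr0.
  rewrite e => h; have := is_cderM h (cder_cst (rotc (sl η) r) w v).
  move=> h2; apply: cder_eq h2 _; rewrite mulr0 addr0; congr (_ * _).
  exact: (congr1 (fun f => f w) (e (cderive v phi))).
- exact: itv_cst.
- move=> a r a1 _; rewrite normcM normc_rotc re_sl mul1r.
  case: ifP => [/andP[_ rB]|/negbT]; first by rewrite ler_pM ?normc_ge0 ?expR_ge0// ler_expR.
  rewrite -ler_norml -ltNge => rB; rewrite hM ?normc0 ?mul0r//.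
  apply: lt_le_trans (norm_snd _); rewrite /=.
  set w2 := a * v.2 + z.2.
  have w2b : `|w2| <= `|v| + `|z|.
    rewrite (le_trans (ler_normD _ _))// lerD ?norm_snd// normrM -[leRHS]mul1r ler_pM ?norm_snd ?(ltW a1)//.
  have : `|r| <= `|w2 + r| + `|w2| by rewrite -{1}[r](addKr w2) addrC (le_trans (ler_normD _ _))// normrN addrC.
  move: rB; rewrite /B; lra.
Qed.

Lemma smooth_psi phi η : test phi -> smooth_on setT (psi phi η).
Proof.
move=> tp; apply: (@dstable_smooth _ _ setT [set f | exists2 q, test q & f = psi q η] _ openT); last by exists phi.
move=> _ [q tq ->]; split => [z _|v]; last first.
  exists (psi (cderive v q) η) => [|z _]; last exact: is_cder_psi.
  by apply: spn1; exists (cderive v q) => //; exact: (test_cderive cptB2).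
have -> : psi q η = fun z => cint mu setT (fun r => q (z.1, z.2 + r) * rotc (sl η) r) by [].
have [M [C [M0 C0 hM hC]]] := test2_bd tq.
pose B := M + `|z| + 1.
apply: (@cint_continuous R (R * R)%type _ _ mu setT (fun z r => q (z.1, z.2 + r) * rotc (sl η) r)
  (fun r => if - B <= r <= B then C * expR B else 0) z 1 measurableT ltr01).
- by move=> y _; apply: cmeasT1 => r; exact: (smooth_cont (test_rotc _ (test_line y.1 y.2 tq)).1).
- move=> r _; apply: ccontM; last exact: ccont_cst.
  have := is_cder_shift (0, r) z (0 : R * R) tq.1.
  have e : (fun x : R * R => q (x + (0, r))) = fun x : R * R => q (x.1, x.2 + r).
    by apply/funext => x; congr q; apply/pair_equal_spec; split => //=; rewrite addr0.
  rewrite -e => _; apply: (ccont_comp (f := q) (g := fun x : R * R => x + (0, r))); last exact: (smooth_cont tq.1).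
  by apply: cvgD; [exact: cvg_id|exact: cvg_cst].
- exact: itv_cst.
- move=> y r zy _; rewrite normcM normc_rotc re_sl mul1r.
  case: ifP => [/andP[_ rB]|/negbT]; first by rewrite ler_pM ?normc_ge0 ?expR_ge0// ler_expR.
  rewrite -ler_norml -ltNge => rB; rewrite hM ?normc0 ?mul0r//.
  apply: lt_le_trans (norm_snd _); rewrite /=.
  have yb : `|y.2| <= `|z| + 1.
    apply: le_trans (norm_snd y) _; rewrite -[y](subKr z) (le_trans (ler_normB _ _))// lerD2l; exact: ltW.
  have : `|r| <= `|y.2 + r| + `|y.2| by rewrite -{1}[r](addKr y.2) addrC (le_trans (ler_normD _ _))// normrN addrC.
  move: rB; rewrite /B; lra.
Qed.

Lemma iter_psi phi η vs : test phi -> iter_derive vs (psi phi η) = psi (iter_derive vs phi) η.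
Proof.
move=> tp; elim: vs => //= v vs ->; apply/funext => z.
by have [_ ->] := is_cderP (is_cder_psi η z v (test_iter cptB2 vs tp)).
Qed.

Lemma psi_inversion phi z : test phi -> cint mu setT (fun η => psi phi η z) = kF%:C * phi z.
Proof.
case: z => x t tp; have [_ <-] := fourier_inversion t (test_slice x tp).
by apply: eq_cint => η _; exact: psiE.
Qed.

Definition tphi phi : R * R -> R[i] := fun z => z.2%:C * phi z.

Lemma test_tphi phi : test phi -> test (tphi phi).
Proof.
move=> tp; have := testM cptB2 tp (smooth_snd (@smooth_id R)).
by congr test; apply/funext => z; rewrite /tphi mulrC.
Qed.

Lemma is_cder_Ft phi x η : test phi -> is_cder (Ft phi x) η (1 : R) (ci * Ft (tphi phi) x η).
Proof.
move=> tp; have tt := test_tphi tp; have [M [C [M0 C0 hM hC]]] := test2_bd tt.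
have -> : ci * Ft (tphi phi) x η = cint mu setT (fun t => ci * (tphi phi (x, t) * rotc (sl η) t)).
  by rewrite cintZT//; exact: (cintble_test (test_rotc (sl η) (test_slice x tt))).
apply: (@is_cder_cint R R _ _ mu setT (fun η t => phi (x, t) * rotc (sl η) t)
  (fun η t => ci * (tphi phi (x, t) * rotc (sl η) t))
  (fun r => if - M <= r <= M then C * expR M else 0) η (1 : R) 1 measurableT ltr01).
- by move=> h _; exact: (cintble_test (test_rotc _ (test_slice x tp))).
- move=> h t _ _; set y := _ + η.
  have := is_cderM (cder_cst (phi (x, t)) y (1 : R)) (cder_exp (is_cderM (is_cder_sl y) (cder_cst t%:C y (1 : R)))).
  by move=> H; apply: cder_eq H _; rewrite /tphi /rotc /=; ring.
- exact: itv_cst.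
- move=> h t _ _; rewrite normcM (normcM (tphi phi (x, t))) normc_rotc re_sl mul1r.
  have -> : normc ci = 1 :> R by rewrite normcEs /= expr0n expr1n add0r sqrtr1.
  have sup : M < `|t| -> tphi phi (x, t) = 0.
    by move=> tM; apply: hM; exact: lt_le_trans tM (norm_snd (x, t)).
  rewrite mul1r; case: ifP => [/andP[_ tM]|/negbT]; first by rewrite ler_pM ?normc_ge0 ?expR_ge0// ler_expR.
  by rewrite -ler_norml -ltNge => /sup ->; rewrite normc0 mul0r.
Qed.

Lemma Ft_cont phi x η : test phi -> ccont (Ft phi x) η.
Proof. by move=> tp; exact: cder_cont (is_cder_Ft x η tp). Qed.

Lemma Ft_wt phi : test phi -> exists2 C, 0 <= C & forall x η, normc (Ft phi x η) <= C * wt 1 η.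
Proof.
move=> tp; have [C C0 hC] := Ft_decay 2 tp; exists C => // x η.
exact: (@decay_wt R _ C η 1 (hC x η)).
Qed.

End PartialFourier.

(** * Convergence of the Riemann sums in Schwartz seminorms *)

Section Star.
Context {R : realType}.
Notation mu := (@lebesgue_measure R).
Implicit Types (phi : R * R -> R[i]) (z : R * R) (η x t : R).
Local Arguments cexp : simpl never.

Lemma is_cder_rot_eta t η : is_cder (fun η => rotc (- sl η) t) η (1 : R) (- ci * t%:C * rotc (- sl η) t).
Proof.
have := cder_exp (is_cderM (is_cderN (is_cder_sl η)) (cder_cst t%:C η (1 : R))).
by move=> H; apply: cder_eq H _; rewrite mulr0 addr0.
Qed.

(** [(1 + |t|) exp (- t)] dominates [exp (- s t)] together with its [η]-derivative; the growth at
    [-oo] is later removed by [step]. *)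
Lemma C1b_psi phi : test phi -> exists2 C, 0 <= C & forall z,
  C1b (fun η => psi phi η z) (C * ((1 + `|z.2|) * expR (- z.2))) /\
  forall η, normc (psi phi η z) <= C * ((1 + `|z.2|) * expR (- z.2)) * wt 1 η.
Proof.
move=> tp; have tt := test_tphi tp.
have [C C0 hC] := Ft_wt tp; have [D D0 hD] := Ft_wt tt.
have w1 η : wt 1 η <= 1 :> R.
  by rewrite /wt -[leRHS](powRr0 (1 + `|η|)) ler_powR ?one_norm_ge1// oppr_le0 addr_ge0.
exists (C + D); first exact: addr_ge0.
move=> z; have z0 := one_norm_ge1 (z.2).
have hF : (fun η => psi phi η z) = fun η => Ft phi z.1 η * rotc (- sl η) z.2.
  by apply/funext => η; exact: psiE.
split; last first.
  move=> η; rewrite psiE// normcM normc_rotc reN re_sl mulN1r.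
  rewrite mulrAC; apply: ler_pM; rewrite ?normc_ge0 ?expR_ge0//; last first.
    by rewrite ler_peMl ?expR_ge0.
  by apply: le_trans (hC _ _) _; rewrite ler_wpM2r ?wt_ge0// lerDl.
rewrite hF; exists (fun η => ci * Ft (tphi phi) z.1 η * rotc (- sl η) z.2 + Ft phi z.1 η * (- ci * z.2%:C * rotc (- sl η) z.2)).
  have cr η : ccont (fun η => rotc (- sl η) z.2) η := cder_cont (is_cder_rot_eta z.2 η).
  split=> η; first exact: is_cderM (is_cder_Ft _ _ tp) (is_cder_rot_eta _ _).
  apply: ccontD.
    by apply: ccontM; [apply: ccontM; [exact: ccont_cst|exact: Ft_cont]|exact: cr].
  by apply: ccontM; [exact: Ft_cont|apply: ccontM; [exact: ccont_cst|exact: cr]].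
move=> η; apply: le_trans (normcD _ _) _.
rewrite !normcM normc_rotc reN re_sl mulN1r normcN normc_ci normcR !mul1r.
have b1 : normc (Ft (tphi phi) z.1 η) <= D by apply: le_trans (hD _ _) _; rewrite ler_piMr.
have b2 : normc (Ft phi z.1 η) <= C by apply: le_trans (hC _ _) _; rewrite ler_piMr.
have e0 := expR_ge0 (- z.2); set E := expR _ in e0 *.
have -> : (C + D) * ((1 + `|z.2|) * E) = (D * E + C * (`|z.2| * E)) + (D * (`|z.2| * E) + C * E) by ring.
rewrite -[leLHS]addr0 lerD ?addr_ge0 ?mulr_ge0// lerD// ler_wpM2r// mulr_ge0//.
Qed.

(** The error of the Riemann sum in the inversion formula. Derivatives pass to [phi] ([iter_En]), so
    the pointwise bound [En_bound] controls every seminorm. *)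
Definition En phi (n : nat) z : R[i] := kF%:C * phi z - rsum (fun η => psi phi η z) n.
Definition en (n : nat) : R := wtail n + 2 / n.+1%:R.

Lemma en_cvg : en n @[n --> \oo] --> (0 : R).
Proof.
rewrite -(addr0 0); apply: cvgD; first exact: wtail_cvg.
by rewrite -(mulr0 2); apply: cvgM; [exact: cvg_cst|exact: cvg_harmonic].
Qed.

Lemma wtail_ge0 (n : nat) : 0 <= wtail n :> R.
Proof.
have := @wtail_bound R (fun=> 0) n 1 (fun x => ccont_cst 0 x) _; rewrite mul1r.
by move=> h; apply: le_trans (normc_ge0 _) (h _) => x; rewrite normc0 mul1r wt_ge0.
Qed.

Lemma en_ge0 n : 0 <= en n. Proof. by rewrite addr_ge0// ?wtail_ge0// divr_ge0. Qed.

Lemma En_bound phi : test phi -> exists2 C, 0 <= C & forall n z,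
  normc (En phi n z) <= C * en n * ((1 + `|z.2|) * expR (- z.2)).
Proof.
move=> tp; have [C C0 hC] := C1b_psi tp; exists C => // n z; have [h1 h2] := hC z.
rewrite /En -psi_inversion//; apply: le_trans (rsum_bound n h1 h2) _.
by rewrite /en -mulrDr mulrAC mulrA mulrAC.
Qed.

Lemma psi_out phi : test phi -> exists2 M, 0 <= M & forall η z, M < `|z.1| -> psi phi η z = 0 /\ phi z = 0.
Proof.
move=> tp; have [M M0 hM] := Ft_out tp; have [N [C [N0 C0 hN hC]]] := test2_bd tp.
exists (M + N) => [|η z zM]; first exact: addr_ge0.
split; first by rewrite psiE// hM ?mul0r//; apply: le_lt_trans zM; rewrite lerDl.
by apply: hN; apply: lt_le_trans (norm_fst z); apply: le_lt_trans zM; rewrite lerDr.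
Qed.

Lemma smooth_rsum phi n : test phi -> smooth_on setT (fun z => rsum (fun η => psi phi η z) n).
Proof.
by move=> tp; apply: (smooth_sum _ openT) => k; apply: (smoothZ _ openT); exact: smooth_psi.
Qed.

Lemma smooth_En phi n : test phi -> smooth_on setT (En phi n).
Proof.
move=> tp; have h1 := smoothZ kF%:C openT tp.1.
have h2 := smoothZ (-1) openT (smooth_rsum n tp).
have := smoothD openT h1 h2; congr smooth_on.
by apply/funext => z; rewrite /En mulN1r.
Qed.

Lemma iter_En phi n vs z : test phi -> iter_derive vs (En phi n) z = En (iter_derive vs phi) n z.
Proof.
move=> tp; have h1 := smoothZ kF%:C openT tp.1.
have h2 := smoothZ (-1) openT (smooth_rsum n tp).
have -> : En phi n = fun z => kF%:C * phi z + (-1) * rsum (fun η => psi phi η z) n.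
  by apply/funext => y; rewrite /En mulN1r.
rewrite (iter_deriveD vs h1 h2 openT (I : setT z)) (iter_deriveZ _ vs tp.1 openT (I : setT z)).
rewrite (iter_deriveZ (-1) vs (smooth_rsum n tp) openT (I : setT z)) mulN1r /En; congr (_ - _).
rewrite /rsum (iter_derive_sum _ vs openT _ (I : setT z)); last first.
  by move=> k; apply: (smoothZ _ openT); exact: smooth_psi.
apply: eq_bigr => k _; rewrite (iter_deriveZ _ vs (smooth_psi _ tp) openT (I : setT z)).
by rewrite iter_psi.
Qed.

Definition step2 z : R[i] := (step z.2)%:C.

Lemma smooth_step2 : smooth_on setT step2.
Proof. exact: (smooth_snd (@smooth_step R)). Qed.

Lemma step2_iter vs : exists2 C, 0 <= C & forall z, normc (iter_derive vs step2 z) <= C /\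
  (z.2 < - 2 -> iter_derive vs step2 z = 0).
Proof.
have [C hC] := step_bounded (map snd vs).
have e : iter_derive vs step2 = fun z : R * R => iter_derive (map snd vs) (fun t => (step t)%:C) z.2.
  exact: (iter_derive_affine (A := snd : R * R -> R) (L := snd) (fun h v z => snd_lin h v z)).
exists C => [|z]; first exact: le_trans (normc_ge0 _) (hC 0).
split; first by rewrite e hC.
move=> z2; have U2 : open [set z : R * R | z.2 < - 2].
  by apply: (open_comp (f := snd : R * R -> R) (D := [set t | t < -2])) => [x _|]; [exact: cvg_snd|exact: open_lt].
have z0 y : [set z : R * R | z.2 < - 2] y -> step2 y = 0 by move=> /ltW h; rewrite /step2 step0.
by rewrite (iter_derive_eq_on U2 z0)// iter_derive_cst; case: (vs).
Qed.

Lemma half_weight p : exists2 C : R, 0 <= C & forall t, - 2 <= t -> (1 + `|t|) ^+ p * expR (- t) <= C.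
Proof.
have h1 t : t < - 2 -> (if t < -2 then 0 else 1) = 0 :> R[i] by move=> ->.
have h2 (t : R) : normc (if t < -2 then 0 else 1 : R[i]) <= 1 by case: ifP; rewrite ?normc0 ?normc1.
have [C hC] := rapid_rotc 0 h1 h2 p.
have b t : - 2 <= t -> (1 + `|t|) ^+ p * expR (- t) <= C.
  move=> t2; have := hC t; rewrite ltNge t2 /= mul1r normc_rotc reN re_sl mulN1r; exact.
exists C => //; apply: le_trans (b 0 _); last by rewrite oppr_le0.
by rewrite mulr_ge0 ?expR_ge0 ?exprn_ge0// addr_ge0.
Qed.

(** [x] is bounded on the support and [step] restricts to [t >= -2], where [exp (- t)] absorbs every
    polynomial weight ([half_weight]). *)
Lemma En_seminorm phi p vs : test phi -> exists2 C, 0 <= C & forall n z,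
  (1 + `|z|) ^+ p * normc (iter_derive vs (fun z => step2 z * En phi n z) z) <= C * en n.
Proof.
move=> tp.
have term (ws ws' : seq (R * R)) : exists2 C, 0 <= C & forall n z,
    (1 + `|z|) ^+ p * normc (iter_derive ws step2 z * iter_derive ws' (En phi n) z) <= C * en n.
  have tw := test_iter cptB2 ws' tp.
  have [A A0 hA] := step2_iter ws; have [B B0 hB] := En_bound tw.
  have [M M0 hM] := psi_out tw; have [D D0 hD] := half_weight p.+1.
  exists (A * B * ((1 + M) ^+ p * D)); first by rewrite !mulr_ge0// exprn_ge0// addr_ge0.
  move=> n z; have [a1 a2] := hA z; rewrite iter_En//.
  have e0 := en_ge0 n.
  have r0 : 0 <= A * B * ((1 + M) ^+ p * D) * en n by rewrite !mulr_ge0// exprn_ge0// addr_ge0.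
  have [z2|z2] := ltP z.2 (- 2); first by rewrite a2// mul0r normc0 mulr0.
  have [z1|z1] := ltP M `|z.1|.
    rewrite /En /rsum big1 => [|k _]; last by rewrite (hM _ z z1).1 mulr0.
    by rewrite (hM 0 z z1).2 mulr0 subr0 mulr0 normc0 mulr0.
  rewrite normcM.
  apply: (@le_trans _ _ (((1 + M) ^+ p * (1 + `|z.2|) ^+ p) * (A * (B * en n * ((1 + `|z.2|) * expR (- z.2)))))).
    apply: ler_pM; rewrite ?exprn_ge0 ?addr_ge0 ?mulr_ge0 ?normc_ge0//.
      rewrite -exprMn lerXn2r ?nnegrE ?mulr_ge0 ?addr_ge0//; apply: le_trans (one_norm_prod z) _.
      by rewrite ler_wpM2r ?addr_ge0// lerD2l.
    by apply: ler_pM; rewrite ?normc_ge0.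
  have -> : (1 + M) ^+ p * (1 + `|z.2|) ^+ p * (A * (B * en n * ((1 + `|z.2|) * expR (- z.2))))
    = (A * B * (1 + M) ^+ p * en n) * ((1 + `|z.2|) ^+ p.+1 * expR (- z.2)) by rewrite exprS; ring.
  have -> : A * B * ((1 + M) ^+ p * D) * en n = (A * B * (1 + M) ^+ p * en n) * D by ring.
  by rewrite ler_wpM2l ?hD// !mulr_ge0// exprn_ge0// addr_ge0.
have [C C0 hC] : exists2 C, 0 <= C & forall n z, (1 + `|z|) ^+ p *
    (\sum_(q <- lsplit vs) normc (iter_derive q.1 step2 z * iter_derive q.2 (En phi n) z)) <= C * en n.
  elim: (lsplit vs) => [|q s [C C0 hC]]; first by exists 0 => // n z; rewrite big_nil mulr0 mul0r.
  have [D D0 hD] := term q.1 q.2; exists (D + C); first exact: addr_ge0.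
  by move=> n z; rewrite big_cons mulrDr mulrDl lerD.
exists C => // n z; rewrite (leibniz vs openT smooth_step2 (smooth_En n tp) (I : setT z)).
apply: le_trans (hC n z); rewrite ler_wpM2l ?normc_sum// exprn_ge0// addr_ge0.
Qed.

Lemma tempered_cvg0 (V : normedModType R) (u : (V -> R[i]) -> R[i]) (f : nat -> V -> R[i]) (e : nat -> R) :
  tempered u -> (forall n, schwartz (f n)) -> e n @[n --> \oo] --> (0 : R) -> (forall n, 0 <= e n) ->
  (forall p vs, exists2 C, 0 <= C & forall n (z : V), (1 + `|z|) ^+ p * normc (iter_derive vs (f n) z) <= C * e n) ->
  ccvg (fun n => u (f n)) 0.
Proof.
move=> [_ [C [ps hu]]] sf ce e0 hf.
have [D D0 hD] : exists2 D, 0 <= D & forall n p, p \in ps -> forall z : V,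
    (1 + `|z|) ^+ p.1 * normc (iter_derive p.2 (f n) z) <= D * e n.
  elim: (ps) => [|q s [D D0 hD]]; first by exists 0.
  have [A A0 hA] := hf q.1 q.2; exists (A + D); first exact: addr_ge0.
  move=> n p; rewrite inE => /orP[/eqP ->|ps'] z; rewrite mulrDl.
    by apply: le_trans (hA n z) _; rewrite lerDl mulr_ge0.
  by apply: le_trans (hD n p ps' z) _; rewrite lerDr mulr_ge0.
apply: (@ccvg_sqz R _ _ (fun n => C * (D * e n))).
  by move=> n; rewrite subr0; exact: hu (sf n) (hD n).
rewrite -(mulr0 C); apply: cvgM; first exact: cvg_cst.
by rewrite -(mulr0 D); apply: cvgM; first exact: cvg_cst.
Qed.

Lemma test_Ft phi η : test phi -> test (fun x => Ft phi x η).
Proof.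
move=> tp; have e : (fun x => Ft phi x η) = psi phi η \o (fun x : R => ((x, 0) : R * R)).
  by apply/funext => x; rewrite /= psiE//= /rotc mulr0 cexp0 mulr1.
have [M M0 hM] := Ft_out tp.
apply/(testP cptB1); split; last by exists M => x xM; exact: hM.
rewrite e; have AL (h : R) (v z : R) : ((h *: v + z, 0) : R * R) = h *: ((v, 0) : R * R) + (z, 0).
  by apply/pair_equal_spec; split; rewrite /= ?scaler0 ?addr0// mulr0.
have cA : continuous (fun x : R => ((x, 0) : R * R)).
  move=> x; have c1 : (y : R) @[y --> x] --> x by exact: cvg_id.
  have c2 : (fun=> 0 : R) y @[y --> x] --> (0 : R) by exact: cvg_cst.
  exact: (cvg_pair c1 c2).
by have := smooth_affine AL cA (smooth_psi η tp); rewrite preimage_setT.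
Qed.

Lemma schwartz_step_psi phi η : test phi -> schwartz (fun z => step2 z * psi phi η z) /\
  (fun z => step2 z * psi phi η z) = fun z => Ft phi z.1 η * eb η z.2.
Proof.
move=> tp; have e : (fun z => step2 z * psi phi η z) = fun z => Ft phi z.1 η * eb η z.2.
  by apply/funext => z; rewrite psiE// /step2 /eb mulrCA.
by rewrite e; split => //; apply: (schwartz_tensor (test_schwartz cptB1 (test_Ft η tp)) (schwartz_eb η)).
Qed.

End Star.

(** * The inversion formula for [S] *)

Section StarFormula.
Context {R : realType} (alpha tau : R) (S : (R * R -> R[i]) -> R[i]).
Context (hp : 0 < alpha < 1 /\ 0 < tau < 1) (hS : zener_fundamental_solution alpha tau S).
Set Default Proof Using "All".
Notation mu := (@lebesgue_measure R).
Implicit Types (phi : R * R -> R[i]) (z : R * R) (η x t : R).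
Local Arguments cexp : simpl never.

Definition Gs phi η : R[i] := cint mu setT (fun x => St alpha tau x η * Ft phi x η).

Lemma powR_jb_le1 η m : 0 <= m -> jb η `^ (- m) <= 1 :> R.
Proof. by move=> m0; rewrite -[leRHS](powRr0 (jb η)) ler_powR ?jb_ge1// oppr_le0. Qed.

Lemma sym_bounded j m a : 0 <= m -> sym alpha j m a -> exists2 C, 0 <= C & forall x η, normc (a x η) <= C.
Proof.
move=> m0 ha; have [C C0 hC] := sym_bound hp ha; exists C => // x η.
by apply: le_trans (hC x η) _; rewrite ler_piMr// powR_jb_le1.
Qed.

Lemma sym_contx j m a x η : sym alpha j m a -> ccont (fun x => a x η) x.
Proof. by move=> ha; apply: (@ccont_pair1 R a x η); exact: (sym_cont hp (x, η) ha). Qed.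

Lemma Ftx_cont phi x η : test phi -> ccont (fun x => Ft phi x η) x.
Proof. by move=> tp; exact: (smooth_cont (test_Ft η tp).1). Qed.

Lemma sym_Ft_cintble j m a phi η : 0 <= m -> sym alpha j m a -> test phi ->
  cintble mu setT (fun x => a x η * Ft phi x η).
Proof.
move=> m0 ha tp; have [C C0 hC] := sym_bounded m0 ha.
have [M M0 hM] := Ft_out tp; have [D D0 hD] := Ft_wt tp.
apply: (@cintble_cpt R _ M (C * (D * wt 1 η))) => [x|x xM|x].
- by apply: ccontM; [exact: (sym_contx _ _ ha)|exact: Ftx_cont].
- by rewrite (hM _ _ xM) mulr0.
- by rewrite normcM ler_pM ?normc_ge0.
Qed.

Lemma sym_Ft_bound j m a phi : 0 <= m -> sym alpha j m a -> test phi ->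
  exists2 C, 0 <= C & forall η, normc (cint mu setT (fun x => a x η * Ft phi x η)) <= C * wt 1 η.
Proof.
move=> m0 ha tp; have [C C0 hC] := sym_bounded m0 ha.
have [M M0 hM] := Ft_out tp; have [D D0 hD] := Ft_wt tp.
have ii c := @itv_cst R (- M) M c.
pose I1 := (\int[mu]_x (if - M <= x <= M then 1 else 0 : R))%R.
have I0 : 0 <= I1 by apply: Rintegral_ge0 => x _; case: ifP.
exists (C * D * I1) => [|η]; first by rewrite !mulr_ge0.
have -> : C * D * I1 * wt 1 η = (C * D * wt 1 η) * I1 by ring.
rewrite /I1 -RintegralZl//.
apply: (cint_le measurableT).
- exact: (cintble_cmeas measurableT (sym_Ft_cintble η m0 ha tp)).
- exact: (integrableZl measurableT _ (ii 1)).
- move=> x _; rewrite normcM; case: ifP => [_|/negbT].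
    by rewrite mulr1 -mulrA ler_pM ?normc_ge0.
  by rewrite -ler_norml -ltNge => /hM ->; rewrite normc0 mulr0 mulr0.
Qed.

Lemma is_cder_symFt j m a a' phi η : 0 <= m -> (forall x η, is_cder (a x) η (1 : R) (a' x η)) ->
  sym alpha j m a -> sym alpha j m a' -> test phi ->
  is_cder (fun η => cint mu setT (fun x => a x η * Ft phi x η)) η (1 : R)
    (cint mu setT (fun x => a' x η * Ft phi x η + a x η * (ci * Ft (tphi phi) x η))).
Proof.
move=> m0 da ha ha' tp; have tt := test_tphi tp.
have [C C0 hC] := sym_bounded m0 ha; have [C' C'0 hC'] := sym_bounded m0 ha'.
have [M M0 hM] := Ft_out tp; have [M' M'0 hM'] := Ft_out tt.
have [D D0 hD] := Ft_wt tp; have [D' D'0 hD'] := Ft_wt tt.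
have w1 y : wt 1 y <= 1 :> R.
  by rewrite /wt -[leRHS](powRr0 (1 + `|y|)) ler_powR ?one_norm_ge1// oppr_le0 addr_ge0.
apply: (@is_cder_cint R R _ _ mu setT (fun η x => a x η * Ft phi x η)
  (fun η x => a' x η * Ft phi x η + a x η * (ci * Ft (tphi phi) x η))
  (fun x => if - (M + M') <= x <= M + M' then C' * D + C * D' else 0) η (1 : R) 1 measurableT ltr01).
- by move=> h _; exact: (sym_Ft_cintble _ m0 ha tp).
- by move=> h x _ _; exact: (is_cderM (da x _) (is_cder_Ft x _ tp)).
- exact: itv_cst.
- move=> h x _ _; set y := _ + η; case: ifP => [_|/negbT].
    apply: le_trans (normcD _ _) _; rewrite !normcM normc_ci mul1r lerD// ler_pM ?normc_ge0//.
      by apply: le_trans (hD _ _) _; rewrite ler_piMr.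
    by apply: le_trans (hD' _ _) _; rewrite ler_piMr.
  rewrite -ler_norml -ltNge => xM.
  have x1 : M < `|x| by apply: le_lt_trans xM; rewrite lerDl.
  have x2 : M' < `|x| by apply: le_lt_trans xM; rewrite lerDr.
  by rewrite (hM _ _ x1) (hM' _ _ x2) !mulr0 addr0 normc0.
Qed.

Lemma C1b_Gs phi : test phi -> exists2 C, 0 <= C &
  C1b (Gs phi) C /\ forall η, normc (Gs phi η) <= C * wt 1 η.
Proof.
move=> tp; have tt := test_tphi tp; have ttt := test_tphi tt.
have rho0 : 1 <= 1 + (1 - alpha) by case: hp => /andP[_ a1' _]; rewrite lerDl subr_ge0 ltW.
(* Two symbol derivatives: [C1b] asks for a continuous derivative, and its continuity is read off
   from the derivative [a2] of [a1]. *)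
have h2 := sym_St hp 2; have [_ [a1 d1 s1]] := h2; have [_ [a2 d2 s2]] := s1.
have s0 : sym alpha 0 1 (St alpha tau) := symS hp (symS hp h2).
have s1' : sym alpha 0 1 a1 := symS hp (sym_le (j := 1) hp rho0 s1).
have s2' : sym alpha 0 1 a2.
  by apply: (sym_le (j := 0) hp _ s2); apply: (le_trans rho0); rewrite lerDl -(lerD2l 1) addr0.
have m1 : 0 <= 1 :> R by [].
have [A A0 hA] := sym_Ft_bound m1 s0 tp.
have [B B0 hB] := sym_Ft_bound m1 s1' tp.
have [D D0 hD] := sym_Ft_bound m1 s0 tt.
have w1 y : wt 1 y <= 1 :> R.
  by rewrite /wt -[leRHS](powRr0 (1 + `|y|)) ler_powR ?one_norm_ge1// oppr_le0 addr_ge0.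
exists (A + (B + D)); first by rewrite !addr_ge0.
split; last first.
  by move=> η; apply: le_trans (hA η) _; rewrite ler_wpM2r ?wt_ge0// lerDl addr_ge0.
exists (fun η => cint mu setT (fun x => a1 x η * Ft phi x η) + ci * cint mu setT (fun x => St alpha tau x η * Ft (tphi phi) x η)).
  split=> η; last first.
    apply: ccontD; first exact: cder_cont (is_cder_symFt η m1 d2 s1' s2' tp).
    by apply: ccontM; [exact: ccont_cst|exact: cder_cont (is_cder_symFt η m1 d1 s0 s1' tt)].
  apply: cder_eq (is_cder_symFt η m1 d1 s0 s1' tp) _.
  rewrite -cintZT; last exact: sym_Ft_cintble m1 s0 tt.
  rewrite -cintDT; last 2 first.
  - exact: sym_Ft_cintble m1 s1' tp.
  - by apply: cintbleZT; exact: sym_Ft_cintble m1 s0 tt.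
  by apply: eq_cint => x _; rewrite [ci * (_ * _)]mulrCA.
move=> η; apply: le_trans (normcD _ _) _; rewrite normcM normc_ci mul1r.
rewrite -[leLHS]add0r lerD// lerD//.
  by apply: le_trans (hB η) _; rewrite ler_piMr.
by apply: le_trans (hD η) _; rewrite ler_piMr.
Qed.

Lemma tempered_sum (f : nat -> R * R -> R[i]) (c : R[i]) n : (forall k, schwartz (f k)) ->
  S (fun z => \sum_(k < n) c * f k z) = \sum_(k < n) c * S (f k) /\ schwartz (fun z => \sum_(k < n) c * f k z).
Proof.
move=> sf; have tS := S_temp hp hS; elim: n => [|n [IH1 IH2]].
  have e : (fun z => \sum_(k < 0) c * f k z) = fun=> 0 by apply/funext => z; rewrite big_ord0.
  by rewrite e big_ord0 (tempered0 tS); split; [reflexivity|exact: schwartz0].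
have e : (fun z => \sum_(k < n.+1) c * f k z) = fun z => (\sum_(k < n) c * f k z) + c * f n z.
  by apply/funext => z; rewrite big_ord_recr.
have sc := schwartzZ c (sf n).
rewrite e (temperedD tS IH2 sc) IH1 (temperedZ tS c (sf n)) big_ord_recr; split => //.
exact: schwartzD IH2 sc.
Qed.

(** Each summand of the Riemann sum of [phi] is a product treated by [U_rep], so [S] maps it to a
    Riemann sum of [Gs phi]. The errors tend to 0 in every seminorm, hence under [S]. *)
Theorem star phi : test phi -> kF%:C * S phi = cint mu setT (Gs phi).
Proof.
move=> tp; have tS := S_temp hp hS.
have [C C0 [h1 h2]] := C1b_Gs tp.
have sp := test_schwartz cptB2 tp.
pose P k z := step2 z * psi phi k z.
have sP k : schwartz (P k) := (schwartz_step_psi k tp).1.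
have SP k : S (P k) = Gs phi k.
  by rewrite /P (schwartz_step_psi k tp).2 -/(Us S k (fun x => Ft phi x k)) (U_rep hp hS _ (test_Ft k tp)).
have ss : schwartz (fun z => step2 z * phi z).
  have := testM cptB2 tp smooth_step2 => /(test_schwartz cptB2).
  by congr schwartz; apply/funext => z; rewrite mulrC.
have Sphi : S (fun z => step2 z * phi z) = S phi.
  by apply: (S_agree hp hS ltr01 _ ss sp) => z z1; rewrite /step2 step1 ?mul1r// ltW.
have lim1 : ccvg (fun n => rsum (Gs phi) n) (cint mu setT (Gs phi)).
  apply: (@ccvg_sqz R _ _ (fun n => C * en n)).
    move=> n; rewrite normc_distC; apply: le_trans (rsum_bound n h1 h2) _.
    by rewrite -mulrDr.
  by rewrite -(mulr0 C); apply: cvgM; [exact: cvg_cst|exact: en_cvg].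
have sE n : schwartz (fun z => step2 z * En phi n z) /\
   S (fun z => step2 z * En phi n z) = kF%:C * S phi - rsum (Gs phi) n.
  have [t1 t2] := tempered_sum (mesh n)%:C (2 * n.+1 ^ 3) (fun k => sP (node n k)).
  have e : (fun z => step2 z * En phi n z) = fun z => kF%:C * (step2 z * phi z) - \sum_(k < 2 * n.+1 ^ 3) (mesh n)%:C * P (node n k) z.
    apply/funext => z; rewrite /En /rsum mulrBr mulrCA mulr_sumr; congr (_ - _).
    by apply: eq_bigr => k _; rewrite mulrCA.
  have s3 := schwartzZ kF%:C ss.
  rewrite e (temperedB tS s3 t2) (temperedZ tS _ ss) Sphi t1; split.
    have := schwartzD s3 (schwartzZ (-1) t2); congr schwartz.
    by apply/funext => z; rewrite mulN1r.
  by congr (_ - _); apply: eq_bigr => k _; rewrite SP.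
have lim2 : ccvg (fun n => kF%:C * S phi - rsum (Gs phi) n) 0.
  have := tempered_cvg0 tS (fun n => (sE n).1) (@en_cvg R) (@en_ge0 R) (fun p vs => En_seminorm p vs tp).
  by congr ccvg; apply/funext => n; exact: (sE n).2.
have h := ccvgD lim1 lim2; rewrite addr0 in h; apply: (ccvg_unique _ h).
have -> : (fun n => rsum (Gs phi) n + (kF%:C * S phi - rsum (Gs phi) n)) = fun=> kF%:C * S phi.
  by apply/funext => n; rewrite addrC subrK.
exact: ccvg_cst.
Qed.

End StarFormula.
Unset Default Proof Using.

Section HalfLines.
Context {R : realType}.
Notation mu := (@lebesgue_measure R).

Lemma Rint_oppr (g : R -> R) (n : nat) : continuous g ->
  (\int[mu]_(x in `[(- n%:R)%R, 0%R]) g x = \int[mu]_(x in `[0%R, n%:R]) g (- x))%R.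
Proof.
move=> cg; rewrite /Rintegral; congr fine; rewrite -{1}[0]oppr0.
apply: (integration_by_substitution_oppr (ler0n _ n)).
exact: continuous_subspaceT.
Qed.

Lemma cintT_half (f : R -> R[i]) (C : R) : (forall x, ccont f x) -> (forall x, normc (f x) <= C * wt 1 x) ->
  cint mu setT f = cint mu `[0, +oo[%classic f + cint mu `[0, +oo[%classic (fun x => f (- x)).
Proof.
move=> cf hC; have iw := integrableZl measurableT C (@integrable_wt R 1 ltr01).
have cg x : ccont (fun x => f (- x)) x.
  by apply: (ccont_comp (f := f) (g := fun x : R => - x)) => //; exact: opp_continuous.
have i1 : cintble mu setT f := cintble_dom measurableT (cmeasT1 cf) iw (fun x _ => hC x).
have i2 : cintble mu setT (fun x => f (- x)).
  by apply: (cintble_dom measurableT (cmeasT1 cg) iw) => x _; have := hC (- x); rewrite /wt normrN.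
have mi : measurable (`[0, +oo[%classic : set (mR R)) by exact: measurable_itv.
have sub (h : R -> R[i]) : cintble mu setT h -> cintble mu `[0, +oo[%classic h.
  by move=> [j1 j2]; split; [exact: (integrableS measurableT mi (@subsetT _ _) j1)|exact: (integrableS measurableT mi (@subsetT _ _) j2)].
have l1 := cint_limit_half (sub _ i1); have l2 := cint_limit_half (sub _ i2).
apply: (ccvg_unique (cint_limitT i1)); have := ccvgD l1 l2; congr ccvg; apply/funext => n.
have n0 : - n%:R <= (0 : R) by rewrite oppr_le0.
have [-> [-> ->]] := @cint_itv_split R f (- n%:R) 0 n%:R n0 (ler0n _ _) (fun x _ => cf x).
rewrite !add0r addrC; congr (_ + _).
by apply: cplxP => /=; apply/esym; apply: Rint_oppr => x; have [] := cf x.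
Qed.

End HalfLines.

(** * Rotation of the contour and positivity of the jump *)

Section Contour.
Context {R : realType} (alpha tau : R).
Context (hp : 0 < alpha < 1 /\ 0 < tau < 1).
Set Default Proof Using "All".
Let alpha_gt0 : 0 < alpha. Proof. by case: hp => /andP[]. Qed.
Let alpha_lt1 : alpha < 1. Proof. by case: hp => /andP[]. Qed.
Notation mu := (@lebesgue_measure R).
Implicit Types (s : R[i]) (B : R -> R[i]).
Local Arguments cexp : simpl never.
Local Arguments clog : simpl never.
Local Arguments cpow : simpl never.

(** The variable part of [l^2 = tau + (1 - tau) msym], off the line [Re s = 1]. *)
Definition msym s : R[i] := (1 + cpow s alpha)^-1.
Definition eith (th : R) : R[i] := cexp (ci * th%:C).
(** Half-lines issued from 1: [th = pi / 2] is the upper half of the line [Re s = 1], and [th = pi]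
    follows the real axis through the branch point 0 onto the cut. *)
Definition ray (th r : R) : R[i] := 1 + r%:C * eith th.

Lemma eithE th : eith th = cos th +i* sin th.
Proof.
have e : ci * th%:C = 0 +i* th by apply: cplxP; rewrite ?reM ?imM /=; ring.
by rewrite /eith e /cexp /= expR0 !mul1r.
Qed.

Lemma normc_eith th : normc (eith th) = 1.
Proof. by rewrite normc_cexp reM /= mul0r mulr0 subr0 expR0. Qed.

Lemma re_ray th r : re (ray th r) = 1 + r * cos th.
Proof. by rewrite reD reMr eithE. Qed.

Lemma im_ray th r : im (ray th r) = r * sin th.
Proof. by rewrite imD imMr eithE /= add0r. Qed.

Lemma slit_ray th r : 0 < sin th -> slit (ray th r).
Proof.
move=> s0; have [r0|r0] := eqVneq r 0.
  by apply: slit_re; rewrite re_ray r0 mul0r addr0 ltr01.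
by apply: slit_im; rewrite im_ray mulf_neq0// gt_eqF.
Qed.

(** Multiplication by [exp (- i th)] lays the ray on the horizontal line of height [- sin th]. *)
Lemma ray_ge th r : 0 <= r -> 0 < sin th -> sin th <= normc (ray th r).
Proof.
move=> r0 s0; have e : (cos th +i* - sin th) * ray th r = (cos th + r) +i* (- sin th).
  have := cos2Dsin2 th => h; rewrite /ray eithE.
  apply: cplxP; rewrite ?reM ?imM ?reD ?imD ?reMr ?imMr /=; last by ring.
  transitivity (cos th + r * (cos th ^+ 2 + sin th ^+ 2)); first by ring.
  by rewrite h mulr1.
have n1 : normc (cos th +i* - sin th) = 1.
  by rewrite normcEs /= sqrrN cos2Dsin2 sqrtr1.
have e2 : normc ((cos th + r) +i* (- sin th)) = normc (ray th r) by rewrite -e normcM n1 mul1r.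
by have := normc_im ((cos th + r) +i* (- sin th)); rewrite e2 [im _]/= normrN gtr0_norm.
Qed.

Lemma arg_ge0 s : slit s -> 0 <= im s -> 0 <= im (clog s).
Proof.
move=> ss s0; rewrite /clog [leRHS]/= mulr_ge0// -(@atan0 R) le_atan// divr_ge0// ltW//.
Qed.

Lemma sin_api : 0 < sin (alpha * pi).
Proof.
apply: sin_gt0_pi; rewrite mulr_gt0 ?pi_gt0//=.
by rewrite gtr_pMl ?pi_gt0.
Qed.

(** [|1 + N exp (i b)|^2 = (N + cos b)^2 + sin^2 b] with [0 <= b <= alpha pi < pi]. For
    [b <= pi / 2] this is at least 1; beyond, [sin b >= sin (alpha pi)]. So [msym] has no pole above
    the real axis. *)
Lemma msym_lower : exists2 d : R, 0 < d & forall s, slit s -> 0 <= im s -> d <= normc (1 + cpow s alpha).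
Proof.
have s0 := sin_api; exists (sin (alpha * pi)) => // s ss is0.
have a0 := arg_ge0 ss is0; have /andP[_ a1] := arg_bound s.
rewrite (cpow_arg hp ss); set N := normc s `^ alpha; set b := alpha * im _.
have N0 : 0 <= N by exact: powR_ge0.
have b0 : 0 <= b by rewrite mulr_ge0// ltW.
have b1 : b <= alpha * pi by rewrite ler_wpM2l// ltW.
have ap : alpha * pi < pi by rewrite gtr_pMl ?pi_gt0.
have s1 : sin (alpha * pi) <= 1 by exact: sin_le1.
have e : normc (1 + (N * cos b +i* (N * sin b))) ^+ 2 = (N + cos b) ^+ 2 + (1 - cos b ^+ 2).
  rewrite normc_sqr reD imD /= add0r; have := cos2Dsin2 b => h.
  have -> : (1 + N * cos b) ^+ 2 + (N * sin b) ^+ 2 = 1 + 2 * (N * cos b) + N ^+ 2 * (cos b ^+ 2 + sin b ^+ 2) by ring.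
  by rewrite h; ring.
rewrite -(@ler_pXn2r _ 2%N) ?nnegrE ?normc_ge0 ?(ltW s0)// e.
have [bp|bp] := leP b (pi / 2).
  have c0 : 0 <= cos b by apply: cos_ge0_pihalf; rewrite bp andbT; apply: le_trans b0; rewrite oppr_le0 divr_ge0// pi_ge0.
  have : sin (alpha * pi) ^+ 2 <= 1 by rewrite expr_le1// ltW.
  by have := mulr_ge0 N0 c0; have := sqr_ge0 N; rewrite sqrrD => *; lra.
have sb : sin (alpha * pi) <= sin b.
  rewrite -[sin b]cosBpihalf -[sin (alpha * pi)]cosBpihalf leNgt; apply/negP.
  by rewrite ltr_cos ?in_itv /=; [move=> ?; lra|apply/andP; split; lra|apply/andP; split; lra].
have : sin (alpha * pi) ^+ 2 <= sin b ^+ 2 by rewrite lerXn2r ?nnegrE ?(ltW s0)// (le_trans (ltW s0)).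
by have := cos2Dsin2 b; have := sqr_ge0 (N + cos b); lra.
Qed.

Lemma iter_supp B n : (forall t, t < 0 -> B t = 0) -> forall t, t < 0 -> iter_derive (nseq n (1 : R)) B t = 0.
Proof.
move=> h t t0; have U0 : open [set t : R | t < 0] by exact: open_lt.
by rewrite (iter_derive_eq_on U0 h)// iter_derive_cst; case: n.
Qed.

(** [B] lives on [t >= 0], where [|exp (s t)| <= exp M] on its support however far to the left [s]
    lies. *)
Lemma L_half_bound B : test B -> (forall t, t < 0 -> B t = 0) ->
  exists2 C : R, 0 <= C & forall s, re s <= 1 -> normc (L B s) <= C.
Proof.
move=> tB B0; have [M [C [M0 C0 hM hC]]] := test_bd_supp tB.
have ii := @itv_cst R (- M) M (C * expR M).
exists (\int[mu]_x (if - M <= x <= M then C * expR M else 0))%R.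
  by apply: Rintegral_ge0 => x _; case: ifP => // _; rewrite mulr_ge0// expR_ge0.
move=> s s1; apply: (cint_le measurableT _ ii).
  by apply: cmeasT1 => x; exact: (smooth_cont (test_rotc s tB).1).
move=> t _; rewrite normcM normc_rotc; have [t0|t0] := ltP t 0.
  rewrite B0// normc0 mul0r; case: ifP => // _; by rewrite mulr_ge0// expR_ge0.
case: ifP => [/andP[_ tM]|/negbT].
  rewrite ler_pM ?normc_ge0 ?expR_ge0// ler_expR; apply: le_trans tM.
  by rewrite ler_piMl.
by rewrite -ler_norml -ltNge => /hM ->; rewrite normc0 mul0r.
Qed.

Lemma L_half_decay B n : test B -> (forall t, t < 0 -> B t = 0) ->
  exists2 C : R, 0 <= C & forall s, re s <= 1 -> (1 + normc s) ^+ n * normc (L B s) <= C.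
Proof.
move=> tB B0; have [C C0 hC] := L_half_bound tB B0.
have [D D0 hD] := L_half_bound (test_iter cptB1 (nseq n (1 : R)) tB) (iter_supp n B0).
exists (2 ^+ n * (C + D)) => [|s s1]; first by rewrite mulr_ge0 ?exprn_ge0 ?addr_ge0.
have eD : normc s ^+ n * normc (L B s) <= D.
  by rewrite -normcX -normcM L_derivn// normcM normcX normcN normc1 expr1n mul1r hD.
have b : (1 + normc s) ^+ n <= 2 ^+ n * (1 + normc s ^+ n).
  have n0 := normc_ge0 s.
  have [h|h] := leP (normc s) 1.
    apply: (@le_trans _ _ (2 ^+ n)); first by rewrite lerXn2r ?nnegrE ?addr_ge0//; lra.
    by rewrite ler_peMr ?exprn_ge0// lerDl exprn_ge0.
  apply: (@le_trans _ _ ((2 * normc s) ^+ n)); first by rewrite lerXn2r ?nnegrE ?addr_ge0 ?mulr_ge0//; lra.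
  by rewrite exprMn ler_wpM2l ?exprn_ge0// lerDr.
apply: le_trans (_ : 2 ^+ n * (1 + normc s ^+ n) * normc (L B s) <= _).
  by rewrite ler_wpM2r ?normc_ge0.
by rewrite -mulrA ler_wpM2l ?exprn_ge0// mulrDl mul1r lerD ?hC.
Qed.

Definition Phi B s : R[i] := L B s * msym s.
Definition dPhi B s : R[i] := L (tB B) s * msym s - L B s * (alpha%:C * cpow s alpha / s * (msym s * msym s)).

Lemma is_cder_msym (g : R -> R[i]) (x : R) d : slit (g x) -> 1 + cpow (g x) alpha != 0 ->
  (\near x, slit (g x)) -> is_cder g x (1 : R) d ->
  is_cder (fun y => msym (g y)) x (1 : R) (- d * (alpha%:C * cpow (g x) alpha / g x * (msym (g x) * msym (g x)))).
Proof.
move=> sx n0 nx dg; have h := cder_exp (is_cderZ alpha%:C (is_cder_clog sx dg)).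
have h1 : is_cder (fun y => cpow (g y) alpha) x (1 : R) (d * (alpha%:C * cpow (g x) alpha / g x)).
  have h2 : is_cder (fun y => cpow (g y) alpha) x (1 : R) (alpha%:C * (d / g x) * cexp (alpha%:C * clog (g x))).
    by apply: is_cder_near h; near=> y; rewrite cpow_clog//; near: y.
  by apply: cder_eq h2 _; rewrite cpow_clog//; ring.
have h3 := is_cderD (cder_cst 1 x (1 : R)) h1.
apply: cder_eq (@is_cderV _ _ (fun y => 1 + cpow (g y) alpha) x _ _ n0 h3) _.
by rewrite /msym -expr2 exprVn add0r; ring.
Unshelve. all: by end_near. Qed.

Lemma msym_bounds : exists2 D : R, 0 < D & forall s, slit s -> 0 <= im s ->
  normc (msym s) <= D /\ normc (cpow s alpha * msym s) <= D.
Proof.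
have [d d0 hd] := msym_lower; exists (1 + d^-1) => [|s ss s0]; first by rewrite addr_gt0// invr_gt0.
have h := hd s ss s0; have n0 : 0 < normc (1 + cpow s alpha) by apply: lt_le_trans h.
have z0 : 1 + cpow s alpha != 0 by rewrite -normc_gt0.
have b1 : normc (msym s) <= d^-1 by rewrite normcV lef_pV2.
split; first by apply: le_trans b1 _; rewrite lerDr.
have -> : cpow s alpha * msym s = 1 - msym s by rewrite /msym; field.
by apply: le_trans (normcB _ _) _; rewrite normc1 lerD2l.
Qed.

Lemma cpow1_neq0 s : slit s -> 0 <= im s -> 1 + cpow s alpha != 0.
Proof.
have [d d0 hd] := msym_lower; move=> ss s0.
by rewrite -normc_gt0; apply: lt_le_trans d0 (hd s ss s0).
Qed.

Lemma is_cder_ray_r th r : is_cder (ray th) r (1 : R) (eith th).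
Proof.
have h := is_cderD (cder_cst 1 r (1 : R)) (is_cderM (is_cder_id r) (cder_cst (eith th) r (1 : R))).
by apply: cder_eq h _; rewrite mulr0 addr0 add0r mul1r.
Qed.

Lemma is_cder_eith th : is_cder eith th (1 : R) (ci * eith th).
Proof.
by have h := cder_exp (is_cderZ ci (is_cder_id th)); apply: cder_eq h _; rewrite mulr1.
Qed.

Lemma is_cder_ray_th th r : is_cder (fun th => ray th r) th (1 : R) (r%:C * (ci * eith th)).
Proof.
have h := is_cderD (cder_cst 1 th (1 : R)) (is_cderZ r%:C (is_cder_eith th)).
by apply: cder_eq h _; rewrite add0r.
Qed.

Lemma normc_ray th r : normc (ray th r) <= 1 + `|r|.
Proof. by apply: le_trans (normcD _ _) _; rewrite normc1 normcM normcR normc_eith mulr1. Qed.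

Lemma near_slit (g : R -> R[i]) x : slit (g x) -> ccont g x -> \near x, slit (g x).
Proof.
move=> sx cg; have cn : {for x, continuous (fun y => normc (g y) + re (g y))}.
  by apply: cvgD; [exact: ccont_norm|exact: cg.1].
have := cvgr_gt _ cn _ sx; apply; exact: _.
Qed.

Lemma is_cder_Phi_r B th r : test B -> 0 < sin th -> 0 <= r ->
  is_cder (fun r => Phi B (ray th r)) r (1 : R) (eith th * dPhi B (ray th r)).
Proof.
move=> hB s0 r0; have sl := slit_ray r s0.
have h1 := @is_cder_L R B (ray th) (fun=> eith th) r (1 + (`|r| + 1)) 1 hB _.
have i0 : 0 <= im (ray th r) by rewrite im_ray mulr_ge0// ltW.
have h2 := is_cder_msym sl (cpow1_neq0 sl i0) (near_slit sl (cder_cont (is_cder_ray_r th r))) (is_cder_ray_r th r).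
have h3 := is_cderM (h1 _) h2.
apply: cder_eq (h3 _) _; last by rewrite /dPhi; ring.
move=> y yr; split; first exact: is_cder_ray_r.
rewrite normc_eith; split => //; apply: le_trans (normc_re _) _; apply: le_trans (normc_ray _ _) _.
rewrite lerD2l; have : `|y| <= `|y - r| + `|r| by rewrite -{1}(subrK r y) ler_normD.
lra.
Qed.

Lemma is_cder_Phi_th B th r : test B -> 0 < sin th -> 0 <= r ->
  is_cder (fun th => Phi B (ray th r)) th (1 : R) (r%:C * (ci * eith th) * dPhi B (ray th r)).
Proof.
move=> hB s0 r0; have sl := slit_ray r s0.
have h1 := @is_cder_L R B (fun th => ray th r) (fun th => r%:C * (ci * eith th)) th (1 + `|r|) `|r| hB _.
have i0 : 0 <= im (ray th r) by rewrite im_ray mulr_ge0// ltW.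
have h2 := @is_cder_msym (fun th => ray th r) th _ sl (cpow1_neq0 sl i0) (@near_slit (fun th => ray th r) th sl (cder_cont (is_cder_ray_th th r))) (is_cder_ray_th th r).
have h3 := is_cderM (h1 _) h2.
apply: cder_eq (h3 _) _; last by rewrite /dPhi; ring.
move=> y yr; split; first exact: is_cder_ray_th.
rewrite !normcM normc_ci normc_eith normcR !mulr1; split => //.
by apply: le_trans (normc_re _) _; exact: normc_ray.
Qed.

Lemma sin_gt0_open (th : R) : pi / 2 <= th < pi -> 0 < sin th /\ cos th <= 0.
Proof.
move=> /andP[t1 t2]; have p0 := @pi_gt0 R; split.
  by apply: sin_gt0_pi; apply/andP; split; lra.
have e : cos (th - pi) = - cos th by rewrite cosB cospi sinpi; ring.
by rewrite -oppr_ge0 -e; apply: cos_ge0_pihalf; apply/andP; split; lra.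
Qed.

Lemma ray_weight th r : 0 <= r -> 1 + r <= 2 * (1 + normc (ray th r)).
Proof.
move=> r0; have : r <= normc (ray th r) + 1.
  have e : normc (ray th r - 1) = r by rewrite /ray addrAC subrr add0r normcM normcR normc_eith mulr1 ger0_norm.
  by rewrite -[leLHS]e; apply: le_trans (normcB _ _) _; rewrite normc1.
by have := normc_ge0 (ray th r); lra.
Qed.

Lemma L_ray B n : test B -> (forall t, t < 0 -> B t = 0) ->
  exists2 C : R, 0 <= C & forall th r, cos th <= 0 -> 0 <= r -> (1 + r) ^+ n * normc (L B (ray th r)) <= C.
Proof.
move=> hB B0; have [C C0 hC] := L_half_decay n hB B0.
exists (2 ^+ n * C) => [|th r c0 r0]; first by rewrite mulr_ge0 ?exprn_ge0.
have s1 : re (ray th r) <= 1 by rewrite re_ray gerDl mulr_ge0_le0.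
apply: le_trans (_ : (2 * (1 + normc (ray th r))) ^+ n * normc (L B (ray th r)) <= _).
  by rewrite ler_wpM2r ?normc_ge0// lerXn2r ?nnegrE ?mulr_ge0 ?addr_ge0 ?normc_ge0// ray_weight.
by rewrite exprMn -mulrA ler_wpM2l ?exprn_ge0// hC.
Qed.

Lemma Phi_ray B : test B -> (forall t, t < 0 -> B t = 0) ->
  exists2 C : R, 0 <= C & forall th r, pi / 2 <= th < pi -> 0 <= r -> normc (Phi B (ray th r)) <= C * wt 1 r.
Proof.
move=> hB B0; have [C C0 hC] := L_ray 2 hB B0; have [D D0 hD] := msym_bounds.
exists (C * D) => [|th r tp r0]; first by rewrite mulr_ge0// ltW.
have [s0 c0] := sin_gt0_open tp; have sl := slit_ray r s0.
have i0 : 0 <= im (ray th r) by rewrite im_ray mulr_ge0// ltW.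
have [m1 _] := hD _ sl i0.
rewrite normcM mulrAC; apply: ler_pM m1; rewrite ?normc_ge0//.
by apply: (@decay_wt R _ C r 1); rewrite ger0_norm// hC.
Qed.

Lemma dPhi_ray B (s1 : R) : 0 < s1 -> test B -> (forall t, t < 0 -> B t = 0) ->
  exists2 C : R, 0 <= C & forall th r, pi / 2 <= th < pi -> s1 <= sin th -> 0 <= r ->
    r * normc (dPhi B (ray th r)) <= C * wt 1 r.
Proof.
move=> s10 hB B0; have tB0 t : t < 0 -> tB B t = 0 by move=> /B0; rewrite /tB => ->; rewrite mulr0.
have [C C0 hC] := L_ray 3 hB B0; have [C' C'0 hC'] := L_ray 3 (test_tB hB) tB0.
have [D D0 hD] := msym_bounds.
exists (C' * D + C * (alpha * D / s1 * D)) => [|th r tp st r0].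
  by rewrite addr_ge0 ?mulr_ge0 ?invr_ge0// ltW.
have [s0 c0] := sin_gt0_open tp; have sl := slit_ray r s0.
have i0 : 0 <= im (ray th r) by rewrite im_ray mulr_ge0// ltW.
have [m1 m2] := hD _ sl i0.
have rs : s1 <= normc (ray th r) := le_trans st (ray_ge r0 s0).
have red (q : R -> R[i]) (A : R) : (1 + r) ^+ 3 * normc (L q (ray th r)) <= A -> r * normc (L q (ray th r)) <= A * wt 1 r.
  move=> h; apply: (@decay_wt R _ A r 1); rewrite (ger0_norm r0); apply: le_trans h.
  have h0 : r * normc (L q (ray th r)) <= (1 + r) * normc (L q (ray th r)) by rewrite ler_wpM2r ?normc_ge0// lerDr.
  by rewrite [(1 + r) ^+ 3]exprSr -mulrA ler_wpM2l// exprn_ge0// addr_ge0.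
have h1 := red _ _ (hC th r c0 r0); have h2 := red _ _ (hC' th r c0 r0).
have -> : dPhi B (ray th r) = L (tB B) (ray th r) * msym (ray th r) - L B (ray th r) *
  (alpha%:C * (cpow (ray th r) alpha * msym (ray th r)) / ray th r * msym (ray th r)) by rewrite /dPhi; ring.
apply: le_trans (ler_wpM2l r0 (normcB _ _)) _; rewrite mulrDr mulrDl lerD//.
  by rewrite normcM mulrA [leRHS]mulrAC; apply: ler_pM m1; rewrite ?mulr_ge0 ?normc_ge0.
set X := alpha%:C * _ / _ * _.
have -> : C * (alpha * D / s1 * D) * wt 1 r = (C * wt 1 r) * (alpha * D / s1 * D) by ring.
have -> : r * normc (L B (ray th r) * X) = (r * normc (L B (ray th r))) * normc X by rewrite normcM mulrA.
apply: ler_pM h1 _; rewrite ?mulr_ge0 ?normc_ge0//.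
rewrite /X (normcM _ (msym _)) (normcM _ (ray th r)^-1) (normcM alpha%:C) normcR normcV (gtr0_norm alpha_gt0).
have a0 := ltW alpha_gt0.
have b1 : alpha * normc (cpow (ray th r) alpha * msym (ray th r)) <= alpha * D by rewrite ler_wpM2l.
have b2 : (normc (ray th r))^-1 <= s1^-1 by rewrite lef_pV2// posrE// (lt_le_trans s10).
apply: ler_pM (ler_pM _ _ b1 b2) m1; rewrite ?mulr_ge0 ?invr_ge0 ?normc_ge0//.
Qed.

Definition Iray B th : R[i] := cint mu `[0, +oo[%classic (fun r => Phi B (ray th r) * eith th).

Lemma mhalf : measurable (`[0, +oo[%classic : set (mR R)).
Proof. exact: measurable_itv. Qed.

Lemma iw_half : mu.-integrable `[0, +oo[%classic (EFin \o (wt 1 : R -> R)).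
Proof. exact: (integrableS measurableT mhalf (@subsetT _ _) (@integrable_wt R 1 ltr01)). Qed.

Lemma cmeas_half (f : R -> R[i]) : (forall r, 0 <= r -> ccont f r) ->
  cmeas (T := mR R) `[0, +oo[%classic f.
Proof.
move=> cf; have cf' x : `[0, +oo[%classic x -> ccont f x by rewrite /= in_itv /= andbT; exact: cf.
have [c1 c2] := ccont_within cf'.
by split; apply: subspace_continuous_measurable_fun => //; exact: mhalf.
Qed.

(** A lower bound on [sin] near [th] keeps the neighbouring rays away from the branch point, which
    dominates the factor [1 / s] in [dPhi]; the condition [pi / 2 <= y] keeps them in
    [Re s <= 1]. *)
Lemma ray_near (th : R) : pi / 2 < th < pi -> exists2 e : R, 0 < e &
  exists2 s1 : R, 0 < s1 & forall y, `|y - th| < e -> pi / 2 <= y < pi /\ s1 <= sin y.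
Proof.
move=> /andP[t1 t2]; have p0 := @pi_gt0 R.
pose e := Num.min (th - pi / 2) ((pi - th) / 2).
have e0 : 0 < e by rewrite lt_min; apply/andP; split; lra.
have [e1 e2] : e <= th - pi / 2 /\ e <= (pi - th) / 2 by split; rewrite ge_min lexx ?orbT.
have s0 : 0 < sin (th + e) by apply: sin_gt0_pi; apply/andP; split; lra.
exists e => //; exists (sin (th + e)) => // y; rewrite ltr_norml => /andP[y1 y2].
split; first by apply/andP; split; lra.
rewrite -[sin y]cosBpihalf -[sin (th + e)]cosBpihalf leNgt; apply/negP.
by rewrite ltr_cos ?in_itv /=; [move=> ?; lra|apply/andP; split; lra|apply/andP; split; lra].
Qed.

Lemma F_cont_r B th r : test B -> 0 < sin th -> 0 <= r -> ccont (fun r => Phi B (ray th r) * eith th) r.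
Proof.
move=> hB s0 r0; apply: ccontM; last exact: ccont_cst.
exact: cder_cont (is_cder_Phi_r hB s0 r0).
Qed.

Lemma cintble_ray B th : test B -> (forall t, t < 0 -> B t = 0) -> pi / 2 <= th < pi ->
  cintble mu `[0, +oo[%classic (fun r => Phi B (ray th r) * eith th).
Proof.
move=> hB B0 tp; have [C C0 hC] := Phi_ray hB B0; have [s0 _] := sin_gt0_open tp.
apply: (cintble_dom mhalf _ (integrableZl mhalf C iw_half)).
  by apply: cmeas_half => r r0; exact: F_cont_r.
by move=> r; rewrite /= in_itv /= andbT => r0; rewrite normcM normc_eith mulr1 hC.
Qed.

Definition dF B th r : R[i] := r%:C * (ci * eith th) * dPhi B (ray th r) * eith th + Phi B (ray th r) * (ci * eith th).

(** In place of Cauchy's theorem: with [z = 1 + r e^(i th)], the [th]-derivative of [Phi z e^(i th)]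
    equals the [r]-derivative of [i r e^(i th) Phi z], so its integral reduces to boundary terms. *)
Lemma is_cder_Iray B th : test B -> (forall t, t < 0 -> B t = 0) -> pi / 2 < th < pi ->
  is_cder (Iray B) th (1 : R) 0.
Proof.
move=> hB B0 tp; have [e e0 [s1 s10 he]] := ray_near tp.
have [C C0 hC] := Phi_ray hB B0; have [D D0 hD] := dPhi_ray s10 hB B0.
have bound y r : `|y - th| < e -> 0 <= r -> normc (dF B y r) <= (D + C) * wt 1 r.
  move=> yt r0; have [yp ys] := he y yt.
  rewrite mulrDl; apply: le_trans (normcD _ _) _; rewrite lerD//.
    by rewrite normcM (normcM _ (dPhi _ _)) (normcM r%:C) (normcM ci) normcR !normc_eith normc_ci !mulr1 ger0_norm// hD.
  by rewrite normcM (normcM ci) normc_eith normc_ci !mulr1 hC.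
have nb (h : R) : `|h| < e -> `|(h *: (1 : R) + th) - th| < e.
  by rewrite addrK -[_ *: _]/(h * 1) mulr1.
have h1 : is_cder (Iray B) th (1 : R) (cint mu `[0, +oo[%classic (dF B th)).
  apply: (@is_cder_cint R R _ _ mu `[0, +oo[%classic (fun th r => Phi B (ray th r) * eith th)
    (dF B) (fun r => (D + C) * wt 1 r) th (1 : R) e mhalf e0).
  - by move=> h /nb/he[yp _]; exact: cintble_ray.
  - move=> h r /nb/he[yp _]; rewrite /= in_itv /= andbT => r0.
    have [s0 _] := sin_gt0_open yp.
    exact: is_cderM (is_cder_Phi_th hB s0 r0) (is_cder_eith _).
  - exact: (integrableZl mhalf (D + C) iw_half).
  - by move=> h r /nb yt; rewrite /= in_itv /= andbT => r0; exact: bound.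
apply: cder_eq h1 _.
have tt : `|th - th| < e by rewrite subrr normr0.
have [yp ys] := he th tt; have [s0 _] := sin_gt0_open yp.
(* Vanishes at [r = 0] through its factor [r], and at infinity because [Phi] is [O (wt 1 r)]. *)
pose H r := r%:C * (ci * eith th) * Phi B (ray th r).
have dH r : 0 <= r -> is_cder H r (1 : R) (dF B th r).
  move=> r0; have h := is_cderM (is_cderM (is_cder_id r) (cder_cst (ci * eith th) r (1 : R))) (is_cder_Phi_r hB s0 r0).
  by apply: cder_eq h _; rewrite mulr0 addr0 /dF; ring.
have cLr (q : R -> R[i]) r : test q -> ccont (fun r => L q (ray th r)) r.
  move=> tq; have h1' := @is_cder_L R q (ray th) (fun=> eith th) r (1 + (`|r| + 1)) 1 tq _.
  apply: cder_cont (h1' _) => y yr; split; first exact: is_cder_ray_r.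
  rewrite normc_eith; split => //; apply: le_trans (normc_re _) _; apply: le_trans (normc_ray _ _) _.
  rewrite lerD2l; have : `|y| <= `|y - r| + `|r| by rewrite -{1}(subrK r y) ler_normD.
  lra.
have cdPhi r : 0 <= r -> ccont (fun r => dPhi B (ray th r)) r.
  move=> r0; have sl := slit_ray r s0.
  have i0 : 0 <= im (ray th r) by rewrite im_ray mulr_ge0// ltW.
  have nsl := near_slit sl (cder_cont (is_cder_ray_r th r)).
  have cm : ccont (fun r => msym (ray th r)) r.
    exact: cder_cont (is_cder_msym sl (cpow1_neq0 sl i0) nsl (is_cder_ray_r th r)).
  have cr : ccont (ray th) r := cder_cont (is_cder_ray_r th r).
  have cp : ccont (fun r => cpow (ray th r) alpha) r.
    have := ccont_exp (ccontM (ccont_cst alpha%:C r) (clog_cont sl cr)).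
    by apply: ccont_near; near=> y; rewrite cpow_clog//; near: y.
  have ci' : ccont (fun r => (ray th r)^-1) r := cder_cont (is_cderV (slit_neq0 sl) (is_cder_ray_r th r)).
  have tt' := test_tB hB.
  have c1 := ccontM (cLr _ r tt') cm.
  have c2 := ccontM (ccontM (ccontM (ccont_cst alpha%:C r) cp) ci') (ccontM cm cm).
  have := ccontD c1 (ccontM (ccont_cst (-1) r) (ccontM (cLr _ r hB) c2)).
  by congr ccont; apply/funext => y; rewrite /dPhi mulN1r.
have cdF r : 0 <= r -> ccont (dF B th) r.
  move=> r0; apply: ccontD; last first.
    by apply: ccontM; [exact: cder_cont (is_cder_Phi_r hB s0 r0)|exact: ccont_cst].
  apply: ccontM; last exact: ccont_cst.
  apply: ccontM; last exact: cdPhi.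
  by apply: ccontM; [exact: cder_cont (is_cder_id r)|exact: ccont_cst].
have idF : cintble mu `[0, +oo[%classic (dF B th).
  apply: (cintble_dom mhalf (cmeas_half cdF) (integrableZl mhalf (D + C) iw_half)).
  by move=> r; rewrite /= in_itv /= andbT => r0; exact: bound.
rewrite (cint_halfline dH cdF idF).
  by rewrite /H rmorph0 !mul0r oppr0.
apply: (@ccvg_sqz R _ _ (fun n => C * n.+1%:R^-1)).
  move=> n; rewrite add0r subr0 /H normcM (normcM _%:C) (normcM ci) normcR normc_ci normc_eith !mulr1 ger0_norm//.
  have h := hC th n%:R yp (ler0n _ _).
  apply: le_trans (ler_wpM2l (ler0n _ _) h) _.
  rewrite mulrCA ler_wpM2l// (wt_natE 1) ger0_norm// nat1r expr2 invfM mulrA ler_piMl ?invr_ge0//.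
  by rewrite ler_pdivrMr ?ltr0n// mul1r ler_nat.
by rewrite -(mulr0 C); apply: cvgM; [exact: cvg_cst|exact: cvg_harmonic].
Unshelve. all: by end_near. Qed.

Lemma Iray_cst B a b : test B -> (forall t, t < 0 -> B t = 0) -> pi / 2 < a -> a <= b -> b < pi ->
  Iray B a = Iray B b.
Proof.
move=> hB B0 pa ab bp; have h x : a <= x <= b -> is_cder (Iray B) x (1 : R) 0.
  by move=> /andP[x1 x2]; apply: is_cder_Iray => //; rewrite (lt_le_trans pa x1) (le_lt_trans x2 bp).
have := cFTC ab h (fun x _ => ccont_cst 0 x).
rewrite (cFTC ab (fun x _ => cder_cst 0 x (1 : R)) (fun x _ => ccont_cst 0 x)) subrr.
by move/eqP; rewrite eq_sym subr_eq0 => /eqP.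
Qed.

Lemma ccont_seq (f : R -> R[i]) (u : nat -> R) x : ccont f x -> u n @[n --> \oo] --> x -> ccvg (fun n => f (u n)) (f x).
Proof. by move=> [c1 c2] ux; split; [exact: (cvg_comp _ _ ux c1)|exact: (cvg_comp _ _ ux c2)]. Qed.

Lemma ccvgV (u : nat -> R[i]) l : l != 0 -> ccvg u l -> ccvg (fun n => (u n)^-1) l^-1.
Proof.
move=> l0 ul; have [u1 u2] := ul; have un := ccvg_norm ul.
have n2 : (normc (u n) ^+ 2)^-1 @[n --> \oo] --> (normc l ^+ 2)^-1.
  apply: cvgV; first by rewrite expf_neq0// normc_eq0.
  by under eq_fun do rewrite expr2; rewrite expr2; exact: cvgM.
split; under eq_fun do rewrite ?reV ?imV; rewrite ?reV ?imV.
  exact: cvgM.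
by apply: cvgM => //; exact: cvgN.
Qed.

(** The reflection [s |-> - conj s] leads from the left half-plane to the right one, where [clog] is
    continuous; so the argument is seen to be continuous up to the cut from above. *)
Lemma carg_neg s : re s < 0 -> 0 <= im s -> carg s = pi - im (clog (- re s +i* im s)).
Proof.
move=> r0 i0; set w := _ +i* _; have w0 : 0 < re w by rewrite /= oppr_gt0.
have nw : normc w = normc s by rewrite !normcEs /= sqrrN.
have n0 : 0 < normc s by rewrite -nw slit_normc// slit_re.
rewrite -carg_clog ?slit_re// /carg [im w]/= i0 nw [re w]/= mulNr acosN ?subKr//.
have := normc_re s; rewrite ler_norml => /andP[h1 h2].
by apply/andP; split; [rewrite ler_pdivlMr// mulN1r|rewrite ler_pdivrMr// mul1r].
Qed.

Lemma eith_pi : eith pi = -1.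
Proof. by rewrite eithE cospi sinpi; apply: cplxP; rewrite /= ?oppr0. Qed.

Lemma ray_pi r : ray pi r = (1 - r)%:C.
Proof. by rewrite /ray eith_pi mulrN1 rmorphB rmorph1. Qed.

Lemma ray_th_cont th r : ccont (fun th => ray th r) th.
Proof. exact: cder_cont (is_cder_ray_th th r). Qed.

(** Angles tending to [pi / 2] and, for [thp], to [pi] from inside the open interval where [Iray] is
    constant; the two end rays are then reached by dominated convergence. *)
Definition thm (n : nat) : R := pi / 2 + eps n * (pi / 4).
Definition thp (n : nat) : R := pi - eps n * (pi / 4).

Lemma eps_le1 n : eps n <= 1 :> R. Proof. by rewrite /eps invf_le1 ?ltr0n// ler1n. Qed.

Lemma th_bounds n : pi / 2 < thm n <= pi * 3 / 4 /\ pi * 3 / 4 <= thp n < pi.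
Proof.
have e0 : 0 < eps n :> R by exact: eps_gt0.
have e1 := eps_le1 n; have p0 := @pi_gt0 R.
have q0 : 0 < pi / 4 :> R by rewrite divr_gt0.
have h : 0 < eps n * (pi / 4 : R) <= (pi / 4 : R) by apply/andP; split; [rewrite mulr_gt0|rewrite ler_piMl// ltW].
move: h => /andP[h1 h2]; rewrite /thm /thp; split; apply/andP; split; lra.
Qed.

Lemma thm_cvg : thm n @[n --> \oo] --> (pi / 2 : R).
Proof.
rewrite -[X in _ --> X]addr0; apply: cvgD; first exact: cvg_cst.
by rewrite -(mul0r (pi / 4)); apply: cvgM; [exact: eps_cvg|exact: cvg_cst].
Qed.

Lemma thp_cvg : thp n @[n --> \oo] --> (pi : R).
Proof.
rewrite -[X in _ --> X]subr0; apply: cvgB; first exact: cvg_cst.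
by rewrite -(mul0r (pi / 4)); apply: cvgM; [exact: eps_cvg|exact: cvg_cst].
Qed.

Lemma cpow_cont (g : R -> R[i]) (x : R) : slit (g x) -> ccont g x -> ccont (fun y => cpow (g y) alpha) x.
Proof.
move=> sl cg; have nsl := near_slit sl cg.
have := ccont_exp (ccontM (ccont_cst alpha%:C x) (clog_cont sl cg)).
by apply: ccont_near; near=> y; rewrite cpow_clog//; near: y.
Unshelve. all: by end_near. Qed.

Lemma ccvg_near (u v : nat -> R[i]) l : (\forall n \near \oo, u n = v n) -> ccvg v l -> ccvg u l.
Proof.
move=> h [l1 l2]; split; [apply: cvg_trans l1|apply: cvg_trans l2]; apply: near_eq_cvg;
  by apply: filterS h => n e; rewrite e.
Qed.

(** Three regimes on the last ray: the positive axis, the negative axis approached from above, and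
    the branch point [r = 1], where the power tends to 0. *)
Lemma cpow_limit r : 0 <= r -> ccvg (fun n => cpow (ray (thp n) r) alpha) (cpow (1 - r)%:C alpha).
Proof.
move=> r0; rewrite -ray_pi; have [r1|r1|r1] := ltgtP r 1.
- have sl : slit (ray pi r) by apply: slit_re; rewrite ray_pi /= subr_gt0.
  exact: (@ccont_seq (fun th => cpow (ray th r) alpha) _ _ (@cpow_cont (fun th => ray th r) pi sl (@ray_th_cont pi r)) thp_cvg).
- pose g th : R[i] := (normc (ray th r) `^ alpha)%:C * cexp (ci * (alpha%:C * (pi%:C - (im (clog (- re (ray th r) +i* im (ray th r))))%:C))).
  have e th : re (ray th r) < 0 -> 0 <= im (ray th r) -> cpow (ray th r) alpha = g th.
    move=> h1 h2; rewrite /cpow (carg_neg h1 h2) /g; congr (_ * cexp _).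
    by apply: cplxP; rewrite ?(reM, imM, reB, imB) /=; ring.
  have cr := @ray_th_cont pi r.
  have re0 : re (ray pi r) < 0 by rewrite ray_pi /= subr_lt0.
  have cw : ccont (fun th => - re (ray th r) +i* im (ray th r)) pi.
    by split; [apply: cvgN; exact: cr.1|exact: cr.2].
  have sw : slit (- re (ray pi r) +i* im (ray pi r)) by apply: slit_re; rewrite /= oppr_gt0.
  have n0 : 0 < normc (ray pi r) by rewrite normc_gt0; apply/eqP => h; move: re0; rewrite h ltxx.
  have cg : ccont g pi.
    apply: ccontM.
      by apply: ccontR; apply: (continuous_powRC (g := fun th => normc (ray th r))) => //; exact: ccont_norm.
    apply: ccont_exp; apply: ccontM; first exact: ccont_cst.
    apply: ccontM; first exact: ccont_cst.
    have c2 := ccontR (clog_cont sw cw).2.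
    have := ccontD (ccont_cst (pi : R)%:C (pi : R)) (ccontM (ccont_cst (-1) (pi : R)) c2).
    by congr ccont; apply/funext => y; rewrite mulN1r.
  rewrite (e pi re0); last by rewrite ray_pi.
  have lim := ccont_seq cg thp_cvg.
  have ev : \forall n \near \oo, cpow (ray (thp n) r) alpha = g (thp n).
    have c1 : re (ray (thp n) r) @[n --> \oo] --> re (ray pi r) := cvg_comp _ _ thp_cvg cr.1.
    near=> n; apply: e; first by near: n; exact: cvgr_lt c1 _ re0.
    have [_ /andP[t1 t2]] := th_bounds n; rewrite im_ray mulr_ge0// ltW//.
    by apply: (sin_gt0_open _).1; rewrite t2 andbT; have := @pi_gt0 R; lra.
  exact: ccvg_near ev lim.
- subst r; have -> : cpow (ray pi 1) alpha = 0.
    by rewrite ray_pi subrr /cpow (_ : normc _ = 0) ?powR0 ?mul0r ?gt_eqF//; apply/eqP; rewrite normc_eq0.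
  apply: ccvg_norm0; under eq_fun do rewrite subr0 (normc_cpow hp).
  have sl n : slit (ray (thp n) 1).
    apply: slit_ray; have [_ /andP[t1 t2]] := th_bounds n; apply: (sin_gt0_open _).1.
    by rewrite t2 andbT; have := @pi_gt0 R; lra.
  have h := powR_cvg0 alpha_gt0; move/cvg_at_rightP: h; apply; split; first by move=> n; exact: slit_normc.
  have := ccvg_norm (ccont_seq (@ray_th_cont pi 1) thp_cvg).
  by rewrite ray_pi subrr (_ : normc _ = 0)//; apply/eqP; rewrite normc_eq0.
Unshelve. all: by end_near. Qed.

Lemma carg_neg_axis (x : R) : 0 < x -> carg (- x)%:C = pi.
Proof.
move=> x0; rewrite /carg /= lexx normcR normrN gtr0_norm// mulNr divff ?gt_eqF//.
by rewrite acosN1.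
Qed.

Lemma cpow_real (x : R) : 0 <= x -> cpow x%:C alpha = (x `^ alpha)%:C.
Proof.
rewrite le_eqVlt => /orP[/eqP <-|x0].
  by rewrite /cpow (_ : normc _ = 0) ?powR0 ?mul0r ?gt_eqF//; apply/eqP; rewrite normc_eq0.
rewrite /cpow /carg /= lexx normcR gtr0_norm// divff ?gt_eqF// acos1 mulr0.
by rewrite -[0 +i* 0]/(0 : R[i]) cexp0 mulr1.
Qed.

Lemma cpow_neg (x : R) : 0 < x -> cpow (- x)%:C alpha = (x `^ alpha * cos (alpha * pi)) +i* (x `^ alpha * sin (alpha * pi)).
Proof.
move=> x0; rewrite /cpow carg_neg_axis// normcR normrN gtr0_norm// /cexp /= expR0 !mul1r.
by apply: cplxP; rewrite ?reMr ?imMr.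
Qed.

Lemma cpow1_axis (x : R) : 1 + cpow x%:C alpha != 0.
Proof.
have [x0|x0] := leP 0 x.
  rewrite (cpow_real x0); apply/eqP => /(congr1 (@re R)) /= /eqP.
  by rewrite gt_eqF// ltr_wpDr ?powR_ge0.
have -> : x = - (- x) by rewrite opprK.
rewrite cpow_neg ?oppr_gt0//; apply/eqP => /(congr1 (@im R)) /= /eqP.
by rewrite add0r gt_eqF// mulr_gt0 ?powR_gt0 ?oppr_gt0// sin_api.
Qed.

Lemma rotate B : test B -> (forall t, t < 0 -> B t = 0) ->
  cintble mu `[0, +oo[%classic (fun r => Phi B (1 - r)%:C * -1) /\
  cint mu `[0, +oo[%classic (fun r => Phi B (sl r) * ci) = cint mu `[0, +oo[%classic (fun r => Phi B (1 - r)%:C * -1).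
Proof.
move=> hB B0; have [C C0 hC] := Phi_ray hB B0.
have inI n : pi / 2 <= thm n < pi /\ pi / 2 <= thp n < pi.
  by have [/andP[a1 a2] /andP[a3 a4]] := th_bounds n; have := @pi_gt0 R; move=> ?; split; apply/andP; split; lra.
have dom th r : pi / 2 <= th < pi -> `[0, +oo[%classic r -> normc (Phi B (ray th r) * eith th) <= C * wt 1 r.
  by rewrite /= in_itv /= andbT => tp r0; rewrite normcM normc_eith mulr1 hC.
have cmI th : pi / 2 <= th < pi -> cmeas (T := mR R) `[0, +oo[%classic (fun r => Phi B (ray th r) * eith th).
  by move=> tp; apply: cmeas_half => r r0; apply: F_cont_r => //; exact: (sin_gt0_open tp).1.
have iC := integrableZl mhalf C iw_half.
have p1 r : `[0, +oo[%classic r -> ccvg (fun n => Phi B (ray (thm n) r) * eith (thm n)) (Phi B (ray (pi / 2) r) * eith (pi / 2)).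
  rewrite /= in_itv /= andbT => r0; have s0 : 0 < sin (pi / 2) :> R by rewrite sin_pihalf.
  exact: (@ccont_seq (fun th => Phi B (ray th r) * eith th) _ _ (ccontM (cder_cont (is_cder_Phi_th hB s0 r0)) (cder_cont (is_cder_eith (pi / 2)))) thm_cvg).
have p2 r : `[0, +oo[%classic r -> ccvg (fun n => Phi B (ray (thp n) r) * eith (thp n)) (Phi B (1 - r)%:C * -1).
  rewrite /= in_itv /= andbT => r0; apply: ccvgM; last first.
    by rewrite -eith_pi; exact: ccont_seq (cder_cont (is_cder_eith pi)) thp_cvg.
  apply: ccvgM.
    have cL : ccont (fun th => L B (ray th r)) pi.
      have h := @is_cder_L R B (fun th => ray th r) (fun th => r%:C * (ci * eith th)) pi (1 + `|r|) `|r| hB _.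
      apply: cder_cont (h _) => y yr; split; first exact: is_cder_ray_th.
      rewrite !normcM normc_ci normc_eith normcR !mulr1; split => //.
      by apply: le_trans (normc_re _) _; exact: normc_ray.
    by rewrite -ray_pi; exact: (@ccont_seq (fun th => L B (ray th r)) _ _ cL thp_cvg).
  apply: ccvgV; first exact: cpow1_axis.
  by apply: ccvgD; [exact: ccvg_cst|exact: cpow_limit].
have [_ l1] := @cint_dct R _ _ mu `[0, +oo[%classic (fun n r => Phi B (ray (thm n) r) * eith (thm n))
    (fun r => Phi B (ray (pi / 2) r) * eith (pi / 2)) (fun r => C * wt 1 r) mhalf (fun n => cmI _ (inI n).1)
    p1 iC (fun n r => dom _ r (inI n).1).
have [i2 l2] := @cint_dct R _ _ mu `[0, +oo[%classic (fun n r => Phi B (ray (thp n) r) * eith (thp n))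
    (fun r => Phi B (1 - r)%:C * -1) (fun r => C * wt 1 r) mhalf (fun n => cmI _ (inI n).2)
    p2 iC (fun n r => dom _ r (inI n).2).
split; first exact: i2.
have -> : cint mu `[0, +oo[%classic (fun r => Phi B (sl r) * ci) = cint mu `[0, +oo[%classic (fun r => Phi B (ray (pi / 2) r) * eith (pi / 2)).
  have ei : eith (pi / 2) = ci by rewrite eithE cos_pihalf sin_pihalf.
  apply: eq_cint => r _; rewrite /ray ei; congr (Phi B _ * _).
  by apply: cplxP; rewrite ?reD ?imD ?reM ?imM /=; ring.
apply: (ccvg_unique l1); move: l2; congr ccvg; apply/funext => n.
have [/andP[a1 a2] /andP[a3 a4]] := th_bounds n.
exact/esym/(Iray_cst hB B0 a1 (le_trans a2 a3) a4).
Qed.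

Lemma cjD (z w : R[i]) : cj (z + w) = cj z + cj w.
Proof. by apply: cplxP; rewrite ?re_cj ?im_cj ?reD ?imD ?re_cj ?im_cj ?opprD. Qed.
Lemma cjV (z : R[i]) : cj z^-1 = (cj z)^-1.
Proof.
have n : normc (cj z) = normc z by rewrite !normcEs /= sqrrN.
by apply: cplxP; rewrite ?re_cj ?im_cj ?reV ?imV n ?re_cj ?im_cj// ?mulNr ?opprK.
Qed.

Lemma cj_spow η : spow alpha (- η) = cj (spow alpha η).
Proof.
rewrite /spow !(cpow_arg hp) ?slit_sl//.
have n : normc (sl (- η)) = normc (sl η) by rewrite !normcEs !re_sl !im_sl sqrrN.
have a : im (clog (sl (- η))) = - im (clog (sl η)).
  by rewrite /clog /im /= -/(im _) n mulNr atanN mulrN.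
by rewrite n a mulrN cosN sinN mulrN; apply: cplxP.
Qed.

(** On the cut [- Im (1 / (1 + s^alpha)) = |s|^alpha sin (alpha pi) / |1 + s^alpha|^2]. For
    [2 <= r <= 3] one has [1 <= |s| <= 2], so the modulus below is at most 3, whence the 9, and
    [exp ((1 - r) t) >= exp (- 2 T)] on the support of [b]. *)
Lemma Phi_axis_im (b : R -> R) (T : R) : 0 < T -> test (fun t => (b t)%:C) -> (forall t, 0 <= b t) ->
  (forall t, t < 0 -> b t = 0) -> (forall t, T < t -> b t = 0) -> forall r, 0 <= r ->
  (if 2 <= r <= 3 then sin (alpha * pi) / 9 * expR (- (2 * T)) * (\int[mu]_t b t)%R else 0)
    <= - im (Phi (fun t => (b t)%:C) (1 - r)%:C).
Proof.
move=> T0 tb b0 bm bT r r0; have sp := sin_api.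
have [ib _] := cintble_test tb.
have [iLb _] : cintble mu setT (fun t => (b t)%:C * rotc (1 - r)%:C t) := cintble_test (test_rotc _ tb).
have e t : re ((b t)%:C * rotc (1 - r)%:C t) = b t * expR ((1 - r) * t) by rewrite /rotc -rmorphM cexpR -rmorphM.
have iL : mu.-integrable setT (EFin \o (fun t => b t * expR ((1 - r) * t))).
  by move: iLb; congr integrable; apply/funext => t /=; rewrite -e.
have I0 : 0 <= (\int[mu]_t b t)%R by apply: Rintegral_ge0 => t _.
have L0 : 0 <= (\int[mu]_t (b t * expR ((1 - r) * t)))%R by apply: Rintegral_ge0 => t _; rewrite mulr_ge0 ?expR_ge0.
rewrite /Phi L_real// imMr [leRHS](_ : _ = (\int[mu]_t (b t * expR ((1 - r) * t)))%R *
  (im (1 + cpow (1 - r)%:C alpha) / normc (1 + cpow (1 - r)%:C alpha) ^+ 2)); last first.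
  by rewrite /msym imV mulNr mulrN opprK.
have nn z : 0 <= normc z ^+ 2 :> R by rewrite exprn_ge0 ?normc_ge0.
have [r1|r1] := leP r 1.
  rewrite cpow_real ?subr_ge0// imD /= addr0 mul0r mulr0.
  by case: ifP => // /andP[r2 _]; have := le_trans r2 r1; rewrite (ler_nat R 2 1).
have rr : 0 < r - 1 by rewrite subr_gt0.
have -> : 1 - r = - (r - 1) by rewrite opprB.
rewrite cpow_neg// imD [im 1]/= add0r [im (_ +i* _)]/=.
set P := (r - 1) `^ alpha; have P0 : 0 < P by rewrite powR_gt0.
case: ifP => [/andP[r2 r3]|_]; last by rewrite !mulr_ge0 ?invr_ge0 ?(ltW P0) ?(ltW sp)//; move: L0; rewrite opprB.
have P1 : 1 <= P by rewrite -(powRr0 (r - 1)) ler_powR ?(ltW alpha_gt0)//; lra.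
have P2 : P <= 2.
  apply: (@le_trans _ _ (2 `^ alpha)).
    by rewrite ge0_ler_powR ?nnegrE ?(ltW alpha_gt0)//; lra.
  by rewrite -[leRHS]powRr1// ler_powR ?ler1n// ltW.
have n3 : normc (1 + (P * cos (alpha * pi) +i* (P * sin (alpha * pi)))) <= 3.
  apply: le_trans (normcD _ _) _; rewrite normc1.
  have -> : P * cos (alpha * pi) +i* (P * sin (alpha * pi)) = P%:C * eith (alpha * pi).
    by rewrite eithE; apply: cplxP; rewrite ?reMr ?imMr.
  by rewrite normcM normc_eith mulr1 normcR gtr0_norm//; lra.
have n0 : 0 < normc (1 + (P * cos (alpha * pi) +i* (P * sin (alpha * pi)))).
  rewrite normc_gt0; apply/eqP => /(congr1 (@im R)); rewrite imD /= add0r => /eqP.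
  by rewrite gt_eqF// mulr_gt0.
have lb : expR (- (2 * T)) * (\int[mu]_t b t)%R <= (\int[mu]_t (b t * expR (- (r - 1) * t)))%R.
  rewrite -RintegralZl//; apply: le_Rintegral => //.
  - exact: (integrableZl measurableT _ ib).
  - by move: iL; rewrite opprB.
  move=> t _; rewrite mulrC; have [t0|t0] := ltP t 0; first by rewrite bm// !mul0r.
  have [tT|tT] := ltP T t; first by rewrite bT// !mul0r.
  rewrite ler_wpM2l// ler_expR mulNr lerN2; apply: (@le_trans _ _ (2 * t)).
    by rewrite ler_wpM2r//; lra.
  by rewrite ler_wpM2l.
rewrite [leLHS](_ : _ = (expR (- (2 * T)) * (\int[mu]_t b t)%R) * (sin (alpha * pi) / 9)); last by ring.
apply: ler_pM lb _; rewrite ?mulr_ge0 ?expR_ge0 ?divr_ge0 ?(ltW sp)//.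
rewrite ler_pdivlMr ?exprn_gt0//.
apply: (@le_trans _ _ (sin (alpha * pi) / 9 * 3 ^+ 2)).
  by rewrite ler_wpM2l ?divr_ge0 ?(ltW sp)// lerXn2r ?nnegrE ?normc_ge0.
have -> : sin (alpha * pi) / 9 * 3 ^+ 2 = sin (alpha * pi) by field.
by rewrite ler_peMl// ltW.
Qed.

(** Conjugation reduces the integral to twice the real part over the upper half-line; the rotation
    turns this into an integral along the real axis with nonnegative integrand, of which the window
    [2 <= r <= 3] alone gives the constant. *)
Lemma Jpos (T : R) : 0 < T -> exists2 c : R, 0 < c & forall b : R -> R,
  test (fun t => (b t)%:C) -> (forall t, 0 <= b t) ->
  (forall t, t <= 0 -> b t = 0) -> (forall t, T < t -> b t = 0) ->
  c * (\int[mu]_t b t)%R <= re (cint mu setT (fun η => qsym alpha tau η * L (fun t => (b t)%:C) (sl η))).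
Proof.
move=> T0; have sp := sin_api; have tau1 : 0 < 1 - tau by case: hp => _ /andP[_]; rewrite subr_gt0.
exists ((1 - tau) * (2 * (sin (alpha * pi) / 9 * expR (- (2 * T))))).
  by rewrite !mulr_gt0 ?divr_gt0 ?expR_gt0.
move=> b tb b0 bm bT; set B := fun t => (b t)%:C.
have B0 t : t < 0 -> B t = 0 by move=> t0; rewrite /B bm ?ltW.
have b00 t : t < 0 -> b t = 0 by move=> t0; rewrite bm ?ltW.
have [C C0 hC] := L_decay 2 tb.
have wL η : normc (L B (sl η)) <= C * wt 1 η by exact: (@decay_wt R _ C η 1 (hC η)).
have m1 η : normc (msym (sl η)) <= 1.
  by rewrite normcV invf_le1 ?(normc_1spow hp)// (lt_le_trans ltr01)// (normc_1spow hp).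
have cm η : ccont (fun η => msym (sl η)) η.
  have := cder_cont (is_cderB (cder_cst 1 η (1 : R)) (is_cder_usym hp η)).
  by congr ccont; apply/funext => y; rewrite (usym1 hp).
have cP η : ccont (fun η => Phi B (sl η)) η by apply: ccontM; [exact: L_cont|exact: cm].
have wP η : normc (Phi B (sl η)) <= C * wt 1 η.
  by rewrite normcM -[leRHS]mulr1 ler_pM ?normc_ge0.
have iP : cintble mu setT (fun η => Phi B (sl η)).
  exact: (cintble_dom measurableT (cmeasT1 cP) (integrableZl measurableT C (@integrable_wt R 1 ltr01)) (fun x _ => wP x)).
have iL := cintble_L tb.
(* The constant part [tau] of [l^2] stands for a multiple of the Dirac mass at [t = 0], where [b]
   vanishes. *)
have L0 : cint mu setT (fun η => L B (sl η)) = 0.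
  have [_] := fourier_inversion 0 tb; rewrite bm// mulr0 => <-.
  by apply: eq_cint => η _; rewrite /rotc mulr0 cexp0 mulr1.
have -> : cint mu setT (fun η => qsym alpha tau η * L B (sl η)) = (1 - tau)%:C * cint mu setT (fun η => Phi B (sl η)).
  rewrite -(cintZT (1 - tau)%:C iP) -[RHS]add0r -[X in X + _](mulr0 tau%:C) -L0 -(cintZT _ iL) -cintDT.
  - by apply: eq_cint => η _; rewrite (qsymE hp) (usym1 hp) /Phi /msym -/(spow alpha η); ring.
  - exact: cintbleZT.
  - exact: cintbleZT.
rewrite reMr; rewrite -[leLHS]mulrA; apply: ler_wpM2l; first exact: ltW.
rewrite (cintT_half cP wP) reD.
have [iN rot] := rotate tb B0.
have cjP η : Phi B (sl (- η)) = cj (Phi B (sl η)).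
  by rewrite /Phi cjM cj_L// /msym cjV cjD -/(spow alpha _) cj_spow; congr (_ * (_ + _)^-1); apply: cplxP; rewrite /= ?oppr0.
have -> : re (cint mu `[0, +oo[%classic (fun η => Phi B (sl (- η)))) = re (cint mu `[0, +oo[%classic (fun η => Phi B (sl η))).
  by apply: eq_Rintegral => η _; rewrite cjP.
have iH : cintble mu `[0, +oo[%classic (fun η => Phi B (sl η)).
  have [j1 j2] := iP; split; [exact: (integrableS measurableT mhalf (@subsetT _ _) j1)|exact: (integrableS measurableT mhalf (@subsetT _ _) j2)].
(* [Re X = Im (i X)], the factor [ci] being the direction of the vertical ray. *)
have e1 : re (cint mu `[0, +oo[%classic (fun η => Phi B (sl η))) = im (cint mu `[0, +oo[%classic (fun r => Phi B (1 - r)%:C * -1)).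
  rewrite -rot; have -> : cint mu `[0, +oo[%classic (fun r => Phi B (sl r) * ci) = ci * cint mu `[0, +oo[%classic (fun η => Phi B (sl η)).
    by rewrite -(cintZ ci mhalf iH); apply: eq_cint => r _; rewrite mulrC.
  by rewrite imM /= mul0r add0r mul1r.
rewrite e1 -mulr2n -[leRHS]mulr_natl -mulrA ler_wpM2l//.
set c := sin (alpha * pi) / 9 * expR (- (2 * T)) * (\int[mu]_t b t)%R.
have m23 : measurable (`[2, 3]%classic : set (mR R)) by exact: measurable_itv.
have sub23 : `[2, 3]%classic `<=` (`[0, +oo[%classic : set (mR R)).
  by move=> r /=; rewrite !in_itv /= andbT => /andP[r2 _]; apply: le_trans r2.
(* The window [[2, 3]] has length 1, so integrating [c] over it returns [c]. *)
have ec : c = (\int[mu]_(r in `[0%R, +oo[) (if (2 <= r <= 3)%R then c else 0))%R.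
  have cE : (\int[mu]_(r in `[2%R, 3%R]) c)%R = c.
    have mE : mu (`[2, 3]%classic : set R) = 1%:E.
      apply: etrans (@lebesgue_measure_itv R `[2, 3]) _; rewrite /= lte_fin ltr_nat /= -EFinB; congr EFin; ring.
    apply: etrans (Rintegral_cst mu m23 _) _; rewrite -[RHS]mulr1; congr (_ * _); exact: (congr1 fine mE).
  apply: etrans (esym cE) _; rewrite Rintegral_mkcond [RHS]Rintegral_mkcond.
  apply: eq_Rintegral => r _; rewrite !patchE; case: ifPn.
    move=> /set_mem r23; rewrite (mem_set (sub23 _ r23)).
    move: r23; rewrite /= in_itv /=.
    by move=> ->.
  rewrite notin_setE /= in_itv /= => h; case: ifP => _ //; case: ifP => // h'; by case: h.
rewrite [leLHS]ec; apply: le_Rintegral => //.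
- have ii := @itv_cst R 2 3 c.
  exact: (integrableS measurableT mhalf (@subsetT _ _) ii).
- by case: iN.
move=> r rI; have r0 : 0 <= r by move: rI; rewrite /= in_itv /= andbT.
apply: le_trans (Phi_axis_im T0 tb b0 b00 bT r0) _.
have -> : Phi B (1 - r)%:C * -1 = - Phi B (1 - r)%:C by rewrite mulrN1.
by rewrite -[leRHS]/(im _) imN.
Qed.

End Contour.
Unset Default Proof Using.

Section Gluing.
Context {R : realType} {V : normedModType R}.

(** On [U0] the product is identically 0 whatever [f] does there, and on [U] both factors are
    smooth. *)
Lemma smooth_glue (U U0 : set V) (phi f : V -> R[i]) : open U -> open U0 ->
  (forall z, U z \/ U0 z) -> (forall z, U0 z -> phi z = 0) ->
  smooth_on setT phi -> smooth_on U f -> smooth_on setT (fun z => phi z * f z).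
Proof.
move=> oU oU0 cov p0 sp sf vs z _; case: (cov z) => zU.
  exact: (smoothM oU (smooth_sub (@subsetT _ U) sp) sf).
have e y : U0 y -> 0 = phi y * f y by move=> y0; rewrite p0// mul0r.
exact: (smooth_eq_on oU0 e (smooth_cst 0 oU0)).
Qed.

Lemma is_cder_linear (l : V -> R) z v : (forall (h : R) v z, l (h *: v + z) = h * l v + l z) ->
  is_cder (fun z => (l z)%:C) z v (l v)%:C.
Proof.
move=> hl; apply: is_cderR; apply/is_derive_line.
rewrite (_ : (fun h : R => _) = fun h : R => h * l v + l z); last by apply/funext => h; rewrite hl.
apply: (@is_derive_eq _ _ _ _ _ _ _ (l v * 1 + 0)); last by rewrite mulr1 addr0.
apply: (is_deriveD _ (is_derive_cst _ _ _)).
rewrite (_ : (fun h => h * l v) = l v \*: id); last by apply/funext => h; rewrite /= mulrC.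
exact: is_deriveZ.
Qed.

End Gluing.

(** * Smoothness off the axis [x = 0] *)

Section OffAxis.
Context {R : realType} (alpha tau : R).
Context (hp : 0 < alpha < 1 /\ 0 < tau < 1).
Notation mu := (@lebesgue_measure R).
Local Arguments re : simpl never.
Implicit Types (z v : R * R) (η x t d sg : R).

(** [y^m exp (-y) <= m!] with [y] a multiple of [<η>^(1 - alpha)]; choosing [m (1 - alpha) >= N + 2]
    pays for the power [N] and leaves an integrable factor. *)
Lemma exp_decay d N : 0 < d -> exists2 C : R, 0 <= C & forall x η, d <= x ->
  jb η ^+ N * expR (- (x * re (psym alpha tau η))) <= C * wt 1 η.
Proof.
move=> d0; have [k k0 hk] := re_psym_ge hp.
have a1 : 0 < 1 - alpha by case: hp => /andP[_]; rewrite -subr_gt0.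
have [m hm] : exists m : nat, N.+2%:R <= m%:R * (1 - alpha).
  exists (Num.trunc (N.+2%:R / (1 - alpha))).+1.
  by rewrite -ler_pdivrMr// ltW// truncnS_gt.
have dk0 : 0 < (d * k) ^+ m by rewrite exprn_gt0// mulr_gt0.
exists (m`!%:R / (d * k) ^+ m); first by rewrite divr_ge0// ltW.
move=> x η dx; have j0 := jb_gt0 η.
have -> : wt 1 η = (jb η ^+ 2)^-1 by rewrite -(wt_natE 1).
rewrite (ler_pdivlMr _ _ (exprn_gt0 2 j0)) [leLHS]mulrAC -exprD (mulrC m`!%:R) (ler_pdivlMl _ _ dk0) mulrC.
rewrite -addn2 in hm; move: (N + 2)%N hm => n hm.
set y := d * k * jb η `^ (1 - alpha).
have y0 : 0 <= y by rewrite !mulr_ge0 ?powR_ge0 ?(ltW d0) ?(ltW k0).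
have py : y <= x * re (psym alpha tau η).
  rewrite /y -mulrA; apply: ler_pM; [exact: ltW|by rewrite mulr_ge0 ?powR_ge0 ?(ltW k0)|exact: dx|exact: hk].
apply: le_trans (exprMexpRN_le m y0).
rewrite mulrAC; apply: ler_pM; rewrite ?expR_ge0 ?mulr_ge0 ?exprn_ge0 ?(ltW j0) ?(ltW d0) ?(ltW k0)//; last first.
  by rewrite ler_expR lerN2.
rewrite /y [in leRHS]exprMn [leLHS]mulrC; apply: ler_wpM2l; first exact: ltW.
rewrite -(powR_mulrn _ (ltW j0)) -(powR_mulrn _ (powR_ge0 _ _)) -powRrM mulrC.
  exact: jb_powR_le.
by rewrite mulr_ge0 ?(ltW d0) ?(ltW k0).
Qed.

(** The amplitude after [j] derivatives in [t], each multiplying by [s], and [k] in [x], each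
    multiplying by [s l] up to sign. [sg] is the sign of [x], so that [osc] contains [|x| = sg x];
    the integrals [osci sg j k] then form a stable family on each open half-plane. *)
Definition amp (j k : nat) η : R[i] := sinv η * lsym alpha tau η * (sl η ^+ j * psym alpha tau η ^+ k).

Definition osc (sg : R) z η : R[i] := cexp (sl η * z.2%:C - (sg * z.1)%:C * psym alpha tau η).

Lemma normc_psym η : normc (psym alpha tau η) <= jb η.
Proof.
rewrite (normcM (sl η)) -[leRHS]mulr1; apply: ler_pM; rewrite ?normc_ge0 ?sl_le_jb//.
exact: normc_lsym.
Qed.

Lemma amp_le j k η : normc (amp j k η) <= jb η ^+ (j + k).
Proof.
rewrite /amp (normcM (sinv η * _)) (normcM (sinv η)) (normcM (sl η ^+ j)) !normcX exprD -[leRHS]mul1r.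
apply: ler_pM; rewrite ?mulr_ge0 ?exprn_ge0 ?normc_ge0//; last first.
  by apply: ler_pM; rewrite ?exprn_ge0 ?normc_ge0// lerXn2r ?nnegrE ?normc_ge0 ?sl_le_jb ?normc_psym ?(ltW (jb_gt0 _))//.
rewrite -[leRHS]mulr1; apply: ler_pM; rewrite ?normc_ge0 ?(normc_lsym hp)//.
by rewrite normcV invf_le1 ?normc_sl_ge// (lt_le_trans ltr01 (normc_sl_ge η)).
Qed.

Lemma normc_osc sg z η : normc (osc sg z η) = expR z.2 * expR (- (sg * z.1 * re (psym alpha tau η))).
Proof.
rewrite normc_cexp reB reMr -expRD.
have -> // : re (sl η * z.2%:C) = z.2 by rewrite reM re_sl mul1r -[im z.2%:C]/0 mulr0 subr0.
Qed.

Lemma amp_dom sg d T j k : 0 < d -> exists2 C : R, 0 <= C & forall z η, d <= sg * z.1 -> z.2 <= T ->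
  normc (amp j k η * osc sg z η) <= C * wt 1 η.
Proof.
move=> d0; have [C C0 hC] := exp_decay (j + k) d0.
exists (expR T * C); first by rewrite mulr_ge0 ?expR_ge0.
move=> z η dz zT; rewrite (normcM (amp _ _ _)) normc_osc.
apply: (@le_trans _ _ (jb η ^+ (j + k) * (expR T * expR (- (sg * z.1 * re (psym alpha tau η)))))).
  by apply: ler_pM; rewrite ?normc_ge0 ?mulr_ge0 ?expR_ge0 ?amp_le// ler_wpM2r ?expR_ge0 ?ler_expR.
rewrite (_ : _ * _ = expR T * (jb η ^+ (j + k) * expR (- (sg * z.1 * re (psym alpha tau η))))); last by ring.
by rewrite -[leRHS]mulrA ler_wpM2l ?expR_ge0 ?hC.
Qed.

Lemma ccontX (V : normedModType R) (f : V -> R[i]) (n : nat) (w : V) : ccont f w -> ccont (fun y => f y ^+ n) w.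
Proof.
move=> cf; elim: n => [|n IH]; first exact: ccont_cst.
by rewrite (_ : (fun _ => _) = fun y => f y * f y ^+ n); [exact: ccontM|apply/funext => y; rewrite exprS].
Qed.

Lemma amp_cont j k η : ccont (amp j k) η.
Proof.
apply: ccontM; apply: ccontM.
- exact: cder_cont (is_cder_sinv η).
- exact: cder_cont (is_cder_lsym hp η).
- apply: ccontX; exact: cder_cont (is_cder_sl η).
- apply: ccontX; exact: cder_cont (is_cder_psym hp η).
Qed.

Lemma osc_cont sg z η : ccont (osc sg z) η.
Proof.
apply: ccont_exp; apply: cder_cont; apply: is_cderB; last exact: is_cderZ (is_cder_psym hp η).
exact: is_cderM (is_cder_sl η) (cder_cst _ _ _).
Qed.

Lemma is_cder_osc sg z v η : is_cder (fun z => osc sg z η) z v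
  ((v.2%:C * sl η - (sg * v.1)%:C * psym alpha tau η) * osc sg z η).
Proof.
have d1 : is_cder (fun z => (sg * z.1)%:C) z v (sg * v.1)%:C.
  by apply: (is_cder_linear (l := fun z => sg * z.1)) => h a b; rewrite fst_lin mulrDr; congr (_ + _); exact: mulrCA.
have d2 : is_cder (fun z => z.2%:C) z v v.2%:C by apply: (is_cder_linear (l := snd)).
have := cder_exp (is_cderB (is_cderZ (sl η) d2) (is_cderM d1 (cder_cst (psym alpha tau η) z v))).
by move=> h; apply: cder_eq h _; rewrite mulr0 addr0 [sl η * _]mulrC.
Qed.

Definition osci sg (j k : nat) z : R[i] := cint mu setT (fun η => amp j k η * osc sg z η).

Lemma cmeas_osci sg j k z : cmeas (T := mR R) setT (fun η => amp j k η * osc sg z η).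
Proof. by apply: cmeasT1 => η; apply: ccontM; [exact: amp_cont|exact: osc_cont]. Qed.

Lemma cintble_osci sg j k z : 0 < sg * z.1 -> cintble mu setT (fun η => amp j k η * osc sg z η).
Proof.
move=> z1; have [C C0 hC] := amp_dom sg z.2 j k z1.
apply: (cintble_dom measurableT (cmeas_osci _ _ _ _) (integrableZl measurableT C (@integrable_wt R 1 ltr01))).
by move=> η _; exact: hC.
Qed.

Lemma near_half sg z y : `|sg| = 1 -> `|z - y| < sg * z.1 / 2 -> sg * z.1 / 2 <= sg * y.1 /\ y.2 <= z.2 + sg * z.1 / 2.
Proof.
move=> s1 h.
have h1 : `|z.1 - y.1| < sg * z.1 / 2 by apply: le_lt_trans h; exact: (norm_fst (z - y)).
have h2 : `|z.2 - y.2| < sg * z.1 / 2 by apply: le_lt_trans h; exact: (norm_snd (z - y)).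
have h3 : sg * (z.1 - y.1) < sg * z.1 / 2.
  by apply: le_lt_trans h1; rewrite -[leRHS]mul1r -s1 -normrM ler_norm.
have : `|y.2 - z.2| < sg * z.1 / 2 by rewrite distrC.
by rewrite ltr_distl => /andP[_ h4]; split; [move: h3; rewrite mulrBr; lra|exact: ltW].
Qed.

Lemma osci_cont sg j k z : `|sg| = 1 -> 0 < sg * z.1 -> ccont (osci sg j k) z.
Proof.
move=> s1 z1; have d0 : 0 < sg * z.1 / 2 by rewrite divr_gt0.
have [C C0 hC] := amp_dom sg (z.2 + sg * z.1 / 2) j k d0.
apply: (cint_continuous measurableT d0 (fun y _ => cmeas_osci sg j k y) _ (integrableZl measurableT C (@integrable_wt R 1 ltr01))).
  move=> η _; apply: ccontM; first exact: ccont_cst.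
  apply: ccont_exp; rewrite (_ : (fun _ => _) = fun y : R * R => sl η * y.2%:C + (- sg%:C * psym alpha tau η) * y.1%:C); last first.
    by apply/funext => y; rewrite rmorphM /=; ring.
  by apply: ccontD; apply: ccontM; [exact: ccont_cst|exact: (ccont_snd (smooth_cont smooth_id I))|exact: ccont_cst|exact: (ccont_fst (smooth_cont smooth_id I))].
by move=> y η /near_half-/(_ s1)[h1 h2] _; exact: hC.
Qed.

Lemma is_cder_osci sg j k z v : `|sg| = 1 -> 0 < sg * z.1 ->
  is_cder (osci sg j k) z v (v.2%:C * osci sg j.+1 k z + (- (sg * v.1))%:C * osci sg j k.+1 z).
Proof.
move=> s1 z1; have d0 : 0 < sg * z.1 / 2 by rewrite divr_gt0.
set T := z.2 + sg * z.1 / 2.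
have [C1 _ h1] := amp_dom sg T j.+1 k d0; have [C2 _ h2] := amp_dom sg T j k.+1 d0.
(* For [|h| < e] the point moves by less than half its distance to the axis. *)
set e := sg * z.1 / 2 / (1 + `|v|).
have v0 : 0 < 1 + `|v| :> R := one_norm_gt0 v.
have e0 : 0 < e by rewrite divr_gt0.
have dz h : `|h| < e -> sg * z.1 / 2 <= sg * (h *: v + z).1 /\ (h *: v + z).2 <= T.
  move=> he; apply: near_half => //; rewrite -normrN opprB addrK normrZ.
  apply: (@le_lt_trans _ _ (`|h| * (1 + `|v|))); first by rewrite ler_wpM2l// lerDr.
  by rewrite -ltr_pdivlMr.
pose D y η := v.2%:C * (amp j.+1 k η * osc sg y η) + (- (sg * v.1))%:C * (amp j k.+1 η * osc sg y η).
have -> : v.2%:C * osci sg j.+1 k z + (- (sg * v.1))%:C * osci sg j k.+1 z = cint mu setT (D z).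
  by rewrite /D cintDT ?cintZT//; try apply: cintbleZT; exact: cintble_osci.
apply: (@is_cder_cint R (R * R)%type _ (mR R) mu setT (fun z η => amp j k η * osc sg z η) D (fun η => (`|v.2| * C1 + `|- (sg * v.1)| * C2) * wt 1 η) z v e measurableT e0).
- move=> h /dz[hx ht]; apply: cintble_osci; exact: lt_le_trans hx.
- move=> h η _ _; have := is_cderZ (amp j k η) (is_cder_osc sg (h *: v + z) v η).
  move/cder_eq; apply; rewrite /D /amp [sl η ^+ j.+1]exprS [psym alpha tau η ^+ k.+1]exprS [(- (sg * v.1))%:C]rmorphN /=; ring.
- exact: (integrableZl measurableT _ (@integrable_wt R 1 ltr01)).
- move=> h η /dz[hx ht] _; apply: le_trans (normcD _ _) _.
  rewrite (normcM v.2%:C) (normcM (- (sg * v.1))%:C) !normcR.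
  rewrite [leRHS](_ : _ = `|v.2| * (C1 * wt 1 η) + `|- (sg * v.1)| * (C2 * wt 1 η)); last by ring.
  by apply: lerD; apply: ler_wpM2l => //; [exact: h1|exact: h2].
Qed.

Lemma smooth_osci (sg : R) j k : `|sg| = 1 -> smooth_on [set z : R * R | 0 < sg * z.1] (osci sg j k).
Proof.
move=> s1; apply: (@dstable_smooth _ _ _ [set f | exists j k, f = osci sg j k]); last by exists j, k.
  rewrite (_ : [set _ | _] = (fun z : R * R => sg * z.1) @^-1` [set x | 0 < x]); last by [].
  apply: open_comp; last exact: open_gt.
  by move=> z _; apply: cvgM; [exact: cvg_cst|exact: cvg_fst].
move=> f [j' [k' ->]]; split; first by move=> z z1; exact: osci_cont.
move=> v; exists (fun z => v.2%:C * osci sg j'.+1 k' z + (- (sg * v.1))%:C * osci sg j' k'.+1 z).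
  by apply: spnD; apply: spnZ; apply: spn1; [exists j'.+1, k'|exists j', k'.+1].
by move=> z z1; exact: is_cder_osci.
Qed.

(** The inverse Laplace integral, the density of [S] off the axis. On the axis the integrand is only
    [O (1 / |η|)]; these values are discarded through [off] below. *)
Definition F0 z : R[i] := (kF^-1)%:C * cint mu setT (fun η => St alpha tau z.1 η * rotc (sl η) z.2).

Lemma St_osc sg z η : `|sg| = 1 -> 0 < sg * z.1 ->
  St alpha tau z.1 η * rotc (sl η) z.2 = 2^-1%:C * (amp 0 0 η * osc sg z η).
Proof.
move=> s1 z1; rewrite /osc -(gtr0_norm z1) normrM s1 mul1r cexpD /St /amp /rotc !expr0 !mulr1; ring.
Qed.

Lemma F0_osci sg z : `|sg| = 1 -> 0 < sg * z.1 -> F0 z = ((2 * kF)^-1)%:C * osci sg 0 0 z.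
Proof.
move=> s1 z1; rewrite /F0 (_ : cint mu _ _ = cint mu setT (fun η => 2^-1%:C * (amp 0 0 η * osc sg z η))); last first.
  by apply: eq_cint => η _; exact: St_osc.
rewrite cintZT; last exact: cintble_osci.
by rewrite mulrA -rmorphM /= -invfM [kF * _]mulrC.
Qed.

Lemma F0_smooth : smooth_on [set z : R * R | z.1 != 0] F0.
Proof.
have sm sg : `|sg| = 1 -> smooth_on [set z : R * R | 0 < sg * z.1] F0.
  move=> s1; have oU : open [set z : R * R | 0 < sg * z.1].
    rewrite (_ : [set _ | _] = (fun z : R * R => sg * z.1) @^-1` [set x | 0 < x]); last by [].
    apply: open_comp; last exact: open_gt.
    by move=> z _; apply: cvgM; [exact: cvg_cst|exact: cvg_fst].
  apply: (smooth_eq_on oU _ (smoothZ ((2 * kF)^-1)%:C oU (smooth_osci 0 0 s1))).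
  by move=> z z1; rewrite (F0_osci s1 z1).
move=> vs z /=; rewrite neq_lt => /orP[z1|z1].
- by apply: (sm (-1)); rewrite ?normrN1//= mulN1r oppr_gt0.
- by apply: (sm 1); rewrite ?normr1//= mul1r.
Qed.

End OffAxis.

(** * Null sets and the majorant [|x|^(-1/2)] *)

Section NullSets.
Context {R : realType} d {T : measurableType d} (m : {measure set T -> \bar R}).

Lemma cint_ae (N : set T) (f g : T -> R[i]) : measurable N -> m N = 0%E -> cmeas setT f -> cmeas setT g ->
  (forall x, ~ N x -> f x = g x) -> cint m setT f = cint m setT g.
Proof.
move=> mN N0 [f1 f2] [g1 g2] fg.
have h (q : R[i] -> R) : measurable_fun setT (q \o f) -> measurable_fun setT (q \o g) ->
    (\int[m]_x q (f x) = \int[m]_x q (g x))%R.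
  move=> qf qg; congr fine; apply: ae_eq_integral => //; [exact/measurable_EFinP|exact/measurable_EFinP|].
  exists N; split => // x /= nx; apply: contrapT => Nx; apply: nx => _; by rewrite (fg x Nx).
by apply: cplxP; rewrite /=; apply: h.
Qed.

End NullSets.

Section InverseSqrt.
Context {R : realType}.
Notation mu := (@lebesgue_measure R).

Definition rsq (M x : R) : R := if `|x| <= M then `|x| `^ (- 2^-1) else 0.

Lemma rsq_ge0 M x : 0 <= rsq M x.
Proof. by rewrite /rsq; case: ifP => _; rewrite ?powR_ge0. Qed.

Lemma rsq_int (a M : R) : 0 < a -> a <= M -> (\int[mu]_(x in `[a, M]) (`|x| `^ (- 2^-1))%:E <= (2 * M `^ 2^-1)%:E)%E.
Proof.
move=> a0 aM; have p x : a <= x <= M -> 0 < x by move=> /andP[ax _]; exact: lt_le_trans ax.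
have dF x : a <= x <= M -> is_cder (fun y => (2 * y `^ 2^-1)%:C) x (1 : R) (`|x| `^ (- 2^-1))%:C.
  move=> /p x0; have := is_cderR (is_deriveZ 2 (is_derive_powRC 2^-1 x0 (is_derive_id x (1 : R)))).
  move/cder_eq; apply; congr (_%:C); rewrite gtr0_norm// /GRing.scale /= mulr1 mulrA mulfV ?mul1r//.
  by congr (_ `^ _); field.
have c x : a <= x <= M -> ccont (fun x => (`|x| `^ (- 2^-1))%:C) x.
  by move=> /p x0; apply: ccontR; apply: continuous_powRC; [rewrite normr_gt0 gt_eqF|exact: norm_continuous].
have [i1 _] := cintble_itv c.
have := congr1 (@re R) (cFTC aM dF c); rewrite /cint /re /= => e.
have mi : measurable (`[a, M]%classic : set (mR R)) by exact: measurable_itv.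
rewrite -[leLHS](fineK (integrable_fin_num mi i1)) -[fine _]/(\int[mu]_(x in `[a, M]) `|x| `^ (- 2^-1))%R.
by rewrite lee_fin e lerBlDr lerDl mulr_ge0 ?powR_ge0.
Qed.

(** The sets [F n] leave out [|x| < eps n]; the primitive [2 sqrt |x|] bounds the integrals over
    them by [4 sqrt M] uniformly, and monotone convergence concludes. The missing point 0 does not
    matter since the power of 0 is 0 by convention. *)
Lemma integrable_rsq M : 0 <= M -> mu.-integrable setT (EFin \o rsq M).
Proof.
move=> M0.
have mr : measurable_fun setT (rsq M).
  apply: measurable_fun_ifT => //.
    by apply: measurable_fun_ler => //; exact: normr_measurable.
  exact: (measurableT_comp (measurable_powR _) (@normr_measurable R setT)).
pose F (n : nat) : set (mR R) := `[- M, - eps n]%classic `|` `[eps n, M]%classic.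
have mF n : measurable (F n) by apply: measurableU; exact: measurable_itv.
have ndF : nondecreasing_seq F.
  move=> n k nk; apply/subsetPset => x; have le : eps k <= eps n :> R.
    by rewrite /eps lef_pV2 ?posrE ?ltr0n// ler_nat ltnS.
  rewrite /F /= !in_itv /= => -[/andP[h1 h2]|/andP[h1 h2]]; [left|right]; rewrite ?h1 ?h2 ?andbT /=.
    by apply: le_trans h2 _; rewrite lerN2.
  exact: le_trans le h1.
have le n : (\int[mu]_(x in F n) (rsq M x)%:E <= (4 * M `^ 2^-1)%:E)%E.
  have e0 := @eps_gt0 R n; have [eM|Me] := leP (eps n) M; last first.
    rewrite /F !set_itv_ge ?bnd_simp -?ltNge ?ltrN2// setU0 integral_set0 lee_fin mulr_ge0 ?powR_ge0//.
  rewrite ge0_integral_setU//; first last.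
  - apply/disj_setPS => x [] /=; rewrite !in_itv /= => /andP[_ h1] /andP[h2 _]; lra.
  - by move=> x _; rewrite lee_fin rsq_ge0.
  - apply/measurable_EFinP; exact: measurable_funTS.
  have E (A : set (mR R)) : (forall x : R, A x -> `|x| <= M) ->
      (\int[mu]_(x in A) (rsq M x)%:E = \int[mu]_(x in A) (`|x : R| `^ (- 2^-1))%:E)%E.
    by move=> h; apply: eq_integral => x; rewrite inE => /h xM; rewrite /rsq xM.
  have -> : 4 * M `^ 2^-1 = 2 * M `^ 2^-1 + 2 * M `^ 2^-1 by ring.
  have H := rsq_int e0 eM; rewrite EFinD; apply: leeD; rewrite E.
  - rewrite integration_by_substitution_oppr//; first by under eq_integral do rewrite /= normrN.
    apply: continuous_in_subspaceT => x; rewrite inE /= in_itv /= => /andP[_ xe].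
    by apply: continuous_powRC; [rewrite normr_gt0 lt_eqF//; lra|exact: norm_continuous].
  - by move=> x; rewrite /= in_itv /= => /andP[h1 h2]; rewrite ler_norml; apply/andP; split; lra.
  - exact: H.
  - by move=> x; rewrite /= in_itv /= => /andP[h1 h2]; rewrite ler_norml; apply/andP; split; lra.
have cv := @ge0_nondecreasing_set_cvg_integral _ _ R F (fun x => (rsq M x)%:E) mu ndF mF
  (fun n => measurable_funTS (iffRL (measurable_EFinP _ _) mr)) (fun n x _ => rsq_ge0 M x).
have l : (\int[mu]_(x in \bigcup_i F i) (rsq M x)%:E <= (4 * M `^ 2^-1)%:E)%E.
  have <- := cvg_lim (@ereal_hausdorff _) cv; apply: lime_le; last exact: nearW.
  by apply/cvg_ex; eexists; exact: cv.
apply/integrableP; split; first exact/measurable_EFinP.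
apply: le_lt_trans (ltry (4 * M `^ 2^-1)); apply: le_trans l.
rewrite [leRHS]integral_mkcond le_eqVlt; apply/orP; left; apply/eqP; apply: eq_integral => x _.
rewrite /= ger0_norm ?rsq_ge0// patchE; case: ifPn => //; rewrite notin_setE => nx; congr EFin.
rewrite /rsq; case: ifP => // xM; have [->|x0] := eqVneq x 0; first by rewrite normr0 powR0// oppr_eq0 invr_eq0.
exfalso; apply: nx; have [N _ hN] : \forall n \near \oo, eps n < `|x|.
  by apply: (cvgr_lt _ (@eps_cvg R)); rewrite normr_gt0.
exists N => //; have := hN N (leqnn N); rewrite /F /= !in_itv /=.
by move: xM x0; case: (ler0P x) => x0 xM _ /= h; [left|right]; rewrite ?xM; lra.
Qed.

End InverseSqrt.

Section Positivity.
Context {R : realType}.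
Notation mu := (@lebesgue_measure R).

Definition bump2 (z0 : R * R) (r : R) (z : R * R) : R[i] := (bumpa z0.1 r z.1)%:C * (bumpa z0.2 r z.2)%:C.

Lemma test_bump2 z0 r : 0 < r -> test (bump2 z0 r).
Proof. by move=> r0; exact: test_tensor (test_bumpa _ r0) (test_bumpa _ r0). Qed.

Lemma bump2_out z0 r z : 0 < r -> r <= `|z - z0| -> bump2 z0 r z = 0.
Proof.
move=> r0; rewrite /Num.norm /= le_max /bump2 => /orP[h|h]; first by rewrite bumpa_out// mul0r.
by rewrite [X in _ * X%:C]bumpa_out// mulr0.
Qed.

Lemma bump2_self z0 r : 0 < r -> bump2 z0 r z0 != 0.
Proof.
move=> r0; rewrite mulf_neq0// -normc_eq0 normcR normr_eq0 gt_eqF// bumpa_gt0//; by rewrite subrr normr0.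
Qed.

End Positivity.

(* The canonical sigma-finite structure on [product_measure1] is registered only
   for subprobabilities. *)
Definition prodsf (R : realType) d1 d2 (T1 : measurableType d1) (T2 : measurableType d2)
    (m1 : {sigma_finite_measure set T1 -> \bar R}) (m2 : {sigma_finite_measure set T2 -> \bar R}) :
    {sigma_finite_measure set (T1 * T2)%type -> \bar R} :=
  HB.pack (m1 \x m2)%E
    (lebesgue_integral_fubini.measure_function_Measure_isSigmaFinite__to__measure_function_isSigmaFinite m1 m2)
    (lebesgue_integral_fubini.measure_function_Measure_isSigmaFinite__to__measure_function_isSFinite m1 m2).

(** * Representation of [S] by a function *)

Section Representation.
Context {R : realType} (alpha tau : R) (S : (R * R -> R[i]) -> R[i]).
Context (hp : 0 < alpha < 1 /\ 0 < tau < 1) (hS : zener_fundamental_solution alpha tau S).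
Notation mu := (@lebesgue_measure R).
Notation mu2 := (@lebesgue_measure R \x @lebesgue_measure R)%E.
Local Arguments re : simpl never.
Implicit Types (z v : R * R) (η x t d : R) (phi : R * R -> R[i]).

Lemma a1_gt0 : 0 < 1 - alpha.
Proof. by case: hp => /andP[_]; rewrite -subr_gt0. Qed.

Lemma is_cder_rotc_sl t η : is_cder (fun η => rotc (sl η) t) η (1 : R) (ci * t%:C * rotc (sl η) t).
Proof.
have := cder_exp (is_cderM (is_cder_sl η) (cder_cst t%:C η (1 : R))).
by move=> h; apply: cder_eq h _; rewrite mulr0 addr0.
Qed.

Lemma rotc2_cont (w : R * R) : ccont (fun w : R * R => rotc (sl w.2) w.1) w.
Proof.
apply: ccont_exp; apply: ccontM; first exact: (ccont_snd (cder_cont (is_cder_sl w.2))).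
exact: (ccont_fst (smooth_cont smooth_id I)).
Qed.

Lemma jb_n (n : nat) : jb (n%:R : R) = n.+1%:R /\ jb (- n%:R : R) = n.+1%:R.
Proof. by rewrite /jb normrN ger0_norm// -natr1 addrC. Qed.

Lemma cici : ci * ci = -1 :> R[i].
Proof. by apply: cplxP; rewrite ?reM ?imM -[re ci]/(0 : R) -[im ci]/(1 : R) ?reN ?imN ?re1 ?im1; ring. Qed.

(** One integration by parts in [η] trades the factor [t] for the derivative of [St], of order
    [1 + (1 - alpha) > 1]. The new integral converges absolutely and locally uniformly up to
    [x = 0]; it is [F1], and so [t F0] extends continuously across the axis. *)
Lemma F1_exists : exists F1 : R * R -> R[i], (forall z, ccont F1 z) /\
  forall z, z.1 != 0 -> z.2%:C * F0 alpha tau z = F1 z.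
Proof.
have [sb [dSt dD sD0]] := sym_St hp 1.
have sD : sym alpha 0 (1 + (1 - alpha)) dSt := sD0.
have [C C0 hC] := sym_bound hp sD; have [B B0 hB] := sym_bound hp (sym_St hp 0).
pose I z η := dSt z.1 η * rotc (sl η) z.2.
have Ib z η T : z.2 <= T -> normc (I z η) <= C * expR T * wt (1 - alpha) η.
  move=> zT; rewrite (normcM (dSt _ _)) normc_rotc re_sl mul1r mulrAC.
  by apply: ler_pM; rewrite ?normc_ge0 ?expR_ge0 ?ler_expR//; exact: hC.
have Ic z η : ccont (I z) η.
  apply: ccontM; last exact: cder_cont (is_cder_rotc_sl _ _).
  exact: (ccont_comp (f := fun w : R * R => dSt w.1 w.2) (g := fun y => (z.1, y)) (cvg_pair (cvg_cst _) cvg_id) (sym_cont hp (z.1, η) sD)).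
have iw T := integrableZl measurableT (C * expR T) (integrable_wt a1_gt0).
have iI z : cintble mu setT (I z) := cintble_dom measurableT (cmeasT1 (Ic z)) (iw z.2) (fun η _ => Ib z η z.2 (lexx _)).
exists (fun z => (kF^-1)%:C * (ci * cint mu setT (I z))); split => [z|z z1].
  apply: ccontM; first exact: ccont_cst.
  apply: ccontM; first exact: ccont_cst.
  apply: (cint_continuous measurableT ltr01 (fun y _ => cmeasT1 (Ic y)) _ (iw (z.2 + 1))).
    move=> η _; apply: ccontM.
      exact: (ccont_fst (f := dSt^~ η) (ccont_pair1 (sym_cont hp (z.1, η) sD))).
    exact: (ccont_snd (cder_cont (is_cder_rotc (sl η) z.2))).
  move=> y η zy _; apply: Ib.
  have : `|z.2 - y.2| < 1 by apply: le_lt_trans zy; exact: (norm_snd (z - y)).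
  by rewrite distrC ltr_distl => /andP[_ /ltW].
have iS : cintble mu setT (fun η => St alpha tau z.1 η * rotc (sl η) z.2).
  have s0 : `|Num.sg z.1| = 1 :> R by rewrite normr_sg z1.
  have s1 : 0 < Num.sg z.1 * z.1 by rewrite -normrEsg normr_gt0.
  have e : (fun η => St alpha tau z.1 η * rotc (sl η) z.2) = fun η => 2^-1%:C * (amp alpha tau 0 0 η * osc alpha tau (Num.sg z.1) z η).
    by apply/funext => η; exact: St_osc.
  by rewrite e; exact: cintbleZT (cintble_osci hp 0 0 s1).
pose f η := I z η + ci * z.2%:C * (St alpha tau z.1 η * rotc (sl η) z.2).
have : cint mu setT f = 0.
  apply: (@cint_derT _ (fun η => St alpha tau z.1 η * rotc (sl η) z.2)).
  - move=> η; apply: cder_eq (is_cderM (dD z.1 η) (is_cder_rotc_sl z.2 η)) _.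
    by rewrite /f /I; ring.
  - move=> η; apply: ccontD; first exact: Ic.
    apply: ccontM; first exact: ccont_cst.
    apply: ccontM; [exact: cder_cont (dD z.1 η)|exact: cder_cont (is_cder_rotc_sl _ _)].
  - exact: cintbleDT (iI z) (cintbleZT _ iS).
  - apply: (@ccvg_sqz _ _ _ (fun n => B * expR z.2 * eps n)); last first.
      by rewrite -[X in _ --> X](mulr0 (B * expR z.2)); apply: cvgMr; exact: eps_cvg.
    move=> n; rewrite subr0 (normcM (St _ _ _ _)) normc_rotc re_sl mul1r mulrAC.
    apply: ler_pM; rewrite ?normc_ge0 ?expR_ge0//.
    by apply: le_trans (hB _ _) _; rewrite (jb_n n).1 powR_inv1 ?ler0n.
  - apply: (@ccvg_sqz _ _ _ (fun n => B * expR z.2 * eps n)); last first.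
      by rewrite -[X in _ --> X](mulr0 (B * expR z.2)); apply: cvgMr; exact: eps_cvg.
    move=> n; rewrite subr0 (normcM (St _ _ _ _)) normc_rotc re_sl mul1r mulrAC.
    apply: ler_pM; rewrite ?normc_ge0 ?expR_ge0//.
    by apply: le_trans (hB _ _) _; rewrite (jb_n n).2 powR_inv1 ?ler0n.
rewrite /f cintDT//; last exact: cintbleZT.
rewrite cintZT// => /eqP; rewrite addr_eq0 => /eqP ->; rewrite /F0.
rewrite [RHS](_ : _ = - (ci * ci) * (z.2%:C * ((kF^-1)%:C * cint mu setT (fun η => St alpha tau z.1 η * rotc (sl η) z.2)))); last by ring.
by rewrite cici opprK mul1r.
Qed.

(** The geometric mean of two symbol bounds, [|St| <= C1 / <η>] and
    [|x| |St| <= C2 <η>^(-1 - (1 - alpha))]: half a power of [1 / |x|] buys the decay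
    [(1 - alpha) / 2] that makes [St] integrable in [x] and [η] jointly. *)
Lemma St_rsq : exists2 C : R, 0 <= C & forall x η, x != 0 ->
  normc (St alpha tau x η) <= C * (`|x| `^ (- 2^-1) * wt ((1 - alpha) / 2) η).
Proof.
have [C1 C10 h1] := sym_bound hp (sym_St hp 0).
have sx : sym alpha 0 (1 + 1%:R * (1 - alpha)) (fun x η => `|x|%:C * St alpha tau x η).
  have := symM hp (sym_sinv hp 0) (symM0 hp (sym_lsym hp 0) (sym_expx hp 0 1)).
  move/(symM0 hp (sym_cst hp 0 2^-1%:C)); apply: (sym_ext hp) => x η.
  by rewrite /St /expx expr1; ring.
have [C2 C20 h2] := sym_bound hp sx.
exists (Num.sqrt (C1 * C2)); first exact: sqrtr_ge0.
move=> x η x0; have ax : 0 < `|x| by rewrite normr_gt0.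
have j0 := jb_gt0 η.
rewrite -ler_sqr ?nnegrE ?normc_ge0 ?mulr_ge0 ?sqrtr_ge0 ?powR_ge0 ?wt_ge0//.
have -> : (Num.sqrt (C1 * C2) * (`|x| `^ (- 2^-1) * wt ((1 - alpha) / 2) η)) ^+ 2 =
    `|x|^-1 * ((C1 * jb η `^ (-1)) * (C2 * jb η `^ (- (1 + 1%:R * (1 - alpha))))).
  rewrite !exprMn sqr_sqrtr ?mulr_ge0// -!(powR_mulrn 2) ?powR_ge0// -!powRrM.
  have -> : - 2^-1 * 2%:R = -1 :> R by field.
  have -> : - (1 + (1 - alpha) / 2) * 2%:R = - 1 + - (1 + 1%:R * (1 - alpha)) by field.
  rewrite -/(jb η) jb_powRD -(powR_inv1 (ltW ax)); ring.
rewrite [leRHS]mulrC ler_pdivlMr//.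
rewrite (_ : _ * _ = normc (St alpha tau x η) * normc (`|x|%:C * St alpha tau x η)).
  by apply: ler_pM; rewrite ?normc_ge0 ?h1 ?h2.
by rewrite (normcM `|x|%:C) normcR normr_id expr2; ring.
Qed.

(** Removes the null set [x = 0], on which the majorant [rsq] is 0 while the integrand need not
    be. *)
Definition off (x : R) : R := \1_([set~ 0]) x.

Lemma off1 x : x != 0 -> off x = 1.
Proof. by move=> /eqP x0; rewrite /off indicE mem_set. Qed.

Lemma off0 : off 0 = 0.
Proof. by rewrite /off indicE memNset//= => /(_ erefl). Qed.

Lemma moff : measurable_fun setT (off : mR R -> R).
Proof. by apply: measurable_indic; apply: measurableC; exact: measurable_set1. Qed.

Definition kerS phi (w : (mR R * mR R) * mR R) : R[i] :=
  (off w.1.1)%:C * (St alpha tau w.1.1 w.2 * (phi w.1 * rotc (sl w.2) w.1.2)).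

Lemma cmeas_kerS phi : test phi -> cmeas setT (kerS phi).
Proof.
move=> [sp _]; apply: cmeasM.
  by apply: cmeasR; exact: (measurableT_comp moff (measurableT_comp measurable_fst measurable_fst)).
apply: cmeasM.
  apply: (cmeas_comp (f := fun w : mR R * mR R => St alpha tau w.1 w.2)
    (g := fun w : (mR R * mR R) * mR R => (w.1.1, w.2))).
    by apply: measurable_fun_pair; [exact: (measurableT_comp measurable_fst measurable_fst)|exact: measurable_snd].
  by apply: ccont_cmeas2 => w; exact: (sym_cont hp w (sym_St hp 0)).
apply: cmeasM.
  apply: (cmeas_comp (f := phi) measurable_fst); apply: ccont_cmeas2 => w.
  exact: (smooth_cont sp I).
apply: (cmeas_comp (f := fun w : mR R * mR R => rotc (sl w.2) w.1)
    (g := fun w : (mR R * mR R) * mR R => (w.1.2, w.2))).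
  by apply: measurable_fun_pair; [exact: (measurableT_comp measurable_snd measurable_fst)|exact: measurable_snd].
by apply: ccont_cmeas2 => w; exact: rotc2_cont.
Qed.

Definition boxc (M c t : R) : R := if - M <= t <= M then c else 0.

Lemma kerS_bound phi : test phi -> exists M C : R, [/\ 0 <= M, 0 <= C &
  forall x t η, normc (kerS phi ((x, t), η)) <= rsq M x * boxc M C t * wt ((1 - alpha) / 2) η].
Proof.
move=> /test2_bd[M [B [M0 B0 out bd]]]; have [C C0 hC] := St_rsq.
exists M, (C * (B * expR M)); split; rewrite ?mulr_ge0 ?expR_ge0// => x t η.
have pos : 0 <= rsq M x * boxc M (C * (B * expR M)) t * wt ((1 - alpha) / 2) η.
  by rewrite !mulr_ge0 ?rsq_ge0 ?wt_ge0// /boxc; case: ifP => // _; rewrite !mulr_ge0 ?expR_ge0.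
case: (eqVneq x 0) pos => [->|x0] pos; first by rewrite /kerS /= off0 mul0r normc0.
have [xM|xM] := leP `|x| M; last first.
  rewrite /kerS /= (out (x, t)) ?mul0r ?mulr0 ?normc0//; exact: lt_le_trans xM (norm_fst (x, t)).
have [tM|tM] := leP `|t| M; last first.
  rewrite /kerS /= (out (x, t)) ?mul0r ?mulr0 ?normc0//; exact: lt_le_trans tM (norm_snd (x, t)).
rewrite /kerS /= off1// mul1r (normcM (St _ _ _ _)) (normcM (phi _)) normc_rotc re_sl mul1r.
rewrite /rsq xM /boxc -ler_norml tM.
rewrite [leRHS](_ : _ = C * (`|x| `^ (- 2^-1) * wt ((1 - alpha) / 2) η) * (B * expR M)); last by ring.
apply: ler_pM; rewrite ?normc_ge0 ?mulr_ge0 ?normc_ge0 ?expR_ge0 ?hC//.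
apply: ler_pM; rewrite ?normc_ge0 ?expR_ge0 ?bd// ler_expR.
by apply: le_trans tM; exact: ler_norm.
Qed.

Lemma off_ae (F G : R -> R[i]) : cmeas (T := mR R) setT F -> cmeas (T := mR R) setT G ->
  (forall x, x != 0 -> F x = G x) -> cint mu setT F = cint mu setT G.
Proof.
move=> mF mG e; apply: (@cint_ae R _ (mR R) mu [set 0] F G _ _ mF mG).
- exact: measurable_set1.
- exact: lebesgue_measure_set1.
- by move=> x /= /eqP; exact: e.
Qed.

Lemma integrable_boxc M c : mu.-integrable setT (EFin \o boxc M c).
Proof. exact: itv_cst. Qed.

Lemma d2_gt0 : 0 < (1 - alpha) / 2.
Proof. by rewrite divr_gt0// a1_gt0. Qed.

Lemma kerS_cint1 phi z : test phi ->
  cint mu setT (fun η => kerS phi (z, η)) = kF%:C * ((off z.1)%:C * F0 alpha tau z * phi z).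
Proof.
move=> tp; have p0 : (kF : R) != 0 := lt0r_neq0 kF_gt0.
have [z0|z0] := eqVneq z.1 0.
  rewrite z0 off0 !mul0r mulr0 (_ : cint _ _ _ = cint mu setT (fun=> 0 * 0)).
    by rewrite cintZT ?mul0r//; split; exact: integrable0.
  by apply: eq_cint => η _; rewrite /kerS /= z0 off0 !mul0r.
have s0 : `|Num.sg z.1| = 1 :> R by rewrite normr_sg z0.
have s1 : 0 < Num.sg z.1 * z.1 by rewrite -normrEsg normr_gt0.
rewrite off1// mul1r /F0 !mulrA -rmorphM divff// mul1r [RHS]mulrC -cintZT.
  by apply: eq_cint => η _; rewrite /kerS /= off1// mul1r; ring.
have e : (fun η => St alpha tau z.1 η * rotc (sl η) z.2) = fun η => 2^-1%:C * (amp alpha tau 0 0 η * osc alpha tau (Num.sg z.1) z η).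
  by apply/funext => η; exact: St_osc.
by rewrite e; exact: cintbleZT (cintble_osci hp 0 0 s1).
Qed.

(** Fubini moves the [η]-integral of [star] inside the integral over the plane; the triple integral
    is dominated by the product in [kerS_bound]. *)
Lemma represent0 phi : test phi -> cintble mu2 setT (fun z => (off z.1)%:C * F0 alpha tau z * phi z) /\
  S phi = cint mu2 setT (fun z => (off z.1)%:C * F0 alpha tau z * phi z).
Proof.
move=> tp; have [M [C [M0 C0 hK]]] := kerS_bound tp.
have p0 : (kF : R) != 0 := lt0r_neq0 kF_gt0.
have c0 := realC_neq0 (@kF_gt0 R).
have mk := cmeas_kerS tp.
have box0 t : 0 <= boxc M C t by rewrite /boxc; case: ifP.
have i1 := integrable_prod_dom (m1 := mu) (m2 := mu) (rsq_ge0 M) box0 (integrable_rsq M0) (integrable_boxc M C).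
pose a (z : mR R * mR R) := rsq M z.1 * boxc M C z.2.
have a0 z : 0 <= a z by rewrite mulr_ge0 ?rsq_ge0.
pose b (η : mR R) := wt ((1 - alpha) / 2) η.
have b0 η : 0 <= b η by exact: wt_ge0.
have ib : mu.-integrable setT (EFin \o b) by exact: integrable_wt d2_gt0.
have hab z η : normc (kerS phi (z, η)) <= a z * b η by case: z => x t; exact: hK.
pose m12 := prodsf mu mu.
have fub1 := @cfubini1 R _ _ _ _ m12 mu (kerS phi) a b mk a0 b0 i1 ib hab.
have fub2 := @cfubini2 R _ _ _ _ m12 mu (kerS phi) a b mk a0 b0 i1 ib hab.
have if1 := @cintble_fubini1 R _ _ _ _ m12 mu (kerS phi) a b mk a0 b0 i1 ib hab.
have E z : (off z.1)%:C * F0 alpha tau z * phi z = (kF^-1)%:C * cint mu setT (fun η => kerS phi (z, η)).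
  by rewrite kerS_cint1// [RHS]mulrA -rmorphM mulVf// mul1r.
have -> : (fun z => (off z.1)%:C * F0 alpha tau z * phi z) = fun z => (kF^-1)%:C * cint mu setT (fun η => kerS phi (z, η)).
  by apply/funext => z; exact: E.
split; first exact: cintbleZ.
rewrite (cintZ _ measurableT if1).
apply: (mulfI c0); rewrite (star hp hS tp) mulrA -rmorphM divff// mul1r fub1 -fub2.
apply: eq_cint => η _; rewrite /Gs.
have mk2 : cmeas setT (fun z : mR R * mR R => kerS phi (z, η)).
  by apply: (cmeas_comp (g := fun z => (z, η))) mk; exact: measurable_pair2.
have hb2 x t : normc (kerS phi ((x, t), η)) <= b η * rsq M x * boxc M C t.
  by apply: le_trans (hK x t η) _; rewrite mulrAC [_ * b η]mulrC -mulrA.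
have ib2 : mu.-integrable setT (EFin \o (fun x => b η * rsq M x)).
  exact: (integrableZl measurableT (b η) (integrable_rsq M0)).
have b20 x : 0 <= b η * rsq M x by rewrite mulr_ge0 ?rsq_ge0.
have <- := @cfubini1 R _ _ (mR R) (mR R) mu mu (fun z => kerS phi (z, η)) _ _ mk2 b20 box0 ib2 (integrable_boxc M C) hb2.
have ifub := @cintble_fubini1 R _ _ (mR R) (mR R) mu mu (fun z => kerS phi (z, η)) _ _ mk2 b20 box0 ib2 (integrable_boxc M C) hb2.
apply: off_ae.
- apply: cmeasT1 => x; apply: ccontM; first exact: (sym_contx hp hS x η (sym_St hp 0)).
  exact: (Ftx_cont hp hS).
- exact: cintble_cmeas ifub.
move=> x x0; rewrite /Ft /L -cintZT.
  by apply: eq_cint => t _; rewrite /kerS /= off1// mul1r.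
exact: cintble_test (test_rotc _ (test_slice x tp)).
Qed.

End Representation.

(** * Continuity, local integrability and the jump of the derivative *)

Section Regularity.
Context {R : realType} (alpha tau : R) (S : (R * R -> R[i]) -> R[i]).
Context (hp : 0 < alpha < 1 /\ 0 < tau < 1) (hS : zener_fundamental_solution alpha tau S).
Notation mu := (@lebesgue_measure R).
Notation mu2 := (@lebesgue_measure R \x @lebesgue_measure R)%E.
Local Arguments re : simpl never.
Local Arguments im : simpl never.
Implicit Types (z v : R * R) (η x t d : R) (phi : R * R -> R[i]).

Lemma bump2_int z0 (r : R) : 0 < r ->
  mu2.-integrable setT (EFin \o (fun z => bumpa z0.1 r z.1 * bumpa z0.2 r z.2)) /\
  0 < (\int[mu2]_z (bumpa z0.1 r z.1 * bumpa z0.2 r z.2))%R.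
Proof.
move=> r0; have [i1 p1] := bumpa_int z0.1 r0; have [i2 p2] := bumpa_int z0.2 r0.
have b1 := @bumpa_ge0 R z0.1 r; have b2 := @bumpa_ge0 R z0.2 r.
have ii := integrable_prod_dom (m1 := mu) (m2 := mu) b1 b2 i1 i2; split => //.
pose K (z : (mR R * mR R)%type) : R[i] := (bumpa z0.1 r z.1 * bumpa z0.2 r z.2)%:C.
have mK : cmeas setT K by apply: cmeasR; have /integrableP[/measurable_EFinP] := ii.
have hK x y : normc (K (x, y)) <= bumpa z0.1 r x * bumpa z0.2 r y by rewrite normcR ger0_norm// mulr_ge0.
have := @cfubini1 R _ _ (mR R) (mR R) mu mu K _ _ mK b1 b2 i1 i2 hK.
rewrite cintR => /(congr1 (@re R)); rewrite -[re _%:C]/(\int[mu2]_z (bumpa z0.1 r z.1 * bumpa z0.2 r z.2))%R => <-.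
have -> : cint mu setT (fun x => cint mu setT (fun y => K (x, y))) = cint mu setT (fun x => (bumpa z0.1 r x * \int[mu]_y bumpa z0.2 r y)%:C)%R.
  apply: eq_cint => x _; rewrite rmorphM /= -cintR -cintZT; last by have := cintble_test (test_bumpa z0.2 r0).
  by apply: eq_cint => y _; rewrite /K /= rmorphM.
by rewrite cintR -[re _]/(\int[mu]_x (bumpa z0.1 r x * \int[mu]_y bumpa z0.2 r y))%R RintegralZr// mulr_gt0.
Qed.

Lemma open_fst (A : set R) : open A -> open [set z : R * R | A z.1].
Proof. by move=> oA; apply: open_comp oA => z _; exact: cvg_fst. Qed.

Lemma open_snd (A : set R) : open A -> open [set z : R * R | A z.2].
Proof. by move=> oA; apply: open_comp oA => z _; exact: cvg_snd. Qed.

Lemma open_off : open [set z : R * R | z.1 != 0].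
Proof. by apply: (open_fst (A := [set x | x != 0])); exact: open_neq. Qed.

Lemma open_before : open [set z : R * R | z.2 < 0].
Proof. by apply: (open_snd (A := [set x | x < 0])); exact: open_lt. Qed.

Let F := fun z => (off z.1)%:C * F0 alpha tau z.

Lemma offF z : z.1 != 0 -> F z = F0 alpha tau z.
Proof. by move=> z1; rewrite /F off1// mul1r. Qed.

Lemma offF_cont z : z.1 != 0 -> ccont F z.
Proof.
move=> z1; apply: ccont_near (smooth_cont (F0_smooth hp) z1).
by apply: filterS (open_nbhs_nbhs (conj open_off z1)) => y; move/offF.
Qed.

(** [S] vanishes for [t < 0] and has the density [F0], continuous off the axis. If the value [w] at
    [z] were nonzero, the density would stay within [|w| / 2] of it on a small bump inside [t < 0],
    and the pairing with the bump could not vanish. *)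
Lemma F0_before z : z.1 != 0 -> z.2 < 0 -> F0 alpha tau z = 0.
Proof.
move=> z1 z2; apply: contrapT => /eqP w0; rewrite -(offF z1) in w0; set w := F z in w0.
have e0 : 0 < normc w / 2 by rewrite divr_gt0// normc_gt0.
have /nbhs_ballP[e /= ep he] : \forall y \near z, normc (w - F y) < normc w / 2.
  have c : normc (w + - 1 * F y) @[y --> z] --> (0 : R).
    have := ccont_norm (ccontD (ccont_cst w z) (ccontM (ccont_cst (-1) z) (offF_cont z1))).
    suff e : normc (w + -1 * F z) = 0 by move=> h; rewrite -e; exact: h.
    by rewrite mulN1r subrr normc0.
  by apply: filterS (cvgr_lt _ c _ e0) => y; rewrite mulN1r.
pose r := Num.min e (- z.2 / 2).
have r0 : 0 < r by rewrite lt_min ep divr_gt0// oppr_gt0.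
have re' : r <= e by rewrite ge_min lexx.
have rz : r <= - z.2 / 2 by rewrite ge_min lexx orbT.
have tp := test_bump2 z r0.
have [iF SF] := represent0 hp hS tp.
have sup : Defs.support (bump2 z r) `<=` [set z | z.2 < 0].
  have cl : closed [set y : R * R | y.2 <= z.2 / 2].
    rewrite (_ : [set _ | _] = ~` [set y : R * R | z.2 / 2 < y.2]); last first.
      by apply/seteqP; split => y /=; rewrite leNgt => /negP.
    by apply: open_closedC; apply: (open_snd (A := [set x | z.2 / 2 < x])); exact: open_gt.
  apply: subset_trans (support_sub cl _) _ => [y /= yz|y /= yz]; last by lra.
  apply: bump2_out => //; apply: le_trans rz _; apply: le_trans (norm_snd (y - z)) => /=.
  apply: le_trans (ler_norm _); move/negP: yz; rewrite -ltNge; lra.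
case: hS => _ vS _; have S0 := vS _ tp sup.
have [ib pb] := bump2_int z r0.
have E y : bump2 z r y = (bumpa z.1 r y.1 * bumpa z.2 r y.2)%:C by rewrite /bump2; apply: esym; exact: rmorphM.
have pos y : 0 <= bumpa z.1 r y.1 * bumpa z.2 r y.2 := mulr_ge0 (bumpa_ge0 z.1 r y.1) (bumpa_ge0 z.2 r y.2).
have ibc : cintble mu2 setT (bump2 z r).
  have [sb _] := tp; apply: (cintble_dom measurableT _ ib).
    by apply: ccont_cmeas2 => y; exact: (smooth_cont sb I).
  by move=> y _; rewrite E normcR (ger0_norm (pos y)).
have Ei : cint mu2 setT (bump2 z r) = (\int[mu2]_y (bumpa z.1 r y.1 * bumpa z.2 r y.2))%:C%R.
  by rewrite (funext E) cintR.
have := cintB measurableT (cintbleZ w measurableT ibc) iF.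
rewrite -SF S0 subr0 cintZ// Ei => /(congr1 (@normc R)).
rewrite (normcM w) normcR ger0_norm ?(ltW pb)// => E1.
have : normc w * (\int[mu2]_y (bumpa z.1 r y.1 * bumpa z.2 r y.2))%R <= normc w / 2 * (\int[mu2]_y (bumpa z.1 r y.1 * bumpa z.2 r y.2))%R.
  rewrite -E1 -(RintegralZl (normc w / 2) measurableT ib); apply: cint_le => //.
  - exact: (cmeasB (cmeasZ w (cintble_cmeas measurableT ibc)) (cintble_cmeas measurableT iF)).
  - exact: (integrableZl measurableT (normc w / 2) ib).
  - move=> y _; rewrite -mulrBl (normcM (w - _)) E normcR (ger0_norm (pos y)).
    have [yz|yz] := ltP `|y - z| r.
      apply: ler_wpM2r; first exact: pos.
      by apply/ltW/he; rewrite -ball_normE /= distrC; exact: lt_le_trans re'.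
    have := bump2_out r0 yz; rewrite E => /(congr1 (@re R)); rewrite -[re _]/(_ * _) -[re 0]/(0 : R) => ->; by rewrite !mulr0.
by rewrite ler_pM2r// leNgt ltr_pdivrMr// ltr_pMr ?normc_gt0// ltr1n.
Qed.

(** The pieces are [F0] off the axis, and on it [F1 / t] for [t > 0] and 0 for [t <= 0], in
    agreement with [F0 = 0] for [t < 0]. The origin is the one point where they need not fit
    together. *)
Lemma regular_exists : exists f : R * R -> R[i], [/\ forall z, z.1 != 0 -> f z = F0 alpha tau z,
  forall z, z.2 < 0 -> f z = 0 & forall z, z != (0, 0) -> ccont f z].
Proof.
have [F1 [cF1 hF1]] := F1_exists hp.
pose f z := if z.1 != 0 then F0 alpha tau z else if 0 < z.2 then (z.2^-1)%:C * F1 z else 0.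
have f1 z : z.1 != 0 -> f z = F0 alpha tau z by rewrite /f => ->.
have f2 z : z.2 < 0 -> f z = 0.
  move=> z2; rewrite /f; case: ifP => [z1|_]; first exact: F0_before.
  by rewrite ltNge (ltW z2).
exists f; split => // z z0; have [z1|z1] := eqVneq z.1 0; last first.
  apply: ccont_near (smooth_cont (F0_smooth hp) z1).
  by apply: filterS (open_nbhs_nbhs (conj open_off z1)) => y; move/f1.
have [z2|z2|z2] := ltrgtP z.2 0.
- apply: ccont_near (ccont_cst 0 z).
  by apply: filterS (open_nbhs_nbhs (conj open_before z2)) => y; move/f2.
- have oz : open [set y : R * R | 0 < y.2] by apply: (open_snd (A := [set x | 0 < x])); exact: open_gt.
  apply: (@ccont_near R (R * R)%type (fun y : R * R => (y.2^-1)%:C * F1 y) f z); last first.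
    apply: ccontM (cF1 z); apply: ccontR; apply: cvgV; [exact: lt0r_neq0|exact: cvg_snd].
  apply: filterS (open_nbhs_nbhs (conj oz z2)) => y /= y2; rewrite /f y2.
  case: ifP => // y1; rewrite -hF1// mulrA -rmorphM mulVf ?mul1r//; exact: lt0r_neq0.
- by move: z0; rewrite [z]surjective_pairing z1 z2 eqxx.
Qed.

Section WithF.
Context (f : R * R -> R[i]).
Context (f1 : forall z, z.1 != 0 -> f z = F0 alpha tau z) (f2 : forall z, z.2 < 0 -> f z = 0)
  (cf : forall z, z != (0, 0) -> ccont f z).

Lemma off_ge0 x : 0 <= off x. Proof. by rewrite /off indicE. Qed.

Lemma f_cmeas : cmeas (T := (mR R * mR R)%type) setT f.
Proof.
have mz : measurable ([set (0, 0)] : set (mR R * mR R)%type).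
  rewrite (_ : [set (0, 0)] = [set 0] `*` [set 0]); last by apply/seteqP; split => -[a b] /= [-> ->].
  by apply: measurableX; exact: measurable_set1.
have oD : open (~` [set (0, 0)] : set (R * R)).
  by apply: closed_openC; apply: accessible_closed_set1; exact: hausdorff_accessible.
have h (q : R[i] -> R) : (forall z, z != (0, 0) -> {for z, continuous (q \o f)}) ->
    measurable_fun (setT : set (mR R * mR R)%type) (q \o f).
  move=> cq; rewrite -(setvU [set (0, 0)]); apply/measurable_funU => //; first exact: measurableC.
  split; last exact: measurable_fun_set1.
  by apply: cont_measurable2 => // z /eqP; exact: cq.
by split; apply: h => z z0; have [] := cf z0.
Qed.

Lemma line_null : measurable ([set z | z.1 = 0] : set (mR R * mR R)%type) /\
  mu2 [set z | z.1 = 0] = 0%E.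
Proof.
have -> : [set z | z.1 = 0] = ([set 0] : set (mR R)) `*` (setT : set (mR R)).
  by apply/seteqP; split => z //= [].
have m0 : measurable ([set 0] : set (mR R)) by exact: measurable_set1.
split; first exact: measurableX.
apply: etrans (product_measure1E mu mu m0 measurableT) _.
have l0 : mu [set 0] = 0%E by exact: lebesgue_measure_set1.
by transitivity (0 * mu setT)%E; [congr (_ * _)%E; exact: l0|rewrite mul0e].
Qed.

Lemma f_represents : represented_by S f.
Proof.
move=> phi tp; have [iF ->] := represent0 hp hS tp; have [mN N0] := line_null.
apply: (cint_ae mN N0).
- exact: (cintble_cmeas measurableT iF).
- by apply: cmeasM f_cmeas _; apply: ccont_cmeas2 => z; have [sp _] := tp; exact: (smooth_cont sp I).
- by move=> z /= /eqP z1; rewrite off1// mul1r f1.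
Qed.

(** Integrating [St_rsq] in [η] bounds [|f|], off the null axis and for [|t| <= M], by a constant
    times [|x|^(-1/2)]. *)
Lemma f_L1loc : L1loc f.
Proof.
have [m1 m2] := f_cmeas; split => // A cA; have [mN N0] := line_null.
have mA : measurable (A : set (mR R * mR R)%type).
  rewrite -[A]setCK; apply: measurableC; apply: open_measurable2; apply: closed_openC.
  exact: compact_closed cA.
have [M [M0 hM]] : exists M : R, 0 <= M /\ forall z, A z -> `|z| <= M.
  have [M0 [_ h]] := compact_bounded cA; exists (Num.max 0 M0 + 1); split.
    by rewrite addr_ge0// le_max lexx.
  by move=> z Az; apply: (h (Num.max 0 M0 + 1)) => //; rewrite ltr_pwDr// le_max lexx orbT.
have [C C0 hC] := St_rsq hp.
pose D := C * (expR M * (\int[mu]_η wt ((1 - alpha) / 2) η)%R) / kF.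
have mF : measurable_fun setT (fun z : (mR R * mR R)%type => off z.1 * normc (f z)).
  apply: measurable_funM; last exact: cmeas_norm f_cmeas.
  exact: (measurableT_comp moff measurable_fst).
have -> : (\int[mu2]_(z in A) (normc (f z))%:E = \int[mu2]_(z in A) (off z.1 * normc (f z))%:E)%E.
  apply: ae_eq_integral => //.
  - by apply/measurable_EFinP; apply: measurable_funTS; exact: cmeas_norm f_cmeas.
  - by apply/measurable_EFinP; exact: measurable_funTS.
  - exists [set z | z.1 = 0]; split => // z /= nz; apply: contrapT => z1; apply: nz => _.
    by rewrite off1 ?mul1r//; exact/eqP.
have iw := integrable_wt (d2_gt0 hp).
have p2 : 0 < kF :> R by exact: kF_gt0.
have D0 : 0 <= D.
  rewrite divr_ge0 ?(ltW p2)// mulr_ge0// mulr_ge0 ?expR_ge0//.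
  by apply: Rintegral_ge0 => η _; exact: wt_ge0.
have iI : mu2.-integrable setT (EFin \o (fun z => rsq M z.1 * boxc M D z.2)).
  apply: integrable_prod_dom (integrable_rsq M0) (integrable_boxc M D); first exact: rsq_ge0.
  by move=> t; rewrite /boxc; case: ifP.
have : mu2.-integrable A (EFin \o (fun z => off z.1 * normc (f z))).
  apply: (integrable_dom mA (measurable_funTS mF) (integrableS measurableT mA (@subsetT _ _) iI)).
  move=> z Az; rewrite ger0_norm; last by rewrite mulr_ge0 ?normc_ge0// /off indicE.
  have zM := hM z Az; have x1 : `|z.1| <= M := le_trans (norm_fst z) zM.
  have x2 : `|z.2| <= M := le_trans (norm_snd z) zM.
  rewrite /rsq x1 /boxc -ler_norml x2; have [z1|z1] := eqVneq z.1 0.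
    by rewrite z1 off0 mul0r normr0 powR0 ?oppr_eq0 ?invr_eq0// mul0r.
  rewrite off1// mul1r f1// /F0 (normcM (kF^-1)%:C) normcR gtr0_norm ?invr_gt0// /D.
  rewrite ler_pdivrMl//.
  rewrite [leRHS](_ : _ = C * `|z.1| `^ (- 2^-1) * expR M * (\int[mu]_η wt ((1 - alpha) / 2) η)%R); last first.
    by have := lt0r_neq0 p2; move: kF => q q0; field.
  rewrite -RintegralZl//; apply: cint_le => //.
  - apply: cmeasT1 => η; apply: ccontM; last exact: cder_cont (is_cder_rotc_sl _ _).
    exact: (ccont_comp (f := fun w : R * R => St alpha tau w.1 w.2) (g := fun y => (z.1, y)) (cvg_pair (cvg_cst _) cvg_id) (sym_cont hp (z.1, η) (sym_St hp 0))).
  - exact: (integrableZl measurableT (C * `|z.1| `^ (- 2^-1) * expR M) iw).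
  - move=> η _; rewrite (normcM (St _ _ _ _)) normc_rotc re_sl mul1r.
    rewrite [leRHS](_ : _ = C * (`|z.1| `^ (- 2^-1) * wt ((1 - alpha) / 2) η) * expR M); last by ring.
    apply: ler_pM; rewrite ?normc_ge0 ?expR_ge0 ?hC// ler_expR; exact: le_trans (ler_norm _) x2.
move=> /integrableP[_ h]; apply: le_lt_trans h; rewrite le_eqVlt; apply/orP; left; apply/eqP.
apply: eq_integral => z _; congr EFin; apply: esym; exact: ger0_norm (mulr_ge0 (off_ge0 z.1) (normc_ge0 (f z))).
Qed.

Lemma f_smooth : smooth_on (~` [set z : R * R | z.1 = 0 /\ 0 <= z.2]) f.
Proof.
move=> vs z zU; have [z2|z2] := ltP z.2 0.
  have e y : y.2 < 0 -> 0 = f y by move=> /f2.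
  exact: (smooth_eq_on open_before e (smooth_cst 0 open_before)).
have z1 : z.1 != 0 by apply/eqP => z1; apply: zU.
have e y : y.1 != 0 -> F0 alpha tau y = f y by move=> /f1.
exact: (smooth_eq_on open_off e (F0_smooth hp)).
Qed.

Lemma dxf_osci (g : R * R -> R[i]) (sg : R) z : (forall z, z.1 != 0 -> g z = cderive e_x f z) ->
  `|sg| = 1 -> 0 < sg * z.1 -> g z = (- (sg / (2 * kF)))%:C * osci alpha tau sg 0 1 z.
Proof.
move=> hg s1 z1; have nz y : 0 < sg * y.1 -> y.1 != 0 by apply: contraTneq => ->; rewrite mulr0 ltxx.
have oU : open [set y : R * R | 0 < sg * y.1].
  apply: (open_fst (A := (fun x => sg * x) @^-1` [set x | 0 < x])); apply: open_comp; last exact: open_gt.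
  by move=> x _; exact: mulrl_continuous.
have d := is_cderZ ((2 * kF)^-1)%:C (is_cder_osci hp 0 0 e_x s1 z1).
have nr : \near z, ((2 * kF)^-1)%:C * osci alpha tau sg 0 0 z = f z.
  apply: filterS (open_nbhs_nbhs (conj oU z1)) => y y1; rewrite f1; last exact: nz.
  by rewrite (F0_osci hp s1).
rewrite hg ?nz// (is_cderP (is_cder_near nr d)).2 /= mul0r add0r mulrA -rmorphM; congr (_%:C * _).
by rewrite mulr1 mulrN [_^-1 * _]mulrC.
Qed.

(** [(l / s) (s l) = l^2]: one [x]-derivative turns the amplitude into the symbol of the jump. *)
Lemma amp01 η : amp alpha tau 0 1 η = qsym alpha tau η.
Proof.
rewrite /amp expr0 expr1 mul1r /psym -(lsym_sqr hp) expr2.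
by rewrite mulrACA /sinv mulVf ?sl_neq0// mul1r.
Qed.

Lemma osci_flip x t : osci alpha tau (-1) 0 1 (- x, t) = osci alpha tau 1 0 1 (x, t).
Proof. by apply: eq_cint => η _; rewrite /osc /= mulrNN. Qed.

(** For fixed [x > 0] everything converges absolutely and Fubini applies. On the right it is [L B]
    that supplies decay in [η], and this decay survives the limit [x -> 0]. *)
Lemma osci_bump x (B : R -> R) (T : R) : 0 < x -> test (fun t => (B t)%:C) -> (forall t, 0 <= B t) ->
  (forall t, T < t -> B t = 0) ->
  cintble mu setT (fun t => osci alpha tau 1 0 1 (x, t) * (B t)%:C) /\
  cint mu setT (fun t => osci alpha tau 1 0 1 (x, t) * (B t)%:C) =
  cint mu setT (fun η => qsym alpha tau η * expx alpha tau x η * L (fun t => (B t)%:C) (sl η)).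
Proof.
move=> x0 tB B0 BT; have [C C0 hC] := amp_dom hp 1 T 0 1 x0.
pose K (w : (mR R * mR R)%type) : R[i] := amp alpha tau 0 1 w.2 * osc alpha tau 1 (x, w.1) w.2 * (B w.1)%:C.
have [iB _] := cintble_test tB.
have cB t : ccont (fun t => (B t)%:C) t by have [sB _] := tB; exact: (smooth_cont sB I).
have mK : cmeas setT K.
  apply: ccont_cmeas2 => w; apply: ccontM; last exact: (ccont_fst (f := fun t => (B t)%:C) (cB w.1)).
  apply: ccontM; first exact: (ccont_snd (f := amp alpha tau 0 1) (amp_cont hp 0 1 w.2)).
  apply: ccont_exp; apply: ccontD.
    by apply: ccontM; [exact: (ccont_snd (cder_cont (is_cder_sl w.2)))|exact: (ccont_fst (smooth_cont smooth_id I))].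
  rewrite (_ : (fun _ => _) = fun y : R * R => - (1 * x)%:C * psym alpha tau y.2); last by apply/funext => y; rewrite mulNr.
  by apply: ccontM; [exact: ccont_cst|exact: (ccont_snd (cder_cont (is_cder_psym hp w.2)))].
have b0 η : 0 <= C * wt 1 η by rewrite mulr_ge0 ?wt_ge0.
have ib : mu.-integrable setT (EFin \o (fun η => C * wt 1 η)) by exact: (integrableZl measurableT C (@integrable_wt R 1 ltr01)).
have hK t η : normc (K (t, η)) <= B t * (C * wt 1 η).
  rewrite /K /= (normcM (_ * _)) normcR (ger0_norm (B0 t)) mulrC.
  have [tT|tT] := leP t T; last by rewrite BT// !mul0r.
  by apply: ler_wpM2l => //; apply: hC; rewrite //= mul1r.
have E1 t : osci alpha tau 1 0 1 (x, t) * (B t)%:C = cint mu setT (fun η => K (t, η)).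
  rewrite /osci mulrC -cintZT; last by apply: cintble_osci; rewrite //= mul1r.
  by apply: eq_cint => η _; rewrite mulrC.
have fub := @cfubini R _ _ (mR R) (mR R) mu mu K B _ mK B0 b0 iB ib hK.
have ifub := @cintble_fubini1 R _ _ (mR R) (mR R) mu mu K B _ mK B0 b0 iB ib hK.
rewrite (funext E1); split; [exact: ifub|rewrite fub]; apply: eq_cint => η _.
rewrite /L -cintZT; last exact: cintble_test (test_rotc _ tB).
apply: eq_cint => t _; rewrite /K /= amp01 /osc cexpD /expx (gtr0_norm x0) mul1r /rotc; ring.
Qed.

(** The [x]-derivative is odd in [x], so a continuous extension would vanish at [(0, t0)] and stay
    below [ep] nearby. Testing with a bump at [t0] and letting [x -> 0] then bounds the pairing of
    the jump by half of what [Jpos] guarantees. *)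
Lemma dxf_jump t0 (g : R * R -> R[i]) : 0 < t0 -> (forall z, z.1 != 0 -> g z = cderive e_x f z) ->
  ~ ccont g (0, t0).
Proof.
move=> t00 hg cg.
have pos x : 0 < x -> forall t, g (x, t) = (- (2 * kF)^-1)%:C * osci alpha tau 1 0 1 (x, t).
  move=> x0 t; have z1 : 0 < 1 * (x, t).1 by rewrite mul1r.
  by rewrite (dxf_osci hg (normr1 _) z1) mul1r.
have neg x : 0 < x -> forall t, g (- x, t) = ((2 * kF)^-1)%:C * osci alpha tau 1 0 1 (x, t).
  move=> x0 t; have z1 : 0 < -1 * (- x, t).1 by rewrite mulrNN mul1r.
  have s1 : `|-1| = 1 :> R by rewrite normrN1.
  rewrite (dxf_osci hg s1 z1).
  by rewrite osci_flip mulNr mul1r opprK.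
have cgx : ccont (fun x => g (x, t0)) (0 : R).
  by apply: (@ccont_pair1 _ (fun x t => g (x, t))); move: cg; congr ccont; apply/funext => -[].
have g0 : g (0, t0) = 0.
  have c1 := ccont_seq hp cgx (@eps_cvg R).
  have c2 : ccvg (fun n => g (- eps n, t0)) (g (0, t0)).
    by apply: (ccont_seq hp cgx); rewrite -oppr0; apply: cvgN; exact: eps_cvg.
  have := ccvgD c1 c2; rewrite (_ : (fun n => _) = fun=> 0); last first.
    by apply/funext => n; rewrite (pos _ (eps_gt0 n)) (neg _ (eps_gt0 n)) rmorphN mulNr addNr.
  by move=> /(ccvg_unique (ccvg_cst 0)) /esym/eqP; rewrite -mulr2n mulrn_eq0 /= => /eqP.
have T0 : 0 < t0 + 1 by rewrite addr_gt0.
have [c c0 hc] := Jpos hp T0.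
have p0 := @kF_gt0 R; have p4 : 0 < 2 * kF :> R by apply: mulr_gt0.
(* Chosen so that [2 kF ep = c / 2], half the constant of [Jpos]. *)
pose ep := c / (4 * kF); have ep0 : 0 < ep by rewrite divr_gt0// mulr_gt0.
have /nbhs_ballP[d /= d0 hd] : \forall y \near ((0, t0) : R * R), normc (g y) < ep.
  apply: (cvgr_lt _ (ccont_norm cg : normc (g y) @[y --> ((0, t0) : R * R)] --> normc (g (0, t0)))).
  by rewrite g0 normc0.
(* The bump has to stay within distance [d] of [t0] and inside []0, t0 + 1]], the range in which
   [Jpos] is applied. *)
pose r := Num.min d (Num.min t0 1).
have r0 : 0 < r by rewrite !lt_min d0 t00 ltr01.
have rd : r <= d by rewrite ge_min lexx.
have rt : r <= t0 by rewrite !ge_min lexx !orbT.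
have r1 : r <= 1 by rewrite !ge_min lexx !orbT.
pose B := bumpa t0 r; have tB : test (fun t => (B t)%:C) := test_bumpa t0 r0.
have B0 t : 0 <= B t := bumpa_ge0 t0 r t.
have Bout t : r <= `|t - t0| -> B t = 0 := bumpa_out r0.
have Bneg t : t <= 0 -> B t = 0.
  by move=> tn; apply: Bout; rewrite distrC; apply: le_trans (ler_norm _); lra.
have BT t : t0 + 1 < t -> B t = 0.
  by move=> tn; apply: Bout; apply: le_trans (ler_norm _); lra.
have [iB pB] := bumpa_int t0 r0; rewrite -/B in iB pB.
have := hc B tB B0 Bneg BT; set J := cint mu setT _ => hJ.
pose Jn n := cint mu setT (fun η => qsym alpha tau η * expx alpha tau (eps n) η * L (fun t => (B t)%:C) (sl η)).
have [CL CL0 hL] := L_decay 2 tB.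
have wL η : normc (L (fun t => (B t)%:C) (sl η)) <= CL * wt 1 η by exact: (@decay_wt R _ CL η 1 (hL η)).
have iw := integrableZl measurableT CL (@integrable_wt R 1 ltr01).
have lim : ccvg Jn J.
  apply: (cint_dct measurableT _ _ iw _).2.
  - move=> n; apply: cmeasT1 => η; apply: ccontM; last exact: L_cont.
    by apply: ccontM; [exact: cder_cont (is_cder_qsym hp η)|exact: cder_cont (is_cder_expx hp (eps n) η)].
  - move=> η _; apply: ccvgM (ccvg_cst _); rewrite -[qsym alpha tau η in X in ccvg _ X]mulr1.
    apply: ccvgM (ccvg_cst _) _; rewrite (_ : 1 = expx alpha tau 0 η); last by rewrite /expx normr0 mul0r oppr0 cexp0.
    apply: (ccont_seq hp (f := fun x => expx alpha tau x η)) (@eps_cvg R).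
    apply: ccont_exp; rewrite (_ : (fun _ => _) = fun y : R => - psym alpha tau η * (`|y|)%:C); last by apply/funext => y; rewrite mulNr mulrC.
    by apply: ccontM; [exact: ccont_cst|apply: ccontR; exact: norm_continuous].
  - move=> n η _; rewrite (normcM (_ * _)) (normcM (qsym _ _ _)); apply: le_trans (wL η).
    rewrite -[leRHS]mul1r; apply: ler_wpM2r; first exact: normc_ge0.
    rewrite -[leRHS]mul1r; apply: ler_pM; [exact: normc_ge0|exact: normc_ge0|exact: normc_qsym|].
    by rewrite (normc_expx hp) -[leRHS]expR0 ler_expR oppr_le0 mulr_ge0// ltW// (re_psym_gt0 hp hS).
have bnd : \forall n \near \oo, normc (Jn n) <= 2 * kF * ep * (\int[mu]_t B t)%R.
  have : \forall n \near \oo, eps n < d by apply: (cvgr_lt _ (@eps_cvg R)).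
  apply: filterS => n nd; have e0 := @eps_gt0 R n.
  have [iI E] := osci_bump e0 tB B0 BT; rewrite /Jn -E.
  rewrite -RintegralZl//; apply: cint_le => //; first exact: cintble_cmeas iI.
    exact: (integrableZl measurableT (2 * kF * ep) iB).
  move=> t _; rewrite (normcM (osci _ _ _ _ _ _)) normcR (ger0_norm (B0 t)).
  have [tt|tt] := ltP `|t - t0| r; last by rewrite Bout// !mulr0.
  apply: ler_wpM2r => //.
  have := hd (eps n, t); rewrite -ball_normE /= => /(_ _); rewrite pos// (normcM (- _)%:C) normcR normrN.
  rewrite normfV (gtr0_norm p4) (ltr_pdivrMl _ _ p4) => h; apply/ltW/h.
  rewrite -[X in X < _]/(Num.max `|0 - eps n| `|t0 - t|) gt_max sub0r normrN (gtr0_norm e0) nd distrC /=; exact: lt_le_trans rd.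
have : c * (\int[mu]_t B t)%R <= 2 * kF * ep * (\int[mu]_t B t)%R.
  apply: le_trans hJ _; apply: le_trans (re_le_normc _) _.
  rewrite leNgt; apply/negP => hlt.
  have [n [h1 h2]] := filter_ex (filterI bnd (cvgr_gt _ (ccvg_norm lim) _ hlt)).
  by move: (lt_le_trans h2 h1); rewrite ltxx.
rewrite ler_pM2r// (_ : 2 * kF * ep = c / 2).
  by rewrite leNgt ltr_pdivrMr// ltr_pMr// ltr1n.
by rewrite /ep; move: (lt0r_neq0 p0); move: kF => q q0; field.
Qed.

End WithF.

End Regularity.

(** * Fourier decay in the plane and wave front set at smooth points *)

Section PlaneFourier.
Context {R : realType}.
Notation mu := (@lebesgue_measure R).
Notation mu2 := (@lebesgue_measure R \x @lebesgue_measure R)%E.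
Local Arguments re : simpl never.
Local Arguments im : simpl never.
Implicit Types (z v zeta : R * R) (q phi : R * R -> R[i]).

Definition osc1 (om x : R) : R[i] := rotc (0 +i* (- om)) x.

Definition plane zeta z : R[i] := cexp (0 +i* (- dot z zeta)).

Lemma normc_osc1 om x : normc (osc1 om x) = 1.
Proof. by rewrite normc_rotc -[re _]/(0 : R) mul0r expR0. Qed.

Lemma re_i (a : R) : re (0 +i* a) = 0. Proof. by []. Qed.
Lemma im_i (a : R) : im (0 +i* a) = a. Proof. by []. Qed.
Lemma reC (a : R) : re a%:C = a. Proof. by []. Qed.
Lemma imC (a : R) : im a%:C = 0. Proof. by []. Qed.
Definition reimC := (@reimE R, (re_i, im_i), (reC, imC)).

Lemma planeE zeta z : plane zeta z = osc1 zeta.1 z.1 * osc1 zeta.2 z.2.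
Proof.
by rewrite /osc1 /rotc -cexpD; congr cexp; apply: cplxP; rewrite !reimC /dot; ring.
Qed.

Lemma normc_plane zeta z : normc (plane zeta z) = 1.
Proof. by rewrite planeE (normcM (osc1 _ _)) !normc_osc1 mulr1. Qed.

Lemma smooth_plane zeta : smooth_on setT (plane zeta).
Proof.
rewrite (_ : plane zeta = fun z => osc1 zeta.1 z.1 * osc1 zeta.2 z.2); last by apply/funext => z; exact: planeE.
by apply: (smoothM openT); [exact: smooth_fst (smooth_rotc _)|exact: smooth_snd (smooth_rotc _)].
Qed.

Lemma test_plane phi zeta : test phi -> test (fun z => phi z * plane zeta z).
Proof. by move=> tp; exact: (testM cptB2 tp (smooth_plane zeta)). Qed.

Lemma is_cder_plane zeta z v : is_cder (plane zeta) z v ((0 +i* (- dot v zeta)) * plane zeta z).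
Proof.
have l : is_cder (fun z => (dot z zeta)%:C) z v (dot v zeta)%:C.
  apply: is_cder_linear => h a b; rewrite /dot fst_lin snd_lin -![h *: _]/(h * _); ring.
have e y : 0 +i* (- dot y zeta) = (0 +i* (- 1)) * (dot y zeta)%:C by apply: cplxP; rewrite !reimC; ring.
have := cder_exp (is_cderZ (0 +i* (- 1)) l).
rewrite (_ : (fun _ => _) = plane zeta); last by apply/funext => y; rewrite /plane e.
by rewrite -!e.
Qed.

Lemma test2_box q : test q -> exists M B : R, [/\ 0 <= B, forall t, 0 <= boxc M 1 t, forall t, 0 <= boxc M B t &
  forall x t, normc (q (x, t)) <= boxc M 1 x * boxc M B t].
Proof.
move=> /test2_bd[M [B [M0 B0 out bd]]]; exists M, B; split => //.
- by move=> t; rewrite /boxc; case: ifP.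
- by move=> t; rewrite /boxc; case: ifP.
- move=> x t; rewrite /boxc -!ler_norml.
  have [xM|xM] := leP `|x| M; last by rewrite out ?normc0 ?mul0r//; exact: lt_le_trans xM (norm_fst (x, t)).
  have [tM|tM] := leP `|t| M; last by rewrite out ?normc0 ?mulr0//; exact: lt_le_trans tM (norm_snd (x, t)).
  by rewrite mul1r.
Qed.

Lemma test2_cmeas q : test q -> cmeas (T := (mR R * mR R)%type) setT q.
Proof. by move=> [sq _]; apply: ccont_cmeas2 => z; exact: (smooth_cont sq I). Qed.

Lemma cintble_test2 q : test q -> cintble mu2 setT q.
Proof.
move=> tq; have [M [B [B0 b1 b2 hb]]] := test2_box tq.
exact: (@cintble_prod R _ _ (mR R) (mR R) mu mu q _ _ (test2_cmeas tq) b1 b2 (integrable_boxc M 1) (integrable_boxc M B) hb).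
Qed.

Lemma line_lin_x (b : R) (h v z : R) : ((h *: v + z, b) : R * R) = h *: ((v, 0) : R * R) + (z, b).
Proof. by congr pair; rewrite /= -[h *: 0]/(h * 0) mulr0 add0r. Qed.

Lemma cderive_slice_x q t : cderive (1 : R) (fun x => q (x, t)) = fun x => cderive e_x q (x, t).
Proof. exact: (cderive_affine (line_lin_x t) q 1). Qed.

Lemma test_slice_x q t : test q -> test (fun x => q (x, t)).
Proof.
move=> tq; have [M [C [M0 C0 hM hC]]] := test2_bd tq.
apply/(testP cptB1); split; last first.
  by exists M => x xM; apply: hM; exact: lt_le_trans xM (norm_fst (x, t)).
have cl : continuous (fun x : R => ((x, t) : R * R)) by move=> x; exact: (cvg_pair (cvg_id : id y @[y --> x] --> x) (cvg_cst t)).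
by have := smooth_affine (line_lin_x t) cl tq.1; rewrite preimage_setT.
Qed.

Lemma cint2_deriv0 q v : v = e_x \/ v = e_t -> test q -> cint mu2 setT (cderive v q) = 0.
Proof.
move=> hv tq; have tq' := test_cderive cptB2 v tq.
have [M [B [B0 b1 b2 hb]]] := test2_box tq'.
have z0 : cint mu setT (fun _ : R => 0 : R[i]) = 0 by rewrite -[RHS](mul0r 0) (cintR mu (fun=> 0)) /Rintegral integral0 mul0r.
case: hv => hv; move: tq' hb; rewrite hv => tq' hb.
- rewrite -(@cfubini2 R _ _ (mR R) (mR R) mu mu _ _ _ (test2_cmeas tq') b1 b2 (integrable_boxc M 1) (integrable_boxc M B) hb).
  rewrite -[RHS]z0; apply: eq_cint => t _.
  by rewrite -(cderive_slice_x q t) (cint_test_deriv (test_slice_x t tq)).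
- rewrite -(@cfubini1 R _ _ (mR R) (mR R) mu mu _ _ _ (test2_cmeas tq') b1 b2 (integrable_boxc M 1) (integrable_boxc M B) hb).
  rewrite -[RHS]z0; apply: eq_cint => x _.
  by rewrite -(cderive_slice q x) (cint_test_deriv (test_slice x tq)).
Qed.

Lemma plane_parts q zeta v : v = e_x \/ v = e_t -> test q ->
  (0 +i* dot v zeta) * cint mu2 setT (fun z => q z * plane zeta z) = cint mu2 setT (fun z => cderive v q z * plane zeta z).
Proof.
move=> hv tq; have tqp := test_plane zeta tq; have tq' := test_cderive cptB2 v tq.
have := cint2_deriv0 hv tqp.
have -> : cderive v (fun z => q z * plane zeta z) = fun z => cderive v q z * plane zeta z - (0 +i* dot v zeta) * (q z * plane zeta z).
  apply/funext => z; have d := is_cderM (smooth_cder0 v tq.1 (I : setT z)) (is_cder_plane zeta z v).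
  rewrite (is_cderP d).2; have -> : 0 +i* (- dot v zeta) = - (0 +i* dot v zeta) by apply: cplxP; rewrite !reimE /re /im /= ?oppr0.
  by ring.
rewrite cintB//; first last.
- exact: cintbleZ (cintble_test2 tqp).
- exact: cintble_test2 (test_plane zeta tq').
rewrite cintZ//; last exact: cintble_test2 tqp.
by move/eqP; rewrite subr_eq0 => /eqP ->.
Qed.

Lemma plane_decay1 n q v : v = e_x \/ v = e_t -> test q -> exists C : R, forall zeta,
  `|dot v zeta| ^+ n * normc (cint mu2 setT (fun z => q z * plane zeta z)) <= C.
Proof.
move=> hv; elim: n q => [|n IH] q tq.
  exists (\int[mu2]_z normc (q z))%R => zeta; rewrite expr0 mul1r.
  apply: cint_le => //; first exact: test2_cmeas (test_plane zeta tq).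
    exact: cintble_norm (cintble_test2 tq).
  by move=> z _; rewrite (normcM (q z)) normc_plane mulr1.
have [C hC] := IH _ (test_cderive cptB2 v tq); exists C => zeta.
apply: le_trans (hC zeta); rewrite -plane_parts// exprSr (normcM (0 +i* _)) -mulrA.
have -> // : normc (0 +i* dot v zeta) = `|dot v zeta|.
by rewrite normcEs -[re _]/(0 : R) -[im _]/(dot v zeta) expr0n add0r sqrtr_sqr.
Qed.

Lemma expr_max_le (n : nat) (a b : R) : 0 <= a -> 0 <= b -> (1 + Num.max a b) ^+ n <= 2 ^+ n * (1 + a ^+ n + b ^+ n).
Proof.
move=> a0 b0.
have h (m : R) : 0 <= m -> (1 + m) ^+ n <= 2 ^+ n * (1 + m ^+ n).
  move=> m0; have [m1|m1] := leP m 1.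
    apply: (@le_trans _ _ (2 ^+ n)); last by rewrite ler_peMr ?exprn_ge0// lerDl exprn_ge0.
    by apply: lerXn2r; rewrite ?nnegrE; lra.
  apply: (@le_trans _ _ ((2 * m) ^+ n)); first by apply: lerXn2r; rewrite ?nnegrE; lra.
  by rewrite exprMn ler_wpM2l ?exprn_ge0// lerDr.
have m0 : 0 <= Num.max a b by rewrite le_max a0.
apply: le_trans (h _ m0) _; apply: ler_wpM2l; first exact: exprn_ge0.
by rewrite -addrA lerD2l maxEle; case: ifP => _; rewrite ?lerDl ?lerDr exprn_ge0.
Qed.

Lemma plane_decay n q : test q -> exists C : R, forall zeta,
  (1 + `|zeta|) ^+ n * normc (cint mu2 setT (fun z => q z * plane zeta z)) <= C.
Proof.
move=> tq; have [C0 h0] := plane_decay1 0 (or_introl erefl) tq.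
have [C1 h1] := plane_decay1 n (or_introl erefl) tq; have [C2 h2] := plane_decay1 n (or_intror erefl) tq.
exists (2 ^+ n * (C0 + C1 + C2)) => zeta.
have {h0} := h0 zeta; have {h1} := h1 zeta; have {h2} := h2 zeta.
have -> : dot e_x zeta = zeta.1 by rewrite /dot /= mul1r mul0r addr0.
have -> : dot e_t zeta = zeta.2 by rewrite /dot /= mul1r mul0r add0r.
rewrite expr0 mul1r; set X := normc _ => h2 h1 h0.
apply: (@le_trans _ _ (2 ^+ n * (1 + `|zeta.1| ^+ n + `|zeta.2| ^+ n) * X)).
  by apply: ler_wpM2r; [exact: normc_ge0|exact: expr_max_le].
rewrite -mulrA ler_wpM2l ?exprn_ge0// !mulrDl mul1r; apply: lerD => //; exact: lerD.
Qed.

(** The bump is supported in [U], so [phi f] is itself a test function and its Fourier transform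
    decays in all directions. *)
Lemma smooth_not_WF (S : (R * R -> R[i]) -> R[i]) (f : R * R -> R[i]) (U : set (R * R)) z zeta :
  represented_by S f -> open U -> smooth_on U f -> U z -> ~ WF S (z, zeta).
Proof.
move=> rep oU sf Uz [_]; apply.
have /nbhs_ballP[e /= e0 he] := open_nbhs_nbhs (conj oU Uz).
have e20 : 0 < e / 2 by rewrite divr_gt0.
have tp := test_bump2 z e20.
exists (bump2 z (e / 2)), setT; split => //; first exact: bump2_self.
  by split => //; exact: openT.
have oV : open [set y : R * R | e / 2 < `|y - z|].
  rewrite (_ : [set _ | _] = (fun y : R * R => `|y - z|) @^-1` [set x | e / 2 < x]); last by [].
  apply: open_comp; last exact: open_gt.
  move=> y _; apply: (@cvg_norm _ _ _ (nbhs y) _ (fun y : R * R => y - z)).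
  by apply: cvgB; [exact: cvg_id|exact: cvg_cst].
have cov y : U y \/ e / 2 < `|y - z|.
  have [h|h] := ltP (e / 2) `|y - z|; [by right|left; apply: he].
  rewrite -ball_normE /= distrC; apply: le_lt_trans h _; lra.
have zero y : e / 2 < `|y - z| -> bump2 z (e / 2) y = 0 by move=> /ltW; exact: bump2_out.
have th : test (fun y => bump2 z (e / 2) y * f y).
  apply/(testP cptB2); split; first exact: (smooth_glue oU oV cov zero tp.1 sf).
  have [M [_ [_ _ out _]]] := test2_bd tp.
  by exists M => y yM; rewrite out// mul0r.
move=> n; have [C hC] := plane_decay n th; exists C => zt _; apply: le_trans (hC zt).
rewrite /localized_fourier rep; last exact: test_plane.
apply: ler_wpM2l; first by rewrite exprn_ge0// addr_ge0.
rewrite le_eqVlt; apply/orP; left; apply/eqP; congr normc.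
by apply: eq_cint => y _; rewrite mulrA [f y * _]mulrC.
Qed.

End PlaneFourier.

(** * The localized transform at positive times *)

Section Localized.
Context {R : realType} (alpha tau : R) (S : (R * R -> R[i]) -> R[i]).
Context (hp : 0 < alpha < 1 /\ 0 < tau < 1) (hS : zener_fundamental_solution alpha tau S).
Notation mu := (@lebesgue_measure R).
Local Arguments re : simpl never.
Local Arguments im : simpl never.
Implicit Types (z v zeta : R * R) (phi : R * R -> R[i]) (x η om sg : R) (n : nat) (q : R -> R[i]).

(** Modulation in [t] shifts [s] along the vertical line. The disjunction carries the hypothesis
    that [phi] is a test function. *)
Lemma Ft_plane phi zeta x η :
  Ft (fun z => phi z * plane zeta z) x η = osc1 zeta.1 x * Ft phi x (η - zeta.2) \/ ~ test phi.
Proof.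
have [tp|] := pselect (test phi); last by right.
left; rewrite /Ft /L -cintZT; last exact: cintble_test (test_rotc _ (test_slice x tp)).
apply: eq_cint => t _; rewrite planeE /=.
have -> : rotc (sl (η - zeta.2)) t = osc1 zeta.2 t * rotc (sl η) t.
  by rewrite /osc1 /rotc -cexpD; congr cexp; apply: cplxP; rewrite !(reimC, re_sl, im_sl); ring.
by ring.
Qed.

Definition Ax (a : R -> R -> R[i]) q η : R[i] := cint mu setT (fun x => a x η * q x).

Lemma localizedE phi zeta : test phi -> kF%:C * localized_fourier S phi zeta =
  cint mu setT (fun η => cint mu setT (fun x => St alpha tau x η * (osc1 zeta.1 x * Ft phi x (η - zeta.2)))).
Proof.
move=> tp; rewrite /localized_fourier (star hp hS (test_plane zeta tp)).
apply: eq_cint => η _; apply: eq_cint => x _; congr (_ * _).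
by case: (Ft_plane phi zeta x η).
Qed.

Lemma osc1_cont om x : ccont (osc1 om) x.
Proof. exact: smooth_cont (smooth_rotc _) I. Qed.

Lemma sym_x_cont j m a x η : sym alpha j m a -> ccont (fun x => a x η) x.
Proof. by move=> sa; exact: (sym_contx hp hS x η sa). Qed.

Lemma sym_eta_cont j m a x η : sym alpha j m a -> ccont (a x) η.
Proof.
move=> sa; exact: (ccont_comp (f := fun w : R * R => a w.1 w.2) (g := fun y => (x, y)) (cvg_pair (cvg_cst _) cvg_id) (sym_cont hp (x, η) sa)).
Qed.

Section Beta.
Context (be : R -> R[i]).
Context (tb : test be).

Lemma Ax_dom om x : normc (be x * osc1 om x) = normc (be x).
Proof. by rewrite (normcM (be x)) normc_osc1 mulr1. Qed.

Lemma ib : mu.-integrable setT (EFin \o (fun x => normc (be x))).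
Proof. exact: cintble_norm (cintble_test tb). Qed.

Lemma bo_cont om x : ccont (fun x => be x * osc1 om x) x.
Proof. by apply: ccontM; [exact: smooth_cont tb.1 I|exact: osc1_cont]. Qed.

Lemma Ax_bound j m a : sym alpha j m a -> exists2 C : R, 0 <= C &
  forall om η, normc (Ax a (fun x => be x * osc1 om x) η) <= C * jb η `^ (- m).
Proof.
move=> sa; have [C C0 hC] := sym_bound hp sa; have i := ib.
exists (C * (\int[mu]_x normc (be x))%R); first by rewrite mulr_ge0// Rintegral_ge0// => x _; exact: normc_ge0.
move=> om η; rewrite mulrAC -(RintegralZl (C * jb η `^ (- m)) measurableT i); apply: (cint_le measurableT).
- by apply: cmeasT1 => x; apply: ccontM; [exact: sym_x_cont sa|exact: bo_cont].
- exact: (integrableZl measurableT (C * jb η `^ (- m)) i).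
- by move=> x _; rewrite (normcM (a _ _)) Ax_dom; apply: ler_wpM2r; [exact: normc_ge0|exact: hC].
Qed.

Lemma cintble_Ax m a om η : 0 <= m -> sym alpha 0 m a -> cintble mu setT (fun x => a x η * (be x * osc1 om x)).
Proof.
move=> m0 sa; have [C C0 hC] := sym_bounded hp hS m0 sa.
apply: (cintble_dom measurableT _ (integrableZl measurableT C ib)).
  by apply: cmeasT1 => x; apply: ccontM; [exact: sym_x_cont sa|exact: bo_cont].
by move=> x _; rewrite (normcM (a _ _)) Ax_dom; apply: ler_wpM2r; [exact: normc_ge0|exact: hC].
Qed.

Lemma is_cder_Ax m a a' om η : 0 <= m -> (forall x η, is_cder (a x) η (1 : R) (a' x η)) ->
  sym alpha 0 m a -> sym alpha 0 m a' ->
  is_cder (Ax a (fun x => be x * osc1 om x)) η (1 : R) (Ax a' (fun x => be x * osc1 om x) η).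
Proof.
move=> m0 da sa sa'; have [C' C'0 hC'] := sym_bounded hp hS m0 sa'.
have iZ c := integrableZl measurableT c ib.
apply: (@is_cder_cint R R _ (mR R) mu setT (fun η x => a x η * (be x * osc1 om x))
  (fun η x => a' x η * (be x * osc1 om x)) (fun x => C' * normc (be x)) η 1 1 measurableT ltr01).
- by move=> h _; exact: cintble_Ax sa.
- move=> h x _ _; apply: cder_eq (is_cderM (da x _) (cder_cst (be x * osc1 om x) _ _)) _.
  by rewrite mulr0 addr0.
- exact: iZ.
- by move=> h x _ _; rewrite (normcM (a' _ _)) Ax_dom; apply: ler_wpM2r; [exact: normc_ge0|exact: hC'].
Qed.

Lemma Ax_cont m a om η : 0 <= m -> sym alpha 0 m a -> ccont (Ax a (fun x => be x * osc1 om x)) η.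
Proof.
move=> m0 sa; have [C C0 hC] := sym_bounded hp hS m0 sa.
apply: (@cint_continuous R R _ (mR R) mu setT (fun η x => a x η * (be x * osc1 om x)) (fun x => C * normc (be x)) η 1 measurableT ltr01).
- move=> y _; apply: cmeasT1 => x; apply: ccontM; [exact: sym_x_cont sa|exact: bo_cont].
- by move=> x _; apply: ccontM; [exact: sym_eta_cont sa|exact: ccont_cst].
- exact: (integrableZl measurableT C ib).
- by move=> y x _ _; rewrite (normcM (a _ _)) Ax_dom; apply: ler_wpM2r; [exact: normc_ge0|exact: hC].
Qed.

Lemma jb_submul (a b : R) : jb (a + b) <= jb a * jb b.
Proof.
rewrite /jb mulrDl mul1r mulrDr mulr1 addrA -[leLHS]addr0.
have := ler_normD a b; have := mulr_ge0 (normr_ge0 a) (normr_ge0 b); lra.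
Qed.

(** Peetre's inequality, from the submultiplicativity of the bracket. It transfers decay in [η] to
    decay in [sg] at the price of a power of [<η - sg>], which [L q] pays. *)
Lemma peetre m η sg : 0 <= m -> jb η `^ (- m) <= jb sg `^ (- m) * jb (η - sg) `^ m.
Proof.
move=> m0; have j0 := jb_gt0 η; have k0 := jb_gt0 sg; have l0 := jb_gt0 (η - sg).
rewrite !powRN mulrC -ler_pdivrMr ?invr_gt0 ?powR_gt0// invrK mulrC.
rewrite ler_pdivrMr ?powR_gt0// -powRM ?(ltW j0) ?(ltW l0)//.
apply: ge0_ler_powR; rewrite ?nnegrE ?mulr_ge0 ?(ltW j0) ?(ltW k0) ?(ltW l0)//.
have := jb_submul (sg - η) η; rewrite subrK => /le_trans; apply.
by rewrite /jb distrC.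
Qed.

Lemma L_shift_cont q sg η : test q -> ccont (fun η => L q (sl (η - sg))) η.
Proof.
move=> tq; apply: (ccont_comp (f := fun η => L q (sl η)) (g := fun η => η - sg)); last exact: L_cont.
by apply: cvgB; [exact: cvg_id|exact: cvg_cst].
Qed.

Lemma is_cder_L_shift q sg η : test q ->
  is_cder (fun η => L q (sl (η - sg))) η (1 : R) (ci * L (tB q) (sl (η - sg))).
Proof.
move=> tq; apply: (is_cder_L (g := fun η => sl (η - sg)) (dg := fun=> ci) (D := 1) (G := 1) tq) => y _.
split; last by rewrite normc_ci re_sl normr1.
have dm : is_derive y (1 : R) (fun y : R => y - sg) 1.
  by apply: is_derive_eq (is_deriveB (is_derive_id y 1) (is_derive_cst sg y 1)) _; rewrite subr0.
by apply: cder_eq (is_cder_comp dm (is_cder_sl (y - sg))) _; rewrite mul1r.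
Qed.

(** The localized transform for the product test function [be x * q t] at the frequency [(om, sg)],
    with a symbol [a] in place of [St]. *)
Definition Tx a q om sg : R[i] := cint mu setT (fun η => Ax a (fun x => be x * osc1 om x) η * L q (sl (η - sg))).

Lemma wt_shift sg : mu.-integrable setT (EFin \o (fun η : R => wt 1 (η - sg))) /\
  (\int[mu]_η wt 1 (η - sg) = \int[mu]_η (wt 1 η : R))%R.
Proof. exact: (integral_shift (- sg) (@integrable_wt R 1 ltr01)). Qed.

Lemma Tx_dom m a q : 0 <= m -> sym alpha 0 m a -> test q -> exists2 C : R, 0 <= C &
  forall om sg η, normc (Ax a (fun x => be x * osc1 om x) η * L q (sl (η - sg))) <= C * jb sg `^ (- m) * wt 1 (η - sg).
Proof.
move=> m0 sa tq; have [C C0 hC] := Ax_bound sa.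
(* A power [m] pays for Peetre's inequality; the other two leave an integrable weight. *)
pose N := ((Num.trunc m).+1 + 2)%N.
have mN : m + 2 <= N%:R by rewrite /N natrD lerD2r ltW// truncnS_gt.
have [D D0 hD] := L_decay N tq.
exists (C * D); first by rewrite mulr_ge0.
move=> om sg η; rewrite (normcM (Ax _ _ _)).
have j0 := jb_gt0 (η - sg).
rewrite [leRHS](_ : _ = C * jb sg `^ (- m) * (D * wt 1 (η - sg))); last by ring.
apply: (@le_trans _ _ (C * (jb sg `^ (- m) * jb (η - sg) `^ m) * normc (L q (sl (η - sg))))).
  by apply: ler_wpM2r; [exact: normc_ge0|apply: le_trans (hC om η) _; apply: ler_wpM2l; rewrite ?peetre].
rewrite [leLHS](_ : _ = C * jb sg `^ (- m) * (jb (η - sg) `^ m * normc (L q (sl (η - sg))))); last by ring.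
apply: ler_wpM2l; first by rewrite mulr_ge0 ?powR_ge0.
have -> : wt 1 (η - sg) = (jb (η - sg) ^+ 2)^-1 by rewrite -(wt_natE 1).
rewrite ler_pdivlMr ?exprn_gt0//; apply: le_trans (hD (η - sg)).
rewrite mulrAC ler_wpM2r ?normc_ge0//.
rewrite -/(jb _) -!(powR_mulrn _ (ltW j0)) -jb_powRD; exact: jb_powR_le.
Qed.

Lemma Tx_bound m a q : 0 <= m -> sym alpha 0 m a -> test q -> exists2 C : R, 0 <= C &
  forall om sg, normc (Tx a q om sg) <= C * jb sg `^ (- m).
Proof.
move=> m0 sa tq; have [C C0 hC] := Tx_dom m0 sa tq.
exists (C * (\int[mu]_η (wt 1 η : R))%R).
  by rewrite mulr_ge0// Rintegral_ge0// => η _; exact: wt_ge0.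
move=> om sg; have [iw ew] := wt_shift sg.
rewrite mulrAC -ew -(RintegralZl (C * jb sg `^ (- m)) measurableT iw); apply: (cint_le measurableT).
- by apply: cmeasT1 => η; apply: ccontM; [exact: Ax_cont sa|exact: L_shift_cont].
- exact: (integrableZl measurableT (C * jb sg `^ (- m)) iw).
- by move=> η _; exact: hC.
Qed.

(** [L (tB q)] is [- i] times the [η]-derivative of [L q]; by parts the derivative falls on the
    symbol, where it will gain [1 - alpha]. *)
Lemma Tx_parts m a a' q om sg : 0 <= m -> (forall x η, is_cder (a x) η (1 : R) (a' x η)) ->
  sym alpha 0 m a -> sym alpha 0 m a' -> test q -> Tx a (tB q) om sg = ci * Tx a' q om sg.
Proof.
move=> m0 da sa sa' tq; have tt := test_tB tq.
have [C C0 hC] := Tx_dom m0 sa tq; have [D D0 hD] := Tx_dom m0 sa' tq; have [E E0 hE] := Tx_dom m0 sa tt.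
have [iw _] := wt_shift sg.
have i1 : cintble mu setT (fun η => Ax a' (fun x => be x * osc1 om x) η * L q (sl (η - sg))).
  apply: (cintble_dom measurableT _ (integrableZl measurableT (D * jb sg `^ (- m)) iw)) => [|η _]; last exact: hD.
  by apply: cmeasT1 => η; apply: ccontM; [exact: Ax_cont sa'|exact: L_shift_cont].
have i2 : cintble mu setT (fun η => Ax a (fun x => be x * osc1 om x) η * L (tB q) (sl (η - sg))).
  apply: (cintble_dom measurableT _ (integrableZl measurableT (E * jb sg `^ (- m)) iw)) => [|η _]; last exact: hE.
  by apply: cmeasT1 => η; apply: ccontM; [exact: Ax_cont sa|exact: L_shift_cont].
have lim (u : nat -> R) : (forall n, (`|u n - sg| + 1)^-1 <= (1 + `|sg|) * eps n) ->
    ccvg (fun n => Ax a (fun x => be x * osc1 om x) (u n) * L q (sl (u n - sg))) 0.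
  move=> hu; apply: (@ccvg_sqz _ _ _ (fun n => C * jb sg `^ (- m) * (1 + `|sg|) * eps n)); last first.
    by rewrite -[X in _ --> X](mulr0 (C * jb sg `^ (- m) * (1 + `|sg|))); apply: cvgMr; exact: eps_cvg.
  move=> n; rewrite subr0; apply: le_trans (hC om sg (u n)) _; rewrite -!mulrA.
  rewrite !(mulrA C); apply: ler_wpM2l; first by rewrite mulr_ge0 ?powR_ge0.
  apply: le_trans (hu n); have -> : wt 1 (u n - sg) = (jb (u n - sg) ^+ 2)^-1 by rewrite -(wt_natE 1).
  have -> : `|u n - sg| + 1 = jb (u n - sg) by rewrite addrC.
  rewrite lef_pV2 ?posrE ?exprn_gt0 ?jb_gt0//.
  by rewrite expr2 ler_peMr ?jb_ge1// ltW// jb_gt0.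
have bnd (y : R) n : `|y| = n%:R -> (`|y - sg| + 1)^-1 <= (1 + `|sg|) * eps n.
  move=> yn; rewrite /eps ler_pdivlMr ?ltr0n// mulrC ler_pdivrMr; last by rewrite ltr_wpDl.
  have : `|y| <= `|y - sg| + `|sg| by rewrite -{1}[y](subrK sg); exact: ler_normD.
  rewrite yn -natr1 => h; have := mulr_ge0 (normr_ge0 sg) (normr_ge0 (y - sg)); lra.
have : cint mu setT (fun η => Ax a' (fun x => be x * osc1 om x) η * L q (sl (η - sg)) + ci * (Ax a (fun x => be x * osc1 om x) η * L (tB q) (sl (η - sg)))) = 0.
  apply: (@cint_derT _ (fun η => Ax a (fun x => be x * osc1 om x) η * L q (sl (η - sg)))).
  - move=> η; apply: cder_eq (is_cderM (is_cder_Ax om η m0 da sa sa') (is_cder_L_shift sg η tq)) _.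
    by congr (_ + _); ring.
  - move=> η; apply: ccontD; first by apply: ccontM; [exact: Ax_cont sa'|exact: L_shift_cont].
    by apply: ccontM; [exact: ccont_cst|apply: ccontM; [exact: Ax_cont sa|exact: L_shift_cont]].
  - exact: cintbleDT i1 (cintbleZT ci i2).
  - by apply: lim => n; apply: bnd; rewrite ger0_norm.
  - by apply: lim => n; apply: bnd; rewrite normrN ger0_norm.
rewrite cintDT//; last exact: cintbleZT.
rewrite cintZT// -/(Tx a' q om sg) -/(Tx a (tB q) om sg) => /eqP; rewrite addr_eq0 => /eqP ->.
by rewrite mulrN mulrA cici mulN1r opprK.
Qed.

(** Support in [t >= c > 0]: division by [t] stays within test functions and can be repeated. *)
Definition late q := exists2 c : R, 0 < c & forall t, t <= c -> q t = 0.

Lemma late_div q : test q -> late q -> exists2 q', test q' /\ late q' & q = tB q'.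
Proof.
move=> tq [c c0 hc]; exists (fun t => q t * (t%:C)^-1).
  split; last by exists c => // t tc; rewrite hc// mul0r.
  apply/(testP cptB1); split; last first.
    have [M [_ [_ _ out _]]] := test_bd_supp tq; exists M => t tM; by rewrite out// mul0r.
  apply: (smooth_glue (U := [set t : R | 0 < t]) (U0 := [set t : R | t < c])).
  - exact: open_gt.
  - exact: open_lt.
  - by move=> t; have [h|h] := ltP t c; [right|left; exact: lt_le_trans h].
  - by move=> t /ltW; exact: hc.
  - exact: tq.1.
  - apply: smoothV; first exact: open_gt.
      by move=> t /= t0; rewrite -normc_eq0 normcR normr_eq0 gt_eqF.
    exact: smooth_sub (@subsetT _ _) smooth_id.
apply/funext => t; rewrite /tB; have [tc|tc] := leP t c; first by rewrite hc// !mul0r mulr0.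
by rewrite mulrCA mulfV ?mulr1// -normc_eq0 normcR normr_eq0 gt_eqF// (lt_trans c0).
Qed.

(** Each of the [M] divisions by [t] is one integration by parts and one gain of [1 - alpha]. *)
Lemma Tx_rapid M m a q : 0 <= m -> sym alpha M m a -> test q -> late q -> exists2 C : R, 0 <= C &
  forall om sg, normc (Tx a q om sg) <= C * jb sg `^ (- (m + M%:R * (1 - alpha))).
Proof.
have a1 := a1_gt0 hp.
elim: M m a q => [|M IH] m a q m0 sa tq lq; first by rewrite mul0r addr0; exact: Tx_bound.
have [q' [tq' lq'] ->] := late_div tq lq.
have [sb [a' da sa']] := sa.
have sa0 : sym alpha 0 m a by [].
have m1 : 0 <= m + (1 - alpha) by rewrite addr_ge0// ltW.
have [C C0 hC] := IH _ _ _ m1 sa' tq' lq'; exists C => // om sg.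
have sa'0 : sym alpha 0 m a'.
  have le : m <= m + (1 - alpha) by rewrite lerDl ltW.
  by case: (M) sa' => [|M'] sa'; apply: (sym_le hp le); [exact: sa'|case: sa'].
rewrite (Tx_parts om sg m0 da sa0 sa'0 tq') (normcM ci) normc_ci mul1r; apply: le_trans (hC om sg) _.
by have -> : m + M.+1%:R * (1 - alpha) = m + (1 - alpha) + M%:R * (1 - alpha) by rewrite -natr1; ring.
Qed.

End Beta.

Lemma late_not_WF t0 xi et : 0 < t0 -> et != 0 -> ~ WF S ((0, t0), (xi, et)).
Proof.
move=> t00 et0 [_]; apply.
have r0 : 0 < t0 / 2 by rewrite divr_gt0.
have ta := test_bumpa 0 r0; have tg := test_bumpa t0 r0.
have lg : late (fun t => (bumpa t0 (t0 / 2) t)%:C).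
  exists (t0 / 2) => // t th; rewrite bumpa_out// distrC; apply: le_trans (ler_norm _); lra.
(* The cone [|zeta.1| < K |zeta.2|] then contains [(xi, et)], and on it [<zeta.2>] controls the
   whole frequency. *)
pose K := 1 + `|xi| / `|et|.
have K0 : 0 < K by rewrite ltr_wpDr// divr_ge0.
have a0 : 0 < `|et| by rewrite normr_gt0.
exists (bump2 (0, t0) (t0 / 2)), [set zeta : R * R | `|zeta.1| < K * `|zeta.2|]; split.
- exact: test_bump2.
- exact: bump2_self.
- split.
    rewrite (_ : [set _ | _] = (fun zeta : R * R => K * `|zeta.2| - `|zeta.1|) @^-1` [set x | 0 < x]); last first.
      by apply/seteqP; split => z /=; rewrite subr_gt0.
    apply: open_comp; last exact: open_gt.
    move=> z _; apply: cvgB; last by apply: cvg_norm; exact: cvg_fst.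
    by apply: cvgM; [exact: cvg_cst|apply: cvg_norm; exact: cvg_snd].
  move=> c z c0 /= h; rewrite -[X in `|X| < _]/(c * z.1) -[X in _ < _ * `|X|]/(c * z.2) !normrM mulrCA.
  by rewrite ltr_pM2l// normr_gt0 gt_eqF.
- by rewrite /= /K mulrDl mul1r divfK ?gt_eqF// ltrDr.
move=> n; have a1 := a1_gt0 hp.
(* Number of integrations by parts needed to reach decay of order [n], starting from order 1. *)
have [M hM] : exists M : nat, n%:R <= 1 + M%:R * (1 - alpha).
  exists (Num.trunc (n%:R / (1 - alpha))).+1; apply: ler_wpDl => //.
  by rewrite -ler_pdivrMr// ltW// truncnS_gt.
have [C C0 hC] := Tx_rapid ta ler01 (sym_St hp M) tg lg.
have p0 : 0 < kF :> R by exact: kF_gt0.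
exists ((K + 1) ^+ n * (C / kF)) => zeta /= hz.
have j0 := jb_gt0 zeta.2.
have zb : 1 + `|zeta| <= (K + 1) * jb zeta.2.
  have m0 : `|zeta| <= (K + 1) * `|zeta.2|.
    rewrite -[`|zeta|]/(Num.max `|zeta.1| `|zeta.2|) ge_max; apply/andP; split.
      by apply: le_trans (ltW hz) _; rewrite ler_wpM2r// lerDl.
    by rewrite ler_peMl// lerDr ltW.
  by rewrite /jb mulrDr mulr1; apply: lerD => //; rewrite lerDr ltW.
have E : kF%:C * localized_fourier S (bump2 (0, t0) (t0 / 2)) zeta = Tx (fun x => (bumpa 0 (t0 / 2) x)%:C) (St alpha tau) (fun t => (bumpa t0 (t0 / 2) t)%:C) zeta.1 zeta.2.
  rewrite localizedE; last exact: test_bump2.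
  apply: eq_cint => η _; rewrite [RHS]mulrC -cintZT.
    apply: eq_cint => x _.
    have -> : Ft (bump2 (0, t0) (t0 / 2)) x (η - zeta.2) = (bumpa 0 (t0 / 2) x)%:C * L (fun t => (bumpa t0 (t0 / 2) t)%:C) (sl (η - zeta.2)).
      rewrite /Ft /L -cintZT; last exact: cintble_test (test_rotc _ tg).
      by apply: eq_cint => t _; rewrite /bump2 /= mulrA.
    by ring.
  exact: (cintble_Ax ta zeta.1 η ler01 (sym_St hp 0)).
have F : normc (localized_fourier S (bump2 (0, t0) (t0 / 2)) zeta) <= C / kF * jb zeta.2 `^ (- n%:R).
  rewrite mulrAC ler_pdivlMr// mulrC -(gtr0_norm p0) -normcR -(normcM kF%:C) E.
  apply: le_trans (hC zeta.1 zeta.2) _; apply: ler_wpM2l => //; apply: jb_powR_le.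
  by rewrite lerN2.
apply: (@le_trans _ _ (((K + 1) * jb zeta.2) ^+ n * (C / kF * jb zeta.2 `^ (- n%:R)))).
  apply: ler_pM; rewrite ?exprn_ge0 ?addr_ge0 ?normc_ge0// lerXn2r ?nnegrE ?addr_ge0 ?mulr_ge0 ?addr_ge0 ?(ltW j0) ?(ltW K0)//.
rewrite exprMn powRN powR_mulrn ?(ltW j0)// [leLHS](_ : _ = (K + 1) ^+ n * (C / kF) * (jb zeta.2 ^+ n / jb zeta.2 ^+ n)); last by ring.
by rewrite divff ?mulr1// expf_neq0// gt_eqF.
Qed.

End Localized.

(** * Arithmetic of the bootstrap *)

Section Arithmetic.
Context {R : realType}.
Notation mu := (@lebesgue_measure R).

Lemma cint_lin3 (f0 f1 f2 : R -> R[i]) (b c : R[i]) : cintble mu setT f0 -> cintble mu setT f1 -> cintble mu setT f2 ->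
  cint mu setT (fun x => f2 x + (b * f1 x + c * f0 x)) = cint mu setT f2 + (b * cint mu setT f1 + c * cint mu setT f0).
Proof.
move=> i0 i1 i2; have j0 := cintbleZT c i0; have j1 := cintbleZT b i1.
by rewrite (cintDT i2 (cintbleDT j1 j0)) (cintDT j1 j0) !cintZT.
Qed.

(** One bootstrap step in real variables: [n = p^K], [b = n^2 / p], [j2 = <s>^2], [Y = <s>^(-N)],
    [Q = p^(-k)], [t = 1 / tau]; [w], [w1], [w2] are the sizes of [W] for [phi] and its first two
    [x]-derivatives, and [m] is the error of the multiplier. *)
Lemma iter_arith (X w w1 w2 m t x n b j2 Y Q CM C0 C1 C2 : R) :
  1 <= n -> n <= b -> 1 <= j2 -> 0 <= Y -> 0 <= Q -> 0 <= t -> 0 <= x -> 0 <= w -> 0 <= CM -> 0 <= C0 -> 0 <= C1 -> 0 <= C2 ->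
  m <= CM * b * j2 -> w <= C0 * Q * (Y / j2) -> w1 <= C1 * Q * Y -> w2 <= C2 * Q * Y ->
  X <= t * w2 + 2 * (n * x) * (t * w1) + m * w ->
  X <= (t * C2 + 2 * x * t * C1 + CM * C0) * (b * Q) * Y.
Proof.
move=> n1 nb j1 Y0 Q0 t0 x0 w0 m0 p0 c1 c2 hm h0 h1 h2 h; apply: le_trans h _.
have np : 0 <= n := le_trans ler01 n1; have jp : 0 < j2 := lt_le_trans ltr01 j1.
have QY : 0 <= Q * Y by rewrite mulr_ge0.
have A2 : t * w2 <= t * C2 * (b * (Q * Y)).
  apply: le_trans (ler_wpM2l t0 h2) _; rewrite -!mulrA ler_wpM2l// ler_wpM2l//.
  by rewrite ler_peMl//; exact: le_trans n1 nb.
have A1 : 2 * (n * x) * (t * w1) <= 2 * x * t * C1 * (b * (Q * Y)).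
  apply: (@le_trans _ _ (2 * x * t * C1 * (n * (Q * Y)))); last by rewrite ler_wpM2l ?mulr_ge0// ler_wpM2r.
  rewrite [leRHS](_ : _ = 2 * (n * x) * (t * (C1 * Q * Y))); last by ring.
  by apply: ler_wpM2l; [rewrite !mulr_ge0|exact: ler_wpM2l].
have A0 : m * w <= CM * C0 * (b * (Q * Y)).
  apply: (@le_trans _ _ (CM * b * j2 * (C0 * Q * (Y / j2)))).
    apply: le_trans (ler_wpM2r w0 hm) _; apply: ler_wpM2l => //.
    by rewrite !mulr_ge0// ?(ltW jp)// (le_trans np).
  by rewrite [leLHS](_ : _ = CM * C0 * (b * (Q * Y)))//; field; rewrite lt0r_neq0.
by rewrite -!mulrA [leRHS]mulrDl mulrDl; lra.
Qed.

Lemma le_expr_self (K : nat) (p : R) : (0 < K)%N -> 1 <= p -> p <= p ^+ K.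
Proof. by move=> K0 p1; rewrite -{1}[p]expr1; exact: ler_weXn2l. Qed.

(** With [n = p^K >= p], the bound [n^3 f <= C3] gives [n^2 f <= C3 / p]. So [b] is at most a
    constant over [p], and [p] is taken beyond that constant divided by [b]. *)
Lemma rapid_vanish (b C d C3 m0 : R) (K : nat) (f : R -> R) : (0 < K)%N -> 0 <= C -> 0 <= d -> 0 <= C3 ->
  (forall p, 1 <= p -> m0 <= p -> (p ^+ K) ^+ 3 * f p <= C3) ->
  (forall p, 1 <= p -> b <= C / p + d * ((p ^+ K) ^+ 2 * f p)) -> b <= 0.
Proof.
move=> K0 C0 d0 p0 h3 hb; rewrite leNgt; apply/negP => b0.
pose p := 1 + `|m0| + (C + d * C3) / b.
have q0 : 0 <= (C + d * C3) / b by rewrite divr_ge0 ?addr_ge0 ?mulr_ge0// ltW.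
have am := ler_norm m0; have am0 := normr_ge0 m0.
have p1 : 1 <= p by rewrite /p; lra.
have pp : 0 < p := lt_le_trans ltr01 p1; have pm : m0 <= p by rewrite /p; lra.
have pn := le_expr_self K0 p1.
have n0 := lt_le_trans pp pn.
have hf : (p ^+ K) ^+ 2 * f p <= C3 / p.
  apply: (@le_trans _ _ (C3 / p ^+ K)); last by rewrite ler_wpM2l// lef_pV2.
  by rewrite ler_pdivlMr//; apply: le_trans (h3 _ p1 pm); rewrite (exprSr _ 2) mulrAC.
have := le_trans (hb _ p1) (lerD (lexx _) (ler_wpM2l d0 hf)).
rewrite mulrA -mulrDl ler_pdivlMr// leNgt => /negP; apply.
by rewrite -ltr_pdivrMl// mulrC /p; lra.
Qed.

End Arithmetic.

(** * Singular directions of the wave front set *)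

Section Singular.
Context {R : realType} (alpha tau : R) (S : (R * R -> R[i]) -> R[i]).
Context (hp : 0 < alpha < 1 /\ 0 < tau < 1) (hS : zener_fundamental_solution alpha tau S).
Notation mu := (@lebesgue_measure R).
Local Arguments re : simpl never.
Local Arguments im : simpl never.
Implicit Types (z v zeta : R * R) (phi : R * R -> R[i]) (x η om sg s p : R) (n N k : nat).

Definition Dx phi := cderive e_x phi.

Lemma test_Dx phi : test phi -> test (Dx phi).
Proof. exact: (test_cderive cptB2 e_x). Qed.

Lemma Ft_psi phi x s : test phi -> Ft phi x s = psi phi s (x, 0).
Proof. by move=> tp; rewrite psiE//= /rotc mulr0 cexp0 mulr1. Qed.

Lemma cderive_Ft phi s : test phi -> cderive (1 : R) (fun x => Ft phi x s) = fun x => Ft (Dx phi) x s.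
Proof.
move=> tp; rewrite (_ : (fun x => Ft phi x s) = fun x => psi phi s (x, 0)); last first.
  by apply/funext => x; exact: Ft_psi.
rewrite cderive_slice_x; apply/funext => x.
by rewrite (is_cderP (is_cder_psi s (x, 0) e_x tp)).2 Ft_psi//; exact: test_Dx.
Qed.

(** [η] is the frequency of [S] and [s] that at which [phi] is read. In the localized transform
    [s = η - zeta.2]; they are kept independent so that [η] can move along a path while [s] is
    fixed. *)
Definition W phi om η s : R[i] := Ax (St alpha tau) (fun x => Ft phi x s * osc1 om x) η.

Lemma is_cder_osc1 om x : is_cder (osc1 om) x (1 : R) ((0 +i* (- om)) * osc1 om x).
Proof. exact: is_cder_rotc. Qed.

Lemma cderive_Fto phi om s : test phi -> cderive (1 : R) (fun x => Ft phi x s * osc1 om x) =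
  fun x => Ft (Dx phi) x s * osc1 om x + (0 +i* (- om)) * (Ft phi x s * osc1 om x).
Proof.
move=> tp; apply/funext => x.
have d := is_cderM (smooth_cder0 (1 : R) (test_Ft s tp).1 (I : setT x)) (is_cder_osc1 om x).
by rewrite (is_cderP d).2 cderive_Ft//; ring.
Qed.

Lemma test_Fto phi om s : test phi -> test (fun x => Ft phi x s * osc1 om x).
Proof. by move=> tp; exact: (testM cptB1 (test_Ft s tp) (smooth_rotc _)). Qed.

Lemma cintble_W phi om η s : test phi -> cintble mu setT (fun x => St alpha tau x η * (Ft phi x s * osc1 om x)).
Proof. by move=> tp; exact: (cintble_Ax hp hS (test_Ft s tp) om η ler01 (sym_St hp 0)). Qed.

Lemma W_eq phi om η s : test phi ->
  (sl η ^+ 2 + csym alpha tau η * (om ^+ 2)%:C) * W phi om η s =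
  Ft phi 0 s + csym alpha tau η * W (Dx (Dx phi)) om η s - (0 +i* (2 * om)) * (csym alpha tau η * W (Dx phi) om η s).
Proof.
move=> tp; have t1 := test_Dx tp; have t2 := test_Dx t1; have th := test_Fto om s tp.
have th2 := test_cderive cptB1 (1 : R) (test_cderive cptB1 (1 : R) th).
have := U_eq hp hS η (test_schwartz cptB1 th).
rewrite (U_rep hp hS η th) (U_rep hp hS η th2).
have e2 : cderive (1 : R) (cderive (1 : R) (fun x => Ft phi x s * osc1 om x)) = fun x =>
    Ft (Dx (Dx phi)) x s * osc1 om x + ((0 +i* (- (2 * om))) * (Ft (Dx phi) x s * osc1 om x) + (- (om ^+ 2)%:C) * (Ft phi x s * osc1 om x)).
  rewrite cderive_Fto//; apply/funext => x.
  have d1 := smooth_cder0 (1 : R) (test_Fto om s t1).1 (I : setT x).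
  have d0 := smooth_cder0 (1 : R) th.1 (I : setT x).
  rewrite (is_cderP (is_cderD d1 (is_cderZ (0 +i* (- om)) d0))).2 !cderive_Fto//.
  have -> : 0 +i* (- (2 * om)) = (0 +i* (- om)) + (0 +i* (- om)) by apply: cplxP; rewrite !reimC; ring.
  have -> : - (om ^+ 2)%:C = (0 +i* (- om)) * (0 +i* (- om)) by apply: cplxP; rewrite !reimC; ring.
  by move: (Ft (Dx (Dx phi)) x s) (Ft (Dx phi) x s) (Ft phi x s) (osc1 om x) (0 +i* (- om)) => a b c d e; ring.
rewrite e2; have -> : cint mu setT (fun x => St alpha tau x η * (Ft (Dx (Dx phi)) x s * osc1 om x +
     ((0 +i* (- (2 * om))) * (Ft (Dx phi) x s * osc1 om x) + (- (om ^+ 2)%:C) * (Ft phi x s * osc1 om x)))) =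
    W (Dx (Dx phi)) om η s + ((0 +i* (- (2 * om))) * W (Dx phi) om η s + (- (om ^+ 2)%:C) * W phi om η s).
  have i0 := cintble_W om η s tp; have i1 := cintble_W om η s t1; have i2 := cintble_W om η s t2.
  rewrite /W /Ax -(cint_lin3 _ _ i0 i1 i2).
  apply: eq_cint => x _; move: (St _ _ _ _) (Ft (Dx (Dx phi)) x s) (Ft (Dx phi) x s) (Ft phi x s) (osc1 om x) (0 +i* (- (2 * om))) => a b c d e f.
  by ring.
rewrite -[cint mu setT (fun x => St alpha tau x η * (Ft phi x s * osc1 om x))]/(W phi om η s); have -> : osc1 om 0 = 1 by rewrite /osc1 /rotc mulr0 cexp0.
have -> : 0 +i* (- (2 * om)) = - (0 +i* (2 * om)) by apply: cplxP; rewrite !reimC ?oppr0.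
rewrite mulr1 => <-; move: (W (Dx (Dx phi)) om η s) (W (Dx phi) om η s) (W phi om η s) (csym _ _ _) (sl η) (0 +i* (2 * om)) => a b c d e f.
by rewrite mulNr; ring.
Qed.

Lemma jbX_gt0 s N : 0 < jb s ^+ N. Proof. by rewrite exprn_gt0// jb_gt0. Qed.

Lemma Ft0_bound phi N : test phi -> exists2 C : R, 0 <= C & forall s, normc (Ft phi 0 s) <= C / jb s ^+ N.
Proof.
by move=> tp; have [C C0 hC] := Ft_decay N tp; exists C => // s; rewrite ler_pdivlMr ?jbX_gt0// mulrC; exact: hC.
Qed.

Lemma W_bound phi N : test phi -> exists2 C : R, 0 <= C &
  forall om η s, normc (W phi om η s) <= C / jb η / jb s ^+ N.
Proof.
move=> tp; have [C C0 hC] := sym_bound hp (sym_St hp 0).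
have [D D0 hD] := Ft_decay N tp; have [M M0 hM] := Ft_out tp.
exists (C * (D * (M + M))); first by rewrite !mulr_ge0// addr_ge0.
move=> om η s; have j0 := jb_gt0 η; have js := jbX_gt0 s N.
have hC' x : normc (St alpha tau x η) <= C / jb η by apply: le_trans (hC x η) _; rewrite powR_inv1 ?(ltW j0).
have MM : - M <= M by rewrite (le_trans _ M0)// oppr_le0.
rewrite [leRHS](_ : _ = C / jb η * (D / jb s ^+ N * (M - (- M)))); last by rewrite opprK; field; rewrite !lt0r_neq0.
rewrite -(Rint_itv_cst _ MM) -(RintegralZl (C / jb η) measurableT (itv_cst (- M) M (D / jb s ^+ N))).
apply: (cint_le measurableT).
- exact: cintble_cmeas measurableT (cintble_W om η s tp).
- exact: (integrableZl measurableT (C / jb η) (itv_cst (- M) M (D / jb s ^+ N))).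
- move=> x _; rewrite (normcM (St _ _ _ _)) (Ax_dom (fun x => Ft phi x s)).
  apply: ler_pM; [exact: normc_ge0|exact: normc_ge0|exact: hC'|].
  rewrite -ler_norml; case: ifPn => [xM|]; last by rewrite -ltNge => /hM ->; rewrite normc0.
  by rewrite ler_pdivlMr// mulrC; exact: hD.
Qed.

Lemma localizedW phi zeta : test phi -> kF%:C * localized_fourier S phi zeta =
    cint mu setT (fun η => W phi zeta.1 η (η - zeta.2)) /\
  cintble mu setT (fun η => W phi zeta.1 η (η - zeta.2)).
Proof.
move=> tp; have [C C0 [c1 b1]] := C1b_Gs hp hS (test_plane zeta tp).
have e : (fun η => W phi zeta.1 η (η - zeta.2)) = Gs alpha tau (fun z => phi z * plane zeta z).
  apply/funext => η; apply: eq_cint => x _; congr (_ * _).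
  by case: (Ft_plane phi zeta x η) => // ->; rewrite mulrC.
split; last first.
  rewrite e; apply: (cintble_dom measurableT _ (integrableZl measurableT C (@integrable_wt R 1 ltr01))) => [|η _]; last exact: b1.
  by apply: cmeasT1 => η; exact: C1b_cont c1.
by rewrite e /localized_fourier (star hp hS (test_plane zeta tp)).
Qed.

Lemma normc_i2 om : normc (0 +i* (2 * om)) = 2 * `|om|.
Proof. by rewrite normcEs re_i im_i expr0n add0r sqrtr_sqr normrM ger0_norm. Qed.

(** * Bootstrap along a path [(om p, h p)] of frequencies *)

Section Convergence.
Context (K : nat) (om h : R -> R) (A : R -> R -> R[i]) (a CM x : R) (K0 : (0 < K)%N) (a0 : 0 < a) (m0 : 0 <= CM).
Context (om_le : forall p, `|om p| = `|p| ^+ K * `|x|).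
Context (A_ge : forall p s, a * (p ^+ K) ^+ 2 <= normc (A p s)).
Context (A_near : forall p s, 1 <= p ->
  normc (sl (s + h p) ^+ 2 + csym alpha tau (s + h p) * (om p ^+ 2)%:C - A p s) <= CM * ((p ^+ K) ^+ 2 / p) * jb s ^+ 2).

(** Stated for all test functions at once, because a step for [phi] uses the bounds for its
    [x]-derivatives. [A] models the multiplier of [W_eq]: its size is at least [a p^(2K)], and it is
    wrong by [O (p^(2K) / p)], with a loss of [<s>^2]. *)
Definition level k := forall phi N, test phi -> exists2 C : R, 0 <= C & forall p s, 1 <= p ->
  normc (W phi (om p) (s + h p) s) <= C * (p ^+ k)^-1 / jb s ^+ N.

(** Terms with derivatives on [phi] carry at most [|om p|], of size [p^K <= p^(2K) / p] as [K > 0].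
    The multiplier error loses [<s>^2], hence [N.+2] in the bound used for [W phi]. *)
Lemma level_approx k phi N : level k -> test phi -> exists2 C : R, 0 <= C & forall p s, 1 <= p ->
  normc (A p s * W phi (om p) (s + h p) s - Ft phi 0 s) <= C * ((p ^+ K) ^+ 2 / p * (p ^+ k)^-1) / jb s ^+ N.
Proof.
move=> IH tp; have t1 := test_Dx tp; have t2 := test_Dx t1.
have [C0 p0 h0] := IH _ N.+2 tp; have [C1 p1 h1] := IH _ N t1; have [C2 p2 h2] := IH _ N t2.
have [_ /andP[ta _]] := hp; have ti : 0 <= tau^-1 by rewrite invr_ge0 ltW.
exists (tau^-1 * C2 + 2 * `|x| * tau^-1 * C1 + CM * C0) => [|p s pp1]; first by rewrite !addr_ge0 ?mulr_ge0.
have pp : 0 < p := lt_le_trans ltr01 pp1; have n1 := exprn_ege1 K pp1.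
have pn := le_expr_self K0 pp1.
have nb : p ^+ K <= (p ^+ K) ^+ 2 / p by rewrite ler_pdivlMr// expr2 ler_wpM2l// (le_trans ler01).
apply: (iter_arith n1 nb (exprn_ege1 2 (jb_ge1 s)) _ _ ti (normr_ge0 x) (normc_ge0 _) m0 p0 p1 p2 (A_near s pp1) _ (h1 p s pp1) (h2 p s pp1)).
- by rewrite invr_ge0 ltW// jbX_gt0.
- by rewrite invr_ge0 exprn_ge0// ltW.
- by rewrite -invfM -exprD addn2; exact: h0 p s pp1.
have E := W_eq (om p) (s + h p) s tp.
have -> : A p s * W phi (om p) (s + h p) s - Ft phi 0 s =
   csym alpha tau (s + h p) * W (Dx (Dx phi)) (om p) (s + h p) s - (0 +i* (2 * om p)) * (csym alpha tau (s + h p) * W (Dx phi) (om p) (s + h p) s)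
   - (sl (s + h p) ^+ 2 + csym alpha tau (s + h p) * (om p ^+ 2)%:C - A p s) * W phi (om p) (s + h p) s.
  move: (sl (s + h p) ^+ 2 + _) E => B E; rewrite mulrBl E.
  by move: (W (Dx (Dx phi)) _ _ _) (W (Dx phi) _ _ _) (W phi _ _ _) (Ft phi 0 s) (csym _ _ _) (_ +i* _) (A p s) => b c d e f g i; ring.
apply: le_trans (normcB _ _) _; rewrite (normcM (_ - _)); apply: lerD; last exact: lexx.
apply: le_trans (normcB _ _) _; rewrite (normcM (csym _ _ _)) (normcM (0 +i* _)) (normcM (csym _ _ _)) normc_i2 om_le (gtr0_norm pp).
have hc := normc_csym hp (s + h p).
apply: lerD; first by apply: ler_wpM2r; rewrite ?normc_ge0.
by apply: ler_wpM2l; [rewrite !mulr_ge0// (le_trans ler01)|apply: ler_wpM2r; rewrite ?normc_ge0].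
Qed.

(** Dividing the approximate equation by [A] gains one power of [p]. After the division the source
    [Ft phi 0 s] is of size [p^(-2K)], where the iteration stops. *)
Lemma level_le k : (k <= 2 * K)%N -> level k.
Proof.
elim: k => [_|k IH kK] phi N tp.
  have [C C0 hC] := W_bound N tp; exists C => // p s _; apply: le_trans (hC _ _ _) _.
  rewrite expr0 invr1 mulr1; apply: ler_wpM2r; first by rewrite invr_ge0 ltW// jbX_gt0.
  by rewrite ler_pdivrMr ?jb_gt0// ler_peMr// jb_ge1.
have [E E0 hE] := level_approx N (IH (ltnW kK)) tp; have [B B0 hB] := Ft0_bound N tp.
exists ((B + E) / a) => [|p s p1]; first by rewrite divr_ge0 ?addr_ge0// ltW.
have pp : 0 < p := lt_le_trans ltr01 p1; have n0 : 0 < p ^+ K by rewrite exprn_gt0.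
have P0 : 0 < p ^+ k by rewrite exprn_gt0.
have PK : p ^+ k * p <= (p ^+ K) ^+ 2 by rewrite -exprSr -exprM mulnC; exact: ler_weXn2l.
have {}hE := hE p s p1; have {}hB := hB s.
have Y0 : 0 <= (jb s ^+ N)^-1 by rewrite invr_ge0 ltW// jbX_gt0.
have H : a * (p ^+ K) ^+ 2 * normc (W phi (om p) (s + h p) s) <= (B + E) * ((p ^+ K) ^+ 2 / p * (p ^+ k)^-1) / jb s ^+ N.
  apply: le_trans (ler_wpM2r (normc_ge0 _) (A_ge p s)) _.
  rewrite -(normcM (A p s)) -[A p s * _](subrK (Ft phi 0 s)).
  apply: le_trans (normcD _ _) _; rewrite addrC mulrDl mulrDl; apply: lerD => //.
  apply: le_trans hB _; apply: ler_wpM2r => //; rewrite ler_peMr// -mulrA -invfM.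
  by rewrite ler_pdivlMr ?mulr_gt0// mul1r mulrC.
rewrite -(ler_pM2l (mulr_gt0 a0 (exprn_gt0 2 n0))); apply: le_trans H _.
rewrite (exprSr p k); move: (p ^+ K) (p ^+ k) (jb s ^+ N)^-1 n0 P0 => n P Y n0 P0.
by rewrite le_eqVlt; apply/orP; left; apply/eqP; field; rewrite !lt0r_neq0.
Qed.

Lemma W_approx phi N : test phi -> exists2 C : R, 0 <= C & forall p s, 1 <= p ->
  normc (A p s * W phi (om p) (s + h p) s - Ft phi 0 s) <= C / p / jb s ^+ N.
Proof.
move=> tp; have [C C0 hC] := level_approx N (level_le (leqnn _)) tp; exists C => // p s p1.
apply: le_trans (hC p s p1) _; rewrite -exprM [(K * 2)%N]mulnC [_ / p / _]mulrAC mulfV ?mul1r//.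
by rewrite gt_eqF// exprn_gt0// (lt_le_trans ltr01).
Qed.

(** After the shift [η = s + h p] the pointwise estimate is integrable in [s], so it survives the
    integration that yields the localized transform. *)
Lemma W_limit phi (c : R -> R[i]) (g : R -> R[i]) : test phi -> cintble mu setT g ->
  (exists2 C : R, 0 <= C & forall p s, 1 <= p -> normc (c p * W phi (om p) (s + h p) s - g s) <= C / p / jb s ^+ 2) ->
  exists2 C : R, 0 <= C & forall p, 1 <= p ->
    normc (c p * (kF%:C * localized_fourier S phi (om p, h p)) - cint mu setT g) <= C / p.
Proof.
move=> tp ig [C C0 hC]; have iw := @integrable_wt R 1 ltr01.
exists (C * (\int[mu]_s (wt 1 s : R))%R) => [|p p1].
  by apply: mulr_ge0 => //; apply: Rintegral_ge0 => s _; exact: wt_ge0.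
have [-> iW] := localizedW (om p, h p) tp; rewrite /= in iW *.
have [iW' <-] := cint_shift (h p) iW.
rewrite -(cintZT _ iW') -(cintBT (cintbleZT _ iW') ig).
rewrite [leRHS]mulrAC -(RintegralZl (C / p) measurableT iw); apply: (cint_le measurableT).
- exact: (cmeasB (cmeasZ _ (cintble_cmeas measurableT iW')) (cintble_cmeas measurableT ig)).
- exact: (integrableZl measurableT (C / p) iw).
by move=> s _; rewrite addrK (wt_natE 1); exact: hC.
Qed.

End Convergence.

(** Along the path the frequency is at least a multiple of [p^K], so decay of order 3 beats the
    factor [c p = O (p^(2K))]; the limit [B] can only be 0. *)
Lemma rapid_limit phi (G : set (R * R)) (K : nat) (om h : R -> R) (c : R -> R[i]) (B : R[i]) (d y m0 : R) :
  (0 < K)%N -> 0 <= d -> 0 < y -> rapidly_decreasing_on G (localized_fourier S phi) ->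
  (forall p, 1 <= p -> m0 <= p -> G (om p, h p)) -> (forall p, 1 <= p -> y * p ^+ K <= `|(om p, h p)|) ->
  (forall p, normc (c p) <= d * (p ^+ K) ^+ 2) ->
  (exists2 C : R, 0 <= C & forall p, 1 <= p ->
    normc (c p * (kF%:C * localized_fourier S phi (om p, h p)) - B) <= C / p) -> B = 0.
Proof.
move=> K0 d0 y0 rd hG hy hc [C C0 hC]; have [C3 h3] := rd 3%N.
have p0 : 0 < kF :> R by exact: kF_gt0.
apply/eqP; rewrite -normc_eq0; apply/eqP/le_anti/andP; split; last exact: normc_ge0.
apply: (@rapid_vanish R _ C (d * kF) (`|C3| / y ^+ 3) m0 K (fun p => normc (localized_fourier S phi (om p, h p)))) => //.
- by rewrite mulr_ge0// ltW.
- by rewrite divr_ge0// exprn_ge0// ltW.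
- move=> p p1 pm; rewrite ler_pdivlMr ?exprn_gt0//; apply: le_trans (ler_norm C3).
  apply: le_trans (h3 _ (hG _ p1 pm)); rewrite mulrAC -exprMn; apply: ler_wpM2r; first exact: normc_ge0.
  have n0 : 0 <= p ^+ K by rewrite exprn_ge0// (le_trans ler01).
  rewrite mulrC; apply: lerXn2r; rewrite ?nnegrE ?addr_ge0 ?mulr_ge0// ?(ltW y0)//.
  by apply: le_trans (hy _ p1) _; rewrite lerDr.
move=> p p1; rewrite -{1}[B](subKr (c p * (kF%:C * localized_fourier S phi (om p, h p)))).
apply: le_trans (normcB _ _) _; rewrite addrC; apply: lerD; first exact: hC.
rewrite (normcM (c p)) (normcM kF%:C) normcR (gtr0_norm p0).
apply: le_trans (ler_wpM2r _ (hc p)) _; first by rewrite mulr_ge0 ?normc_ge0// ltW.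
by rewrite le_eqVlt; apply/orP; left; apply/eqP; move: (normc _) => f; ring.
Qed.

(** Up to the factor [kF], the pairing of the jump with [phi (0, t) exp (- i sg t)]. *)
Definition J phi sg : R[i] := cint mu setT (fun η => qsym alpha tau η * Ft phi 0 (η - sg)).

Lemma q_cont η : ccont (qsym alpha tau) η.
Proof. exact: cder_cont (is_cder_qsym hp η). Qed.

Lemma Ft0_cont phi sg η : test phi -> ccont (fun η => Ft phi 0 (η - sg)) η.
Proof. by move=> tp; exact: (L_shift_cont sg η (test_slice 0 tp)). Qed.

Lemma J_dom phi : test phi -> exists2 C : R, 0 <= C & forall sg η,
  normc (qsym alpha tau η * Ft phi 0 (η - sg)) <= C * wt 1 (η - sg).
Proof.
move=> tp; have [C C0 hC] := Ft0_bound 2 tp; exists C => // sg η.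
rewrite (wt_natE 1) (normcM (qsym _ _ _)); apply: le_trans (hC _); rewrite -[leRHS]mul1r.
by apply: ler_wpM2r; [exact: normc_ge0|exact: normc_qsym].
Qed.

(** Rescaled by [p], the path [(p xi, sg)] is [(xi, sg / p)], inside the cone for large [p]. Since
    [s^2] is bounded in [p], the model multiplier is [c om^2]; multiplying by [om^2] alone leaves
    the symbol [1 / c = l^2] in the limit. *)
Lemma cone_J phi (G : set (R * R)) (xi : R) sg : test phi -> open_cone G -> G (xi, 0) -> xi != 0 ->
  rapidly_decreasing_on G (localized_fourier S phi) -> J phi sg = 0.
Proof.
move=> tp [oG cG] Gx x0 rd; have b0 : 0 < `|xi| by rewrite normr_gt0.
have /nbhs_ballP[e /= e0 he] := open_nbhs_nbhs (conj oG Gx).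
have oE p : `|p * xi| = `|p| ^+ 1 * `|xi| by rewrite normrM.
have nE p : normc ((p * xi) ^+ 2)%:C = xi ^+ 2 * (p ^+ 1) ^+ 2 by rewrite normcR ger0_norm ?sqr_ge0// exprMn mulrC.
have An p s : 1 <= p -> normc (sl (s + sg) ^+ 2 + csym alpha tau (s + sg) * ((p * xi) ^+ 2)%:C - csym alpha tau (s + sg) * ((p * xi) ^+ 2)%:C)
    <= jb sg ^+ 2 * ((p ^+ 1) ^+ 2 / p) * jb s ^+ 2.
  move=> p1; have pp : 0 < p := lt_le_trans ltr01 p1.
  have e' : (p ^+ 1) ^+ 2 / p = p by rewrite expr1 expr2 mulfK// gt_eqF.
  rewrite addrK normcX e' mulrAC -exprMn.
  apply: (@le_trans _ _ ((jb sg * jb s) ^+ 2)); last by rewrite ler_peMr// sqr_ge0.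
  apply: lerXn2r; rewrite ?nnegrE ?normc_ge0 ?mulr_ge0 ?(ltW (jb_gt0 _))//.
  by apply: le_trans (sl_le_jb _) _; rewrite addrC; exact: jb_submul.
have x2 : 0 < xi ^+ 2 by rewrite -real_normK ?num_real// exprn_gt0.
have Ag p s : xi ^+ 2 * (p ^+ 1) ^+ 2 <= normc (csym alpha tau (s + sg) * ((p * xi) ^+ 2)%:C).
  rewrite (normcM (csym _ _ _)) nE ler_peMl//; first exact: mulr_ge0 (sqr_ge0 _) (sqr_ge0 _).
  have q1 := normc_qsym hp (s + sg); have q0 := qsym_neq0 hp (s + sg).
  by rewrite normcV invf_ge1// normc_gt0.
have key : exists2 C : R, 0 <= C & forall p s, 1 <= p ->
    normc (((p * xi) ^+ 2)%:C * W phi (p * xi) (s + sg) s - qsym alpha tau (s + sg) * Ft phi 0 (s + sg - sg)) <= C / p / jb s ^+ 2.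
  have [C C0 hC] := W_approx (ltnSn 0) x2 (sqr_ge0 (jb sg)) oE Ag An 2 tp.
  exists C; first exact: C0.
  move=> p s p1; apply: le_trans (hC p s p1); rewrite addrK -[leRHS]mul1r.
  apply: le_trans (ler_wpM2r (normc_ge0 _) (normc_qsym hp (s + sg))).
  rewrite -(normcM (qsym _ _ _)) mulrBr !mulrA mulfV ?mul1r; [exact: lexx|exact: qsym_neq0].
apply: (@rapid_limit phi G 1 (fun p => p * xi) (fun=> sg) (fun p => ((p * xi) ^+ 2)%:C) _ (xi ^+ 2) `|xi| (1 + `|sg| / e) (ltnSn 0) (sqr_ge0 xi) b0 rd).
- move=> p p1 pm; have pp : 0 < p := lt_le_trans ltr01 p1.
  rewrite (_ : (p * xi, sg) = p *: ((xi, sg / p) : R * R)); last first.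
    by congr pair; rewrite /= -[_ *: _]/(p * (sg / p)) mulrC divfK// gt_eqF.
  apply: cG pp _; apply: he; rewrite -ball_normE /=.
  rewrite -[X in X < _]/(Num.max `|xi - xi| `|0 - sg / p|) subrr normr0 sub0r normrN gt_max e0 /=.
  have pp : 0 < p := lt_le_trans ltr01 p1.
  by rewrite normrM normfV (gtr0_norm pp) ltr_pdivrMr// mulrC -ltr_pdivrMr//; lra.
- move=> p p1; apply: le_trans (norm_fst (_, _)); rewrite /= normrM mulrC ger0_norm// (le_trans ler01)//.
- by move=> p; rewrite nE.
have [D D0 hD] := J_dom tp; have [iw _] := wt_shift sg.
have iJ : cintble mu setT (fun η => qsym alpha tau η * Ft phi 0 (η - sg)).
  apply: (cintble_dom measurableT _ (integrableZl measurableT D iw)) => [|η _]; last exact: hD.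
  by apply: cmeasT1 => η; apply: ccontM; [exact: q_cont|exact: Ft0_cont].
have [iJ' eJ] := cint_shift sg iJ; rewrite /J -eJ.
exact: (W_limit tp iJ' key).
Qed.

Lemma osc1_cont2 (w : R * R) : ccont (fun w : R * R => osc1 w.2 w.1) w.
Proof.
apply: ccont_exp; apply: ccontM; last exact: (ccont_fst (smooth_cont smooth_id I)).
rewrite (_ : (fun _ => _) = fun w : R * R => - ci * w.2%:C); last first.
  by apply/funext => y; apply: cplxP; rewrite !reimC; ring.
apply: ccontM; [exact: ccont_cst|exact: (ccont_snd (smooth_cont smooth_id I))].
Qed.

(* Superposing the modulations [J phi sg = 0] over [sg] with the Fourier transform
   of [B / phi (0, .)] produces the same integral for [B] in place of [phi (0, .)]. *)
Lemma J_superpose phi (chi : R -> R[i]) : test phi -> test chi -> (forall sg, J phi sg = 0) ->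
  cint mu setT (fun η => qsym alpha tau η * L (fun t => phi (0, t) * chi t) (sl η)) = 0.
Proof.
move=> tp tc J0; have ts := test_slice 0 tp; pose ps t := phi (0, t).
have tX := test_rotc (-1) tc; pose X sg := L (fun t => chi t * rotc (-1) t) (sl sg).
have p0 := realC_neq0 (@kF_gt0 R).
(* Inversion writes [kF chi] as a superposition of [exp (- i sg t)] with weights [X sg]. The factor
   [rotc (-1)] in [X] moves the Fourier transform of [chi] to the line [Re s = 1], where
   [fourier_inversion] applies. *)
have inv t : cint mu setT (fun sg => X sg * osc1 sg t) = kF%:C * chi t.
  have [iX eX] := fourier_inversion t tX.
  have rr s : rotc 1 t * rotc (- sl s) t = osc1 s t.
    by rewrite /osc1 /rotc -cexpD; congr cexp; apply: cplxP; rewrite !(reimC, re_sl, im_sl); ring.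
  have r1 : rotc 1 t * rotc (-1) t = 1 by rewrite /rotc -cexpD mulN1r mul1r subrr cexp0.
  have -> : cint mu setT (fun sg => X sg * osc1 sg t) = rotc 1 t * cint mu setT (fun sg => X sg * rotc (- sl sg) t).
    by rewrite -(cintZT _ iX); apply: eq_cint => s _; rewrite -rr mulrCA.
  by rewrite eX mulrCA [chi t * _]mulrC [rotc 1 t * _]mulrA r1 mul1r.
(* Of the four powers, two pay for the shift of [η] by [sg] and two for integrability in [sg]. *)
have [C C0 hC] := L_decay 4 tX; have [D D0 hD] := L_decay 2 ts.
have cX s : ccont X s by exact: L_cont tX s.
have j2 s : wt 1 s = (jb s ^+ 2)^-1 by rewrite -(wt_natE 1).
have Xb s : normc (X s) * jb s ^+ 2 <= C * wt 1 s.
  rewrite j2 ler_pdivlMr ?jbX_gt0// -mulrA -exprD mulrC; exact: hC.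
have Xb1 s : normc (X s) <= C * wt 1 s.
  apply: le_trans (Xb s); rewrite ler_peMr ?normc_ge0//; apply: exprn_ege1; exact: jb_ge1.
have bC s : 0 <= C * wt 1 s by rewrite mulr_ge0 ?wt_ge0.
have iC := integrableZl measurableT C (@integrable_wt R 1 ltr01).
have LB η : kF%:C * L (fun t => phi (0, t) * chi t) (sl η) = cint mu setT (fun sg => X sg * L ps (sl (η - sg))).
  have tr := test_rotc (sl η) ts.
  pose K (w : (mR R * mR R)%type) : R[i] := ps w.1 * rotc (sl η) w.1 * (X w.2 * osc1 w.2 w.1).
  have mK : cmeas setT K.
    apply: ccont_cmeas2 => w; apply: ccontM; first exact: (ccont_fst (smooth_cont tr.1 (I : setT w.1))).
    by apply: ccontM; [exact: (ccont_snd (cX w.2))|exact: osc1_cont2].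
  have a0 t : 0 <= normc (ps t * rotc (sl η) t) by exact: normc_ge0.
  have hK t s : normc (K (t, s)) <= normc (ps t * rotc (sl η) t) * (C * wt 1 s).
    rewrite /K (normcM (_ * rotc _ _)) (normcM (X _)) normc_osc1 mulr1; apply: ler_wpM2l; [exact: a0|exact: Xb1].
  have ia := cintble_norm measurableT (cintble_test tr).
  have iXo t : cintble mu setT (fun sg => X sg * osc1 sg t).
    apply: (cintble_dom measurableT _ iC) => [|s _]; last by rewrite (normcM (X _)) normc_osc1 mulr1; exact: Xb1.
    apply: cmeasT1 => s; apply: ccontM; first exact: cX.
    exact: (ccont_comp (f := fun w : R * R => osc1 w.2 w.1) (g := fun y => (t, y)) (cvg_pair (cvg_cst _) cvg_id) (osc1_cont2 (t, s))).
  have fub := @cfubini R _ _ (mR R) (mR R) mu mu K _ _ mK a0 bC ia iC hK.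
  rewrite /L -cintZT; last exact: cintble_test (test_rotc _ (testM cptB1 ts tc.1)).
  transitivity (cint mu setT (fun t => cint mu setT (fun s => K (t, s)))).
    apply: eq_cint => t _; apply/esym.
  transitivity (cint mu setT (fun s => (ps t * rotc (sl η) t) * (X s * osc1 s t))); first by [].
  by rewrite (cintZT _ (iXo t)) inv /ps; move: (phi (0, t)) (chi t) (rotc _ _) kF%:C => a b c d; ring.
  rewrite fub; apply: eq_cint => s _; rewrite -cintZT; last exact: cintble_test (test_rotc _ ts).
  apply: eq_cint => t _; rewrite /K /=.
  have -> : rotc (sl (η - s)) t = osc1 s t * rotc (sl η) t.
    by rewrite /osc1 /rotc -cexpD; congr cexp; apply: cplxP; rewrite !(reimC, re_sl, im_sl); ring.
  by ring.
apply: (mulfI p0); rewrite mulr0; have tp2 := testM cptB1 ts tc.1.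
have iq : cintble mu setT (fun η => qsym alpha tau η * L (fun t => phi (0, t) * chi t) (sl η)).
  apply: (cintble_dom measurableT _ (cintble_norm measurableT (cintble_L tp2))) => [|η _].
    by apply: cmeasT1 => η; apply: ccontM; [exact: q_cont|exact: L_cont tp2 η].
  rewrite (normcM (qsym _ _ _)) -[leRHS]mul1r; apply: ler_wpM2r; [exact: normc_ge0|exact: normc_qsym].
pose K (w : (mR R * mR R)%type) : R[i] := qsym alpha tau w.1 * (X w.2 * L ps (sl (w.1 - w.2))).
have cL2 (w : R * R) : ccont (fun w : R * R => L ps (sl (w.1 - w.2))) w.
  apply: (ccont_comp (f := fun η => L ps (sl η)) (g := fun w : R * R => w.1 - w.2)); last exact: L_cont ts _.
  by apply: cvgB; [exact: cvg_fst|exact: cvg_snd].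
have mK : cmeas setT K.
  apply: ccont_cmeas2 => w; apply: ccontM; first exact: (ccont_fst (q_cont w.1)).
  by apply: ccontM; [exact: (ccont_snd (cX w.2))|exact: cL2].
have Lb η s : normc (X s * L ps (sl (η - s))) <= D * wt 1 η * (C * wt 1 s).
  rewrite (normcM (X s)) (j2 η).
  have h1 : normc (L ps (sl (η - s))) <= jb s ^+ 2 * (D * (jb η ^+ 2)^-1).
    rewrite mulrA ler_pdivlMr ?jbX_gt0//.
    apply: (@le_trans _ _ (normc (L ps (sl (η - s))) * (jb (η - s) ^+ 2 * jb s ^+ 2))).
      apply: ler_wpM2l; first exact: normc_ge0.
      rewrite -exprMn; apply: lerXn2r; rewrite ?nnegrE ?mulr_ge0 ?(ltW (jb_gt0 _))//.
      by rewrite -{1}[η](subrK s); exact: jb_submul.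
    rewrite mulrA mulrC; apply: ler_wpM2l; first exact: ltW (jbX_gt0 _ _).
    by rewrite mulrC; exact: hD.
  have D1 : 0 <= D * (jb η ^+ 2)^-1 by apply: mulr_ge0; [exact: D0|rewrite invr_ge0 ltW// jbX_gt0].
  apply: le_trans (ler_wpM2l (normc_ge0 _) h1) _; rewrite [leLHS](_ : _ = D * (jb η ^+ 2)^-1 * (normc (X s) * jb s ^+ 2)).
    exact: (ler_wpM2l D1 (Xb s)).
  by move: (normc (X s)) (jb s ^+ 2) ((jb η ^+ 2)^-1) => a b d; ring.
have dC s : 0 <= D * wt 1 s by rewrite mulr_ge0 ?wt_ge0.
have iD := integrableZl measurableT D (@integrable_wt R 1 ltr01).
have hK η s : normc (K (η, s)) <= D * wt 1 η * (C * wt 1 s).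
  apply: le_trans (Lb η s); rewrite /K (normcM (qsym _ _ _)) -[leRHS]mul1r; apply: ler_wpM2r; [exact: normc_ge0|exact: normc_qsym].
have iXL η : cintble mu setT (fun s => X s * L ps (sl (η - s))).
  apply: (cintble_dom measurableT _ (integrableZl measurableT (D * wt 1 η) iC)) => [|s _]; last exact: Lb.
  apply: cmeasT1 => s; apply: ccontM; first exact: cX.
  exact: (ccont_comp (f := fun w : R * R => L ps (sl (w.1 - w.2))) (g := fun y => (η, y)) (cvg_pair (cvg_cst _) cvg_id) (cL2 (η, s))).
have fub := @cfubini R _ _ (mR R) (mR R) mu mu K _ _ mK dC bC iD iC hK.
rewrite -(cintZT _ iq); transitivity (cint mu setT (fun η => cint mu setT (fun s => K (η, s)))).
  apply: eq_cint => η _; apply/esym.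
  transitivity (cint mu setT (fun s => qsym alpha tau η * (X s * L ps (sl (η - s))))); first by [].
  by rewrite (cintZT _ (iXL η)) -LB mulrCA.
rewrite fub -(mul0r (cint mu setT X)) -(cintZT 0 (cintble_L tX)); apply: eq_cint => s _; rewrite mul0r; have [iw _] := wt_shift s; have [E E0 hE] := J_dom tp.
have iJ : cintble mu setT (fun η => qsym alpha tau η * Ft phi 0 (η - s)).
  apply: (cintble_dom measurableT _ (integrableZl measurableT E iw)) => [|η _]; last exact: hE.
  by apply: cmeasT1 => η; apply: ccontM; [exact: q_cont|exact: Ft0_cont].
transitivity (cint mu setT (fun η => X s * (qsym alpha tau η * Ft phi 0 (η - s)))).
  by apply: eq_cint => η _; rewrite /K mulrCA.
by rewrite (cintZT _ iJ) -[cint _ _ _]/(J phi s) J0 mulr0.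
Qed.

(** Near [t0] the function [phi (0, t)] has no zero, so [chi], a bump divided by it, is a test
    function. Superposition then makes the integral vanish for the bump itself, against [Jpos]. *)
Lemma singular_late t0 xi : 0 < t0 -> xi != 0 -> WF S ((0, t0), (xi, 0)).
Proof.
move=> t00 x0; split; first by apply/eqP => -[] /eqP; rewrite (negbTE x0).
move=> [phi [G [/= tp ph0 cG Gx rd]]]; have J0 sg := cone_J sg tp cG Gx x0 rd.
have ts := test_slice 0 tp.
have c := ccont_norm (smooth_cont ts.1 (I : setT t0)).
have : \forall t \near t0, 0 < normc (phi (0, t)).
  by apply: (cvgr_gt _ c); rewrite lt_neqAle normc_ge0 andbT eq_sym normc_eq0.
move=> /nbhs_ballP[e /= e0 he].
(* Half the admissible radius: the bump occupies [|t - t0| <= r], while [1 / phi (0, t)] is smooth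
   on twice that. *)
pose r := Num.min e (Num.min t0 1) / 2.
have m0 : 0 < Num.min e (Num.min t0 1) by rewrite !lt_min e0 t00 ltr01.
have r0 : 0 < r by rewrite divr_gt0.
have [re' rt r1] : [/\ 2 * r <= e, 2 * r <= t0 & 2 * r <= 1].
  by rewrite /r mulrC divfK// !ge_min !lexx !orbT.
have nz t : `|t - t0| < 2 * r -> phi (0, t) != 0.
  move=> ht; rewrite -normc_eq0 gt_eqF//; apply: he; rewrite -ball_normE /= distrC; exact: lt_le_trans ht re'.
have tB := test_bumpa t0 r0; have [sB [M hM]] := (testP cptB1 _).1 tB.
pose chi t := (bumpa t0 r t)%:C * (phi (0, t))^-1.
have cd : continuous (fun t : R => `|t - t0|).
  by move=> t; apply: cvg_norm; apply: cvgB; [exact: cvg_id|exact: cvg_cst].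
have tc : test chi.
  apply/(testP cptB1); split; last by exists M => t ht; rewrite /chi hM// mul0r.
  have oU : open ((fun t : R => `|t - t0|) @^-1` [set x | x < 2 * r]) by apply: open_comp; [move=> t _; exact: cd|exact: open_lt].
  apply: (smooth_glue oU (U0 := (fun t : R => `|t - t0|) @^-1` [set x | r < x])) => //.
  - by apply: open_comp; [move=> t _; exact: cd|exact: open_gt].
  - by move=> t /=; case: (ltP r `|t - t0|) => h; [right|left; lra].
  - by move=> t /= h; rewrite bumpa_out// ltW.
  - apply: (smoothV oU); first by move=> t /nz.
    exact: smooth_sub (@subsetT _ _) ts.1.
have eB : (fun t => phi (0, t) * chi t) = fun t => (bumpa t0 r t)%:C.
  apply/funext => t; rewrite /chi; case: (ltP `|t - t0| (2 * r)) => h; first by rewrite mulrCA mulfV ?mulr1 ?nz.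
  rewrite bumpa_out ?mul0r ?mulr0//; lra.
have := J_superpose tp tc J0; rewrite eB => J1.
have T0 : 0 < t0 + 1 by rewrite addr_gt0.
have [k k0 hk] := Jpos hp T0.
have [_ ip] := bumpa_int t0 r0.
have bl t : t <= 0 -> bumpa t0 r t = 0.
  by move=> ht; rewrite bumpa_out// distrC; apply: le_trans (ler_norm _); lra.
have br t : t0 + 1 < t -> bumpa t0 r t = 0.
  by move=> ht; rewrite bumpa_out//; apply: le_trans (ler_norm _); lra.
have := hk (bumpa t0 r) tB (bumpa_ge0 t0 r) bl br; rewrite J1 leNgt => /negP; apply.
by rewrite -[re 0]/(0 : R) mulr_gt0.
Qed.

(** [c - 1 / tau = - ((1 - tau) / tau) c (1 - u)] with [1 - u = 1 / (1 + s^alpha)]. *)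
Lemma csym_tail : exists2 C : R, 0 <= C & forall η, normc (csym alpha tau η - (tau^-1)%:C) <= C * jb η `^ (- alpha).
Proof.
have [/andP[a0 a1] /andP[t0 t1]] := hp.
have ti : 0 <= tau^-1 by rewrite invr_ge0 ltW.
have t2 : 0 <= 1 - tau by rewrite subr_ge0 ltW.
exists (tau^-1 * (1 - tau) * tau^-1 * 2) => [|η]; first by rewrite !mulr_ge0.
have q0 := qsym_neq0 hp η; have j0 := jb_gt0 η.
have -> : csym alpha tau η - (tau^-1)%:C = - (tau^-1 * (1 - tau))%:C * (csym alpha tau η * (1 - usym alpha η)).
  have tN : tau%:C != 0 :> R[i] by rewrite -normc_eq0 normcR normr_eq0 gt_eqF.
  apply: (mulfI tN); apply: (mulfI q0).
  have ct : tau%:C * (tau^-1)%:C = 1 :> R[i] by rewrite -rmorphM mulfV ?gt_eqF.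
  have cq : qsym alpha tau η * csym alpha tau η = 1 by rewrite /csym mulfV.
  have -> : qsym alpha tau η * (tau%:C * (csym alpha tau η - (tau^-1)%:C)) =
      tau%:C * (qsym alpha tau η * csym alpha tau η) - qsym alpha tau η * (tau%:C * (tau^-1)%:C) by ring.
  rewrite ct cq rmorphM /=.
  have -> : qsym alpha tau η * (tau%:C * (- ((tau^-1)%:C * (1 - tau)%:C) * (csym alpha tau η * (1 - usym alpha η)))) =
      - ((tau%:C * (tau^-1)%:C) * ((1 - tau)%:C * (1 - usym alpha η)) * (qsym alpha tau η * csym alpha tau η)) by ring.
  by rewrite ct cq (qsymE hp); ring.
rewrite (normcM (- _)) normcN normcR ger0_norm ?mulr_ge0// -[leRHS]mulrA -[leRHS]mulrA ler_wpM2l ?mulr_ge0//.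
rewrite (normcM (csym alpha tau η)); apply: ler_pM; rewrite ?normc_ge0//; first exact: normc_csym.
rewrite (usym1 hp) normcV powRN.
have sp : (jb η / 2) `^ alpha <= normc (1 + spow alpha η).
  apply: (@le_trans _ _ (normc (spow alpha η))).
    rewrite /spow (normc_cpow hp); apply: ge0_ler_powR; rewrite ?nnegrE ?normc_ge0 ?(ltW a0)//.
      by rewrite divr_ge0// ltW.
    by rewrite ler_pdivrMr// mulrC; exact: jb_le_sl.
  rewrite !normcEs; apply: ler_wsqrtr; rewrite reD imD; have := re_spow hp η.
  by rewrite -[re 1]/(1 : R) -[im 1]/(0 : R); move: (re _) (im _) => a b ?; nra.
have h2 : jb η `^ alpha / 2 <= (jb η / 2) `^ alpha.
  rewrite powRM ?invr_ge0// ?(ltW j0)//; apply: ler_wpM2l; first exact: powR_ge0.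
  by rewrite -powR_inv1// -powRrM mulN1r ler_powR ?ler1n// lerN2 ltW.
rewrite -[leRHS]invrK lef_pV2 ?posrE ?invr_gt0 ?mulr_gt0 ?invr_gt0 ?powR_gt0//.
  by rewrite invfM invrK mulrC; exact: le_trans sp.
by rewrite (lt_le_trans ltr01)// (normc_1spow hp).
Qed.

(** * Rays [p^K (x1, e1)] with [e1] nonzero, at the origin *)

Section Direction.
Context (x1 e1 : R) (K : nat).
Context (e10 : e1 != 0) (K0 : (0 < K)%N) (aK : 1 <= alpha * K%:R).
(** The symbol of the limiting wave equation of speed [tau^(-1/2)], zero on its characteristic cone.
    The ray is run through with the power [p^K], [alpha K >= 1], so that the correction
    [<η>^(-alpha)] of [csym_tail] is [O (1 / p)]. *)
Let D : R := x1 ^+ 2 / tau - e1 ^+ 2.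
Local Notation η p s := (s + p ^+ K * e1).
Implicit Types m : nat.

Lemma jb_dir p s : p ^+ K * `|e1| <= jb (η p s) * jb s.
Proof.
apply: (@le_trans _ _ (jb (η p s + - s))).
  by rewrite addrC addKr /jb normrM; apply: ler_wpDl => //; apply: ler_wpM2r => //; exact: ler_norm.
by apply: le_trans (jb_submul _ _) _; rewrite /jb normrN.
Qed.

Lemma jb_dir_powR p s : 1 <= p -> jb (η p s) `^ (- alpha) <= `|e1| `^ (- alpha) * (jb s / p).
Proof.
move=> p1; have [/andP[a0 a1] _] := hp.
have pp : 0 < p := lt_le_trans ltr01 p1; have n0 : 0 < p ^+ K by rewrite exprn_gt0.
have e0 : 0 < `|e1| by rewrite normr_gt0.
have j0 := jb_gt0 (η p s); have s0 := jb_gt0 s.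
have h : p * `|e1| `^ alpha <= jb (η p s) `^ alpha * jb s.
  apply: (@le_trans _ _ ((p ^+ K * `|e1|) `^ alpha)).
    rewrite powRM ?(ltW n0)// ler_wpM2r ?powR_ge0//.
    by rewrite -powR_mulrn ?(ltW pp)// -powRrM mulrC -{1}[p]powRr1 ?(ltW pp)// ler_powR.
  apply: le_trans (ge0_ler_powR (ltW a0) _ _ (jb_dir p s)) _; rewrite ?nnegrE ?mulr_ge0 ?(ltW n0) ?(ltW j0) ?(ltW s0)//.
  rewrite powRM ?(ltW j0) ?(ltW s0)// ler_wpM2l ?powR_ge0//.
  by rewrite -{2}[jb s]powRr1 ?(ltW s0)// ler_powR ?jb_ge1// ltW.
have ja := powR_gt0 alpha j0; have ea := powR_gt0 alpha e0.
rewrite !powRN mulrA ler_pdivlMr// -ler_pdivrMl ?invr_gt0// invrK mulrA mulrAC ler_pdivrMr//.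
by rewrite mulrC [leRHS]mulrC.
Qed.

(** Two errors: the displacement [s] off the ray, linear in [n = p^K <= n^2 / p], and the tail of
    [c], of size [n^2 n^(-alpha) <= n^2 / p]. *)
Lemma M_bound : exists2 C : R, 0 <= C & forall p s, 1 <= p ->
  normc (sl (η p s) ^+ 2 + csym alpha tau (η p s) * ((p ^+ K * x1) ^+ 2)%:C - ((p ^+ K) ^+ 2 * D)%:C) <=
  C * ((p ^+ K) ^+ 2 / p) * jb s ^+ 2.
Proof.
have [C C0 hC] := csym_tail; have cc : 0 <= C * `|e1| `^ (- alpha) by apply: mulr_ge0; [exact: C0|exact: powR_ge0].
exists (1 + 2 * `|e1| + x1 ^+ 2 * (C * `|e1| `^ (- alpha))) => [|p s p1].
  by apply: addr_ge0; [rewrite addr_ge0 ?mulr_ge0|apply: mulr_ge0 => //; exact: sqr_ge0].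
have pp : 0 < p := lt_le_trans ltr01 p1; have pn := le_expr_self K0 p1.
have hj := jb_dir_powR s p1; have hc := hC (η p s).
set n := p ^+ K in pn hj hc *; have np : 0 < n := lt_le_trans pp pn; have n1 := le_trans p1 pn.
set et := s + n * e1 in hj hc *.
(* A difference of squares: [(1 + i et)^2 + (n e1)^2 = (1 + i s) (1 + i s + 2 i n e1)]. *)
have -> : sl et ^+ 2 + csym alpha tau et * ((n * x1) ^+ 2)%:C - (n ^+ 2 * D)%:C =
   sl s * (sl s + (0 +i* (2 * (n * e1)))) + ((n * x1) ^+ 2)%:C * (csym alpha tau et - (tau^-1)%:C).
  rewrite (_ : sl et = sl s + (0 +i* (n * e1))); last by apply: cplxP; rewrite !(reimC, re_sl, im_sl) ?addr0 ?add0r.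
  rewrite (_ : 0 +i* (2 * (n * e1)) = (0 +i* (n * e1)) + (0 +i* (n * e1))); last by apply: cplxP; rewrite !reimC; ring.
  rewrite (_ : (n ^+ 2 * D)%:C = ((n * x1) ^+ 2)%:C * (tau^-1)%:C + (0 +i* (n * e1)) * (0 +i* (n * e1))).
    by move: (sl s) (0 +i* _) (csym _ _ _) => a b c; ring.
  by apply: cplxP; rewrite !reimC /D; ring.
have j1 := jb_ge1 s; have j0 : 0 <= jb s := le_trans ler01 j1.
have nq : n <= n ^+ 2 / p by rewrite ler_pdivlMr// expr2 ler_wpM2l// ltW.
apply: le_trans (normcD _ _) _; rewrite -[leRHS]mulrA [leRHS]mulrDl; apply: lerD.
  have h2 : normc (sl s + (0 +i* (2 * (n * e1)))) <= (1 + 2 * `|e1|) * (n ^+ 2 / p) * jb s.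
    have qj : n <= n ^+ 2 / p * jb s by apply: (le_trans nq); rewrite ler_peMr//; exact: (le_trans (ltW np) nq).
    rewrite [leRHS](_ : _ = n ^+ 2 / p * jb s + 2 * `|e1| * (n ^+ 2 / p * jb s)); last by ring.
    apply: le_trans (normcD _ _) _; rewrite normc_i2 normrM (gtr0_norm np); apply: lerD.
      by apply: le_trans (sl_le_jb s) _; rewrite ler_peMl//; exact: le_trans n1 nq.
    by rewrite [n * _]mulrC mulrA ler_wpM2l ?mulr_ge0.
  apply: le_trans (_ : jb s * ((1 + 2 * `|e1|) * (n ^+ 2 / p) * jb s) <= _); last first.
    by rewrite le_eqVlt; apply/orP; left; apply/eqP; ring.
  by rewrite (normcM (sl s)); apply: (ler_pM (normc_ge0 _) (normc_ge0 _) (sl_le_jb s) h2).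
rewrite (normcM (((n * x1) ^+ 2)%:C)) normcR ger0_norm ?sqr_ge0//.
apply: le_trans (ler_wpM2l (sqr_ge0 _) (le_trans hc (ler_wpM2l C0 hj))) _.
rewrite [leRHS](_ : _ = (n * x1) ^+ 2 * (C * (`|e1| `^ (- alpha) * (jb s ^+ 2 / p)))); last by ring.
rewrite ler_wpM2l ?sqr_ge0// ler_wpM2l// ler_wpM2l ?powR_ge0// ler_wpM2r ?invr_ge0 ?(ltW pp)//.
by rewrite expr2 ler_peMl.
Qed.

(** With the model multiplier [n^2 D] the limit is the integral of [Ft phi 0], which Fourier
    inversion at [t = 0] evaluates as [kF phi (0, 0)]. *)
Lemma origin_cone phi (G : set (R * R)) : test phi -> open_cone G -> G (x1, e1) -> D != 0 ->
  rapidly_decreasing_on G (localized_fourier S phi) -> phi (0, 0) = 0.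
Proof.
move=> tp [_ cG] Gz D0 rd; have Dp : 0 < `|D| by rewrite normr_gt0.
have b0 : 0 < `|e1| by rewrite normr_gt0.
have oE p : `|p ^+ K * x1| = `|p| ^+ K * `|x1| by rewrite normrM normrX.
have cE p : normc ((p ^+ K) ^+ 2 * D)%:C = `|D| * (p ^+ K) ^+ 2 by rewrite normcR normrM mulrC (ger0_norm (sqr_ge0 _)).
have p0 := realC_neq0 (@kF_gt0 R).
have ts := test_slice 0 tp; have [_ e0] := fourier_inversion 0 ts; have iF := cintble_L ts.
apply: (mulfI p0); rewrite mulr0 -e0.
rewrite (_ : cint _ _ _ = cint mu setT (fun s => Ft phi 0 s)); last first.
  by apply: eq_cint => s _; rewrite /rotc mulr0 cexp0 mulr1.
apply: (@rapid_limit phi G K (fun p => p ^+ K * x1) (fun p => p ^+ K * e1) (fun p => ((p ^+ K) ^+ 2 * D)%:C) _ `|D| `|e1| 0 K0 (normr_ge0 D) b0 rd).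
- by move=> p p1 _; apply: (cG _ (x1, e1) _ Gz); rewrite exprn_gt0// (lt_le_trans ltr01).
- move=> p p1; apply: le_trans (norm_snd (_, _)); rewrite /= normrM mulrC ger0_norm// exprn_ge0// (le_trans ler01)//.
- by move=> p; rewrite cE.
have [CM m0 hM] := M_bound.
have cG' p (s : R) : `|D| * (p ^+ K) ^+ 2 <= normc ((p ^+ K) ^+ 2 * D)%:C by rewrite cE.
have [C C0 hC] := W_approx K0 Dp m0 oE cG' hM 2 tp.
by apply: (W_limit tp iF); exists C.
Qed.

End Direction.

Lemma nat_above (A : R) : exists2 n : nat, (0 < n)%N & A <= n%:R.
Proof.
exists (Num.trunc `|A|).+1 => //; apply: le_trans (ler_norm A) _.
by apply/ltW; exact: truncnS_gt.
Qed.

(** The cone is open, so a direction with zero time component or on the characteristic cone can be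
    moved inside it to one that avoids both. *)
Lemma singular_origin zeta : zeta != (0, 0) -> WF S ((0, 0), zeta).
Proof.
move: zeta => [a b] z0; split => //; move=> [phi [G [/= tp ph0 cG Gz rd]]].
have [_ /andP[ta _]] := hp.
have /nbhs_ballP[e /= e0 he] := open_nbhs_nbhs (conj cG.1 Gz).
have hG x y : `|x - a| < e -> `|y - b| < e -> G (x, y).
  move=> hx hy; apply: he; rewrite -ball_normE /= distrC.
  by rewrite -[X in X < _]/(Num.max `|x - a| `|y - b|) gt_max hx hy.
have e2 : `|e / 2| < e by rewrite gtr0_norm ?divr_gt0// gtr_pMr// invf_lt1// ltr1n.
suff [x [y [Gxy y0 D0]]] : exists x y, [/\ G (x, y), y != 0 & x ^+ 2 / tau - y ^+ 2 != 0].
  have [K K0 hK] := nat_above alpha^-1.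
  have aK : 1 <= alpha * K%:R by rewrite -ler_pdivrMl ?mulr1//; case: hp => /andP[].
  by have H := origin_cone y0 K0 aK tp cG Gxy D0 rd; move: ph0; rewrite H eqxx.
have [y hy y0] : exists2 y, `|y - b| < e & y != 0.
  have [->|b0] := eqVneq b 0; last by exists b => //; rewrite subrr normr0.
  by exists (e / 2); rewrite ?subr0// gt_eqF// divr_gt0.
have [D0|D0] := eqVneq (a ^+ 2 / tau - y ^+ 2) 0; last by exists a, y; split => //; apply: hG => //; rewrite subrr normr0.
have a0 : 0 < `|a|.
  rewrite normr_gt0; apply/eqP => a0; move: D0; rewrite a0 expr0n mul0r sub0r => /eqP.
  by rewrite oppr_eq0 sqrf_eq0 (negbTE y0).
(* The factor [1 + r] displaces [a] by [e / 2], within the cone, and adds a positive amount to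
   [a^2 / tau]. *)
pose r := e / 2 / `|a|; have r0 : 0 < r by rewrite !divr_gt0.
exists (a * (1 + r)), y; split => //.
  apply: hG => //; rewrite mulrDr mulr1 addrAC subrr add0r normrM (gtr0_norm r0) mulrC divfK ?gt_eqF//.
  by move: e2; rewrite gtr0_norm ?divr_gt0.
have -> : (a * (1 + r)) ^+ 2 / tau - y ^+ 2 = (a ^+ 2 / tau - y ^+ 2) + `|a| ^+ 2 * (r * (2 + r)) / tau.
  by rewrite real_normK ?num_real//; ring.
rewrite D0 add0r; apply: lt0r_neq0; apply: divr_gt0 ta.
by apply: mulr_gt0; [exact: exprn_gt0|apply: mulr_gt0 => //; rewrite addr_gt0].
Qed.

End Singular.

Theorem theorem3p1 (R : realType) (alpha tau : R)
    (S : (R * R -> R[i]) -> R[i])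
    (alpha_gt0 : 0 < alpha) (alpha_lt1 : alpha < 1)
    (tau_gt0 : 0 < tau) (tau_lt1 : tau < 1)
    (S_fund : zener_fundamental_solution alpha tau S) :
  (exists f : R * R -> R[i],
     [/\ L1loc f,
         represented_by S f,
         (forall z : R * R, z != (0, 0) -> ccontinuous_at f z),
         (forall t : R, 0 < t -> forall g : R * R -> R[i],
            (forall z : R * R, z.1 != 0 -> g z = cderive e_x f z) ->
            ~ ccontinuous_at g (0, t))
       & smooth_on (~` [set z : R * R | z.1 = 0 /\ 0 <= z.2]) f]) /\
  WF S = [set p : (R * R) * (R * R) | p.1 = (0, 0) /\ p.2 != (0, 0)]
     `|` [set p : (R * R) * (R * R) |
            exists t xi : R, [/\ 0 < t, xi != 0 & p = ((0, t), (xi, 0))]].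
Proof.
have hp : 0 < alpha < 1 /\ 0 < tau < 1 by rewrite alpha_gt0 tau_gt0.
have [f [f1 f2 cf]] := regular_exists hp S_fund.
have rf := f_represents hp S_fund f1 cf; have sf := f_smooth hp f1 f2.
split.
  exists f; split.
  - exact: f_L1loc hp _ f1 cf.
  - exact: rf.
  - exact: cf.
  - by move=> t t0 g hg; exact: (dxf_jump hp S_fund f1 t0 hg).
  - exact: sf.
apply/seteqP; split => [[z zeta] WFz|[z zeta] /= [[-> z0]|[t [xi [t0 x0 [-> ->]]]]]]; last first.
- have h := singular_late hp S_fund t0 x0; exact: h.
- have h := singular_origin hp S_fund z0; exact: h.
have oU : open (~` [set z : R * R | z.1 = 0 /\ 0 <= z.2]).
  rewrite (_ : ~` _ = [set z : R * R | z.1 != 0] `|` [set z : R * R | z.2 < 0]).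
    by apply: openU; [exact: open_off|exact: open_before].
  apply/seteqP; split => y /=.
    move=> h; have [y0|y0] := eqVneq y.1 0; last by left.
    by right; rewrite ltNge; apply/negP => y2; apply: h.
  by case=> [/eqP y1 [/y1]|y2 [_]] //; rewrite leNgt y2.
(* Smoothness leaves only the closed half-axis. At the origin every covector belongs to the
   right-hand side; for [t > 0] it remains to exclude [et <> 0]. *)
have z1 : z.1 = 0 /\ 0 <= z.2.
  by apply: contrapT => nz; exact: (smooth_not_WF (f := f) rf oU sf nz WFz).
move: z z1 WFz => [x t] /= [-> t0] WFz; have n0 := WFz.1.
move: t0; rewrite le_eqVlt => /orP[/eqP t0|t0]; first by left; rewrite -t0.
right; move: zeta n0 WFz => [xi et] n0 WFz.
have [e0|e0] := eqVneq et 0; last by case: (late_not_WF hp S_fund t0 e0 WFz).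
exists t, xi; split => //; last by rewrite e0.
by apply: contra_neq n0 => x0; rewrite x0 e0.
Qed.
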